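(* Let $t>0$, $k\in\mathbb{Z}\setminus\{0\}$ and $\Gamma=\mathbb{Z}^n\times\mathbb{Z}^n\times\frac12\mathbb{Z}$. For $F\in\mathcal{H}_k$ write $F(x,u,\xi)=e^{4\pi ik\xi}f(x,u)$. Then the map $$\mathcal{H}_k\to\mathcal{B}_{t,\Gamma}^{4\pi k},\qquad F\mapsto f*_{-4\pi k}p_t^{-4\pi k}$$ (where $f*_{-4\pi k}p_t^{-4\pi k}$ is extended to an entire function on $\mathbb{C}^n\times\mathbb{C}^n$) is an isometric isomorphism, i.e. it is linear, isometric and onto.
   Context: $\mathbb{H}=\mathbb{R}^n\times\mathbb{R}^n\times\mathbb{R}$ is the Heisenberg group with law $(x,u,\xi)(x',u',\xi')=(x+x',u+u',\xi+\xi'+\frac12(u\cdot x'-x\cdot u'))$. Functions on $\Gamma\backslash\mathbb{H}$ are identified with left-$\Gamma$-invariant functions on $\mathbb{H}$. $\mathcal{H}_k$ is the space of $F\in L^2(\Gamma\backslash\mathbb{H})$ with $F(x,u,\xi)=e^{4\pi ik\xi}F(x,u,0)$, normed by $\|F\|^2=\int_{[0,1)^{2n}}|F(x,u,0)|^2\,dx\,du$ (the $L^2$-norm for the invariant probability measure on $\Gamma\backslash\mathbb{H}$). For $\lambda\in\mathbb{R}\setminus\{0\}$ put $$p_t^\lambda(x,u)=(4\pi)^{-n}\lambda^n(\sinh(\lambda t))^{-n}e^{-\frac14\lambda\coth(\lambda t)(x^2+u^2)},$$ $$f*_\lambda p_t^\lambda(x,u)=\int_{\mathbb{R}^{2n}}f(x',u')\,p_t^\lambda(x-x',u-u')\,e^{-i\frac{\lambda}{2}(u\cdot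 x'-x\cdot u')}\,dx'\,du',$$ $$W_t^\lambda(x+iy,u+iv)=4^n\,e^{\lambda(u\cdot y-v\cdot x)}p_{2t}^\lambda(2y,2v)\qquad(x,y,u,v\in\mathbb{R}^n),$$ where $x^2=\sum_jx_j^2$, $z\cdot w=\sum_jz_jw_j$. $\mathcal{B}_{t,\Gamma}^{4\pi k}$ is the space of entire functions $G$ on $\mathbb{C}^n\times\mathbb{C}^n$ with $G(z+\mathbf{m},w+\mathbf{n})=e^{2\pi ik(w\cdot\mathbf{m}-z\cdot\mathbf{n})}G(z,w)$ for all $\mathbf{m},\mathbf{n}\in\mathbb{Z}^n$ and $$\|G\|^2=\int_{\mathbb{R}^{2n}}\int_{[0,1)^{2n}}|G(z,w)|^2W_t^{-4\pi k}(z,w)\,dx\,du\,dy\,dv<\infty\qquad(z=x+iy,\ w=u+iv).$$ (The heat kernel transform $T_t$ of $\Gamma\backslash\mathbb{H}$ satisfies $T_tF(z,w,\zeta)=e^{-t(4\pi k)^2}e^{4\pi ik\zeta}(f*_{-4\pi k}p_t^{-4\pi k})(z,w)$ for such $F$.) *)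

(* Defs.v *)
From HB Require Import structures.
From mathcomp Require Import all_boot all_order all_algebra.
From mathcomp Require Import all_classical all_reals all_analysis.
From mathcomp Require Import complex.
Set Implicit Arguments.
Unset Strict Implicit.
Unset Printing Implicit Defensive.
Import Order.TTheory GRing.Theory Num.Theory.
Import numFieldNormedType.Exports.

Local Open Scope classical_set_scope.
Local Open Scope ring_scope.

Definition rV_display : measure_display -> measure_display.
Proof. exact. Qed.

Section rV_measurable.
Context (R : realType) (n : nat).

Let coord (i : 'I_n) (v : 'rV[R]_n) : measurableTypeR R := v ord0 i.

Let rV_set0 : g_sigma_preimage coord set0.
Proof. exact: sigma_algebra0. Qed.

Let rV_setC A : g_sigma_preimage coord A -> g_sigma_preimage coord (~` A).
Proof. exact: sigma_algebraC. Qed.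

Let rV_bigcup (F : _^nat) : (forall i, g_sigma_preimage coord (F i)) ->
  g_sigma_preimage coord (\bigcup_i (F i)).
Proof. exact: sigma_algebra_bigcup. Qed.

HB.instance Definition _ := @isMeasurable.Build (rV_display default_measure_display)
  'rV[R]_n (g_sigma_preimage coord) rV_set0 rV_setC rV_bigcup.

End rV_measurable.


Section lebesgue_rV.
Context (R : realType).

(* (x, (v_1, ..., v_n)) |-> (x, v_1, ..., v_n) *)
Definition row_cons n (p : measurableTypeR R * 'rV[R]_n) : 'rV[R]_n.+1 :=
  \row_i (if unlift ord0 i is Some j then p.2 ord0 j else p.1).

Lemma row_cons0 n p : @row_cons n p ord0 ord0 = p.1.
Proof. by rewrite mxE unlift_none. Qed.

Lemma row_consS n p (i : 'I_n) : @row_cons n p ord0 (lift ord0 i) = p.2 ord0 i.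
Proof. by rewrite mxE liftK. Qed.

Lemma measurable_coord n (i : 'I_n) :
  measurable_fun [set: 'rV[R]_n]
    ((fun v : 'rV[R]_n => v ord0 i) : _ -> measurableTypeR R).
Proof.
move=> _ Y mY; rewrite setTI; apply: sub_sigma_algebra => /=.
rewrite -bigcup_seq/=; exists i => /=; first by rewrite mem_index_enum.
by exists Y => //; rewrite setTI.
Qed.

Lemma measurable_rV d (T : measurableType d) n (f : T -> 'rV[R]_n) :
  (forall i, measurable_fun [set: T]
    ((fun t => f t ord0 i) : _ -> measurableTypeR R)) ->
  measurable_fun [set: T] f.
Proof.
move=> mf _ A mA; rewrite setTI; move: A mA.
apply: smallest_sub => [|A].
  split=> [|A /= mA|F /= mF]; rewrite ?preimage_set0//.
  - by rewrite setTD preimage_setC; exact: measurableC.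
  - by rewrite preimage_bigcup; exact: bigcup_measurable.
rewrite -bigcup_seq/= => -[i _ [B mB <-]].
rewrite setTI -comp_preimage.
by rewrite -[X in measurable X]setTI; exact: mf.
Qed.

Lemma measurable_row_cons n : measurable_fun setT (@row_cons n).
Proof.
apply: measurable_rV => i.
have [j ->|->] := unliftP ord0 i.
- under eq_fun do rewrite row_consS.
  exact: (measurableT_comp (measurable_coord j) measurable_snd).
- under eq_fun do rewrite row_cons0.
  exact: measurable_fst.
Qed.

Section step.
Context (n : nat) (mu : {sigma_finite_measure set 'rV[R]_n -> \bar R}).

Definition row_measure : set 'rV[R]_n.+1 -> \bar R :=
  pushforward (lebesgue_measure \x mu)%E (@row_cons n).

Let row_measure0 : row_measure set0 = 0%E.
Proof. by rewrite /row_measure /pushforward preimage_set0 (measure0 (lebesgue_measure \x mu)%E). Qed.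

Let row_measure_ge0 A : (0 <= row_measure A)%E.
Proof. exact: (measure_ge0 (lebesgue_measure \x mu)%E). Qed.

Let row_measure_sigma_additive : semi_sigma_additive row_measure.
Proof.
move=> F mF tF mUF; rewrite /row_measure /pushforward preimage_bigcup.
have mpre k : measurable (@row_cons n @^-1` F k).
  by rewrite -[X in measurable X]setTI; exact: measurable_row_cons.
apply: (@measure_semi_sigma_additive _ _ _ (lebesgue_measure \x mu)%E) => //; last exact: bigcup_measurable.
apply/trivIsetP => /= i j _ _ ij; rewrite -preimage_setI.
by move/trivIsetP : tF => /(_ _ _ _ _ ij) ->//; rewrite preimage_set0.
Qed.

HB.instance Definition _ := isMeasure.Build _ _ _ row_measure
  row_measure0 row_measure_ge0 row_measure_sigma_additive.

Let row_measure_sigma_finite : sigma_finite setT row_measure.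
Proof.
have /sigma_finiteP[F [TF ndF Foo]] := sigma_finiteT (@lebesgue_measure R).
have /sigma_finiteP[G [TG ndG Goo]] := sigma_finiteT mu.
pose hd (v : 'rV[R]_n.+1) : measurableTypeR R := v ord0 ord0.
pose tl (v : 'rV[R]_n.+1) : 'rV[R]_n := \row_i v ord0 (lift ord0 i).
have mhd : measurable_fun setT hd by exact: measurable_coord.
have mtl : measurable_fun setT tl.
  apply: measurable_rV => i; under eq_fun do rewrite mxE.
  exact: measurable_coord.
exists (fun k => hd @^-1` F k `&` tl @^-1` G k).
  apply/seteqP; split => // v _.
  have : (\bigcup_k F k) (hd v) by rewrite -TF.
  have : (\bigcup_k G k) (tl v) by rewrite -TG.
  move=> [k _ Gk] [j _ Fj]; exists (maxn j k) => //; split.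
    by have /subsetPset := ndF _ _ (leq_maxl j k); exact.
  by have /subsetPset := ndG _ _ (leq_maxr j k); exact.
move=> k; have [mF Fk] := Foo k; have [mG Gk] := Goo k; split.
  apply: measurableI.
    by rewrite -[X in measurable X]setTI; exact: mhd.
  by rewrite -[X in measurable X]setTI; exact: mtl.
rewrite /row_measure /pushforward (_ : _ @^-1` _ = F k `*` G k).
  by rewrite product_measure1E// lte_mul_pinfty// ge0_fin_numE.
have tlK p : tl (row_cons p) = p.2.
  by apply/rowP => i; rewrite mxE row_consS.
by apply/seteqP; split => -[x y] /=; rewrite /hd tlK row_cons0.
Qed.

HB.instance Definition _ := Measure_isSigmaFinite.Build _ _ _ row_measure
  row_measure_sigma_finite.

End step.

Fixpoint lebesgue_rV n : {sigma_finite_measure set 'rV[R]_n -> \bar R} :=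
  match n with
  | 0 => \d_(0 : 'rV[R]_0)
  | m.+1 => row_measure (lebesgue_rV m)
  end.

End lebesgue_rV.

Notation plane R n := ('rV[R]_n * 'rV[R]_n)%type.

(* points are written ((x, u), xi) *)
Notation heis R n := (plane R n * measurableTypeR R)%type.

Definition dotv (K : pzRingType) n (z w : 'rV[K]_n) : K :=
  \sum_(j < n) z ord0 j * w ord0 j.

Section complex_valued.
Context (R : realType).

Definition cexp (z : R[i]) : R[i] :=
  ((expR (complex.Re z) * cos (complex.Im z)) +i*
   (expR (complex.Re z) * sin (complex.Im z)))%C.

Definition cmeasurable d (T : measurableType d) (f : T -> R[i]) : Prop :=
  measurable_fun [set: T] (fun x => complex.Re (f x)) /\
  measurable_fun [set: T] (fun x => complex.Im (f x)).

Definition cintegral d (T : measurableType d)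
    (mu : {measure set T -> \bar R}) (f : T -> R[i]) : R[i] :=
  ((\int[mu]_x complex.Re (f x)) +i* (\int[mu]_x complex.Im (f x)))%C.

Definition sinh (x : R) : R := (expR x - expR (- x)) / 2.
Definition cosh (x : R) : R := (expR x + expR (- x)) / 2.
Definition coth (x : R) : R := cosh x / sinh x.

End complex_valued.

Section heisenberg.
Context (R : realType) (n : nat).
Implicit Types (F : heis R n -> R[i]) (t lambda : R) (k : int).

Definition lebesgue_plane : {measure set (plane R n) -> \bar R} :=
  (lebesgue_rV R n \x lebesgue_rV R n)%E.

Definition haar : {measure set (heis R n) -> \bar R} :=
  (lebesgue_plane \x lebesgue_measure)%E.

Definition heis_mul (g h : heis R n) : heis R n :=
  ((g.1.1 + h.1.1, g.1.2 + h.1.2),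
   g.2 + h.2 + 2^-1 * (dotv g.1.2 h.1.1 - dotv g.1.1 h.1.2)).

(* Gamma = Z^n x Z^n x (1/2)Z *)
Definition Gamma : set (heis R n) :=
  [set g | exists (a b : 'rV[int]_n) (c : int),
     g = ((map_mx intr a, map_mx intr b), c%:~R / 2)].

Definition unit_cube : set 'rV[R]_n :=
  [set x | forall j, 0 <= x ord0 j < 1].

(* [0,1)^n x [0,1)^n x [0,1/2) is a fundamental domain of Gamma *)
Definition fundamental_domain : set (heis R n) :=
  (unit_cube `*` unit_cube) `*` [set xi | 0 <= xi < 2^-1].

(* Everywhere Gamma-invariant representatives of the elements of L^2(Gamma\H): equality in L^2 is
   haar-almost everywhere equality. *)
Definition L2_quotient F : Prop :=
  [/\ cmeasurable F,
      forall g h, Gamma g -> F (heis_mul g h) = F h &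
      (\int[haar]_(h in fundamental_domain) (Normc.normc (F h) ^+ 2)%:E < +oo)%E].

Definition Hspace k F : Prop :=
  L2_quotient F /\
  forall p xi, F (p, xi) = cexp (0 +i* (4 * pi * k%:~R * xi))%C * F (p, 0).

Definition Hspace_sqnorm F : \bar R :=
  (\int[lebesgue_plane]_(p in unit_cube `*` unit_cube)
     (Normc.normc (F (p, 0)) ^+ 2)%:E)%E.

Definition twisted_heat lambda t (p : plane R n) : R :=
  (4 * pi) ^- n * lambda ^+ n * (sinh (lambda * t)) ^- n *
  expR (- (4^-1 * lambda * coth (lambda * t) *
           (dotv p.1 p.1 + dotv p.2 p.2))).

Definition twisted_conv lambda (f : plane R n -> R[i]) (g : plane R n -> R)
    (p : plane R n) : R[i] :=
  cintegral lebesgue_plane (fun q =>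
    f q * (g (p.1 - q.1, p.2 - q.2))%:C%C *
    cexp (0 +i* (- (lambda / 2 * (dotv p.2 q.1 - dotv p.1 q.2))))%C).

Definition weight lambda t (P : plane R[i] n) : R :=
  let x := map_mx (@complex.Re R) P.1 in let y := map_mx (@complex.Im R) P.1 in
  let u := map_mx (@complex.Re R) P.2 in let v := map_mx (@complex.Im R) P.2 in
  4 ^+ n * expR (lambda * (dotv u y - dotv v x)) *
  twisted_heat lambda (2 * t) (2 *: y, 2 *: v).

(* Frechet differentiability over the field R[i], i.e. complex
   differentiability, at every point of C^n x C^n *)
Definition entire (G : plane R[i] n -> R[i]) : Prop :=
  forall P, differentiable (G : plane R[i] n -> R[i]^o) P.

Definition entire_extension (g : plane R n -> R[i]) (G : plane R[i] n -> R[i])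
    : Prop :=
  entire G /\
  forall x u, G (map_mx (real_complex R) x, map_mx (real_complex R) u) = g (x, u).

(* junk value 0 when there is no entire extension *)
Definition extend (g : plane R n -> R[i]) : plane R[i] n -> R[i] :=
  xget (cst 0) [set G | entire_extension g G].

Definition cpoint (p q : plane R n) : plane R[i] n :=
  (map2_mx (@Complex R) p.1 q.1, map2_mx (@Complex R) p.2 q.2).

Definition Bspace_sqnorm t k (G : plane R[i] n -> R[i]) : \bar R :=
  (\int[lebesgue_plane]_q
     \int[lebesgue_plane]_(p in unit_cube `*` unit_cube)
       (Normc.normc (G (cpoint p q)) ^+ 2 *
        weight (- (4 * pi * k%:~R)) t (cpoint p q))%:E)%E.

Definition Bspace t k (G : plane R[i] n -> R[i]) : Prop :=
  [/\ entire G,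
      forall (a b : 'rV[int]_n) z w,
        let m := map_mx intr a in let m' := map_mx intr b in
        G (z + m, w + m') =
        cexp ((0 +i* (2 * pi * k%:~R))%C * (dotv w m - dotv z m')) * G (z, w) &
      (Bspace_sqnorm t k G < +oo)%E].

Definition heat_conv t k F : plane R n -> R[i] :=
  let lambda := - (4 * pi * k%:~R) in
  twisted_conv lambda (fun p => F (p, 0)) (twisted_heat lambda t).

Definition heat_map t k F : plane R[i] n -> R[i] := extend (heat_conv t k F).

End heisenberg.

(* Main.v *)
Require Import Defs.
From HB Require Import structures.
From mathcomp Require Import all_boot all_order all_algebra.
From mathcomp Require Import all_classical all_reals all_analysis.
From mathcomp Require Import complex ring lra measurable_realfun gauss_integral.
Set Implicit Arguments.
Unset Strict Implicit.
Unset Printing Implicit Defensive.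
Import Order.TTheory GRing.Theory Num.Theory.
Import numFieldNormedType.Exports.
Local Open Scope classical_set_scope.
Local Open Scope ring_scope.

(** Write [Tr f] for the analytic continuation of the twisted convolution of [f] with the heat kernel;
    its kernel is a Gaussian [kap], and [Ts] is the adjoint of [Tr] for the weight [wt].  Gaussian
    integrals show that [Tr \o Ts] has the explicit kernel [ker], which decays like a Gaussian once
    multiplied by the square roots [sw] of the weight, so that Schur's test makes [Ts], hence [Tr],
    bounded.  The product [ker * wt], recentred, is an entire function times a Gaussian that is
    invariant under the rotations [S |-> exp(i th) S] of C^(2n); by the mean value property it
    reproduces every entire function [G] of finite norm.  Applying [Ts] to truncations of [G] gives a
    sequence converging in L^2 to some [f] with [Tr f = G] and the same norm as [G].  If [Tr f = 0],
    then the Fourier transform of [f(x) exp(- gam |x|^2)] vanishes identically, so [f = 0]; hence [Tr]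
    is injective, and therefore isometric.

    A point of [Y] is a pair [(q, p)] standing for the complex point [p + i q]. *)

(** The relation [lam ^+ 2 = 16 * (gam * del)] shapes the argument. It makes the exponent of
    [normc (kap p q x) * sw p q], namely [lam / 2 * dOm a q - gam * sqn a - del * sqn q] with
    [a = p - x], a degenerate form: it vanishes for [a = (lam / (4 * gam)) *: rJ q]. So the kernel
    of [Tr] by itself fails Schur's test, and [Tr] must be reached through [Ts]; the exponent for
    [ker] is strictly negative because the arithmetic mean of [gam] and [del] exceeds the geometric
    one. The same lack of decay in [q] is why [Ts] is estimated only on functions cut off in [q].
    The degeneracy also helps: for [p = (lam / (4 * gam)) *: rJ q] the modulus of [kap] is a pure
    Gaussian in [x], and a Fourier transform appears. The constants are those of the heat semigroup:
    [kap] belongs to time [t], [ker] and [wt] to time [2 * t]. A crude bound on [Tr] is still needed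
    before the isometry, since only functions of finite norm are reproduced. *)

Notation cpoint := Defs.cpoint.

(** * Complex numbers *)
Notation normc := Normc.normc.

Section complex_numbers.
Context {R : realType}.
Implicit Types (z w : R[i]) (x y : R).

Lemma cReD z w : complex.Re (z + w) = complex.Re z + complex.Re w.
Proof. by case: z w => [? ?] [? ?]. Qed.
Lemma cImD z w : complex.Im (z + w) = complex.Im z + complex.Im w.
Proof. by case: z w => [? ?] [? ?]. Qed.
Lemma cReN z : complex.Re (- z) = - complex.Re z.
Proof. by case: z. Qed.
Lemma cImN z : complex.Im (- z) = - complex.Im z.
Proof. by case: z. Qed.
Lemma cReM z w :
  complex.Re (z * w) = complex.Re z * complex.Re w - complex.Im z * complex.Im w.
Proof. by case: z w => [? ?] [? ?]. Qed.
Lemma cImM z w :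
  complex.Im (z * w) = complex.Re z * complex.Im w + complex.Im z * complex.Re w.
Proof. by case: z w => [? ?] [? ?]. Qed.
Lemma cRe_conj z : complex.Re z^*%C = complex.Re z.
Proof. by case: z. Qed.
Lemma cIm_conj z : complex.Im z^*%C = - complex.Im z.
Proof. by case: z. Qed.

Lemma cRe_sum (I : Type) (r : seq I) (P : pred I) (F : I -> R[i]) :
  complex.Re (\sum_(i <- r | P i) F i) = \sum_(i <- r | P i) complex.Re (F i).
Proof. exact: (big_morph _ cReD erefl). Qed.
Lemma cIm_sum (I : Type) (r : seq I) (P : pred I) (F : I -> R[i]) :
  complex.Im (\sum_(i <- r | P i) F i) = \sum_(i <- r | P i) complex.Im (F i).
Proof. exact: (big_morph _ cImD erefl). Qed.

Lemma complexP z w :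
  complex.Re z = complex.Re w -> complex.Im z = complex.Im w -> z = w.
Proof. by case: z w => [? ?] [? ?] /= -> ->. Qed.

Lemma conjcM z w : (z * w)^*%C = z^*%C * w^*%C.
Proof.
by apply: complexP; rewrite ?cReM ?cImM ?cRe_conj ?cIm_conj ?cReM ?cImM ?mulrNN ?mulrN ?mulNr ?opprD.
Qed.

Lemma normcE2 z : normc z = Num.sqrt (complex.Re z ^+ 2 + complex.Im z ^+ 2).
Proof. by case: z. Qed.

Lemma normc_ge0 z : 0 <= normc z.
Proof. by rewrite normcE2 sqrtr_ge0. Qed.

Lemma sqr_normcE z : normc z ^+ 2 = complex.Re z ^+ 2 + complex.Im z ^+ 2.
Proof. by rewrite normcE2 sqr_sqrtr// addr_ge0 ?sqr_ge0. Qed.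

Lemma normc_conj z : normc z^*%C = normc z.
Proof. by rewrite !normcE2 cRe_conj cIm_conj sqrrN. Qed.

Lemma mulc_conj z : z * z^*%C = (normc z ^+ 2)%:C%C.
Proof.
by rewrite sqr_normcE; case: z => a b; apply: complexP => /=; ring.
Qed.

Lemma normc0E : normc (0 : R[i]) = 0.
Proof. by rewrite normcE2/= !expr0n addr0 sqrtr0. Qed.

Lemma normc0_eq z : (normc z == 0) = (z == 0).
Proof. by apply/eqP/eqP => [/Normc.eq0_normc//|->]; exact: normc0E. Qed.

Lemma normc_real x : normc x%:C%C = `|x|.
Proof. by rewrite normcE2/= expr0n addr0 sqrtr_sqr. Qed.

Lemma absRe_le z : `|complex.Re z| <= normc z.
Proof.
by rewrite normcE2 -sqrtr_sqr ler_wsqrtr// lerDl sqr_ge0.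
Qed.

Lemma absIm_le z : `|complex.Im z| <= normc z.
Proof.
by rewrite normcE2 -sqrtr_sqr ler_wsqrtr// lerDr sqr_ge0.
Qed.

Lemma normc_le z : normc z <= `|complex.Re z| + `|complex.Im z|.
Proof.
rewrite -(@ler_pXn2r _ 2)// ?nnegrE ?normc_ge0 ?addr_ge0//.
rewrite sqr_normcE.
rewrite -(real_normK (num_real (complex.Re z))) -(real_normK (num_real (complex.Im z))).
by have := mulr_ge0 (normr_ge0 (complex.Re z)) (normr_ge0 (complex.Im z)); rewrite !expr2; lra.
Qed.

Lemma normc_triangle_sum (I : Type) (r : seq I) (P : pred I) (F : I -> R[i]) :
  normc (\sum_(i <- r | P i) F i) <= \sum_(i <- r | P i) normc (F i).
Proof.
elim/big_rec2: _ => [|i y1 y2 Pi]; first by rewrite normc0E.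
by move=> h; apply: (le_trans (le_normcD _ _)); rewrite lerD2l.
Qed.

Lemma cexpD z w : cexp (z + w) = cexp z * cexp w.
Proof.
apply: complexP; rewrite ?cReM ?cImM /= cReD cImD expRD ?cosD ?sinD; ring.
Qed.

Lemma cexp0 : cexp (0 : R[i]) = 1.
Proof. by apply: complexP => /=; rewrite expR0 ?cos0 ?sin0; ring. Qed.

Lemma cexp_neq0 z : cexp z != 0.
Proof.
apply/eqP => h; have := cexpD z (- z); rewrite subrr cexp0 h mul0r.
by move/eqP; rewrite oner_eq0.
Qed.

Lemma cexpN z : cexp (- z) = (cexp z)^-1.
Proof.
apply: (mulfI (cexp_neq0 z)); rewrite -cexpD subrr cexp0 mulfV//.
exact: cexp_neq0.
Qed.

Lemma normc_cexp z : normc (cexp z) = expR (complex.Re z).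
Proof.
by rewrite normcE2/= !exprMn -mulrDr cos2Dsin2 mulr1 sqrtr_sqr ger0_norm// expR_ge0.
Qed.

Lemma cexp_real x : cexp x%:C%C = (expR x)%:C%C.
Proof. by rewrite /cexp/= cos0 sin0 mulr1 mulr0. Qed.

Lemma cexp_conj z : (cexp z)^*%C = cexp z^*%C.
Proof.
by apply: complexP; rewrite ?cRe_conj ?cIm_conj /= cRe_conj cIm_conj ?cosN ?sinN ?mulrN.
Qed.

Lemma cexp_2pi (m : int) : cexp (0 +i* (2 * pi * m%:~R))%C = 1 :> R[i].
Proof.
have h (j : nat) : cexp (0 +i* (2 * pi * j%:R))%C = 1 :> R[i].
  have e1 : cexp (0 +i* (pi *+ 2))%C = 1 :> R[i].
    by apply: complexP => /=; rewrite expR0 ?cos2pi ?sin2pi mul1r.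
  elim: j => [|j ih]; first by rewrite mulr0 -[RHS]cexp0.
  rewrite -[RHS]mul1r -{1}ih -e1 -cexpD; congr cexp.
  by apply: complexP => /=; rewrite ?addr0// -natr1; ring.
case: m => j; first exact: h.
rewrite NegzE mulrNz mulrN -[X in (X +i* _)%C]oppr0.
have -> : (- 0 +i* - (2 * pi * j.+1%:~R))%C = - (0 +i* (2 * pi * j.+1%:R))%C :> R[i] by [].
by rewrite cexpN h invr1.
Qed.

Lemma sin_abs_le x : `|sin x| <= `|x|.
Proof.
wlog x0 : x / 0 <= x => [h|].
  have [/h//|/ltW x0] := leP 0 x.
  by rewrite -(normrN (sin x)) -sinN -(normrN x); apply: h; rewrite oppr_ge0.
have hd (y : R) (_ : y \in `]0, x[) := is_derive_sin y.
have [c _] := MVT_segment x0 hd (continuous_subspaceT (@continuous_sin R)).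
rewrite sin0 !subr0 => ->; rewrite normrM ler_piMl//.
exact: cos_max.
Qed.

Lemma cos_abs_le x : `|cos x - 1| <= x ^+ 2.
Proof.
wlog x0 : x / 0 <= x => [h|].
  have [/h//|/ltW x0] := leP 0 x.
  by rewrite -cosN -sqrrN; apply: h; rewrite oppr_ge0.
have hd (y : R) (_ : y \in `]0, x[) := is_derive_cos y.
have [c] := MVT_segment x0 hd (continuous_subspaceT (@continuous_cos R)).
rewrite in_itv/= => /andP[c0 cx].
rewrite cos0 !subr0 => ->; rewrite normrM normrN (ger0_norm x0) expr2 ler_wpM2r//.
by rewrite (le_trans (sin_abs_le _))// ger0_norm.
Qed.

Lemma cos_abs_le1 x : `|cos x - 1| <= `|x|.
Proof.
wlog x0 : x / 0 <= x => [h|].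
  have [/h//|/ltW x0] := leP 0 x.
  by rewrite -cosN -normrN; rewrite -(normrN x) normrN; apply: h; rewrite oppr_ge0.
have hd (y : R) (_ : y \in `]0, x[) := is_derive_cos y.
have [c] := MVT_segment x0 hd (continuous_subspaceT (@continuous_cos R)).
rewrite in_itv/= => /andP[c0 cx].
by rewrite cos0 !subr0 => ->; rewrite normrM normrN ler_piMl// sin_max.
Qed.

Lemma sin_sub_abs_le x : `|sin x - x| <= x ^+ 2.
Proof.
wlog x0 : x / 0 <= x => [h|].
  have [/h//|/ltW x0] := leP 0 x.
  have := h (- x); rewrite oppr_ge0 sinN sqrrN -opprD normrN; exact.
have hd (y : R) : y \in `]0, x[ -> is_derive y 1 (fun y => sin y - y) (cos y - 1).
  by move=> _; apply: is_deriveB.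
have hc : continuous (fun y : R => sin y - y).
  by move=> y; apply: cvgB; [exact: continuous_sin|exact: cvg_id].
have [c] := MVT_segment x0 hd (continuous_subspaceT hc).
rewrite in_itv/= => /andP[c0 cx].
rewrite sin0 !subr0 => ->; rewrite normrM (ger0_norm x0) expr2 ler_wpM2r//.
by rewrite (le_trans (cos_abs_le1 _))// ger0_norm.
Qed.

Lemma expR_sub1_abs_le x : `|expR x - 1| <= `|x| * expR `|x|.
Proof.
have key y : 0 <= y -> expR y - 1 <= y * expR y.
  move=> y0; have := expR_ge1Dx (- y); rewrite expRN => h.
  have e0 := expR_gt0 y.
  have : (1 - y) * expR y <= 1 by rewrite -ler_pdivlMr// div1r.
  by rewrite mulrBl mul1r; lra.
have [x0|x0] := leP 0 x.
  by rewrite !ger0_norm ?subr_ge0 ?key// -expR0 ler_expR.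
rewrite (ltr0_norm x0) ler0_norm; last by rewrite subr_le0 expR_le1 ltW.
have h := expR_ge1Dx x.
have h2 : 1 <= expR (- x) by rewrite -expR0 ler_expR; lra.
by nra.
Qed.

Lemma expR_sub1D_abs_le x : `|expR x - 1 - x| <= x ^+ 2 * expR `|x|.
Proof.
have h0 : 0 <= expR x - 1 - x by have := expR_ge1Dx x; lra.
rewrite (ger0_norm h0).
have hm := expR_ge1Dx (- x); rewrite expRN in hm.
have e0 := expR_gt0 x.
have h1 : (1 - x) * expR x <= 1 by rewrite -ler_pdivlMr// div1r.
have h2 : expR x - 1 - x <= x * (expR x - 1) by lra.
apply: (le_trans h2); apply: (le_trans (ler_norm _)).
by rewrite normrM -real_normK ?num_real// expr2 -mulrA ler_wpM2l// expR_sub1_abs_le.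
Qed.

(** One bound serves both for the derivative of [cexp] and for differentiation under the integral
    sign: the factor [expR (normc z)] stays integrable against weights with all exponential
    moments. *)
Lemma cexp_sub1D_le z : normc (cexp z - 1 - z) <= 4 * normc z ^+ 2 * expR (normc z).
Proof.
set r := normc z; have r0 : 0 <= r := normc_ge0 z.
case: z @r r0 => a b r r0.
have ar : `|a| <= r by exact: (absRe_le (a +i* b)%C).
have br : `|b| <= r by exact: (absIm_le (a +i* b)%C).
have er : expR `|a| <= expR r by rewrite ler_expR.
have e1 : 1 + r <= expR r := expR_ge1Dx r.
have sq (x : R) : `|x| <= r -> x ^+ 2 <= r ^+ 2.
  by move=> h; rewrite -real_normK ?num_real// ler_pXn2r ?nnegrE.
apply: (le_trans (normc_le _)).
(* The real and the imaginary part are regrouped so that each summand is quadratically small by one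
   of the one-variable estimates above. *)
rewrite (_ : complex.Re _ = (expR a - 1 - a) * cos b + (1 + a) * (cos b - 1)); last by rewrite /=; ring.
rewrite (_ : complex.Im _ = (expR a - 1) * sin b + (sin b - b)); last by rewrite /=; ring.
have A1 : `|(expR a - 1 - a) * cos b + (1 + a) * (cos b - 1)| <= r ^+ 2 * expR r + expR r * r ^+ 2.
  apply: (le_trans (ler_normD _ _)); apply: lerD; rewrite normrM.
    rewrite -[leRHS]mulr1; apply: ler_pM => //; last exact: cos_max.
    apply: (le_trans (expR_sub1D_abs_le a)); apply: ler_pM => //; first exact: sqr_ge0.
    exact: sq.
  apply: ler_pM => //; last exact: (le_trans (cos_abs_le b) (sq _ br)).
  apply: le_trans e1; apply: (le_trans (ler_normD _ _)).
  by rewrite normr1 lerD2l.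
have A2 : `|(expR a - 1) * sin b + (sin b - b)| <= r * expR r * r + 1 * r ^+ 2.
  apply: (le_trans (ler_normD _ _)); apply: lerD; rewrite ?mul1r.
    rewrite normrM; apply: ler_pM => //; last exact: (le_trans (sin_abs_le b) br).
    by apply: (le_trans (expR_sub1_abs_le a)); apply: ler_pM.
  exact: (le_trans (sin_sub_abs_le b) (sq _ br)).
have := lerD A1 A2 => h; apply: (le_trans h).
have r2 : 0 <= r ^+ 2 by exact: sqr_ge0.
have : r ^+ 2 * 1 <= r ^+ 2 * expR r by rewrite ler_wpM2l//; lra.
by rewrite !expr2; nra.
Qed.

End complex_numbers.

(** * Complex differentiability *)
Section complex_differentiability.
Context {R : realType}.

(** The norm of a normed module over [R[i]] takes its values in [R[i]]; its real part keeps all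
    estimates in [R], and [nrmE] goes back. *)
Definition nrm (V : normedModType R[i]) (h : V) : R := complex.Re `|h|.

Lemma nrmE (V : normedModType R[i]) (h : V) : `|h| = (nrm h)%:C%C.
Proof. by rewrite /nrm; apply/complexP => //=; apply: ger0_Im. Qed.

Lemma nrm_ge0 (V : normedModType R[i]) (h : V) : 0 <= nrm h.
Proof. by have := normr_ge0 h; rewrite nrmE ler0c. Qed.

Lemma nrm_normc (z : R[i]^o) : nrm z = normc z.
Proof. by rewrite /nrm; case: z. Qed.

Lemma normcE3 (z : R[i]) : `|z| = (normc z)%:C%C.
Proof. by []. Qed.

(** A positive element of [R[i]] is real, so the little-o over [R[i]] amounts to an estimate with
    real [e] and [d]. *)
Lemma differentiable_bound (V : normedModType R[i]) (f : V -> R[i]^o) (x : V)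
    (df : {linear V -> R[i]^o}) :
  continuous df ->
  (forall e : R, 0 < e -> exists2 d : R, 0 < d &
     forall h, nrm h < d -> normc (f (x + h) - f x - df h) <= e * nrm h) ->
  differentiable f x.
Proof.
move=> dfc H.
have E : f \o shift x = cst (f x) + df +o_ 0 id.
  apply/eqaddoP => eps e0.
  have eE : eps = (complex.Re eps)%:C%C.
    by apply: complexP => //=; exact/ger0_Im/ltW.
  rewrite eE ltcR in e0 *.
  have [d d0 Hd] := H _ e0.
  apply/nbhs_ballP; exists (d%:C%C); first by rewrite /= ltcR.
  move=> h; rewrite -ball_normE /= sub0r normrN nrmE ltcR => /Hd.
  rewrite -rmorphM/=.
  rewrite (_ : (f \o _ - _) h = f (x + h) - f x - df h); last first.
    by rewrite -addrA -opprD addrC addrC (addrC x).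
  by rewrite normcE3 lecR.
have dE := diff_unique dfc E.
by apply/diff_locallyP; rewrite dE; split.
Qed.

(** An [R[i]]-linear map of a one-dimensional space is multiplication by its value at [1], which is
    [L]. *)
Lemma differentiable_epsdelta (g : R[i]^o -> R[i]^o) (z : R[i]^o) :
  differentiable g z -> exists L : R[i], forall e : R, 0 < e ->
    exists2 d : R, 0 < d & forall h : R[i], normc h < d ->
      normc (g (z + h) - g z - L * h) <= e * normc h.
Proof.
move=> dg; exists ('d g z (1 : R[i]^o)) => e e0.
have /diff_locally := dg; move/eqaddoP => /(_ e%:C%C).
rewrite ltcR => /(_ e0)/nbhs_ballP[d /= d0 Hd].
have dE : d = (complex.Re d)%:C%C by apply: complexP => //=; exact/ger0_Im/ltW.
rewrite dE ltcR in d0 Hd; exists (complex.Re d) => // h hd.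
have := Hd h; rewrite -ball_normE /= sub0r normrN normcE3 ltcR => /(_ hd).
rewrite (_ : (g \o _ - _) h = g (z + h) - g z - 'd g z h); last first.
  by rewrite -addrA -opprD (addrC z).
rewrite !normcE3 -rmorphM/= lecR.
suff -> : 'd g z h = 'd g z (1 : R[i]^o) * h by [].
by rewrite -{1}[h]mulr1 -[h * 1]/(h *: (1 : R[i]^o)) linearZ/= mulrC.
Qed.

Lemma differentiable_cexp (z : R[i]^o) : differentiable (@cexp R : R[i]^o -> R[i]^o) z.
Proof.
pose df : {linear R[i]^o -> R[i]^o} := GRing.scale (cexp z).
apply: (@differentiable_bound _ _ _ df).
  exact: mulrl_continuous.
move=> e e0.
pose M := normc (cexp z) * (4 * expR 1) + 1.
have M0 : 0 < M.
  by rewrite ltr_wpDl// !mulr_ge0// ?normc_ge0 ?expR_ge0.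
exists (Num.min 1 (e / M)); first by rewrite lt_min ltr01 divr_gt0.
move=> h; rewrite nrm_normc lt_min => /andP[h1 h2].
have -> : cexp (z + h) - cexp z - df h = cexp z * (cexp h - 1 - h).
  by rewrite cexpD !mulrBr mulr1.
rewrite Normc.normcM.
have h0 := normc_ge0 h.
apply: (@le_trans _ _ (normc (cexp z) * (4 * normc h ^+ 2 * expR 1))).
  rewrite ler_wpM2l ?normc_ge0//; apply: (le_trans (cexp_sub1D_le h)).
  by rewrite ler_wpM2l ?mulr_ge0 ?sqr_ge0// ler_expR ltW.
have -> : normc (cexp z) * (4 * normc h ^+ 2 * expR 1) = (M - 1) * normc h * normc h.
  by rewrite /M; ring.
rewrite ler_wpM2r//; apply: (@le_trans _ _ (M * normc h)).
  by rewrite ler_wpM2r// gerBl.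
by rewrite mulrC -ler_pdivlMr// ltW.
Qed.

End complex_differentiability.

(** * Integrals of complex-valued functions *)
Section complex_measurability.
Context {R : realType} d (T : measurableType d).
Implicit Types (f g : T -> R[i]).

Lemma cmeasurable_cst (c : R[i]) : cmeasurable (fun _ : T => c).
Proof. by split; exact: measurable_cst. Qed.

Lemma cmeasurableD f g : cmeasurable f -> cmeasurable g -> cmeasurable (fun x => f x + g x).
Proof.
move=> [rf jf] [rg jg]; split.
  by under eq_fun do rewrite cReD; exact: measurable_funD.
by under eq_fun do rewrite cImD; exact: measurable_funD.
Qed.

Lemma cmeasurableN f : cmeasurable f -> cmeasurable (fun x => - f x).
Proof.
move=> [rf jf]; split.
  by under eq_fun do rewrite cReN; exact: measurableT_comp.
by under eq_fun do rewrite cImN; exact: measurableT_comp.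
Qed.

Lemma cmeasurableB f g : cmeasurable f -> cmeasurable g -> cmeasurable (fun x => f x - g x).
Proof. by move=> mf mg; apply: cmeasurableD => //; exact: cmeasurableN. Qed.

Lemma cmeasurableM f g : cmeasurable f -> cmeasurable g -> cmeasurable (fun x => f x * g x).
Proof.
move=> [rf jf] [rg jg]; split.
  under eq_fun do rewrite cReM.
  by apply: measurable_funB; apply: measurable_funM.
under eq_fun do rewrite cImM.
by apply: measurable_funD; apply: measurable_funM.
Qed.

Lemma cmeasurable_conj f : cmeasurable f -> cmeasurable (fun x => (f x)^*%C).
Proof.
move=> [rf jf]; split.
  by under eq_fun do rewrite cRe_conj.
by under eq_fun do rewrite cIm_conj; exact: measurableT_comp.
Qed.

Lemma cmeasurable_real (h : T -> R) : measurable_fun setT h ->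
  cmeasurable (fun x => (h x)%:C%C).
Proof. by move=> mh; split => //=; exact: measurable_cst. Qed.

Lemma cmeasurable_sum (I : Type) (s : seq I) (P : pred I) (F : I -> T -> R[i]) :
  (forall j, cmeasurable (F j)) -> cmeasurable (fun x => \sum_(j <- s | P j) F j x).
Proof.
move=> mF; elim: s => [|a s ih].
  by under eq_fun do rewrite big_nil; exact: cmeasurable_cst.
under eq_fun do rewrite big_cons.
by case: (P a) => //; exact: cmeasurableD.
Qed.

Lemma measurable_cos_fun (h : T -> R) : measurable_fun setT h ->
  measurable_fun setT (fun x => cos (h x)).
Proof.
move=> mh; apply: (measurableT_comp (f := @cos R)) => //.
by apply: continuous_measurable_fun; exact: continuous_cos.
Qed.

Lemma measurable_sin_fun (h : T -> R) : measurable_fun setT h ->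
  measurable_fun setT (fun x => sin (h x)).
Proof.
move=> mh; apply: (measurableT_comp (f := @sin R)) => //.
by apply: continuous_measurable_fun; exact: continuous_sin.
Qed.

Lemma measurable_expR_fun (h : T -> R) : measurable_fun setT h ->
  measurable_fun setT (fun x => expR (h x)).
Proof. by move=> mh; apply: (measurableT_comp (f := @expR R)) => //; exact: measurable_expR. Qed.

Lemma cmeasurable_cexp f : cmeasurable f -> cmeasurable (fun x => cexp (f x)).
Proof.
move=> [rf jf]; split => /=; apply: measurable_funM; try exact: measurable_expR_fun.
  exact: measurable_cos_fun.
exact: measurable_sin_fun.
Qed.

Lemma measurable_normc f : cmeasurable f -> measurable_fun setT (fun x => normc (f x)).
Proof.
move=> [rf jf]; under eq_fun do rewrite normcE2.
apply: (measurableT_comp (f := @Num.sqrt R)).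
  by apply: continuous_measurable_fun; exact: sqrt_continuous.
by apply: measurable_funD; apply: measurable_funX.
Qed.

End complex_measurability.

Lemma cmeasurable_comp (R : realType) d d' (T : measurableType d) (T' : measurableType d')
    (f : T' -> R[i]) (h : T -> T') :
  measurable_fun setT h -> cmeasurable f -> cmeasurable (fun x => f (h x)).
Proof.
move=> mh [rf jf]; split.
  exact: (measurableT_comp rf mh).
exact: (measurableT_comp jf mh).
Qed.

Section complex_integral.
Context {R : realType} d (T : measurableType d) (mu : {measure set T -> \bar R}).
Implicit Types (f g : T -> R[i]).

Definition cintegrable f : Prop :=
  cmeasurable f /\ (\int[mu]_x (normc (f x))%:E < +oo)%E.

Lemma measurable_EFin_normc f : cmeasurable f ->
  measurable_fun setT (fun x => (normc (f x))%:E).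
Proof. by move=> mf; apply/measurable_EFinP; exact: measurable_normc. Qed.

Lemma le_cintegrable f (g : T -> R) : cmeasurable f -> measurable_fun setT g ->
  (forall x, normc (f x) <= g x) -> (\int[mu]_x (g x)%:E < +oo)%E -> cintegrable f.
Proof.
move=> mf mg fg g_fin; split => //; apply: le_lt_trans g_fin.
apply: ge0_le_integral => //=.
- by move=> x _; rewrite lee_fin normc_ge0.
- exact: measurable_EFin_normc.
- exact/measurable_EFinP.
- by move=> x _; rewrite lee_fin.
Qed.

Lemma cintegrable_normc f : cintegrable f -> mu.-integrable setT (EFin \o (fun x => normc (f x))).
Proof.
move=> [mf fi]; apply/integrableP; split; first exact: measurable_EFin_normc.
under eq_integral => x _ do rewrite /= ger0_norm ?normc_ge0//; exact: fi.
Qed.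

Lemma cintegrable_Re f : cintegrable f -> mu.-integrable setT (EFin \o (fun x => complex.Re (f x))).
Proof.
move=> fi; apply: (le_integrable measurableT _ _ (cintegrable_normc fi)).
  by apply/measurable_EFinP; case: fi => -[].
by move=> x _; rewrite /= !lee_fin (ger0_norm (normc_ge0 _)) absRe_le.
Qed.

Lemma cintegrable_Im f : cintegrable f -> mu.-integrable setT (EFin \o (fun x => complex.Im (f x))).
Proof.
move=> fi; apply: (le_integrable measurableT _ _ (cintegrable_normc fi)).
  by apply/measurable_EFinP; case: fi => -[].
by move=> x _; rewrite /= !lee_fin (ger0_norm (normc_ge0 _)) absIm_le.
Qed.

Lemma cintegrable_parts f : cmeasurable f ->
  mu.-integrable setT (EFin \o (fun x => complex.Re (f x))) ->
  mu.-integrable setT (EFin \o (fun x => complex.Im (f x))) -> cintegrable f.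
Proof.
move=> mf /integrableP[_ rf] /integrableP[_ jf]; case: (mf) => mr mj.
apply: (@le_cintegrable _ (fun x => `|complex.Re (f x)| + `|complex.Im (f x)|)) => //.
- by apply: measurable_funD; apply: measurableT_comp.
- by move=> x; exact: normc_le.
under eq_integral do rewrite EFinD.
rewrite ge0_integralD//=; first exact: lte_add_pinfty.
- by apply/measurable_EFinP; apply: measurableT_comp.
- by apply/measurable_EFinP; apply: measurableT_comp.
Qed.

Lemma cintegrableD f g : cintegrable f -> cintegrable g -> cintegrable (fun x => f x + g x).
Proof.
move=> fi gi; apply: (@le_cintegrable _ (fun x => normc (f x) + normc (g x))).
- by apply: cmeasurableD; [case: fi|case: gi].
- by apply: measurable_funD; apply: measurable_normc; [case: fi|case: gi].
- by move=> x; exact: le_normcD.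
under eq_integral do rewrite EFinD.
rewrite ge0_integralD//=; first by apply: lte_add_pinfty; [case: fi|case: gi].
- by move=> x _; rewrite lee_fin normc_ge0.
- by apply: measurable_EFin_normc; case: fi.
- by move=> x _; rewrite lee_fin normc_ge0.
- by apply: measurable_EFin_normc; case: gi.
Qed.

Lemma cintegrableZl (c : R[i]) f : cintegrable f -> cintegrable (fun x => c * f x).
Proof.
move=> [mf fi]; split; first by apply: cmeasurableM => //; exact: cmeasurable_cst.
under eq_integral do rewrite Normc.normcM EFinM.
rewrite ge0_integralZl//=.
- by apply: lte_mul_pinfty => //; rewrite lee_fin normc_ge0.
- exact: measurable_EFin_normc.
- by move=> x _; rewrite lee_fin normc_ge0.
- by rewrite lee_fin normc_ge0.
Qed.

Lemma cintegrableN f : cintegrable f -> cintegrable (fun x => - f x).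
Proof. by move=> /(cintegrableZl (-1)); under eq_fun do rewrite mulN1r. Qed.

Lemma cintegrableB f g : cintegrable f -> cintegrable g -> cintegrable (fun x => f x - g x).
Proof. by move=> fi gi; apply: cintegrableD => //; exact: cintegrableN. Qed.

Lemma cintegrable_conj f : cintegrable f -> cintegrable (fun x => (f x)^*%C).
Proof.
move=> [mf fi]; split; first exact: cmeasurable_conj.
by under eq_integral do rewrite normc_conj.
Qed.

Lemma eq_cintegral f g : f =1 g -> cintegral mu f = cintegral mu g.
Proof. by move=> /funext ->. Qed.

Lemma cintegralD f g : cintegrable f -> cintegrable g ->
  cintegral mu (fun x => f x + g x) = cintegral mu f + cintegral mu g.
Proof.
move=> fi gi; apply: complexP; rewrite ?cReD ?cImD /=.
  by under eq_Rintegral do rewrite cReD; rewrite RintegralD//; exact: cintegrable_Re.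
by under eq_Rintegral do rewrite cImD; rewrite RintegralD//; exact: cintegrable_Im.
Qed.

Lemma cintegralZl (c : R[i]) f : cintegrable f ->
  cintegral mu (fun x => c * f x) = c * cintegral mu f.
Proof.
move=> fi; have rf := cintegrable_Re fi; have jf := cintegrable_Im fi.
have rz (r : R) (h : T -> R) : mu.-integrable setT (EFin \o h) ->
    mu.-integrable setT (EFin \o (fun x => r * h x)).
  by move=> hi; exact: (integrableZl measurableT r hi).
apply: complexP; rewrite ?cReM ?cImM /=.
  under eq_Rintegral do rewrite cReM.
  by rewrite RintegralB ?RintegralZl//; exact: rz.
under eq_Rintegral do rewrite cImM.
by rewrite RintegralD ?RintegralZl//; exact: rz.
Qed.

Lemma cintegralZr (c : R[i]) f : cintegrable f ->
  cintegral mu (fun x => f x * c) = cintegral mu f * c.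
Proof. by move=> fi; under eq_cintegral do rewrite mulrC; rewrite cintegralZl// mulrC. Qed.

Lemma cintegralN f : cintegrable f -> cintegral mu (fun x => - f x) = - cintegral mu f.
Proof.
by move=> fi; under eq_cintegral do rewrite -mulN1r; rewrite cintegralZl// mulN1r.
Qed.

Lemma cintegralB f g : cintegrable f -> cintegrable g ->
  cintegral mu (fun x => f x - g x) = cintegral mu f - cintegral mu g.
Proof. by move=> fi gi; rewrite cintegralD ?cintegralN//; exact: cintegrableN. Qed.

Lemma cintegral0 : cintegral mu (fun _ => 0) = 0.
Proof. by apply: complexP => /=; rewrite /Rintegral integral0. Qed.

Lemma cintegral_conj f : cintegrable f ->
  cintegral mu (fun x => (f x)^*%C) = (cintegral mu f)^*%C.
Proof.
move=> fi; apply: complexP; rewrite ?cRe_conj ?cIm_conj /=.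
  by under eq_Rintegral do rewrite cRe_conj.
under eq_Rintegral do rewrite cIm_conj -mulN1r.
by rewrite RintegralZl ?mulN1r//; exact: cintegrable_Im.
Qed.

Lemma cintegral_real (h : T -> R) : cintegral mu (fun x => (h x)%:C%C) = (\int[mu]_x h x)%:C%C.
Proof. by apply: complexP => //=; rewrite /Rintegral integral0. Qed.

(* Rotating the integral onto the positive axis reduces the bound to its real part. *)
Lemma normc_cintegral_le f : cintegrable f ->
  ((normc (cintegral mu f))%:E <= \int[mu]_x (normc (f x))%:E)%E.
Proof.
move=> fi; set I := cintegral mu f.
have [I0|I0] := eqVneq I 0.
  by rewrite I0 normc0E; apply: integral_ge0 => x _; rewrite lee_fin normc_ge0.
have nI0 : normc I != 0 by rewrite normc0_eq.
pose u := I^*%C * ((normc I)^-1)%:C%C.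
have nu : normc u = 1.
  by rewrite /u Normc.normcM normc_conj normc_real ger0_norm ?invr_ge0 ?normc_ge0// mulfV.
have uI : u * I = (normc I)%:C%C.
  by rewrite /u mulrAC (mulrC I^*%C) mulc_conj -rmorphM/= expr2 mulfK.
have ui := cintegrableZl u fi.
have : normc I = \int[mu]_x complex.Re (u * f x).
  by have := cintegralZl u fi; rewrite -/I uI => /(congr1 (@complex.Re R)) /= <-.
move=> ->; rewrite /Rintegral fineK; last first.
  by apply: integrable_fin_num => //; exact: cintegrable_Re.
apply: le_integral => //.
- exact: cintegrable_Re.
- exact: cintegrable_normc.
move=> x _; rewrite lee_fin.
by rewrite -[leRHS]mul1r -nu -Normc.normcM (le_trans (ler_norm _)) ?absRe_le.
Qed.

Lemma normc_cintegral_le_fine f : cintegrable f ->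
  normc (cintegral mu f) <= fine (\int[mu]_x (normc (f x))%:E).
Proof.
move=> fi; rewrite -lee_fin fineK ?normc_cintegral_le//.
by rewrite ge0_fin_numE; [case: fi|apply: integral_ge0 => x _; rewrite lee_fin normc_ge0].
Qed.

Lemma ae_eq_cintegral f g : cmeasurable f -> cmeasurable g ->
  {ae mu, forall x, f x = g x} -> cintegral mu f = cintegral mu g.
Proof.
move=> [rf jf] [rg jg] fg; apply: complexP => /=; rewrite /Rintegral; congr fine.
  apply: ae_eq_integral => //; try exact/measurable_EFinP.
  by apply: filterS fg => x /= -> _.
apply: ae_eq_integral => //; try exact/measurable_EFinP.
by apply: filterS fg => x /= -> _.
Qed.

End complex_integral.

(** * Dominated convergence and Fubini for complex integrands *)

Section complex_dominated_convergence.
Context {R : realType} d (T : measurableType d) (mu : {measure set T -> \bar R}).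

(** The real theorem is applied to [normc (f j x - g x)], dominated by [2 * h x]. *)
Lemma cdominated_convergence (f : nat -> T -> R[i]) (g : T -> R[i]) (h : T -> R) :
  (forall j, cmeasurable (f j)) -> cmeasurable g -> measurable_fun setT h ->
  (forall j x, normc (f j x) <= h x) -> (forall x, normc (g x) <= h x) ->
  (\int[mu]_x (h x)%:E < +oo)%E ->
  (forall x, normc (f j x - g x) @[j --> \oo] --> 0) ->
  normc (cintegral mu (f j) - cintegral mu g) @[j --> \oo] --> 0.
Proof.
move=> mf mg mh fh gh hoo fg.
have h0 x : 0 <= h x by rewrite (le_trans (normc_ge0 _) (gh x)).
have fi j : cintegrable mu (f j) by apply: (@le_cintegrable _ _ _ mu _ h).
have gi : cintegrable mu g by apply: (@le_cintegrable _ _ _ mu _ h).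
have hi : mu.-integrable setT (EFin \o (fun x => 2 * h x)).
  have hi1 : mu.-integrable setT (EFin \o h).
    apply/integrableP; split; first exact/measurable_EFinP.
    by under eq_integral => x _ do rewrite /= ger0_norm//.
  exact: (integrableZl measurableT 2 hi1).
pose F j x := (normc (f j x - g x))%:E.
have mF j : measurable_fun setT (F j).
  by apply: measurable_EFin_normc; apply: cmeasurableB.
have [] := @dominated_convergence _ T R mu setT measurableT F (cst 0%E) (EFin \o (fun x => 2 * h x)) mF.
- exact: measurable_cst.
- apply: aeW => x _; apply: cvg_EFin; last exact: fg.
  by apply: nearW.
- exact: hi.
- apply: aeW => x j _; rewrite /F /= lee_fin ger0_norm ?normc_ge0// mulrDl mul1r.
  by rewrite (le_trans (le_normcD _ _))// normcN lerD.
move=> _ _; rewrite integral0 => /fine_cvgP[_ H].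
apply: (squeeze_cvgr _ (cvg_cst (0 : R)) H).
apply: nearW => j; apply/andP; split; first exact: normc_ge0.
rewrite -cintegralB//; exact/normc_cintegral_le_fine/cintegrableB.
Qed.

End complex_dominated_convergence.

Section complex_fubini.
Context {R : realType} d1 d2 (T1 : measurableType d1) (T2 : measurableType d2).
Context (m1 : {sigma_finite_measure set T1 -> \bar R}).
Context (m2 : {sigma_finite_measure set T2 -> \bar R}).
Context (f : T1 * T2 -> R[i]).
Context (mf : cmeasurable f).

Lemma measurable_Rintegral_section (h : T1 * T2 -> R) : measurable_fun setT h ->
  measurable_fun setT (fun x => \int[m2]_y h (x, y)).
Proof.
move=> mh; have mE : measurable_fun setT (EFin \o h) by exact/measurable_EFinP.
rewrite (_ : (fun x => _) = fine \o
   (fun x => \int[m2]_y ((EFin \o h)^\+ (x, y)) - \int[m2]_y ((EFin \o h)^\- (x, y)))%E).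
  apply: measurableT_comp; first exact: fine_measurable.
  apply: emeasurable_funB; apply: measurable_fun_fubini_tonelli_F => //.
    exact: measurable_funepos.
  exact: measurable_funeneg.
apply/funext => x /=; rewrite /Rintegral [in LHS]integralE.
by congr (fine (_ - _)); apply: eq_integral => y _; rewrite ?funeposE ?funenegE.
Qed.

Lemma cmeasurable_cintegral : cmeasurable (fun x => cintegral m2 (fun y => f (x, y))).
Proof. by case: mf => rf jf; split; [exact: measurable_Rintegral_section rf|exact: measurable_Rintegral_section jf]. Qed.

Context (foo : (\int[m1]_x \int[m2]_y (normc (f (x, y)))%:E < +oo)%E).

(** [Rintegral] of a section agrees with the extended integral only where the section is integrable,
    that is almost everywhere; all three claims are therefore transported along almost-everywhere
    equality. *)
Let fub (h : T1 * T2 -> R) : measurable_fun setT h ->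
  (forall z, `|h z| <= normc (f z)) ->
  [/\ \int[m1]_x \int[m2]_y h (x, y) = \int[m2]_y \int[m1]_x h (x, y),
  \int[(m1 \x m2)%E]_z h z = \int[m1]_x \int[m2]_y h (x, y) &
  m1.-integrable setT (EFin \o (fun x => \int[m2]_y h (x, y)))].
Proof.
move=> mh hf.
have mE : measurable_fun setT (EFin \o h) by exact/measurable_EFinP.
have hi : (m1 \x m2)%E.-integrable setT (EFin \o h).
  apply/(integrable12ltyP _ _ mE); apply: le_lt_trans foo.
  apply: ge0_le_integral => //=.
  - by move=> x _; apply: integral_ge0.
  - apply: (@measurable_fun_fubini_tonelli_F _ _ _ _ _ m2 (fun z => `|(h z)%:E|%E)) => //.
    exact: measurableT_comp.
  - apply: (@measurable_fun_fubini_tonelli_F _ _ _ _ _ m2 (fun z => (normc (f z))%:E)) => //.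
      by apply: measurable_EFin_normc.
    by move=> z; rewrite lee_fin normc_ge0.
  move=> x _; apply: ge0_le_integral => //=.
  - apply/measurable_EFinP; apply: measurableT_comp => //.
    exact: (measurableT_comp mh (pair1_measurable x)).
  - apply/measurable_EFinP; exact: (measurableT_comp (measurable_normc mf) (pair1_measurable x)).
  - by move=> y _; rewrite lee_fin.
have a1 := ae_integrable1 hi; have a2 := ae_integrable2 hi.
have F1 := integral12_prod_meas1 hi; have F2 := integral21_prod_meas1 hi.
have e1 : {ae m1, forall x, (\int[m2]_y h (x, y))%:E = fubini_F m2 (EFin \o h) x}.
  apply: filterS a1 => x hx; rewrite /Rintegral fineK//.
  exact: integrable_fin_num hx.
have e2 : {ae m2, forall y, (\int[m1]_x h (x, y))%:E = fubini_G m1 (EFin \o h) y}.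
  apply: filterS a2 => x hx; rewrite /Rintegral fineK//.
  exact: integrable_fin_num hx.
have mR1 := measurable_Rintegral_section mh.
have mR2 : measurable_fun setT (fun y => \int[m1]_x h (x, y)).
  rewrite (_ : (fun x => _) = fine \o
    (fun y => \int[m1]_x ((EFin \o h)^\+ (x, y)) - \int[m1]_x ((EFin \o h)^\- (x, y)))%E).
    apply: measurableT_comp; first exact: fine_measurable.
    apply: emeasurable_funB; apply: measurable_fun_fubini_tonelli_G => //.
      exact: measurable_funepos.
    exact: measurable_funeneg.
  apply/funext => x /=; rewrite /Rintegral [in LHS]integralE.
by congr (fine (_ - _)); apply: eq_integral => y _; rewrite ?funeposE ?funenegE.
have iF := integrable_fubini_F hi.
have E1 : (\int[m1]_x (\int[m2]_y h (x, y))%:E = \int[m1]_x fubini_F m2 (EFin \o h) x)%E.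
  apply: ae_eq_integral => //.
  - exact/measurable_EFinP.
  - exact: (measurable_fubini_F hi).
  - by apply: filterS e1 => x -> _.
split.
- rewrite {1}/Rintegral [RHS]/Rintegral; congr fine; rewrite E1.
  rewrite F1 -F2; apply: ae_eq_integral => //.
  + exact: (measurable_fubini_G hi).
  + exact/measurable_EFinP.
  + by apply: filterS e2 => x <- _.
- by rewrite {1}/Rintegral [RHS]/Rintegral; congr fine; rewrite E1 F1.
apply/integrableP; split; first exact/measurable_EFinP.
have /integrableP[_ H] := iF; apply: le_lt_trans H.
rewrite le_eqVlt; apply/orP; left; apply/eqP; apply: ae_eq_integral => //.
- by apply: measurableT_comp => //; exact/measurable_EFinP.
- by apply: measurableT_comp => //; exact: (measurable_fubini_F hi).
- by apply: filterS e1 => x /= <- _.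
Qed.

Lemma cfubini : cintegral m1 (fun x => cintegral m2 (fun y => f (x, y))) =
  cintegral m2 (fun y => cintegral m1 (fun x => f (x, y))).
Proof.
case: (mf) => rf jf; apply: complexP => /=.
  by have [] := fub rf (fun z => absRe_le _).
by have [] := fub jf (fun z => absIm_le _).
Qed.

Lemma cintegral_prod : cintegral (m1 \x m2)%E f =
  cintegral m1 (fun x => cintegral m2 (fun y => f (x, y))).
Proof.
case: (mf) => rf jf; apply: complexP => /=.
  by have [] := fub rf (fun z => absRe_le _).
by have [] := fub jf (fun z => absIm_le _).
Qed.

Lemma cintegrable_cintegral : cintegrable m1 (fun x => cintegral m2 (fun y => f (x, y))).
Proof.
case: (mf) => rf jf; apply: cintegrable_parts; first exact: cmeasurable_cintegral.
  by have [] := fub rf (fun z => absRe_le _).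
by have [] := fub jf (fun z => absIm_le _).
Qed.

End complex_fubini.

(** * Holomorphic functions of one variable *)
Section path_integrals.
Context {R : realType}.
Implicit Types (a b c : R) (phi : R -> R[i]).

(** With half-open intervals the additivity [cint_split] is a pointwise identity of indicators. *)
Definition cint a b phi : R[i] :=
  cintegral lebesgue_measure (fun x : measurableTypeR R => (\1_`]a, b] x)%:C%C * phi x).

Definition path_continuous phi : Prop :=
  continuous (fun x => complex.Re (phi x)) /\ continuous (fun x => complex.Im (phi x)).

Lemma path_continuousP phi :
  (forall x e : R, 0 < e -> exists2 d : R, 0 < d &
     forall y, `|y - x| < d -> normc (phi y - phi x) <= e) -> path_continuous phi.
Proof.
move=> H; split => x; apply/cvgrPdist_le => e e0; have [d d0 Hd] := H x e e0.
  apply/nbhs_ballP; exists d => // y /=; rewrite distrC => /Hd.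
  by apply: le_trans; rewrite distrC -cReN -cReD absRe_le.
apply/nbhs_ballP; exists d => // y /=; rewrite distrC => /Hd.
by apply: le_trans; rewrite distrC -cImN -cImD absIm_le.
Qed.

Lemma cint_integrable a b phi : path_continuous phi ->
  cintegrable lebesgue_measure (fun x : measurableTypeR R => (\1_`]a, b] x)%:C%C * phi x).
Proof.
move=> [cr ci]; pose h (x : R) : R := `|complex.Re (phi x)| + `|complex.Im (phi x)|.
have hc : continuous h.
  move=> x; apply: cvgD; apply: cvg_norm; [exact: cr|exact: ci].
have mI : measurable_fun setT (\1_`]a, b] : measurableTypeR R -> R) by exact: measurable_indic.
apply: (@le_cintegrable R _ (measurableTypeR R) lebesgue_measure _ (fun x => h x * \1_`]a, b] x)).
- apply: cmeasurableM; first exact: cmeasurable_real.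
  by split; exact: continuous_measurable_fun.
- by apply: measurable_funM => //; exact: continuous_measurable_fun.
- move=> x; rewrite Normc.normcM normc_real ger0_norm ?indicE//.
  by rewrite mulrC ler_wpM2r// normc_le.
have : lebesgue_measure.-integrable `[a, b] (EFin \o h).
  apply: continuous_compact_integrable; first exact: segment_compact.
  exact: continuous_subspaceT.
move=> /integrableP[_]; apply: le_lt_trans.
rewrite [leRHS]integral_mkcond; apply: ge0_le_integral => //=.
- by move=> x _; rewrite lee_fin mulr_ge0 ?indicE// /h addr_ge0.
- apply/measurable_EFinP; apply: measurable_funM => //; exact: continuous_measurable_fun.
- apply/(measurable_restrictT _ _).1 => //; apply: measurable_funTS; apply/measurable_EFinP.
  rewrite (_ : (fun _ => _) = h); first exact: continuous_measurable_fun.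
  by apply/funext => x; rewrite ger0_norm// /h addr_ge0.
- move=> x _; rewrite patchE; case: ifPn => xab.
    by rewrite lee_fin ger0_norm /h ?addr_ge0// ler_piMr ?addr_ge0// indicE; case: (_ \in _).
  rewrite indicE (_ : x \in _ = false) ?mulr0//.
  apply: contraNF xab; rewrite !inE/= !in_itv/= => /andP[/ltW -> ->//].
Qed.

Lemma eq_cint a b phi psi : phi =1 psi -> cint a b phi = cint a b psi.
Proof. by move=> /funext ->. Qed.

Lemma cintD a b phi psi : path_continuous phi -> path_continuous psi ->
  cint a b (fun x => phi x + psi x) = cint a b phi + cint a b psi.
Proof.
move=> /(cint_integrable a b) h1 /(cint_integrable a b) h2.
by rewrite /cint -cintegralD//; apply: eq_cintegral => x; rewrite mulrDr.
Qed.

Lemma cintN a b phi : path_continuous phi -> cint a b (fun x => - phi x) = - cint a b phi.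
Proof.
move=> /(cint_integrable a b) h.
by rewrite /cint -cintegralN//; apply: eq_cintegral => x; rewrite mulrN.
Qed.

Lemma cint_split a b c phi : path_continuous phi -> a <= c -> c <= b ->
  cint a b phi = cint a c phi + cint c b phi.
Proof.
move=> pc ac cb; rewrite /cint -cintegralD; try exact: cint_integrable.
apply: eq_cintegral => x; rewrite -mulrDl -rmorphD/=; congr (_%:C%C * _).
rewrite !indicE !mem_setE !in_itv/=.
have [xc|xc] := leP x c; first by rewrite (le_trans xc cb) !andbT/= addr0.
by rewrite (le_lt_trans ac xc)/= add0r.
Qed.

Lemma integral_indic_ocitv a b : a <= b ->
  (\int[lebesgue_measure]_x (\1_`]a, b] x)%:E)%E = (b - a)%:E.
Proof.
move=> ab.
have e : lebesgue_measure (`]a, b]%classic : set R) = (b - a)%:E.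
  rewrite lebesgue_measure_itv/= lte_fin; case: ltP => h; first by rewrite -EFinB.
  by congr EFin; apply/eqP; rewrite eq_sym subr_eq0 eq_le h.
by rewrite integral_indic// setIT; exact: e.
Qed.

Lemma cint_le a b phi M : path_continuous phi -> a <= b ->
  (forall x, a <= x <= b -> normc (phi x) <= M) ->
  normc (cint a b phi) <= M * (b - a).
Proof.
move=> pc ab H.
have M0 : 0 <= M by apply: le_trans (H a _); rewrite ?normc_ge0 ?lexx.
rewrite -lee_fin; apply: (le_trans (normc_cintegral_le (cint_integrable a b pc))).
apply: (@le_trans _ _ (\int[lebesgue_measure]_x (M%:E * (\1_`]a, b] x)%:E))%E).
  apply: ge0_le_integral => //=.
  - by move=> x _; rewrite lee_fin normc_ge0.
  - by apply: measurable_EFin_normc; case: (cint_integrable a b pc).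
  - by apply: emeasurable_funM => //; apply/measurable_EFinP; exact: measurable_indic.
  move=> x _; rewrite -EFinM lee_fin Normc.normcM normc_real ger0_norm ?indicE// mulrC.
  rewrite mem_setE; case: (boolP (x \in _)) => xab; last by rewrite !mulr0.
  by rewrite !mulr1 H//; move: xab; rewrite in_itv/= => /andP[/ltW -> ->].
rewrite ge0_integralZl//; last by apply/measurable_EFinP; exact: measurable_indic.
by rewrite integral_indic_ocitv// -EFinM.
Qed.

Lemma path_continuous_cst (z : R[i]) : path_continuous (fun _ => z).
Proof. by split => x; exact: cvg_cst. Qed.

Lemma cint_cst a b (z : R[i]) : a <= b -> cint a b (fun _ => z) = (b - a)%:C%C * z.
Proof.
move=> ab; have := cint_integrable a b (path_continuous_cst 1) => h.
transitivity (cint a b (fun _ => 1) * z).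
  by rewrite /cint -cintegralZr//; apply: eq_cintegral => x; rewrite mulr1.
congr (_ * _); rewrite /cint.
under eq_cintegral do rewrite mulr1.
rewrite cintegral_real; congr (_%:C%C).
by rewrite /Rintegral integral_indic_ocitv.
Qed.

End path_integrals.

(** * Goursat's theorem on rectangles *)

Section rectangle_bisection.
Context {R : realType}.
Context (J : R -> R -> R -> R -> R).
Context (J_split : forall a b c d m k, a <= m -> m <= b -> c <= k -> k <= d ->
  J a b c d <= J a m c k + J m b c k + J a m k d + J m b k d).
Context (J_local : forall x0 y0 e : R, 0 < e -> exists2 r : R, 0 < r &
  forall a b c d, a <= x0 <= b -> c <= y0 <= d -> (b - a) + (d - c) < r ->
    J a b c d <= e * ((b - a) + (d - c)) ^+ 2).
Context (a b c d : R).
Context (ab : a <= b) (cd : c <= d).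

Let w j := (b - a) / 2 ^+ j.
Let v j := (d - c) / 2 ^+ j.
Let w_ge0 j : 0 <= w j.
Proof. by rewrite divr_ge0 ?exprn_ge0// subr_ge0. Qed.
Let v_ge0 j : 0 <= v j.
Proof. by rewrite divr_ge0 ?exprn_ge0// subr_ge0. Qed.
Let wS j : w j = w j.+1 + w j.+1.
Proof. by rewrite /w exprS invfM; field. Qed.
Let vS j : v j = v j.+1 + v j.+1.
Proof. by rewrite /v exprS invfM; field. Qed.

Let good j (p : R * R) :=
  J a b c d / 4 ^+ j <= J p.1 (p.1 + w j) p.2 (p.2 + v j).

(** Pigeonhole: if all four quarters fell below the share [J a b c d / 4 ^+ j.+1], subadditivity
    [J_split] would contradict [good j p]. *)
Let good_step j p : good j p -> exists q, [/\ good j.+1 q,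
  p.1 <= q.1, q.1 + w j.+1 <= p.1 + w j, p.2 <= q.2 & q.2 + v j.+1 <= p.2 + v j].
Proof.
move: p => [x y]; rewrite /good /= => h.
have w1 := w_ge0 j.+1; have v1 := v_ge0 j.+1; have e1 := wS j; have e2 := vS j.
have := @J_split x (x + w j) y (y + v j) (x + w j.+1) (y + v j.+1).
move=> /(_ ltac:(lra) ltac:(lra) ltac:(lra) ltac:(lra)) h'.
have e4 : J a b c d / 4 ^+ j = 4 * (J a b c d / 4 ^+ j.+1) by rewrite exprS invfM; field.
have [h1|h1] := leP (J a b c d / 4 ^+ j.+1) (J x (x + w j.+1) y (y + v j.+1)).
  by exists (x, y); split => /=; lra.
have [h2|h2] := leP (J a b c d / 4 ^+ j.+1) (J (x + w j.+1) (x + w j) y (y + v j.+1)).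
  by exists (x + w j.+1, y); rewrite /= -addrA -e1; split; lra.
have [h3|h3] := leP (J a b c d / 4 ^+ j.+1) (J x (x + w j.+1) (y + v j.+1) (y + v j)).
  by exists (x, y + v j.+1); rewrite /= -[y + _ + _]addrA -e2; split; lra.
exists (x + w j.+1, y + v j.+1); rewrite /= -!addrA -e1 -e2; split; lra.
Qed.

Let limit_pt (f l : nat -> R) : (forall j, 0 <= l j) ->
  (forall j, f j <= f j.+1 /\ f j.+1 + l j.+1 <= f j + l j) ->
  exists x, forall j, f j <= x <= f j + l j.
Proof.
move=> l0 step.
have H j k : (j <= k)%N -> f j <= f k /\ f k + l k <= f j + l j.
  elim: k => [|k ih]; first by rewrite leqn0 => /eqP ->; rewrite !lexx.
  rewrite leq_eqVlt => /orP[/eqP ->|]; first by rewrite !lexx.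
  by rewrite ltnS => /ih; have := step k; lra.
exists (sup (range f)) => j.
have ub k m : f k <= f m + l m.
  have [km|/ltnW mk] := leqP k m.
    by have [h _] := H _ _ km; apply: (le_trans h); rewrite lerDl.
  by have [_ h] := H _ _ mk; apply: le_trans h; rewrite lerDl.
apply/andP; split.
  apply: ub_le_sup; last by exists j.
  by exists (f 0%N + l 0%N) => _ [k _ <-].
apply: ge_sup; first by exists (f 0%N), 0%N.
by move=> _ [k _ <-].
Qed.

(** The core of Goursat's argument, freed from integrals. The nested quarters shrink to a point
    [(x0, y0)]; there [J_local] bounds [J] by [e] times the squared half-perimeter, which scales by
    the same [4 ^- N] as the share carried by the quarter, so [J a b c d <= e * K ^+ 2] for every
    [e]. *)
Lemma rectangle_bisection : J a b c d <= 0.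
Proof.
have good0 : good 0 (a, c).
  by rewrite /good /w /v !expr0 !divr1 /= [a + _]addrC [c + _]addrC !subrK.
have [s [s0 sS]] : exists s : nat -> R * R, s 0%N = (a, c) /\
  forall j, good j (s j) /\ [/\ (s j).1 <= (s j.+1).1,
     (s j.+1).1 + w j.+1 <= (s j).1 + w j, (s j).2 <= (s j.+1).2 &
     (s j.+1).2 + v j.+1 <= (s j).2 + v j].
  (* The next corner is picked by [xget]; its default [p] is never taken, since [good_step] shows
     that the set is inhabited. *)
  pose nx j p := xget p [set q | [/\ good j.+1 q,
    p.1 <= q.1, q.1 + w j.+1 <= p.1 + w j, p.2 <= q.2 & q.2 + v j.+1 <= p.2 + v j]].
  pose s := fix s j := if j is j'.+1 then nx j' (s j') else (a, c).
  have sg j : good j (s j).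
    elim: j => [//|j ih]; rewrite [s _]/(nx j (s j)) /nx.
    by have [q hq] := good_step ih; case: xgetP => [r _ []//|/(_ q)]; case.
  exists s; split => // j; split; first exact: sg.
  rewrite [s j.+1]/(nx j (s j)) /nx.
  by have [q hq] := good_step (sg j); case: xgetP => [r _ []//|/(_ q)]; case.
have [x0 hx] := @limit_pt (fun j => (s j).1) w w_ge0 (fun j =>
   let: conj _ (And4 h1 h2 _ _) := sS j in conj h1 h2).
have [y0 hy] := @limit_pt (fun j => (s j).2) v v_ge0 (fun j =>
   let: conj _ (And4 _ _ h1 h2) := sS j in conj h1 h2).
pose K := (b - a) + (d - c).
have K0 : 0 <= K by rewrite addr_ge0// subr_ge0.
have key (e : R) : 0 < e -> J a b c d <= e * K ^+ 2.
  move=> e0; have [r r0 Hr] := J_local x0 y0 e0.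
  have [N HN] : exists N : nat, K / 2 ^+ N < r.
    have := @cvg_geometric R K (2^-1); rewrite ger0_norm ?invr_ge0// invf_lt1// ltr1n => /(_ isT).
    move=> /cvgrPdist_lt/(_ r r0)[N _ /(_ N (leqnn _))].
    by rewrite sub0r normrN /geometric/= exprVn ger0_norm ?divr_ge0 ?exprn_ge0//; exists N.
  have [gN _] := sS N; move: gN; rewrite /good ler_pdivrMr ?exprn_gt0// => h; apply: (le_trans h).
  have hK : w N + v N = K / 2 ^+ N by rewrite /w /v -mulrDl.
  have := Hr (s N).1 ((s N).1 + w N) (s N).2 ((s N).2 + v N) (hx N) (hy N).
  rewrite ![_ + _ - _]addrAC !subrr !add0r hK => /(_ HN) h2.
  have p4 : 0 <= 4 ^+ N :> R by rewrite exprn_ge0.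
  apply: (le_trans (ler_wpM2r p4 h2)).
  rewrite (_ : 4 ^+ N = 2 ^+ N * 2 ^+ N :> R); last by rewrite -exprMn; congr (_ ^+ _); ring.
  rewrite le_eqVlt; apply/orP; left; apply/eqP.
  have n2 : 2 ^+ N != 0 :> R by rewrite expf_neq0.
  by field.
have [K00|Kn0] := eqVneq K 0.
  by have := key 1 ltr01; rewrite K00 expr0n mulr0.
have K2 : 0 < K ^+ 2 by rewrite exprn_even_gt0.
apply/ler_addgt0Pr => e e0; rewrite add0r.
have := key (e / K ^+ 2); rewrite (divr_gt0 e0 K2) => /(_ isT) h.
by apply: (le_trans h); rewrite divfK// gt_eqF.
Qed.

End rectangle_bisection.

Lemma normc_le4 (R : realType) (z a b c d : R[i]) : z = (a + c) + (b + d) ->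
  normc z <= normc a + normc b + normc c + normc d.
Proof.
move=> ->; apply: (le_trans (le_normcD _ _)); rewrite -addrA addrACA.
by apply: lerD; exact: le_normcD.
Qed.

Section goursat.
Context {R : realType}.
Context (g : R[i] -> R[i]).
Context (dg : forall z : R[i]^o, differentiable (g : R[i]^o -> R[i]^o) z).

Lemma holomorphic_continuous (z : R[i]) (e : R) : 0 < e ->
  exists2 d : R, 0 < d & forall h : R[i], normc h < d -> normc (g (z + h) - g z) <= e.
Proof.
move=> e0; have [L /(_ 1 ltr01)[d d0 H]] := differentiable_epsdelta (dg z).
have M0 : 0 < 1 + normc L by rewrite ltr_pwDl// normc_ge0.
exists (Num.min d (e / (1 + normc L))); first by rewrite lt_min d0 divr_gt0.
move=> h; rewrite lt_min => /andP[hd he].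
have -> : g (z + h) - g z = (g (z + h) - g z - L * h) + L * h by ring.
apply: (le_trans (le_normcD _ _)).
apply: (@le_trans _ _ (1 * normc h + normc L * normc h)).
  by apply: lerD; [exact: H|rewrite Normc.normcM].
by rewrite -mulrDl mulrC -ler_pdivlMr// ltW.
Qed.

Lemma path_continuous_holomorphic (K : R) (p : R -> R[i]) :
  (forall x y, normc (p y - p x) <= K * `|y - x|) -> path_continuous (fun x => g (p x)).
Proof.
move=> Hp; apply: path_continuousP => x e e0.
have [d d0 H] := holomorphic_continuous (p x) e0.
exists (d / (1 + `|K|)); first by rewrite divr_gt0// ltr_pwDl.
move=> y; rewrite ltr_pdivlMr ?ltr_pwDl// => xy.
have -> : p y = p x + (p y - p x) by ring.
apply: H; apply: le_lt_trans xy; apply: (le_trans (Hp x y)).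
by rewrite mulrC ler_wpM2l//; have := ler_norm K; lra.
Qed.

Lemma path_continuousB (p q : R -> R[i]) : path_continuous p -> path_continuous q ->
  path_continuous (fun x => p x - q x).
Proof.
move=> [pr pj] [qr qj]; split => x.
  by under eq_fun do rewrite cReD cReN; apply: cvgB; [exact: pr|exact: qr].
by under eq_fun do rewrite cImD cImN; apply: cvgB; [exact: pj|exact: qj].
Qed.

Lemma path_continuousD (p q : R -> R[i]) : path_continuous p -> path_continuous q ->
  path_continuous (fun x => p x + q x).
Proof.
move=> [pr pj] [qr qj]; split => x.
  by under eq_fun do rewrite cReD; apply: cvgD; [exact: pr|exact: qr].
by under eq_fun do rewrite cImD; apply: cvgD; [exact: pj|exact: qj].
Qed.

Lemma path_horizontal (c : R) : path_continuous (fun x => g (x +i* c)%C).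
Proof.
apply: (@path_continuous_holomorphic 1) => x y; rewrite mul1r.
have -> : ((y +i* c) - (x +i* c))%C = (y - x)%:C%C by apply: complexP => /=; ring.
by rewrite normc_real.
Qed.

Lemma path_vertical (a : R) : path_continuous (fun y => g (a +i* y)%C).
Proof.
apply: (@path_continuous_holomorphic 1) => x y; rewrite mul1r.
have -> : ((a +i* y) - (a +i* x))%C = 'i%C * (y - x)%:C%C by apply: complexP => /=; ring.
by rewrite Normc.normcM normc_real normcE2/= expr0n expr1n add0r sqrtr1 mul1r.
Qed.

(** The counterclockwise boundary integral over [[a, b] x [c, d]], with opposite sides paired in one
    integrand so that splitting the rectangle makes inner sides cancel under the integral. *)
Definition rint (a b c d : R) : R[i] :=
  cint a b (fun x => g (x +i* c)%C - g (x +i* d)%C) +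
  'i%C * cint c d (fun y => g (b +i* y)%C - g (a +i* y)%C).

Let hp c d : path_continuous (fun x => g (x +i* c)%C - g (x +i* d)%C).
Proof. by apply: path_continuousB; exact: path_horizontal. Qed.

Let vp a b : path_continuous (fun y => g (b +i* y)%C - g (a +i* y)%C).
Proof. by apply: path_continuousB; exact: path_vertical. Qed.

Lemma rint_hsplit a b c d m : a <= m -> m <= b ->
  rint a b c d = rint a m c d + rint m b c d.
Proof.
move=> am mb; rewrite /rint (cint_split (hp c d) am mb).
rewrite (@eq_cint _ c d (fun y => g (b +i* y)%C - g (a +i* y)%C)
  (fun y => (g (m +i* y)%C - g (a +i* y)%C) + (g (b +i* y)%C - g (m +i* y)%C))).
  rewrite (cintD _ _ (vp a m) (vp m b)).
  by move: (cint _ _ _) (cint _ _ _) (cint _ _ _) (cint _ _ _) => *; ring.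
by move=> y /=; ring.
Qed.

Lemma rint_vsplit a b c d k : c <= k -> k <= d ->
  rint a b c d = rint a b c k + rint a b k d.
Proof.
move=> ck kd; rewrite /rint (cint_split (vp a b) ck kd).
rewrite (@eq_cint _ a b (fun x => g (x +i* c)%C - g (x +i* d)%C)
  (fun x => (g (x +i* c)%C - g (x +i* k)%C) + (g (x +i* k)%C - g (x +i* d)%C))).
  rewrite (cintD _ _ (hp c k) (hp k d)).
  by move: (cint _ _ _) (cint _ _ _) (cint _ _ _) (cint _ _ _) => *; ring.
by move=> y /=; ring.
Qed.

(** The boundary integral of the affine function [A + L * (z - z0)] is zero, so only the remainder
    [rho] contributes; each pair of opposite sides gives at most [2 * M] times its length. *)
Lemma rint_le a b c d (z0 A L : R[i]) (M : R) : a <= b -> c <= d ->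
  (forall x y, a <= x <= b -> c <= y <= d ->
     normc (g (x +i* y)%C - A - L * ((x +i* y)%C - z0)) <= M) ->
  normc (rint a b c d) <= 2 * M * ((b - a) + (d - c)).
Proof.
move=> ab cd H.
pose rho z := g z - A - L * (z - z0).
have rr x y : a <= x <= b -> c <= y <= d -> normc (rho (x +i* y)%C) <= M by exact: H.
have aff (z : R[i]) : path_continuous (fun=> z) by exact: path_continuous_cst.
have hr : path_continuous (fun x => rho (x +i* c)%C - rho (x +i* d)%C).
  have := path_continuousD (hp c d) (aff (- (L * 'i%C * (c - d)%:C%C))).
  congr path_continuous; apply/funext => x; rewrite /rho.
  have -> : ((x +i* d) = (x +i* c) - 'i%C * (c - d)%:C)%C by apply: complexP => /=; ring.
  by ring.
have vr : path_continuous (fun y => rho (b +i* y)%C - rho (a +i* y)%C).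
  have := path_continuousD (vp a b) (aff (- (L * (b - a)%:C%C))).
  congr path_continuous; apply/funext => y; rewrite /rho.
  have -> : ((b +i* y) = (a +i* y) + (b - a)%:C)%C by apply: complexP => /=; ring.
  by ring.
have -> : rint a b c d = cint a b (fun x => rho (x +i* c)%C - rho (x +i* d)%C) +
    'i%C * cint c d (fun y => rho (b +i* y)%C - rho (a +i* y)%C).
  rewrite /rint (@eq_cint _ a b (fun x => g (x +i* c)%C - g (x +i* d)%C)
    (fun x => rho (x +i* c)%C - rho (x +i* d)%C + L * 'i%C * (c - d)%:C%C)); last first.
    move=> x; rewrite /rho.
    have -> : ((x +i* d) = (x +i* c) - 'i%C * (c - d)%:C)%C by apply: complexP => /=; ring.
    by ring.
  rewrite (cintD _ _ hr (aff _)) cint_cst//.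
  rewrite (@eq_cint _ c d (fun y => g (b +i* y)%C - g (a +i* y)%C)
    (fun y => rho (b +i* y)%C - rho (a +i* y)%C + L * (b - a)%:C%C)); last first.
    move=> y; rewrite /rho.
    have -> : ((b +i* y) = (a +i* y) + (b - a)%:C)%C by apply: complexP => /=; ring.
    by ring.
  rewrite (cintD _ _ vr (aff _)) cint_cst// -[(c - d)]opprB rmorphN/=; ring.
have B1 : normc (cint a b (fun x => rho (x +i* c)%C - rho (x +i* d)%C)) <= (2 * M) * (b - a).
  apply: cint_le => // x hx; apply: (le_trans (le_normcD _ _)).
  by rewrite normcN mulrDl mul1r lerD// rr// ?lexx ?cd.
have B2 : normc (cint c d (fun y => rho (b +i* y)%C - rho (a +i* y)%C)) <= (2 * M) * (d - c).
  apply: cint_le => // x hx; apply: (le_trans (le_normcD _ _)).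
  by rewrite normcN mulrDl mul1r lerD// rr// ?lexx ?ab.
apply: (le_trans (le_normcD _ _)); rewrite mulrDr lerD// Normc.normcM.
by rewrite (_ : normc 'i%C = 1) ?mul1r// normcE2/= expr0n expr1n add0r sqrtr1.
Qed.

Lemma goursat_rectangle a b c d : a <= b -> c <= d -> rint a b c d = 0.
Proof.
move=> ab cd; apply/eqP; rewrite -normc0_eq; apply/eqP/le_anti; rewrite normc_ge0 andbT.
apply: (@rectangle_bisection _ (fun a b c d => normc (rint a b c d))) => //.
  move=> {ab cd}{}a {}b {}c {}d m k am mb ck kd.
  apply: normc_le4.
  by rewrite (rint_hsplit _ _ am mb) (rint_vsplit _ _ ck kd) (rint_vsplit m b ck kd).
move=> x0 y0 e e0; have [L /(_ (e / 2))[|r r0 Hr]] := differentiable_epsdelta (dg (x0 +i* y0)%C).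
  by rewrite divr_gt0.
exists r => // {ab cd}{}a {}b {}c {}d /andP[ax xb] /andP[cy yd] hr.
have ab := le_trans ax xb; have cd := le_trans cy yd.
have -> : e * (b - a + (d - c)) ^+ 2 = 2 * (e / 2 * (b - a + (d - c))) * (b - a + (d - c)) by field.
apply: (@rint_le _ _ _ _ (x0 +i* y0)%C (g (x0 +i* y0)%C) L) => // x y /andP[x3 x4] /andP[y3 y4].
have nK : normc ((x +i* y)%C - (x0 +i* y0)%C) <= (b - a) + (d - c).
  apply: (le_trans (normc_le _)) => /=.
  by apply: lerD; rewrite ler_norml; apply/andP; split; lra.
have := Hr ((x +i* y)%C - (x0 +i* y0)%C) (le_lt_trans nK hr).
rewrite [X in g X](_ : _ = (x +i* y)%C); last by apply: complexP => /=; ring.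
by move=> h'; apply: (le_trans h'); rewrite ler_wpM2l// divr_ge0// ltW.
Qed.

End goursat.

(** * Mean value property and identity theorem *)

Section mean_value.
Context {R : realType}.

Lemma differentiable_mulr (f g : R[i] -> R[i]) (z : R[i]^o) :
  differentiable (f : R[i]^o -> R[i]^o) z -> differentiable (g : R[i]^o -> R[i]^o) z ->
  differentiable ((fun w => f w * g w) : R[i]^o -> R[i]^o) z.
Proof. exact: differentiableM. Qed.

Lemma differentiable_compC (f g : R[i] -> R[i]) (z : R[i]^o) :
  differentiable (f : R[i]^o -> R[i]^o) z ->
  differentiable (g : R[i]^o -> R[i]^o) (f z : R[i]^o) ->
  differentiable ((fun w => g (f w)) : R[i]^o -> R[i]^o) z.
Proof. exact: (@differentiable_comp _ R[i]^o R[i]^o R[i]^o f g). Qed.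

Lemma differentiable_affine (a b : R[i]) (z : R[i]^o) :
  differentiable ((fun w => a + w * b) : R[i]^o -> R[i]^o) z.
Proof.
apply: differentiableD; first exact: differentiable_cst.
exact: differentiable_mulr.
Qed.

(** In the variable [s] with [z = z0 + cexp s], circles become vertical segments of length [2 * pi],
    and periodicity cancels the horizontal sides in Goursat's theorem. Hence the mean does not
    depend on the radius, and it tends to [g z0] as the radius shrinks; no quotient by [z - z0] ever
    occurs. *)
Lemma circle_mean_value (g : R[i] -> R[i]) (z0 : R[i]) (r : R) : 0 < r ->
  (forall z : R[i]^o, differentiable (g : R[i]^o -> R[i]^o) z) ->
  cint 0 (2 * pi) (fun th => g (z0 + r%:C%C * cexp (0 +i* th)%C)) = (2 * pi)%:C%C * g z0.
Proof.
move=> r0 dg; pose h (s : R[i]) := g (z0 + cexp s).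
have dh (s : R[i]^o) : differentiable (h : R[i]^o -> R[i]^o) s.
  apply: (@differentiable_compC (fun s => z0 + cexp s) g); last exact: dg.
  by apply: differentiableD; [exact: differentiable_cst|exact: differentiable_cexp].
have pi2 : 0 <= 2 * pi :> R by rewrite mulr_ge0// pi_ge0.
have pi2p : 0 < 2 * pi :> R by rewrite mulr_gt0// pi_gt0.
have const s0 s1 : s0 <= s1 ->
    cint 0 (2 * pi) (fun th => h (s1 +i* th)%C - h (s0 +i* th)%C) = 0.
  move=> s01; have := goursat_rectangle dh s01 pi2; rewrite /rint.
  rewrite (@eq_cint _ s0 s1 _ (fun=> 0)); last first.
    move=> x; apply/eqP; rewrite subr_eq0; apply/eqP; rewrite /h; congr (g (_ + _)).
    have -> : (x +i* (2 * pi))%C = (x +i* 0)%C + (0 +i* (2 * pi * 1%:~R))%C :> R[i].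
      by apply: complexP => /=; ring.
    by rewrite cexpD cexp_2pi mulr1.
  rewrite cint_cst// mulr0 add0r => /eqP; rewrite mulf_eq0 => /orP[|/eqP//].
  by rewrite eq_complex/= oner_eq0 andbF.
have [T TE] : exists T : R, T = 2 * pi by exists (2 * pi).
rewrite -TE in pi2 pi2p const *.
have main s1 : cint 0 T (fun th => h (s1 +i* th)%C) = T%:C%C * g z0.
  apply/eqP; rewrite -subr_eq0 -normc0_eq; apply/eqP/le_anti; rewrite normc_ge0 andbT.
  apply/ler_addgt0Pr => e e0; rewrite add0r.
  have [d d0 Hd] := holomorphic_continuous dg z0 (divr_gt0 e0 pi2p).
  (* The radius [expR s0] is below [d], so continuity at [z0] applies on the whole small circle. *)
  pose s0 := Num.min s1 (ln (d / 2)).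
  have ed : expR s0 < d.
    apply: (@le_lt_trans _ _ (expR (ln (d / 2)))); first by rewrite ler_expR ge_min lexx orbT.
    by rewrite lnK ?posrE ?divr_gt0// ltr_pdivrMr// ltr_pMr// ltr1n.
  have s01 : s0 <= s1 by rewrite ge_min lexx.
  have pc s : path_continuous (fun th => h (s +i* th)%C) := path_vertical dh s.
  have E : cint 0 T (fun th => h (s1 +i* th)%C) =
      cint 0 T (fun th => h (s0 +i* th)%C).
    have := const _ _ s01; rewrite (cintD _ _ (pc s1)); last first.
      by case: (pc s0) => p1 p2; split => x;
        [under eq_fun do rewrite cReN; apply: cvgN; exact: p1|
         under eq_fun do rewrite cImN; apply: cvgN; exact: p2].
    by rewrite (cintN _ _ (pc s0)) => /eqP; rewrite subr_eq0 => /eqP.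
  rewrite E.
  have := cint_cst (- g z0) pi2; rewrite subr0 mulrN => <-.
  rewrite -(cintD _ _ (pc s0) (path_continuous_cst _)).
  have eE : e = e / T * (T - 0) by rewrite subr0 divfK ?gt_eqF.
  rewrite [leRHS]eE.
  apply: (cint_le _ pi2).
    have := path_continuousD (pc s0) (path_continuous_cst (- g z0)).
    by [].
  move=> x _; rewrite /h; apply: Hd; rewrite normc_cexp/=; exact: ed.
rewrite -(main (ln r)); apply: eq_cint => th; rewrite /h; congr (g (_ + _)).
by apply: complexP => /=; rewrite lnK// ?posrE// expR0; ring.
Qed.

Lemma differentiable_scale_bound (g : R[i] -> R[i]) (z L : R[i]) :
  (forall e : R, 0 < e -> exists2 d : R, 0 < d & forall h : R[i], normc h < d ->
      normc (g (z + h) - g z - L * h) <= e * normc h) ->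
  differentiable (g : R[i]^o -> R[i]^o) (z : R[i]^o).
Proof.
move=> H; pose df : {linear R[i]^o -> R[i]^o} := GRing.scale L.
apply: (@differentiable_bound _ _ _ _ df); first exact: mulrl_continuous.
by move=> e /H[d d0 Hd]; exists d => // h; rewrite nrm_normc; exact: Hd.
Qed.

(** At a real point the derivative [L] of [g] is zero, because the difference quotients along real
    increments vanish. The pieces [g] and [0] therefore join differentiably. *)
Lemma zero_extension_holomorphic (g : R[i] -> R[i]) :
  (forall z : R[i]^o, differentiable (g : R[i]^o -> R[i]^o) z) ->
  (forall x : R, g x%:C%C = 0) ->
  forall z : R[i]^o, differentiable
    ((fun w => if 0 <= complex.Im w then g w else 0) : R[i]^o -> R[i]^o) z.
Proof.
move=> dg g0 z; have [L HL] := differentiable_epsdelta (dg z).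
have [z0|z0|z0] := ltgtP (complex.Im z) 0.
- apply: (@differentiable_scale_bound _ _ 0) => e e0.
  exists (- complex.Im z); first by rewrite oppr_gt0.
  move=> h hz; rewrite !ifF; first by rewrite subrr mul0r subr0 normc0E mulr_ge0 ?normc_ge0 ?ltW.
    by apply/negbTE; rewrite -ltNge.
  apply/negbTE; rewrite -ltNge cImD; have := le_lt_trans (absIm_le h) hz.
  by have := ler_norm (complex.Im h); lra.
- apply: (@differentiable_scale_bound _ _ L) => e e0; have [d d0 Hd] := HL e e0.
  exists (Num.min d (complex.Im z)); first by rewrite lt_min d0.
  move=> h; rewrite lt_min => /andP[hd hz]; rewrite !ifT; first exact: Hd.
    exact: ltW.
  rewrite cImD; have := le_lt_trans (absIm_le h) hz.
  by have := ler_norm (- complex.Im h); rewrite normrN; lra.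
- have zR : z = (complex.Re z)%:C%C by apply: complexP => //=; rewrite z0.
  have gz : g z = 0 by rewrite zR g0.
  have L0 : L = 0.
    apply/eqP; rewrite -normc0_eq; apply/eqP/le_anti; rewrite normc_ge0 andbT.
    apply/ler_addgt0Pr => e e0; rewrite add0r; have [d d0 Hd] := HL e e0.
    have d20 : 0 < d / 2 by rewrite divr_gt0.
    have := Hd (d / 2)%:C%C; rewrite normc_real gtr0_norm// => Hd2.
    have := Hd2 _; rewrite ltr_pdivrMr// ltr_pMr// ltr1n => /(_ isT).
    rewrite gz zR -rmorphD/= g0 subrr add0r normcN Normc.normcM normc_real gtr0_norm//.
    by rewrite ler_pM2r.
  apply: (@differentiable_scale_bound _ _ 0) => e e0; have [d d0 Hd] := HL e e0.
  exists d => // h hd; have := Hd h hd; rewrite L0 z0 lexx gz !mul0r !subr0.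
  by case: ifP => // _ _; rewrite normc0E mulr_ge0 ?normc_ge0 ?ltW.
Qed.

(** The product [P] of the four quarter-turns of [h] about [c] vanishes on the circle of radius
    [2 * s] around [c]: at each point one of the four rotated arguments lies in the lower
    half-plane. The mean value property then gives [h c ^+ 4 = 0], without power series. *)
Lemma holomorphic_eq0_upper (h : R[i] -> R[i]) :
  (forall z : R[i]^o, differentiable (h : R[i]^o -> R[i]^o) z) ->
  (forall z, complex.Im z < 0 -> h z = 0) -> forall z, 0 < complex.Im z -> h z = 0.
Proof.
move=> dh h0 c c0; pose u l (w : R[i]) := c + (w - c) * 'i%C ^+ l.
pose P w := h (u 0%N w) * h (u 1%N w) * (h (u 2%N w) * h (u 3%N w)).
have dP (w : R[i]^o) : differentiable (P : R[i]^o -> R[i]^o) w.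
  have d1 l : differentiable ((fun w => h (u l w)) : R[i]^o -> R[i]^o) w.
    apply: (@differentiable_compC (u l) h); last exact: dh.
    apply: differentiableD; first exact: differentiable_cst.
    apply: differentiable_mulr; last exact: differentiable_cst.
    by apply: differentiableB => //; exact: differentiable_cst.
  by do 3 ?[apply: differentiable_mulr]; exact: d1.
set s := complex.Im c in c0; have s2 : 0 < 2 * s by rewrite mulr_gt0.
have := circle_mean_value c s2 dP.
rewrite (@eq_cint _ _ _ _ (fun=> 0)).
  rewrite cint_cst ?mulr_ge0 ?pi_ge0// mulr0 => /esym/eqP.
  rewrite mulf_eq0 => /orP[|].
    by rewrite eq_complex/= eqxx andbT mulf_eq0 pnatr_eq0/= gt_eqF// pi_gt0.
  by rewrite /P /u !subrr !mul0r !addr0 !mulf_eq0 !orbb => /eqP.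
move=> th; rewrite /P /u [_ + _ - c](_ : _ = (2 * s)%:C%C * cexp (0 +i* th)%C); last by ring.
have Imu l : complex.Im (c + (2 * s)%:C%C * cexp (0 +i* th)%C * 'i%C ^+ l) =
    s + 2 * s * complex.Im (cexp (0 +i* th)%C * 'i%C ^+ l).
  rewrite -mulrA; move: (cexp (0 +i* th)%C * _) => q.
  by rewrite cImD cImM /= mul0r addr0.
have cs := cos2Dsin2 th.
have e0 : complex.Im (cexp (0 +i* th)%C * 'i%C ^+ 0) = sin th by rewrite /= expR0; ring.
have e1 : complex.Im (cexp (0 +i* th)%C * 'i%C ^+ 1) = cos th by rewrite /= expR0; ring.
have e2 : complex.Im (cexp (0 +i* th)%C * 'i%C ^+ 2) = - sin th by rewrite /= expR0; ring.
have e3 : complex.Im (cexp (0 +i* th)%C * 'i%C ^+ 3) = - cos th by rewrite /= expR0; ring.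
(* Below [- 2^-1] the imaginary part [s + 2 * s * _] is negative. One of [sin], [cos], [- sin],
   [- cos] is always below it, since otherwise both squares would be at most [1 / 4]. *)
have Z l : complex.Im (cexp (0 +i* th)%C * 'i%C ^+ l) < - 2^-1 ->
    h (c + (2 * s)%:C%C * cexp (0 +i* th)%C * 'i%C ^+ l) = 0.
  by move=> hl; apply: h0; rewrite Imu; nra.
have [h1|h1] := ltP (sin th) (- 2^-1); first by rewrite (Z 0%N) ?e0// !mul0r.
have [h2|h2] := ltP (cos th) (- 2^-1); first by rewrite (Z 1%N) ?e1// mulr0 mul0r.
have [h3|h3] := ltP (- sin th) (- 2^-1); first by rewrite (Z 2%N) ?e2// mul0r mulr0.
have [h4|h4] := ltP (- cos th) (- 2^-1); first by rewrite (Z 3%N) ?e3// !mulr0.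
by exfalso; move: cs; rewrite !expr2; nra.
Qed.

(** Replacing [g] by zero below the real axis gives an entire function that vanishes on a
    half-plane, hence everywhere; the lower half-plane follows by [w |-> - w]. *)
Theorem holomorphic_eq0_of_real (g : R[i] -> R[i]) :
  (forall z : R[i]^o, differentiable (g : R[i]^o -> R[i]^o) z) ->
  (forall x : R, g x%:C%C = 0) -> forall z, g z = 0.
Proof.
have key (f : R[i] -> R[i]) : (forall z : R[i]^o, differentiable (f : R[i]^o -> R[i]^o) z) ->
    (forall x : R, f x%:C%C = 0) -> forall z, 0 <= complex.Im z -> f z = 0.
  move=> df f0 z; rewrite le_eqVlt => /orP[/eqP z0|z0].
    have -> : z = (complex.Re z)%:C%C by apply: complexP => //=; rewrite -z0.
    exact: f0.
  have := @holomorphic_eq0_upper _ (zero_extension_holomorphic df f0) _ z z0.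
  by rewrite (ltW z0); apply=> w w0; rewrite leNgt w0.
move=> dg g0 z; have [z0|z0] := leP 0 (complex.Im z); first exact: key.
have := @key (fun w => g (0 + w * (-1))) _ _ (- z); rewrite add0r mulrN1 opprK; apply.
- move=> w; apply: (@differentiable_compC (fun w => 0 + w * (-1)) g); last exact: dg.
  exact: differentiable_affine.
- by move=> x; rewrite add0r mulrN1 -rmorphN/= g0.
- by rewrite cImN oppr_ge0 ltW.
Qed.

End mean_value.

(** * Gaussian integrals and lattice-periodic functions *)
Section real_line.
Context {R : realType}.
Local Notation leb := (@lebesgue_measure R).

(** The pushforward of Lebesgue measure under a translation has the same value on intervals, so it
    is Lebesgue measure by uniqueness. *)
Lemma ge0_integral_lebesgue_shift (c : R) (f : measurableTypeR R -> \bar R) :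
  measurable_fun setT f -> (forall x, (0 <= f x)%E) ->
  (\int[leb]_x f (x + c)%R = \int[leb]_x f x)%E.
Proof.
move=> mf f0; pose sh (x : measurableTypeR R) : measurableTypeR R := x + c.
have msh : measurable_fun setT sh by apply: measurable_funD.
pose m := measure_function_pushforward__canonical__measure_function_Measure leb msh.
have mE A : measurable A -> leb A = m A.
  apply: lebesgue_measure_unique => X [[a b] _ <-]; rewrite /m /= /pushforward.
  have -> : sh @^-1` `]a, b] = `]a - c, b - c]%classic.
    by apply/seteqP; split => x /=; rewrite !in_itv/= /sh ltrBlDr lerBrDr.
  rewrite !lebesgue_measure_itv/= !lte_fin ltrD2r; case: ifP => // _.
  by rewrite -!EFinB; congr EFin; ring.
rewrite [RHS](@eq_measure_integral _ _ _ _ m); last by move=> A mA _; exact: mE.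
by rewrite ge0_integral_pushforward.
Qed.

Lemma integral_gauss (a : R) : 0 < a ->
  (\int[leb]_x (expR (- (a * x ^+ 2)))%:E)%E = (Num.sqrt (pi / a))%:E.
Proof.
(* The standard deviation for which the normal density is a multiple of [expR (- (a * x ^+ 2))]. *)
move=> a0; pose s := (Num.sqrt (2 * a))^-1.
have a2 : 0 < 2 * a by rewrite mulr_gt0.
have s0 : s != 0 by rewrite invr_neq0// gt_eqF// sqrtr_gt0.
have s2 : s ^+ 2 = (2 * a)^-1 by rewrite exprVn sqr_sqrtr// ltW.
have an0 : a != 0 by rewrite gt_eqF.
have [p [p0 pE]] : exists p : R, 0 < p /\ pi = p by exists pi; rewrite pi_gt0.
have := integral_normal_pdf 0 s; rewrite (normal_pdfE _ s0).
have -> : (fun x : R => (normal_peak s * normal_fun 0 s x)%:E) =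
   (fun x => (normal_peak s)%:E * (expR (- (a * x ^+ 2)))%:E)%E.
  apply/funext => x; rewrite -EFinM; congr (_ * expR _)%:E.
  by rewrite subr0 s2; field.
rewrite ge0_integralZl//; last 2 first.
  - apply/measurable_EFinP; apply: measurable_expR_fun; apply: measurableT_comp => //.
    by apply: measurable_funM => //; apply: measurable_funX.
  - by rewrite lee_fin normal_peak_ge0.
have pk : normal_peak s = (Num.sqrt (pi / a))^-1.
  congr (Num.sqrt _)^-1; by rewrite s2 pE -mulr_natr; field.
rewrite pk; have q0 : 0 < Num.sqrt (pi / a) by rewrite sqrtr_gt0 divr_gt0// pi_gt0.
move: (Num.sqrt _) q0 => q q0 h.
have qn : q != 0 by rewrite gt_eqF.
by rewrite -[LHS]mul1e -(@mulfV _ q)// EFinM -muleA h mule1.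
Qed.

End real_line.

(** * Translations and Gaussian integrals on rows *)

Section row_measures.
Context {R : realType}.
Local Notation rV n := ('rV[R]_n).
Local Notation leb := (@lebesgue_measure R).

Lemma measurable_row_add n (c : rV n) : measurable_fun setT (fun v : rV n => v + c).
Proof.
apply: measurable_rV => i; under eq_fun do rewrite mxE.
by apply: measurable_funD => //; exact: measurable_coord.
Qed.

Lemma ge0_integral_rV_cons n (f : rV n.+1 -> \bar R) :
  measurable_fun setT f -> (forall v, (0 <= f v)%E) ->
  (\int[lebesgue_rV R n.+1]_v f v =
   \int[leb]_x \int[lebesgue_rV R n]_v f (row_cons (x, v)))%E.
Proof.
move=> mf f0.
pose m := measure_function_pushforward__canonical__measure_function_Measure
  (leb \x lebesgue_rV R n)%E (@measurable_row_cons R n).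
rewrite (@eq_measure_integral _ _ _ _ m)//.
rewrite (ge0_integral_pushforward (@measurable_row_cons R n))//.
rewrite preimage_setT (fubini_tonelli1 (f \o @row_cons R n))//.
  by apply: measurableT_comp => //; exact: measurable_row_cons.
by move=> x; exact: f0.
Qed.

Lemma ge0_integral_rV_shift n (c : rV n) (f : rV n -> \bar R) :
  measurable_fun setT f -> (forall v, (0 <= f v)%E) ->
  (\int[lebesgue_rV R n]_v f (v + c)%R = \int[lebesgue_rV R n]_v f v)%E.
Proof.
elim: n c f => [|n ih] c f mf f0.
  by apply: eq_integral => v _; congr f; apply/rowP => -[].
have msf : measurable_fun setT (fun v : rV n.+1 => f (v + c)).
  by apply: measurableT_comp => //; exact: measurable_row_add.
rewrite (ge0_integral_rV_cons mf f0) (ge0_integral_rV_cons msf (fun v => f0 _)).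
pose c' : rV n := \row_i c ord0 (lift ord0 i).
have cE x v : row_cons (x, v) + c = row_cons (x + c ord0 ord0, v + c').
  apply/rowP => i; rewrite !mxE; case: unliftP => [j ->|->]; by rewrite ?mxE.
transitivity (\int[leb]_x (fun x => \int[lebesgue_rV R n]_v f (row_cons (x, v))) (x + c ord0 ord0)%R)%E.
  apply: eq_integral => x _; under eq_integral do rewrite cE.
  apply: (ih c' (fun v => f (row_cons (x + c ord0 ord0, v)))) => //.
  apply: (measurableT_comp mf); apply: (measurableT_comp (@measurable_row_cons R n)).
  exact: pair1_measurable.
apply: ge0_integral_lebesgue_shift.
  apply: (@measurable_fun_fubini_tonelli_F _ _ _ _ _ (lebesgue_rV R n) (f \o @row_cons R n)) => //.
  - by apply: measurableT_comp => //; exact: measurable_row_cons.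
  - by move=> x; exact: f0.
by move=> x; apply: integral_ge0.
Qed.

Lemma dotv_row_cons n (x : R) (v : rV n) :
  dotv (row_cons (x, v)) (row_cons (x, v)) = x ^+ 2 + dotv v v.
Proof.
rewrite /dotv big_ord_recl row_cons0 -expr2; congr (_ + _).
by apply: eq_bigr => i _; rewrite row_consS.
Qed.

Lemma measurable_dotv d (T : measurableType d) n (f g : T -> rV n) :
  measurable_fun setT f -> measurable_fun setT g ->
  measurable_fun setT (fun t => dotv (f t) (g t)).
Proof.
move=> mf mg; apply: measurable_sum => j; apply: measurable_funM.
  exact: (measurableT_comp (measurable_coord j) mf).
exact: (measurableT_comp (measurable_coord j) mg).
Qed.

Lemma integral_gauss_rV n (a : R) : 0 < a ->
  (\int[lebesgue_rV R n]_v (expR (- (a * dotv v v)))%:E)%E = (Num.sqrt (pi / a) ^+ n)%:E.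
Proof.
move=> a0; have mg m : measurable_fun setT (fun v : rV m => (expR (- (a * dotv v v)))%:E).
  apply/measurable_EFinP; apply: measurable_expR_fun; apply: measurableT_comp => //.
  by apply: measurable_funM => //; exact: measurable_dotv.
have ge m (v : rV m) : (0 <= (expR (- (a * dotv v v)))%:E)%E by rewrite lee_fin expR_ge0.
elim: n => [|n ih].
  (* In dimension 0 the measure is a Dirac mass, so the integral is the value at the only point. *)
  have := integral_dirac (0 : rV 0) measurableT (mg 0%N).
  by rewrite diracT mul1e /dotv !big_ord0 mulr0 oppr0 expR0 expr0; apply: etrans.
rewrite (ge0_integral_rV_cons (mg n.+1) (ge n.+1)).
transitivity (\int[leb]_x ((expR (- (a * x ^+ 2)))%:E * (Num.sqrt (pi / a) ^+ n)%:E))%E.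
  apply: eq_integral => x _; rewrite -ih.
  under eq_integral do rewrite dotv_row_cons mulrDr opprD expRD EFinM.
  by apply: (ge0_integralZl _ measurableT) => //; exact: (mg n).
rewrite ge0_integralZr//.
- by rewrite integral_gauss// -EFinM exprS.
- apply/measurable_EFinP; apply: measurable_expR_fun; apply: measurableT_comp => //.
  by apply: measurable_funM => //; apply: measurable_funX.
Qed.

End row_measures.

Section sigma_finite_product.
Context d1 d2 (T1 : measurableType d1) (T2 : measurableType d2) (R : realType).
Context (m1 : {sigma_finite_measure set T1 -> \bar R}).
Context (m2 : {sigma_finite_measure set T2 -> \bar R}).

(** The product measure carried by a name of its own, to which a sigma-finite structure is attached;
    products can then be nested and Tonelli applied at every level. *)
Definition sprod : set (T1 * T2) -> \bar R := (m1 \x m2)%E.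

HB.instance Definition _ := Measure.on sprod.

Let sprod_sigma_finite : sigma_finite setT sprod.
Proof.
exact: (isSigmaFinite.sigma_finiteT
  (lebesgue_integral_fubini.measure_function_Measure_isSigmaFinite__to__measure_function_isSigmaFinite m1 m2)).
Qed.

HB.instance Definition _ := Measure_isSigmaFinite.Build _ _ _ sprod sprod_sigma_finite.

End sigma_finite_product.

Section plane_measure.
Context (R : realType) (n : nat).
Local Notation X := (plane R n).

Definition mu_plane : {sigma_finite_measure set X -> \bar R} :=
  sprod (lebesgue_rV R n) (lebesgue_rV R n).

Lemma lebesgue_planeE : lebesgue_plane R n = mu_plane.
Proof. by []. Qed.

Definition sqn (p : X) : R := dotv p.1 p.1 + dotv p.2 p.2.

Lemma sqn_ge0 p : 0 <= sqn p.
Proof. by rewrite addr_ge0// sumr_ge0// => j _; rewrite -expr2 sqr_ge0. Qed.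

Lemma measurable_plane_add (c : X) : measurable_fun setT (fun p : X => p + c).
Proof.
apply/measurable_fun_pairP; split.
  exact: (measurableT_comp (measurable_row_add c.1) measurable_fst).
exact: (measurableT_comp (measurable_row_add c.2) measurable_snd).
Qed.

Lemma ge0_integral_plane_shift (c : X) (f : X -> \bar R) :
  measurable_fun setT f -> (forall p, (0 <= f p)%E) ->
  (\int[mu_plane]_p f (p + c)%R = \int[mu_plane]_p f p)%E.
Proof.
move=> mf f0.
have msf : measurable_fun setT (fun p : X => f (p + c)).
  by apply: measurableT_comp => //; exact: measurable_plane_add.
rewrite /mu_plane (fubini_tonelli1 _ msf (fun p => f0 _)) (fubini_tonelli1 _ mf f0).
transitivity (\int[lebesgue_rV R n]_x (fubini_F (lebesgue_rV R n) f (x + c.1)%R))%E.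
  apply: eq_integral => x _; rewrite /fubini_F.
  apply: (ge0_integral_rV_shift c.2 (f := fun y => f (x + c.1, y))) => //.
  by apply: (measurableT_comp mf); exact: pair1_measurable.
apply: ge0_integral_rV_shift; first exact: measurable_fun_fubini_tonelli_F.
by move=> x; apply: integral_ge0.
Qed.

Lemma measurable_sqn d (T : measurableType d) (f : T -> X) : measurable_fun setT f ->
  measurable_fun setT (fun t => sqn (f t)).
Proof.
by move=> mf; apply: measurable_funD; apply: measurable_dotv;
  exact: (measurableT_comp _ mf).
Qed.

Lemma integral_gauss_plane (a : R) : 0 < a ->
  (\int[mu_plane]_p (expR (- (a * sqn p)))%:E)%E = ((pi / a) ^+ n)%:E.
Proof.
move=> a0.
have mg m : measurable_fun setT (fun v : 'rV[R]_m => (expR (- (a * dotv v v)))%:E).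
  apply/measurable_EFinP; apply: measurable_expR_fun; apply: measurableT_comp => //.
  by apply: measurable_funM => //; exact: measurable_dotv.
rewrite /mu_plane (fubini_tonelli1 (fun p : X => (expR (- (a * sqn p)))%:E)); last 2 first.
- apply/measurable_EFinP; apply: measurable_expR_fun; apply: measurableT_comp => //.
  by apply: measurable_funM => //; exact: measurable_sqn.
- by move=> p; rewrite lee_fin expR_ge0.
rewrite /fubini_F.
transitivity (\int[lebesgue_rV R n]_x ((expR (- (a * dotv x x)))%:E * (Num.sqrt (pi / a) ^+ n)%:E))%E.
  apply: eq_integral => x _; rewrite -(integral_gauss_rV n a0).
  under eq_integral do rewrite /sqn/= mulrDr opprD expRD EFinM.
  by apply: (ge0_integralZl _ measurableT) => //; exact: (mg n).
rewrite (ge0_integralZr _ measurableT)//.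
- rewrite (integral_gauss_rV n a0) -EFinM -exprMn -expr2 sqr_sqrtr//.
  by rewrite divr_ge0 ?pi_ge0// ltW.
- exact: (mg n).
Qed.

End plane_measure.

(** * Lattice translates of the unit cube *)

Section lattice.
Context (R : realType) (n : nat).
Local Notation X := (plane R n).
Local Notation mu := (mu_plane R n).

Definition lattice := ('rV[int]_n * 'rV[int]_n)%type.

Definition lpt (g : lattice) : X := (map_mx intr g.1, map_mx intr g.2).

Definition cube : set X := unit_cube (R:=R) (n:=n) `*` unit_cube (R:=R) (n:=n).

(** Integrals over the torus are written as integrals over the whole plane against this weight, so
    that translation invariance and Tonelli apply directly. *)
Definition icube (p : X) : R := \1_cube p.

Lemma icubeE p : icube p = (p \in cube)%:R.
Proof. by rewrite /icube indicE. Qed.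

Lemma icube_ge0 p : 0 <= icube p.
Proof. by rewrite icubeE ler0n. Qed.

Lemma measurable_unit_cube : measurable (@unit_cube R n).
Proof.
rewrite (_ : unit_cube (R:=R) (n:=n) = \bigcap_(j in [set: 'I_n])
    ((fun v : 'rV[R]_n => (v ord0 j : measurableTypeR R)) @^-1` `[0, 1[%classic)).
  apply: fin_bigcap_measurable; first exact: finite_finset.
  by move=> j _; rewrite -[X in measurable X]setTI; apply: (@measurable_coord R n j).
apply/seteqP; split => v /= H j; first by move=> _ /=; rewrite in_itv/= H.
by have := H j I; rewrite /= in_itv.
Qed.

Lemma measurable_cube : measurable cube.
Proof. by apply: measurableX; exact: measurable_unit_cube. Qed.

Lemma measurable_icube d (T : measurableType d) (f : T -> X) : measurable_fun setT f ->
  measurable_fun setT (fun t => icube (f t)).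
Proof.
by move=> mf; apply: (measurableT_comp _ mf); apply: measurable_indic; exact: measurable_cube.
Qed.

Definition lfloor (p : X) : lattice :=
  (map_mx (@Num.floor R) p.1, map_mx (@Num.floor R) p.2).

Lemma cube_lfloor p : cube (p - lpt (lfloor p)).
Proof.
have key (x : R) : 0 <= x - (Num.floor x)%:~R < 1.
  have h1 := real_floor_le (num_real x); have := real_floorD1_gt (num_real x).
  by rewrite intrD => h2; apply/andP; split; lra.
by split => j; rewrite !mxE; exact: key.
Qed.

Lemma cube_uniq p g : cube (p - lpt g) -> g = lfloor p.
Proof.
have key (x : R) (m : int) : 0 <= x - m%:~R < 1 -> m = Num.floor x.
  by move=> /andP[h1 h2]; apply/esym/floor_def; rewrite intrD; apply/andP; split; lra.
case: g => a b [H1 H2]; congr (_, _); apply/rowP => j; rewrite !mxE; apply: key.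
  by have := H1 j; rewrite !mxE.
by have := H2 j; rewrite !mxE.
Qed.

Lemma nneseries_single (u : nat -> \bar R) k : (forall i, (0 <= u i)%E) ->
  (forall i, i <> k -> u i = 0%E) -> (\sum_(i <oo) u i)%E = u k.
Proof.
move=> u0 uk.
rewrite (nneseries_split 0 k.+1)//.
rewrite add0n eseries0 ?adde0; last by move=> i ki _; apply: uk => ik; rewrite ik ltnn in ki.
rewrite big_nat_recr//= big_nat big1 ?add0e// => i /andP[_ ik].
by apply: uk => e; rewrite e ltnn in ik.
Qed.

Lemma pickle_inv_Some (T : countType) i (h : T) : pickle_inv i = Some h -> pickle h = i.
Proof. by move=> E; have := @pickle_invK T i; rewrite E. Qed.

(** A lattice sum as a series over [nat], through the countable structure; indices that encode no
    lattice point contribute 0. *)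
Definition lsum (u : lattice -> R) (i : nat) : R :=
  if pickle_inv i is Some g then u g else 0.

Lemma lsum_single (u : lattice -> R) g : (forall h, 0 <= u h) -> (forall h, h <> g -> u h = 0) ->
  (\sum_(i <oo) (lsum u i)%:E)%E = (u g)%:E.
Proof.
move=> u0 ug; rewrite (@nneseries_single (fun i => (lsum u i)%:E) (pickle g)).
- by rewrite /lsum pickleK_inv.
- by move=> i; rewrite lee_fin /lsum; case: pickle_inv.
- move=> i ig; rewrite /lsum; case E : (pickle_inv i) => [h|//]; rewrite ug// => hg.
  by apply: ig; rewrite -hg (pickle_inv_Some E).
Qed.

(** The half-open cubes tile the plane: the single nonzero term is at [lfloor p]. *)
Lemma lsum_cube_sub p : (\sum_(i <oo) (lsum (fun g => icube (p - lpt g)) i)%:E = 1)%E.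
Proof.
rewrite (@lsum_single _ (lfloor p)).
- by rewrite icubeE mem_set//; exact: cube_lfloor.
- by move=> h; exact: icube_ge0.
- move=> h hp; rewrite icubeE memNset// => /cube_uniq; exact: hp.
Qed.

Definition lopp (g : lattice) : lattice := (- g.1, - g.2).

Lemma lpt_opp g : lpt (lopp g) = - lpt g.
Proof. by congr (_, _); apply/rowP => j; rewrite !mxE intrN. Qed.

Lemma lsum_cube_add p : (\sum_(i <oo) (lsum (fun g => icube (p + lpt g)) i)%:E = 1)%E.
Proof.
have oppK g : lopp (lopp g) = g by case: g => a b; rewrite /lopp/= !opprK.
have E g : p + lpt g = p - lpt (lopp g) by rewrite lpt_opp opprK.
rewrite (@lsum_single _ (lopp (lfloor p))).
- by rewrite E oppK icubeE mem_set//; exact: cube_lfloor.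
- by move=> h; exact: icube_ge0.
- move=> h hp; rewrite E icubeE memNset// => /cube_uniq e; apply: hp.
  by rewrite -e oppK.
Qed.

Section exchange.
Implicit Types (Psi : X * X -> R) (c : X -> R).

Let H Psi c1 c2 (z : X * X) := (c1 z.1 * Psi z * c2 z.2)%:E.

Let mH Psi c1 c2 : measurable_fun setT Psi ->
  measurable_fun setT c1 -> measurable_fun setT c2 -> measurable_fun setT (H Psi c1 c2).
Proof.
move=> mPsi m1 m2; apply/measurable_EFinP; apply: measurable_funM; first apply: measurable_funM => //.
  exact: (measurableT_comp m1 measurable_fst).
exact: (measurableT_comp m2 measurable_snd).
Qed.

Let H0 Psi c1 c2 z : (forall z, 0 <= Psi z) -> (forall p, 0 <= c1 p) -> (forall p, 0 <= c2 p) ->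
  (0 <= H Psi c1 c2 z)%E.
Proof. by move=> h h1 h2; rewrite lee_fin !mulr_ge0. Qed.

Let mlsum (f : lattice -> X -> R) i : (forall g, measurable_fun setT (f g)) ->
  measurable_fun setT (fun p : X => lsum (fun g => f g p) i).
Proof. by move=> mf; rewrite /lsum; case: (pickle_inv i). Qed.

Let ls0 (f : lattice -> R) i : (forall g, 0 <= f g) -> 0 <= lsum f i.
Proof. by move=> h; rewrite /lsum; case: pickle_inv. Qed.

Let I Psi c1 c2 : \bar R := (\int[mu]_p \int[mu]_x H Psi c1 c2 (p, x))%E.

Let swapf Psi : X * X -> R := fun z => Psi (z.2, z.1).

Let mswapf Psi : measurable_fun setT Psi -> measurable_fun setT (swapf Psi).
Proof.
move=> m; apply: (measurableT_comp m).
by apply/measurable_fun_pairP; split; [exact: measurable_snd|exact: measurable_fst].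
Qed.

Let I_swap Psi c1 c2 : measurable_fun setT Psi -> (forall z, 0 <= Psi z) ->
  measurable_fun setT c1 -> measurable_fun setT c2 ->
  (forall p, 0 <= c1 p) -> (forall p, 0 <= c2 p) ->
  I Psi c1 c2 = I (swapf Psi) c2 c1.
Proof.
move=> mPsi Psi0 m1 m2 h1 h2.
rewrite /I (fubini_tonelli (H Psi c1 c2) (mH mPsi m1 m2) (fun z => H0 z Psi0 h1 h2)).
apply: eq_integral => x _; apply: eq_integral => p _.
by rewrite /H/= /swapf/=; congr EFin; ring.
Qed.

(** The weight 1 of the second variable is replaced by a partition of unity, and the series leaves
    both integrals because all terms are nonnegative. *)
Let I_sum Psi c1 (f : lattice -> X -> R) :
  measurable_fun setT Psi -> (forall z, 0 <= Psi z) ->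
  measurable_fun setT c1 -> (forall p, 0 <= c1 p) ->
  (forall g, measurable_fun setT (f g)) -> (forall g p, 0 <= f g p) ->
  (forall p, \sum_(i <oo) (lsum (fun g => f g p) i)%:E = 1)%E ->
  I Psi c1 (cst 1) = (\sum_(i <oo) I Psi c1 (fun p => lsum (fun g => f g p) i))%E.
Proof.
move=> mPsi Psi0 mc c0 mf f0 f1.
have m2 i := mH mPsi mc (mlsum i mf).
have ge i z : (0 <= H Psi c1 (fun p => lsum (fun g => f g p) i) z)%E.
  by apply: H0 => // p; exact: ls0.
rewrite /I -integral_nneseries//.
- apply: eq_integral => p _; rewrite -integral_nneseries//.
  + apply: eq_integral => x _; rewrite /H/= mulr1.
    under eq_eseriesr do rewrite EFinM.
    by rewrite nneseriesZl ?f1 ?mule1// => i _; rewrite lee_fin; exact: ls0.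
  + by move=> i; apply: (measurableT_comp (m2 i)); exact: pair1_measurable.
- move=> i; apply: (measurable_fun_fubini_tonelli_F _ (m2 i)) => z; exact: ge.
- by move=> i p _; apply: integral_ge0.
Qed.

Let I0 Psi c1 : I Psi c1 (fun=> 0) = 0%E.
Proof.
rewrite /I; under eq_integral => p _.
  under eq_integral do rewrite /H/= mulr0.
  rewrite integral0; over.
by rewrite integral0.
Qed.

Let msub g : measurable_fun setT (fun p : X => icube (p - lpt g)).
Proof. by apply: measurable_icube; exact: measurable_plane_add. Qed.
Let madd g : measurable_fun setT (fun p : X => icube (p + lpt g)).
Proof. by apply: measurable_icube; exact: measurable_plane_add. Qed.
Let mid : measurable_fun setT (icube : X -> R).
Proof. exact: measurable_icube. Qed.

(** Both sides are integrals of [Psi] over the quotient by the diagonal action, for two fundamental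
    domains. The free variable is cut into lattice cubes by [I_sum], with opposite signs on the two
    sides, and the terms for the same lattice vector are matched. *)
Lemma ge0_exchange Psi : measurable_fun setT Psi -> (forall z, 0 <= Psi z) ->
  (forall p x g, Psi (p + lpt g, x + lpt g) = Psi (p, x)) ->
  (\int[mu]_p \int[mu]_x (icube p * Psi (p, x))%:E =
   \int[mu]_p \int[mu]_x (icube x * Psi (p, x))%:E)%E.
Proof.
move=> mPsi Psi0 invPsi.
have mc1 : measurable_fun setT (cst 1 : X -> R) by exact: measurable_cst.
transitivity (I Psi icube (cst 1)).
  by apply: eq_integral => p _; apply: eq_integral => x _; rewrite /H/= mulr1.
transitivity (I Psi (cst 1) icube); last first.
  by apply: eq_integral => p _; apply: eq_integral => x _; rewrite /H/= mul1r mulrC.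
have s0 z : 0 <= swapf Psi z by exact: Psi0.
rewrite (I_swap mPsi Psi0 mc1 mid (fun=> ler01) (@icube_ge0)).
rewrite (I_sum mPsi Psi0 mid (@icube_ge0) msub (fun g p => icube_ge0 _) lsum_cube_sub).
rewrite (I_sum (mswapf mPsi) s0 mid (@icube_ge0) madd (fun g p => icube_ge0 _) lsum_cube_add).
apply: eq_eseriesr => i _; rewrite /lsum; case: (pickle_inv i) => [g|]; last by rewrite !I0.
rewrite -(I_swap mPsi Psi0 (madd g) mid (fun p => icube_ge0 _) (@icube_ge0)).
rewrite /I.
(* Translating [x] and [p] by the same lattice vector leaves [Psi] unchanged and carries one term of
   the sum to the other; [x] is translated first, then [p]. *)
transitivity (\int[mu]_p \int[mu]_x H Psi (fun p => icube (p + lpt g)%R) icube ((p - lpt g)%R, x))%E.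
  apply: eq_integral => p _; rewrite /H/= subrK.
  rewrite -(ge0_integral_plane_shift (lpt g) (f := fun x => (icube p * Psi (p, x) * icube (x - lpt g))%:E)).
  - apply: eq_integral => x _; rewrite addrK.
    by rewrite -(invPsi (p - lpt g) x g) subrK.
  - apply/measurable_EFinP; apply: measurable_funM; last exact: msub.
    apply: measurable_funM; first exact: measurable_cst.
    exact: (measurableT_comp mPsi (pair1_measurable p)).
  - by move=> x; rewrite lee_fin !mulr_ge0 ?icube_ge0.
rewrite -[RHS](ge0_integral_plane_shift (- lpt g)); first exact: erefl.
- apply: (measurable_fun_fubini_tonelli_F _ (mH mPsi (madd g) mid)) => z.
  by apply: H0 => // p; exact: icube_ge0.
- by move=> p; apply: integral_ge0 => x _; apply: H0 => // y; exact: icube_ge0.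
Qed.

End exchange.

End lattice.

(** * Periodic functions integrated against Gaussians *)

Section periodic_gaussian.
Context (R : realType) (n : nat).
Local Notation X := (plane R n).
Local Notation mu := (mu_plane R n).

Lemma integral_unit_cube m :
  (\int[lebesgue_rV R m]_v (\1_(@unit_cube R m) v : R)%:E = 1)%E.
Proof.
have mI k : measurable_fun setT (fun v : 'rV[R]_k => (\1_(@unit_cube R k) v : R)%:E).
  by apply/measurable_EFinP; apply: measurable_indic; exact: measurable_unit_cube.
have I0 k (v : 'rV[R]_k) : (0 <= (\1_(@unit_cube R k) v : R)%:E)%E by rewrite lee_fin.
elim: m => [|m ih].
  have := integral_dirac (0 : 'rV[R]_0) measurableT (mI 0%N).
  rewrite diracT mul1e indicE mem_set; first by apply: etrans.
  by case.
rewrite (ge0_integral_rV_cons (mI m.+1) (I0 m.+1)).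
transitivity (\int[lebesgue_measure]_x (\1_`[0%R, 1%R[ x : R)%:E)%E.
  apply: eq_integral => x _.
  rewrite -[RHS]mule1 -ih -(ge0_integralZl _ measurableT (mI m))//.
  apply: eq_integral => v _; rewrite -EFinM; congr EFin.
  rewrite !indicE -natrM mulnb; congr (nat_of_bool _)%:R.
  apply/idP/andP => [|[]]; rewrite !inE.
    move=> H; split; first by have := H ord0; rewrite row_cons0 /= in_itv.
    by move=> j; have := H (lift ord0 j); rewrite row_consS.
  move=> hx hv j; have [k ->|->] := unliftP ord0 j; first by rewrite row_consS.
  by move: hx; rewrite row_cons0 /= in_itv.
rewrite integral_indic// setIT.
transitivity (lebesgue_measure (`[0, 1[%classic : set R)); first exact: erefl.
by rewrite lebesgue_measure_itv/= lte_fin ltr01 oppr0 adde0.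
Qed.

Lemma integral_icube : (\int[mu]_p (icube p)%:E = 1)%E.
Proof.
rewrite /mu_plane (fubini_tonelli1 (fun p : X => (icube p)%:E)); last 2 first.
- by apply/measurable_EFinP; exact: measurable_icube.
- by move=> p; rewrite lee_fin icube_ge0.
rewrite -[RHS](integral_unit_cube n); apply: eq_integral => x _.
rewrite /fubini_F -[RHS]mule1 -(integral_unit_cube n) -(ge0_integralZl _ measurableT)//.
  apply: eq_integral => u _; rewrite -EFinM /icube !indicE -natrM mulnb.
  congr (nat_of_bool _)%:R%:E; apply/idP/andP => [|[]]; rewrite !inE; first by case.
  by move=> h1 h2; split.
by apply/measurable_EFinP; apply: measurable_indic; exact: measurable_unit_cube.
Qed.

Lemma measurable_planeD d (T : measurableType d) (f g : T -> X) :
  measurable_fun setT f -> measurable_fun setT g -> measurable_fun setT (fun t => f t + g t).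
Proof.
move=> mf mg; apply/measurable_fun_pairP; split; apply: measurable_rV => j;
  under eq_fun do rewrite mxE; apply: measurable_funD;
  apply: (measurableT_comp (@measurable_coord R n j)).
- exact: (measurableT_comp measurable_fst mf).
- exact: (measurableT_comp measurable_fst mg).
- exact: (measurableT_comp measurable_snd mf).
- exact: (measurableT_comp measurable_snd mg).
Qed.

Lemma measurable_planeN d (T : measurableType d) (f : T -> X) :
  measurable_fun setT f -> measurable_fun setT (fun t => - f t).
Proof.
move=> mf; apply/measurable_fun_pairP; split; apply: measurable_rV => j;
  under eq_fun do rewrite mxE; apply: measurableT_comp => //;
  apply: (measurableT_comp (@measurable_coord R n j)).
- exact: (measurableT_comp measurable_fst mf).
- exact: (measurableT_comp measurable_snd mf).
Qed.

Lemma measurable_planeB d (T : measurableType d) (f g : T -> X) :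
  measurable_fun setT f -> measurable_fun setT g -> measurable_fun setT (fun t => f t - g t).
Proof. by move=> mf mg; apply: measurable_planeD => //; exact: measurable_planeN. Qed.

Lemma sqnN (p : X) : sqn (- p) = sqn p.
Proof. by congr (_ + _); apply: eq_bigr => j _; rewrite !mxE mulrNN. Qed.

Lemma sqnD_le (p q : X) : sqn (p + q) <= 2 * sqn p + 2 * sqn q.
Proof.
have key (v w : 'rV[R]_n) : dotv (v + w) (v + w) <= 2 * dotv v v + 2 * dotv w w.
  rewrite /dotv !mulr_sumr -big_split/=; apply: ler_sum => j _; rewrite !mxE.
  by have := sqr_ge0 (v ord0 j - w ord0 j); rewrite expr2; nra.
have := lerD (key p.1 q.1) (key p.2 q.2); rewrite /sqn/=; lra.
Qed.

Lemma sqn_cube_le (p : X) : cube p -> sqn p <= 2 * n%:R.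
Proof.
have key (v : 'rV[R]_n) : unit_cube v -> dotv v v <= n%:R.
  move=> H; apply: (@le_trans _ _ (\sum_(j < n) 1)).
    by apply: ler_sum => j _; have /andP[h1 h2] := H j; nra.
  by rewrite sumr_const card_ord.
by move=> [/key h1 /key h2]; rewrite /sqn; lra.
Qed.

(** Average over [p] in the unit cube. By [sqnD_le] and [sqn p <= 2 * n], half of the rate and the
    factor [expR (2 * a * n)] pay for replacing [x - c] by [x - c - p]. Then [ge0_exchange] moves
    the cube from [p] to [x], and the free [p] yields the full Gaussian integral of rate [a / 2]. *)
Lemma periodic_gauss_le (a : R) (h : X -> R) (c : X) : 0 < a ->
  measurable_fun setT h -> (forall x, 0 <= h x) ->
  (forall x g, h (x + lpt R g) = h x) ->
  (\int[mu]_x (h x * expR (- (a * sqn (x - c))))%:E <=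
   (expR (2 * a * n%:R) * (2 * pi / a) ^+ n)%:E * \int[mu]_x (icube x * h x)%:E)%E.
Proof.
move=> a0 mh h0 hper.
pose Psi (z : X * X) := h z.2 * expR (- (a / 2 * sqn (z.2 - c - z.1))).
have a20 : 0 < a / 2 by rewrite divr_gt0.
have mE d (T : measurableType d) (f : T -> X) (b : R) : measurable_fun setT f ->
    measurable_fun setT (fun t => expR (- (b * sqn (f t)))).
  move=> mf; apply: measurable_expR_fun; apply: measurableT_comp => //.
  by apply: measurable_funM => //; exact: measurable_sqn.
have mPsi : measurable_fun setT Psi.
  apply: measurable_funM; first exact: (measurableT_comp mh measurable_snd).
  apply: mE; apply: measurable_planeB => //; apply: measurable_planeB => //.
have Psi0 z : 0 <= Psi z by rewrite mulr_ge0 ?expR_ge0.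
have invPsi p x g : Psi (p + lpt R g, x + lpt R g) = Psi (p, x).
  rewrite /Psi/= hper (_ : x + lpt R g - c - (p + lpt R g) = x - c - p)//.
  by rewrite (addrAC x) opprD addrACA subrr addr0.
set LHS := (X in (X <= _)%E).
have -> : LHS = (\int[mu]_p ((icube p)%:E * LHS))%E.
  rewrite ge0_integralZr//.
  - by rewrite integral_icube mul1e.
  - by apply/measurable_EFinP; exact: measurable_icube.
  - by move=> p _; rewrite lee_fin icube_ge0.
  - by apply: integral_ge0 => x _; rewrite lee_fin mulr_ge0 ?expR_ge0.
set K := expR (2 * a * n%:R).
have K0 : 0 <= K by exact: expR_ge0.
have mPsi1 p : measurable_fun setT (fun x => Psi (p, x)).
  exact: (measurableT_comp mPsi (pair1_measurable p)).
have mF : measurable_fun setT (fun z : X * X => (icube z.1 * Psi z)%:E).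
  apply/measurable_EFinP; apply: measurable_funM => //.
  by apply: measurable_icube; exact: measurable_fst.
have F0 (z : X * X) : (0 <= (icube z.1 * Psi z)%:E)%E by rewrite lee_fin mulr_ge0 ?icube_ge0.
have mG : measurable_fun setT (fun z : X * X => (icube z.2 * Psi z)%:E).
  apply/measurable_EFinP; apply: measurable_funM => //.
  by apply: measurable_icube; exact: measurable_snd.
have G0 (z : X * X) : (0 <= (icube z.2 * Psi z)%:E)%E by rewrite lee_fin mulr_ge0 ?icube_ge0.
apply: (@le_trans _ _ (\int[mu]_p (K%:E * \int[mu]_x (icube p * Psi (p, x))%:E))%E).
  apply: ge0_le_integral => //=.
  - by move=> p _; rewrite mule_ge0 ?lee_fin ?icube_ge0//; apply: integral_ge0 => x _; rewrite lee_fin mulr_ge0 ?expR_ge0.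
  - by apply: emeasurable_funM => //; apply/measurable_EFinP; exact: measurable_icube.
  - by apply: emeasurable_funM => //; exact: (measurable_fun_fubini_tonelli_F _ mF F0).
  move=> p _; rewrite -(ge0_integralZl _ measurableT)//; last 3 first.
  - apply/measurable_EFinP; apply: measurable_funM => //; apply: mE.
    by apply: measurable_planeB.
  - by move=> x _; rewrite lee_fin mulr_ge0 ?expR_ge0.
  - by rewrite lee_fin icube_ge0.
  rewrite -(ge0_integralZl _ measurableT)//; last 2 first.
  - by apply/measurable_EFinP; apply: measurable_funM.
  - by move=> x _; exact: (F0 (p, x)).
  apply: ge0_le_integral => //=.
  - by move=> x _; rewrite -EFinM lee_fin !mulr_ge0 ?expR_ge0 ?icube_ge0.
  - apply: emeasurable_funM => //; apply/measurable_EFinP; apply: measurable_funM => //; apply: mE.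
    by apply: measurable_planeB.
  - by apply: emeasurable_funM => //; apply/measurable_EFinP; apply: measurable_funM.
  move=> x _; rewrite -!EFinM lee_fin /Psi /= icubeE.
  have [|_] := boolP (p \in cube (n:=n)); last by rewrite !mul0r mulr0.
  rewrite inE => /sqn_cube_le hp; rewrite !mul1r mulrCA ler_wpM2l// -expRD ler_expR.
  have := sqnD_le (x - c) (- p); rewrite sqnN; nra.
rewrite (ge0_integralZl _ measurableT)//; last 2 first.
- exact: (measurable_fun_fubini_tonelli_F _ mF F0).
- by move=> p _; apply: integral_ge0 => x _; exact: (F0 (p, x)).
rewrite EFinM -muleA; apply: lee_wpmul2l; first by rewrite lee_fin.
rewrite (ge0_exchange mPsi Psi0 invPsi) (fubini_tonelli _ mG G0) /=.
rewrite -(ge0_integralZl _ measurableT)//; last 3 first.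
- by apply/measurable_EFinP; apply: measurable_funM => //; exact: measurable_icube.
- by move=> x _; rewrite lee_fin mulr_ge0 ?icube_ge0.
- by rewrite lee_fin exprn_ge0// divr_ge0 ?mulr_ge0 ?pi_ge0// ltW.
rewrite le_eqVlt; apply/orP; left; apply/eqP; apply: eq_integral => x _.
have -> : 2 * pi / a = pi / (a / 2) by rewrite invf_div mulrCA mulrA.
rewrite -(integral_gauss_plane n a20) -(ge0_integral_plane_shift (- (x - c))); last 2 first.
- by apply/measurable_EFinP; exact: mE.
- by move=> p; rewrite lee_fin expR_ge0.
rewrite -(ge0_integralZr _ measurableT)//; last 2 first.
- by apply/measurable_EFinP; apply: mE; exact: measurable_plane_add.
- by rewrite lee_fin mulr_ge0 ?icube_ge0.
apply: eq_integral => p _; rewrite -EFinM /Psi/= mulrA mulrC -sqnN opprB.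
by [].
Qed.

End periodic_gaussian.

(** * Entire functions defined by integrals *)
Lemma eq_ler (R : realType) (x y : R) : x = y -> x <= y.
Proof. by move=> ->. Qed.

Section laplace.
Context {R : realType} d (T : measurableType d) (mu : {measure set T -> \bar R}).
Context (V : normedModType R[i]).
Context (phi : T -> R[i]) (N : T -> R) (l : T -> V -> R[i]).
Context (mphi : cmeasurable phi).
Context (mN : measurable_fun setT N).
Context (N0 : forall x, 0 <= N x).
Context (ml : forall v, cmeasurable (l ^~ v)).
Context (lD : forall x v w, l x (v + w) = l x v + l x w).
Context (lZ : forall x a v, l x (a *: v) = a * l x v).
Context (l_le : forall x v, normc (l x v) <= N x * nrm v).
Context (phioo : forall M : R, (\int[mu]_x (normc (phi x) * expR (M * N x))%:E < +oo)%E).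

Let wgt M x := normc (phi x) * expR (M * N x).

Let mw M : measurable_fun setT (wgt M).
Proof.
apply: measurable_funM; first exact: measurable_normc.
by apply: measurable_expR_fun; exact: measurable_funM.
Qed.

Let w0 M x : 0 <= wgt M x.
Proof. by rewrite mulr_ge0 ?normc_ge0 ?expR_ge0. Qed.

Let normc_cexp_le x v : normc (cexp (l x v)) <= expR (nrm v * N x).
Proof.
rewrite normc_cexp ler_expR; apply: le_trans (ler_norm _) _; apply: le_trans (absRe_le _) _.
by rewrite mulrC.
Qed.

Let N_le x : N x <= expR (N x).
Proof. by apply: le_trans (expR_ge1Dx _); rewrite lerDr. Qed.

Let int0 v : cintegrable mu (fun x => phi x * cexp (l x v)).
Proof.
apply: (@le_cintegrable _ _ _ _ _ (wgt (nrm v))) => //.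
- by apply: cmeasurableM => //; apply: cmeasurable_cexp; exact: ml.
- by move=> x; rewrite Normc.normcM ler_wpM2l ?normc_ge0.
- exact: phioo.
Qed.

Let int1 v h : cintegrable mu (fun x => phi x * cexp (l x v) * l x h).
Proof.
apply: (@le_cintegrable _ _ _ _ _ (fun x => nrm h * wgt (nrm v + 1) x)).
- apply: cmeasurableM; last exact: ml.
  by apply: cmeasurableM => //; apply: cmeasurable_cexp; exact: ml.
- by apply: measurable_funM => //; exact: mw.
- move=> x; rewrite !Normc.normcM.
  apply: le_trans (_ : normc (phi x) * expR (nrm v * N x) * (expR (N x) * nrm h) <= _).
    rewrite ler_pM ?mulr_ge0 ?normc_ge0//; first by rewrite ler_wpM2l ?normc_ge0.
    by apply: le_trans (l_le _ _) _; rewrite ler_wpM2r ?nrm_ge0.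
  by rewrite /wgt mulrDl mul1r expRD; apply: eq_ler; ring.
- under eq_integral do rewrite EFinM.
  rewrite ge0_integralZl//; [|by apply/measurable_EFinP; exact: mw|by move=> x _; rewrite lee_fin|by rewrite lee_fin nrm_ge0].
  by rewrite lte_mul_pinfty ?lee_fin ?nrm_ge0// ; exact: phioo.
Qed.

(** Differentiation under the integral sign for a Laplace transform with a vector parameter. Powers
    of [N x] from the derivative and from the remainder are absorbed by [N x <= expR (N x)], so
    finiteness of all exponential moments suffices. *)
Lemma differentiable_laplace v :
  differentiable ((fun w => cintegral mu (fun x => phi x * cexp (l x w))) : V -> R[i]^o) v.
Proof.
pose D h : R[i]^o := cintegral mu (fun x => phi x * cexp (l x v) * l x h).
have Dlin : linear D.
  move=> a u w; rewrite /D.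
  transitivity (cintegral mu (fun x => a * (phi x * cexp (l x v) * l x u) + phi x * cexp (l x v) * l x w)).
    by apply: eq_cintegral => x; rewrite lD lZ; ring.
  rewrite cintegralD; [|by apply: cintegrableZl; exact: int1|exact: int1].
  by rewrite cintegralZl//; exact: int1.
pose dfM := GRing.isLinear.Build _ _ _ _ D Dlin.
pose df : {linear V -> R[i]^o} := HB.pack D dfM.
pose I M := fine (\int[mu]_x (wgt M x)%:E)%E.
have I0 M : 0 <= I M by apply: fine_ge0; apply: integral_ge0 => x _; rewrite lee_fin.
have IE M : (\int[mu]_x (wgt M x)%:E)%E = (I M)%:E.
  rewrite fineK// ge0_fin_numE ?phioo//; apply: integral_ge0 => x _; rewrite lee_fin//.
have cle (f : T -> R[i]) (c M : R) : 0 <= c -> cintegrable mu f ->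
    (forall x, normc (f x) <= c * wgt M x) -> normc (cintegral mu f) <= c * I M.
  move=> c0 fi fle; rewrite -lee_fin; apply: le_trans (normc_cintegral_le fi) _.
  apply: (@le_trans _ _ (\int[mu]_x (c * wgt M x)%:E)%E).
    apply: ge0_le_integral => //.
    - by move=> x _; rewrite lee_fin normc_ge0.
    - by apply/measurable_EFinP; apply: measurable_normc; case: fi.
    - by apply/measurable_EFinP; apply: measurable_funM => //; exact: mw.
    - by move=> x _; rewrite lee_fin.
  under eq_integral do rewrite EFinM.
  rewrite ge0_integralZl//; [|by apply/measurable_EFinP; exact: mw|by move=> x _; rewrite lee_fin].
  by rewrite IE EFinM.
have Dle h : normc (D h) <= nrm h * I (nrm v + 1).
  apply: cle; [exact: nrm_ge0|exact: int1|move=> x].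
  rewrite !Normc.normcM.
  apply: le_trans (_ : normc (phi x) * expR (nrm v * N x) * (expR (N x) * nrm h) <= _).
    rewrite ler_pM ?mulr_ge0 ?normc_ge0//; first by rewrite ler_wpM2l ?normc_ge0.
    by apply: le_trans (l_le _ _) _; rewrite ler_wpM2r ?nrm_ge0.
  by rewrite /wgt mulrDl mul1r expRD; apply: eq_ler; ring.
apply: (@differentiable_bound _ _ _ _ df).
  apply: bounded_linear_continuous.
  pose M1 := I (nrm v + 1).
  apply/linear_boundedP; exists (M1%:C%C + 1); split; first by apply: realD; rewrite ?ger0_real ?lecR ?I0//.
  move=> M MM h; rewrite normcE3 nrmE.
  apply: le_trans (_ : M1%:C%C * (nrm h)%:C%C <= _).
    by rewrite -rmorphM/= lecR mulrC; exact: Dle.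
  rewrite ler_wpM2r//; first by rewrite lecR nrm_ge0.
  by apply: le_trans (ltW MM); rewrite lerDl.
move=> e e0.
pose C := 4 * I (nrm v + 3).
have C0 : 0 <= C by rewrite mulr_ge0.
exists (Num.min 1 (e / (C + 1))) => [|h].
  by rewrite lt_min ltr01/= divr_gt0// ltr_wpDl.
rewrite lt_min => /andP[h1 h2].
rewrite -cintegralB; [|exact: int0|exact: int0].
rewrite (_ : _ - df h = cintegral mu (fun x => phi x * cexp (l x (v + h)) -
    phi x * cexp (l x v) - phi x * cexp (l x v) * l x h)); last first.
  by apply/esym; apply: cintegralB; [apply: cintegrableB; exact: int0|exact: int1].
(* The 3 counts factors [expR (N x)]: two from the square of [l x h], and one from [cexp_sub1D_le],
   where [nrm h < 1] bounds the exponent by [N x]. *)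
apply: (@le_trans _ _ (nrm h ^+ 2 * 4 * I (nrm v + 3))).
  apply: cle; first by rewrite mulr_ge0 ?sqr_ge0.
    by apply: cintegrableB; [apply: cintegrableB; exact: int0|exact: int1].
  move=> x; rewrite lD cexpD.
  rewrite (_ : _ - _ = phi x * cexp (l x v) * (cexp (l x h) - 1 - l x h)); last by ring.
  rewrite !Normc.normcM /wgt.
  apply: le_trans (_ : normc (phi x) * expR (nrm v * N x) * (4 * (expR (N x) * nrm h) ^+ 2 * expR (N x)) <= _).
    rewrite ler_pM ?mulr_ge0 ?normc_ge0//; first by rewrite ler_wpM2l ?normc_ge0.
    apply: le_trans (cexp_sub1D_le _) _.
    have H : normc (l x h) <= expR (N x) * nrm h.
      by apply: le_trans (l_le _ _) _; rewrite ler_wpM2r ?nrm_ge0.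
    rewrite ler_pM ?mulr_ge0 ?sqr_ge0 ?expR_ge0 ?exprn_ge0 ?normc_ge0//.
      by rewrite ler_wpM2l// lerXn2r ?nnegrE ?normc_ge0 ?mulr_ge0 ?expR_ge0 ?nrm_ge0.
    rewrite ler_expR; apply: le_trans (l_le _ _) _.
    by rewrite -[leRHS]mulr1 ler_wpM2l// ltW.
  rewrite (_ : (nrm v + 3) * N x = nrm v * N x + (N x + (N x + N x))); last by ring.
  by rewrite !expRD; apply: eq_ler; ring.
rewrite (_ : _ * _ * _ = C * nrm h * nrm h); last by rewrite /C; ring.
rewrite ler_wpM2r ?nrm_ge0//.
apply: le_trans (_ : (C + 1) * nrm h <= _); first by rewrite ler_wpM2r ?nrm_ge0// lerDl.
by rewrite mulrC -ler_pdivlMr ?ltr_wpDl// ltW.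
Qed.

End laplace.

(** * The symmetric and the symplectic form *)

Section dot_products.
Context (K : comNzRingType) (n : nat).
Local Notation X := (plane K n).
Implicit Types (v w : 'rV[K]_n) (p q r : X) (a : K).

Lemma dotvDl u v w : dotv (u + v) w = dotv u w + dotv v w.
Proof. by rewrite /dotv -big_split; apply: eq_bigr => j _; rewrite mxE mulrDl. Qed.

Lemma dotvZl a v w : dotv (a *: v) w = a * dotv v w.
Proof. by rewrite /dotv mulr_sumr; apply: eq_bigr => j _; rewrite mxE mulrA. Qed.

Lemma dotv_sym v w : dotv v w = dotv w v.
Proof. by apply: eq_bigr => j _; rewrite mulrC. Qed.

(** No conjugation, even over [R[i]]: exponents built from this form are holomorphic. *)
Definition dB p q : K := dotv p.1 q.1 + dotv p.2 q.2.

(** The symplectic form of the group law, with the sign it has in [heis_mul] and in the phase of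
    [twisted_conv]. *)
Definition dOm p q : K := dotv p.2 q.1 - dotv p.1 q.2.

Lemma dBC p q : dB p q = dB q p.
Proof. by rewrite /dB (dotv_sym p.1) (dotv_sym p.2). Qed.

Lemma dBDl p q r : dB (p + q) r = dB p r + dB q r.
Proof. by rewrite /dB !dotvDl addrACA. Qed.

Lemma dBZl a p q : dB (a *: p) q = a * dB p q.
Proof. by rewrite /dB !dotvZl mulrDr. Qed.

Lemma dBNl p q : dB (- p) q = - dB p q.
Proof. by rewrite -scaleN1r dBZl mulN1r. Qed.

Lemma dBDr p q r : dB p (q + r) = dB p q + dB p r.
Proof. by rewrite dBC dBDl !(dBC p). Qed.

Lemma dBZr a p q : dB p (a *: q) = a * dB p q.
Proof. by rewrite dBC dBZl (dBC p). Qed.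

Lemma dBNr p q : dB p (- q) = - dB p q.
Proof. by rewrite dBC dBNl (dBC p). Qed.

Lemma dB0l p : dB 0 p = 0.
Proof. by rewrite -(scale0r 0) dBZl mul0r. Qed.

Lemma dB0r p : dB p 0 = 0.
Proof. by rewrite dBC dB0l. Qed.

Lemma dOmC p q : dOm p q = - dOm q p.
Proof. by rewrite /dOm opprB (dotv_sym p.1) (dotv_sym p.2). Qed.

Lemma dOmDl p q r : dOm (p + q) r = dOm p r + dOm q r.
Proof. by rewrite /dOm !dotvDl; ring. Qed.

Lemma dOmZl a p q : dOm (a *: p) q = a * dOm p q.
Proof. by rewrite /dOm !dotvZl; ring. Qed.

Lemma dOmNl p q : dOm (- p) q = - dOm p q.
Proof. by rewrite -scaleN1r dOmZl mulN1r. Qed.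

Lemma dOmDr p q r : dOm p (q + r) = dOm p q + dOm p r.
Proof. by rewrite dOmC dOmDl opprD -!(dOmC p). Qed.

Lemma dOmZr a p q : dOm p (a *: q) = a * dOm p q.
Proof. by rewrite dOmC dOmZl -mulrN -(dOmC p). Qed.

Lemma dOmNr p q : dOm p (- q) = - dOm p q.
Proof. by rewrite dOmC dOmNl -(dOmC p). Qed.

Lemma dOm0l p : dOm 0 p = 0.
Proof. by rewrite -(scale0r 0) dOmZl mul0r. Qed.

Lemma dOm0r p : dOm p 0 = 0.
Proof. by rewrite dOmC dOm0l oppr0. Qed.

(** The complex structure that links the two forms: through it, estimates and Gaussian integrals
    with a symplectic term reduce to those with [dB]. *)
Definition rJ q : X := (- q.2, q.1).

Lemma dB_rJ p q : dB p (rJ q) = dOm p q.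
Proof.
rewrite /dB /rJ/= /dOm [RHS]addrC; congr (_ + _).
by rewrite dotv_sym -scaleN1r dotvZl mulN1r dotv_sym.
Qed.

Lemma rJrJ q : rJ (rJ q) = - q.
Proof. by case: q. Qed.

Lemma dOm_rJ p q : dOm p (rJ q) = - dB p q.
Proof. by rewrite -dB_rJ rJrJ dBNr. Qed.

Lemma dB_rJ2 p q : dB (rJ p) (rJ q) = dB p q.
Proof. by rewrite dB_rJ dOmC dOm_rJ opprK dBC. Qed.

Definition dBE := (dBDl, dBDr, dBNl, dBNr, dBZl, dBZr).
Definition dOmE := (dOmDl, dOmDr, dOmNl, dOmNr, dOmZl, dOmZr).

End dot_products.

Section complex_points.
Context {R : realType} {n : nat}.
Local Notation X := (plane R n).
Local Notation XC := (plane R[i] n).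
Implicit Types (p q : X) (P Q : XC).

Definition iotac p : XC := (map_mx (real_complex R) p.1, map_mx (real_complex R) p.2).

Definition rep P : X := (map_mx (@complex.Re R) P.1, map_mx (@complex.Re R) P.2).
Definition imp P : X := (map_mx (@complex.Im R) P.1, map_mx (@complex.Im R) P.2).

Lemma planeP (K : pzRingType) (p q : plane K n) :
  (forall j, p.1 ord0 j = q.1 ord0 j) -> (forall j, p.2 ord0 j = q.2 ord0 j) -> p = q.
Proof. by case: p q => [a b] [c e] /= h1 h2; congr (_, _); apply/rowP. Qed.

Lemma cpoint_rep P : cpoint (rep P) (imp P) = P.
Proof. by apply: planeP => j; rewrite !mxE; case: (_ ord0 j). Qed.

Lemma iotaE p : iotac p = cpoint p 0.
Proof. by apply: planeP => j; rewrite !mxE. Qed.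

Lemma cpointD p q p' q' : cpoint p q + cpoint p' q' = cpoint (p + p') (q + q').
Proof. by apply: planeP => j; rewrite !mxE. Qed.

Lemma dotv_complex m (a b c e : 'rV[R]_m) :
  dotv (map2_mx (@Complex R) a b) (map2_mx (@Complex R) c e) =
  ((dotv a c - dotv b e) +i* (dotv a e + dotv b c))%C.
Proof.
apply: complexP; rewrite ?cRe_sum ?cIm_sum /= -?sumrB -?big_split/=; apply: eq_bigr => j _;
  rewrite !mxE/=; ring.
Qed.

Lemma dB_cpoint p q p' q' : dB (cpoint p q) (cpoint p' q') =
  ((dB p p' - dB q q') +i* (dB p q' + dB q p'))%C.
Proof. by rewrite /dB !dotv_complex; apply: complexP => /=; ring. Qed.

Lemma dOm_cpoint p q p' q' : dOm (cpoint p q) (cpoint p' q') =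
  ((dOm p p' - dOm q q') +i* (dOm p q' + dOm q p'))%C.
Proof. by rewrite /dOm !dotv_complex; apply: complexP => /=; ring. Qed.

Lemma mx_coord_le (v : 'rV[R[i]]_n) j : normc (v ord0 j) <= nrm v.
Proof.
rewrite -lecR -normcE3 -nrmE; rewrite {2}/Num.norm/= mx_normE.
have H : (`|v ord0 j|%:nng <= \big[Num.max/0%:nng]_i `|v i.1 i.2|%:nng)%R.
  exact: (le_bigmax _ (fun i => `|v i.1 i.2|%:nng) (ord0, j)).
by move: H; rewrite -num_le.
Qed.

Lemma nrm_pair (U V : normedModType R[i]) (u : U) (v : V) :
  nrm (u : U) <= nrm (u, v) /\ nrm v <= nrm (u, v).
Proof.
rewrite -!lecR -!nrmE; have -> : `|(u, v)| = Num.max `|u| `|v| by [].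
by rewrite /Order.max; case: real_ltP => [||/ltW h|h]; rewrite ?normr_real//; split.
Qed.

Lemma coord1_le P j : normc (P.1 ord0 j) <= nrm P.
Proof. by case: P => a b; apply: le_trans (mx_coord_le a j) _; case: (nrm_pair a b). Qed.

Lemma coord2_le P j : normc (P.2 ord0 j) <= nrm P.
Proof. by case: P => a b; apply: le_trans (mx_coord_le b j) _; case: (nrm_pair a b). Qed.

(** The norm dual to the supremum norm [nrm] under the pairing [dB], as [normc_dB_le] requires. *)
Definition nrm1 P : R := \sum_j normc (P.1 ord0 j) + \sum_j normc (P.2 ord0 j).

Lemma nrm1_ge0 P : 0 <= nrm1 P.
Proof. by rewrite addr_ge0// sumr_ge0// => j _; exact: normc_ge0. Qed.

Lemma normc_dB_le P Q : normc (dB P Q) <= nrm1 Q * nrm P.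
Proof.
apply: le_trans (le_normcD _ _) _; rewrite mulrDl; apply: lerD.
  apply: le_trans (normc_triangle_sum _ _ _) _; rewrite mulr_suml; apply: ler_sum => j _.
  by rewrite Normc.normcM mulrC ler_wpM2l ?normc_ge0 ?coord1_le.
apply: le_trans (normc_triangle_sum _ _ _) _; rewrite mulr_suml; apply: ler_sum => j _.
by rewrite Normc.normcM mulrC ler_wpM2l ?normc_ge0 ?coord2_le.
Qed.

End complex_points.

(** * Measurability of continuous functions of a measurable complex point *)

Section continuous_composition.
Context {R : realType} {n : nat} d (T : measurableType d).
Local Notation X := (plane R n).
Local Notation XC := (plane R[i] n).
Local Notation XCo := (plane R[i]^o n).
Implicit Types (p q : X) (P Q : XC).

(** A grid cell of mesh [m.+1%:R^-1], in the real and in the imaginary part, labelled by two lattice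
    vectors. *)
Let cell (m : nat) (g : lattice n * lattice n) P :=
  cube (m.+1%:R *: rep P - lpt R g.1) /\ cube (m.+1%:R *: imp P - lpt R g.2).

Let cell_close (e : R) m g P Q : 2 < e * m.+1%:R -> cell m g P -> cell m g Q ->
  (forall j, normc (P.1 ord0 j - Q.1 ord0 j) < e) /\ (forall j, normc (P.2 ord0 j - Q.2 ord0 j) < e).
Proof.
move=> em [[P1 P2] [P3 P4]] [[Q1 Q2] [Q3 Q4]].
have m0 : (0 : R) < m.+1%:R by rewrite ltr0n.
have e0 : 0 < e by rewrite -(pmulr_lgt0 _ m0); lra.
have key (z w : R[i]) (a b : R) :
    0 <= m.+1%:R * complex.Re z - a < 1 -> 0 <= m.+1%:R * complex.Re w - a < 1 ->
    0 <= m.+1%:R * complex.Im z - b < 1 -> 0 <= m.+1%:R * complex.Im w - b < 1 ->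
    normc (z - w) < e.
  move=> /andP[h1 h2] /andP[h3 h4] /andP[h5 h6] /andP[h7 h8].
  apply: le_lt_trans (normc_le _) _; rewrite cReD cReN cImD cImN.
  rewrite -(ltr_pM2r m0) mulrDl; apply: lt_trans em.
  have H (x : R) : - 1 < x * m.+1%:R -> x * m.+1%:R < 1 -> `|x| * m.+1%:R < 1.
    by move=> h h'; case: (ger0P x) => _ //; lra.
  have H1 : `|complex.Re z - complex.Re w| * m.+1%:R < 1 by apply: H; lra.
  have H2 : `|complex.Im z - complex.Im w| * m.+1%:R < 1 by apply: H; lra.
  lra.
split => j.
  by apply: (@key _ _ ((lpt R g.1).1 ord0 j) ((lpt R g.2).1 ord0 j));
     [have := P1 j|have := Q1 j|have := P3 j|have := Q3 j]; rewrite !mxE.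
by apply: (@key _ _ ((lpt R g.1).2 ord0 j) ((lpt R g.2).2 ord0 j));
   [have := P2 j|have := Q2 j|have := P4 j|have := Q4 j]; rewrite !mxE.
Qed.

Context (zeta : T -> XC).
Context (mz1 : forall j, cmeasurable (fun t => (zeta t).1 ord0 j)).
Context (mz2 : forall j, cmeasurable (fun t => (zeta t).2 ord0 j)).

Let mrep : measurable_fun setT (fun t => rep (zeta t)).
Proof.
apply/measurable_fun_pairP; split; apply: measurable_rV => j;
  under eq_fun do rewrite mxE; [by case: (mz1 j)|by case: (mz2 j)].
Qed.

Let mimp : measurable_fun setT (fun t => imp (zeta t)).
Proof.
apply/measurable_fun_pairP; split; apply: measurable_rV => j;
  under eq_fun do rewrite mxE; [by case: (mz1 j)|by case: (mz2 j)].
Qed.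

Lemma measurable_plane_scale d' (T' : measurableType d') (a : R) (f : T' -> X) :
  measurable_fun setT f -> measurable_fun setT (fun t => a *: f t).
Proof.
move=> mf; apply/measurable_fun_pairP; split; apply: measurable_rV => j;
  under eq_fun do rewrite mxE; apply: measurable_funM => //; apply: measurableT_comp (measurable_coord j) _.
  exact: (measurableT_comp measurable_fst mf).
exact: (measurableT_comp measurable_snd mf).
Qed.

Let mcell m g : measurable [set t | cell m g (zeta t)].
Proof.
have H (f : T -> X) (c : X) : measurable_fun setT f ->
    measurable [set t | cube (m.+1%:R *: f t - c)].
  move=> mf; have mg : measurable_fun setT (fun t => m.+1%:R *: f t - c).
    by apply: measurable_planeB => //; exact: measurable_plane_scale.
  by rewrite -[X in measurable X]setTI; apply: mg => //; exact: measurable_cube.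
by apply: measurableI; exact: H.
Qed.

(** The sigma-algebra on rows is generated by coordinates, not by the topology. An open set is the
    countable union of the grid cells that it contains: by [cell_close] every point of it lies in
    such a cell once the mesh is fine enough. *)
Let mopen (O : set XCo) : open O -> measurable (zeta @^-1` O).
Proof.
move=> oO; pose good m g := forall P, cell m g P -> O P.
have -> : zeta @^-1` O = \bigcup_(mg : nat * (lattice n * lattice n))
    (if `[< good mg.1 mg.2 >] then [set t | cell mg.1 mg.2 (zeta t)] else set0).
  apply/seteqP; split => t /=; last first.
    by move=> [[m g] _] /=; case: asboolP => // h /h.
  move=> Ot; have /nbhs_ballP[e0 /= e00 He] : nbhs (zeta t : XCo) O by exact: open_nbhs_nbhs.
  have eE : e0 = (complex.Re e0)%:C%C by apply: complexP => //=; exact/ger0_Im/ltW.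
  set e := complex.Re e0 in eE; rewrite eE ltcR in e00 He.
  have [m em] : exists m : nat, 2 < e * m.+1%:R.
    exists (Num.truncn (2 / e)); rewrite mulrC -ltr_pdivrMr//.
    by rewrite truncnS_gt// divr_ge0// ltW.
  exists (m, (lfloor (m.+1%:R *: rep (zeta t)), lfloor (m.+1%:R *: imp (zeta t)))) => //=.
  have ct : cell m (lfloor (m.+1%:R *: rep (zeta t)), lfloor (m.+1%:R *: imp (zeta t))) (zeta t).
    by split; exact: cube_lfloor.
  rewrite asboolT// => P cP; apply: He; have [H1 H2] := cell_close em ct cP.
    by split; split; rewrite ?ltcR// => i j; rewrite (ord1 i) -ball_normE /ball_/= normcE3 ltcR.
apply: countable_bigcupT_measurable; first exact: countableP.
move=> [m g] /=.
by case: asboolP => // _; exact: mcell.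
Qed.

Let mreal (F : XCo -> R) : continuous F -> measurable_fun setT (fun t => F (zeta t)).
Proof.
move=> cF; apply: (measurability _ (RGenOInfty.measurableE R)) => _ [_ [x ->] <-].
rewrite setTI.
apply: (mopen (O := F @^-1` `]x, +oo[)).
by apply: open_comp; [move=> ? _; exact: cF|exact: interval_open].
Qed.

Lemma cmeasurable_continuous (G : XC -> R[i]) : continuous (G : XCo -> R[i]^o) ->
  cmeasurable (fun t => G (zeta t)).
Proof.
move=> cG; have cR (r : R[i] -> R) : (forall z w, `|r z - r w| <= normc (z - w)) ->
    continuous ((fun P => r (G P)) : XCo -> R).
  move=> rl P; apply/cvgrPdist_lt => e e0.
  have /cvgrPdist_lt/(_ e%:C%C) := cG P; rewrite ltcR => /(_ e0).
  apply: filterS => Q; rewrite normcE3 ltcR; exact: le_lt_trans.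
split.
  apply: (mreal (F := fun P => complex.Re (G P))); apply: cR => z w.
  by rewrite -cReN -cReD absRe_le.
apply: (mreal (F := fun P => complex.Im (G P))); apply: cR => z w.
by rewrite -cImN -cImD absIm_le.
Qed.

Lemma cmeasurable_entire (G : XC -> R[i]) : entire G -> cmeasurable (fun t => G (zeta t)).
Proof.
by move=> eG; apply: cmeasurable_continuous => P; exact: (differentiable_continuous (eG P)).
Qed.

End continuous_composition.

(** * Fourier transforms of Gaussians *)
Section gaussian_integrals.
Context {R : realType} {n : nat}.
Local Notation X := (plane R n).
Local Notation mu := (mu_plane R n).
Implicit Types (b c x : X).

Lemma sqnE x : sqn x = dB x x. Proof. by []. Qed.

Lemma measurable_dB d (T : measurableType d) (f g : T -> X) :
  measurable_fun setT f -> measurable_fun setT g -> measurable_fun setT (fun t => dB (f t) (g t)).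
Proof.
by move=> mf mg; apply: measurable_funD; apply: measurable_dotv;
  (apply: measurableT_comp; [|by []]).
Qed.

Lemma measurable_dOm d (T : measurableType d) (f g : T -> X) :
  measurable_fun setT f -> measurable_fun setT g -> measurable_fun setT (fun t => dOm (f t) (g t)).
Proof.
by move=> mf mg; apply: measurable_funB; apply: measurable_dotv;
  (apply: measurableT_comp; [|by []]).
Qed.

(** Completing the square is a translation by [(2 * al)^-1 *: b]. *)
Lemma integral_gauss_shifted (al : R) b : 0 < al ->
  (\int[mu]_x (expR (dB b x - al * sqn x))%:E)%E = ((pi / al) ^+ n * expR (sqn b / (4 * al)))%:E.
Proof.
move=> al0; have aN0 : al != 0 by rewrite gt_eqF.
pose f (x : X) : \bar R := (expR (- (al * sqn x)))%:E.
have mf : measurable_fun setT f.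
  apply/measurable_EFinP; apply: measurable_expR_fun; apply: measurableT_comp => //.
  by apply: measurable_funM => //; exact: measurable_sqn.
have f0 x : (0 <= f x)%E by rewrite lee_fin expR_ge0.
rewrite EFinM -(integral_gauss_plane n al0) -/f -(ge0_integral_plane_shift (- ((2 * al)^-1 *: b)) mf f0).
rewrite -ge0_integralZr//; last by apply: (measurableT_comp mf); exact: measurable_plane_add.
apply: eq_integral => x _; rewrite /f -EFinM -expRD; congr (expR _)%:E.
by rewrite !sqnE !dBE (dBC x b); field.
Qed.

Lemma measurable_id_plane : measurable_fun setT (fun x : X => x).
Proof. exact: measurable_id. Qed.

Let mdBc b : measurable_fun setT (fun x : X => dB b x).
Proof. by apply: measurable_dB => //; exact: measurable_cst. Qed.

Let mgauss (al : R) b : measurable_fun setT (fun x : X => dB b x - al * sqn x).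
Proof.
by apply: measurable_funB; [exact: mdBc|apply: measurable_funM => //; exact: measurable_sqn].
Qed.

Lemma cintegrable_gauss (al : R) b c : 0 < al ->
  cintegrable mu (fun x => cexp ((dB b x - al * sqn x) +i* dB c x)%C).
Proof.
move=> al0; split.
  by apply: cmeasurable_cexp; split => /=; [exact: mgauss|exact: mdBc].
under eq_integral do rewrite normc_cexp /=.
by rewrite integral_gauss_shifted// ltry.
Qed.

(** Replace the phase ['i * dB c x] by [s * dB c x] with a complex parameter [s]. Both sides are
    entire in [s] and agree for real [s], where the square can be completed; the identity theorem
    then gives [s = 'i]. *)
Lemma cintegral_gauss (al : R) b c : 0 < al ->
  cintegral mu (fun x => cexp ((dB b x - al * sqn x) +i* dB c x)%C) =
  ((pi / al) ^+ n)%:C%C * cexp ((sqn b - sqn c) / (4 * al) +i* (dB b c / (2 * al)))%C.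
Proof.
move=> al0; have aN0 : al != 0 by rewrite gt_eqF.
pose phi x : R[i] := (expR (dB b x - al * sqn x))%:C%C.
pose C := ((pi / al) ^+ n)%:C%C : R[i].
pose g (s : R[i]) := cintegral mu (fun x => phi x * cexp (s * (dB c x)%:C%C)).
pose h (s : R[i]) := C * cexp ((sqn b / (4 * al))%:C%C + s * (dB b c / (2 * al))%:C%C +
  s * s * (sqn c / (4 * al))%:C%C).
have dg (z : R[i]^o) : differentiable (g : R[i]^o -> R[i]^o) z.
  apply: (differentiable_laplace (N := fun x => `|dB c x|)
     (l := fun x (s : R[i]^o) => (s : R[i]) * (dB c x)%:C%C)).
  - by apply: cmeasurable_real; apply: measurable_expR_fun; exact: mgauss.
  - by apply: measurableT_comp => //; exact: mdBc.
  - by move=> x; exact: normr_ge0.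
  - move=> v; apply: cmeasurableM; first exact: cmeasurable_cst.
    by apply: cmeasurable_real; exact: mdBc.
  - by move=> x v w; rewrite mulrDl.
  - by move=> x a v; rewrite -mulrA.
  - by move=> x v; rewrite Normc.normcM normc_real nrm_normc mulrC.
  - move=> M; rewrite /phi.
    (* The exponential of [M * |dB c x|] is at most the sum of the exponentials with either sign,
       and each of these is a real shifted Gaussian. *)
    apply: (@le_lt_trans _ _ (\int[mu]_x ((expR (dB (b + M *: c) x - al * sqn x))%:E +
       (expR (dB (b - M *: c) x - al * sqn x))%:E))%E).
      apply: ge0_le_integral => //.
      + by move=> x _; rewrite lee_fin mulr_ge0 ?normc_ge0 ?expR_ge0.
      + apply/measurable_EFinP; apply: measurable_funM.
          apply: measurable_normc; apply: cmeasurable_real.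
          by apply: measurable_expR_fun; exact: mgauss.
        apply: measurable_expR_fun; apply: measurable_funM => //.
        by apply: measurableT_comp => //; exact: mdBc.
      + by apply: emeasurable_funD; apply/measurable_EFinP; apply: measurable_expR_fun; exact: mgauss.
      + move=> x _; rewrite -EFinD lee_fin normc_real ger0_norm ?expR_ge0// -expRD !dBE.
        case: (ger0P (dB c x)) => _.
          by rewrite [X in expR X <= _](_ : _ = dB b x + M * dB c x - al * sqn x) ?lerDl ?expR_ge0//; ring.
        by rewrite [X in expR X <= _](_ : _ = dB b x - M * dB c x - al * sqn x) ?lerDr ?expR_ge0//; ring.
    have mE b' : measurable_fun setT (fun x : X => (expR (dB b' x - al * sqn x))%:E).
      by apply/measurable_EFinP; apply: measurable_expR_fun; exact: mgauss.
    have E0 b' (x : X) : (0 <= (expR (dB b' x - al * sqn x))%:E)%E by rewrite lee_fin expR_ge0.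
    rewrite (ge0_integralD mu measurableT (fun x _ => E0 (b + M *: c) x) (mE _) (fun x _ => E0 (b - M *: c) x) (mE _)).
    by rewrite !integral_gauss_shifted// -EFinD ltry.
have dh (z : R[i]^o) : differentiable (h : R[i]^o -> R[i]^o) z.
  apply: (@differentiable_mulr _ (fun=> C)); first exact: differentiable_cst.
  apply: (@differentiable_compC _ (fun s => (sqn b / (4 * al))%:C%C + s * (dB b c / (2 * al))%:C%C +
     s * s * (sqn c / (4 * al))%:C%C)); last exact: differentiable_cexp.
  apply: differentiableD; first exact: differentiable_affine.
  by apply: differentiable_mulr => //; apply: differentiable_mulr.
have gh s : g s - h s = 0.
  apply: (@holomorphic_eq0_of_real _ (fun s => g s - h s)) => [z|x]; first exact: differentiableB.
  apply/eqP; rewrite subr_eq0; apply/eqP; rewrite /g /h.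
  transitivity (cintegral mu (fun y => (expR (dB (b + x *: c) y - al * sqn y))%:C%C)).
    apply: eq_cintegral => y; rewrite /phi -rmorphM/= cexp_real -rmorphM/= -expRD !dBE.
    by congr (expR _)%:C%C; ring.
  rewrite cintegral_real /Rintegral integral_gauss_shifted//= -!rmorphM/= -!rmorphD/= cexp_real -rmorphM/=.
  by congr (_ * expR _)%:C%C; rewrite !sqnE !dBE (dBC c b); field.
have /eqP := gh 'i%C; rewrite subr_eq0 => /eqP; rewrite /g /h => E.
transitivity (cintegral mu (fun x => phi x * cexp ('i%C * (dB c x)%:C%C))).
  apply: eq_cintegral => x; rewrite /phi -cexp_real -cexpD; congr cexp.
  by apply: complexP => /=; ring.
by rewrite E; congr (_ * cexp _); apply: complexP => /=; field.
Qed.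

End gaussian_integrals.

(** * Transfer of identities from nonnegative to complex integrands *)

Section transfer.
Context {R : realType}.

Definition cpart (b1 b2 : bool) (z : R[i]) : R :=
  let r := if b1 then complex.Re z else complex.Im z in Num.max (if b2 then - r else r) 0.

Lemma cpart_ge0 b1 b2 z : 0 <= cpart b1 b2 z.
Proof. by rewrite /cpart le_max lexx orbT. Qed.

Lemma cpart0 b1 b2 : cpart b1 b2 0 = 0.
Proof. by case: b1; case: b2; rewrite /cpart/= ?oppr0 maxxx. Qed.

Lemma measurable_cpart d (T : measurableType d) b1 b2 (f : T -> R[i]) :
  cmeasurable f -> measurable_fun setT (fun x => cpart b1 b2 (f x)).
Proof.
move=> [mR mI]; apply: measurable_maxr; last exact: measurable_cst.
by case: b1; case: b2 => //; apply: measurableT_comp.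
Qed.

Lemma cpart_indic (b : bool) b1 b2 z : cpart b1 b2 ((b%:R : R)%:C%C * z) = b%:R * cpart b1 b2 z.
Proof. by case: b; rewrite ?mul1r ?mul0r ?cpart0. Qed.

(** No integrability is required: [cintegral] is computed by [fine] from these four nonnegative
    integrals, so their equality alone transfers. *)
Lemma cintegral_cpart d1 d2 (T1 : measurableType d1) (T2 : measurableType d2)
    (m1 : {measure set T1 -> \bar R}) (m2 : {measure set T2 -> \bar R})
    (f1 : T1 -> R[i]) (f2 : T2 -> R[i]) :
  (forall b1 b2, \int[m1]_x (cpart b1 b2 (f1 x))%:E = \int[m2]_x (cpart b1 b2 (f2 x))%:E)%E ->
  cintegral m1 f1 = cintegral m2 f2.
Proof.
move=> H; rewrite /cintegral /Rintegral; congr (fine _ +i* fine _)%C.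
  rewrite integralE [in RHS]integralE; congr (_ - _)%E.
    transitivity (\int[m1]_x (cpart true false (f1 x))%:E)%E.
      by apply: eq_integral => x _; rewrite funeposE/= -EFin_max.
    by rewrite H; apply: eq_integral => x _; rewrite funeposE/= -EFin_max.
  transitivity (\int[m1]_x (cpart true true (f1 x))%:E)%E.
    by apply: eq_integral => x _; rewrite funenegE/= -EFin_max.
  by rewrite H; apply: eq_integral => x _; rewrite funenegE/= -EFin_max.
rewrite integralE [in RHS]integralE; congr (_ - _)%E.
  transitivity (\int[m1]_x (cpart false false (f1 x))%:E)%E.
    by apply: eq_integral => x _; rewrite funeposE/= -EFin_max.
  by rewrite H; apply: eq_integral => x _; rewrite funeposE/= -EFin_max.
transitivity (\int[m1]_x (cpart false true (f1 x))%:E)%E.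
  by apply: eq_integral => x _; rewrite funenegE/= -EFin_max.
by rewrite H; apply: eq_integral => x _; rewrite funenegE/= -EFin_max.
Qed.

Lemma cintegral_invariant d1 d2 (T1 : measurableType d1) (T2 : measurableType d2)
    (m1 : {measure set T1 -> \bar R}) (m2 : {measure set T2 -> \bar R})
    (s : T1 -> T2) (f : T2 -> R[i]) : cmeasurable f ->
  (forall h : T2 -> \bar R, measurable_fun setT h -> (forall x, (0 <= h x)%E) ->
     \int[m1]_x h (s x) = \int[m2]_x h x)%E ->
  cintegral m1 (fun x => f (s x)) = cintegral m2 f.
Proof.
move=> mf H; apply: cintegral_cpart => b1 b2.
apply: (H (fun x => (cpart b1 b2 (f x))%:E)) => [|x].
  by apply/measurable_EFinP; exact: measurable_cpart.
by rewrite lee_fin cpart_ge0.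
Qed.

End transfer.

(** * Phase space: unfolding and Schur's estimate *)

Section phase_space.
Context (R : realType) (n : nat).
Local Notation X := (plane R n).
Local Notation Y := (X * X)%type.
Local Notation YY := ((X * X) * (X * X))%type.
Local Notation YX := (X * X * X)%type.
Local Notation mu := (mu_plane R n).
Implicit Types (p q x : X) (z : Y) (l : lattice n).
Local Notation lp := (lpt R).

Definition nu : {sigma_finite_measure set Y -> \bar R} := sprod mu mu.

Definition triple : {sigma_finite_measure set YX -> \bar R} := sprod nu mu.

Lemma cintegral_plane_shift (c : X) (f : X -> R[i]) : cmeasurable f ->
  cintegral mu (fun x => f (x + c)) = cintegral mu f.
Proof.
move=> mf; apply: (cintegral_invariant (s := fun x => x + c)) => // h mh h0.
exact: ge0_integral_plane_shift.
Qed.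

Lemma ge0_integral_nu_shift (c : Y) (h : Y -> \bar R) :
  measurable_fun setT h -> (forall z, (0 <= h z)%E) ->
  (\int[nu]_z h (z + c)%R = \int[nu]_z h z)%E.
Proof.
move=> mh h0; have msh : measurable_fun setT (fun z : Y => h (z + c)).
  apply: measurableT_comp => //; apply/measurable_fun_pairP; split.
    exact: (measurableT_comp (measurable_plane_add c.1) measurable_fst).
  exact: (measurableT_comp (measurable_plane_add c.2) measurable_snd).
rewrite /nu (fubini_tonelli1 _ msh (fun z => h0 _)) (fubini_tonelli1 _ mh h0).
transitivity (\int[mu]_x (fubini_F mu h (x + c.1)%R))%E.
  apply: eq_integral => x _; rewrite /fubini_F.
  apply: (ge0_integral_plane_shift c.2 (f := fun y => h (x + c.1, y))) => //.
  by apply: (measurableT_comp mh); exact: pair1_measurable.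
apply: ge0_integral_plane_shift; first exact: measurable_fun_fubini_tonelli_F.
by move=> x; apply: integral_ge0.
Qed.

Lemma cintegral_nu_shift (c : Y) (f : Y -> R[i]) : cmeasurable f ->
  cintegral nu (fun z => f (z + c)) = cintegral nu f.
Proof.
move=> mf; apply: (cintegral_invariant (s := fun z => z + c)) => // h mh h0.
exact: ge0_integral_nu_shift.
Qed.

Lemma measurable_icube1 : measurable_fun setT (fun y : YX => icube y.1.2).
Proof. by apply: measurable_icube; exact: (measurableT_comp measurable_snd measurable_fst). Qed.

Lemma measurable_icube2 : measurable_fun setT (fun y : YX => icube y.2).
Proof. by apply: measurable_icube; exact: measurable_snd. Qed.

(** For fixed [q] this is [ge0_exchange]; lattice vectors never act on the imaginary part. *)
Lemma ge0_exchange_triple (Psi : YX -> R) : measurable_fun setT Psi ->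
  (forall y, 0 <= Psi y) ->
  (forall q p x l, Psi ((q, p + lp l), x + lp l) = Psi ((q, p), x)) ->
  (\int[triple]_y (icube y.1.2 * Psi y)%:E = \int[triple]_y (icube y.2 * Psi y)%:E)%E.
Proof.
move=> mPsi Psi0 inv.
have m1 : measurable_fun setT (fun y : YX => (icube y.1.2 * Psi y)%:E).
  by apply/measurable_EFinP; apply: measurable_funM => //; exact: measurable_icube1.
have m2 : measurable_fun setT (fun y : YX => (icube y.2 * Psi y)%:E).
  by apply/measurable_EFinP; apply: measurable_funM => //; exact: measurable_icube2.
have p1 (y : YX) : (0 <= (icube y.1.2 * Psi y)%:E)%E by rewrite lee_fin mulr_ge0 ?icube_ge0.
have p2 (y : YX) : (0 <= (icube y.2 * Psi y)%:E)%E by rewrite lee_fin mulr_ge0 ?icube_ge0.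
rewrite /triple (fubini_tonelli1 _ m1 p1) (fubini_tonelli1 _ m2 p2).
have mF1 := measurable_fun_fubini_tonelli_F (m2 := mu) _ m1 p1.
have mF2 := measurable_fun_fubini_tonelli_F (m2 := mu) _ m2 p2.
have F1 z : (0 <= fubini_F mu (fun y : YX => (icube y.1.2 * Psi y)%:E) z)%E.
  by apply: integral_ge0 => x _; exact: p1.
have F2 z : (0 <= fubini_F mu (fun y : YX => (icube y.2 * Psi y)%:E) z)%E.
  by apply: integral_ge0 => x _; exact: p2.
rewrite /nu (fubini_tonelli1 _ mF1 F1) (fubini_tonelli1 _ mF2 F2).
apply: eq_integral => q _; rewrite /fubini_F/=.
apply: (ge0_exchange (Psi := fun z => Psi ((q, z.1), z.2))) => //.
- apply: (measurableT_comp mPsi); apply/measurable_fun_pairP; split; last exact: measurable_snd.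
  by apply/measurable_fun_pairP; split; [exact: measurable_cst|exact: measurable_fst].
- by move=> p x l; exact: inv.
Qed.

Lemma cexchange_triple (Th : YX -> R[i]) : cmeasurable Th ->
  (forall q p x l, Th ((q, p + lp l), x + lp l) = Th ((q, p), x)) ->
  cintegral triple (fun y => (icube y.1.2)%:C%C * Th y) =
  cintegral triple (fun y => (icube y.2)%:C%C * Th y).
Proof.
move=> mT inv; apply: cintegral_cpart => b1 b2.
transitivity (\int[triple]_y (icube y.1.2 * cpart b1 b2 (Th y))%:E)%E.
  by apply: eq_integral => y _; rewrite icubeE cpart_indic.
rewrite (ge0_exchange_triple (Psi := fun y => cpart b1 b2 (Th y))).
- by apply: eq_integral => y _; rewrite icubeE cpart_indic.
- exact: measurable_cpart.
- by move=> y; exact: cpart_ge0.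
- by move=> q p x l; rewrite inv.
Qed.

Lemma eq_lee (x y : \bar R) : x = y -> (x <= y)%E.
Proof. by move=> ->. Qed.

Definition ygauss (e : R) z : R := expR (- (e * (sqn z.1 + sqn z.2))).

Lemma ygaussE e z : ygauss e z = expR (- (e * sqn z.1)) * expR (- (e * sqn z.2)).
Proof. by rewrite -expRD /ygauss mulrDr opprD. Qed.

Lemma measurable_gauss d (T : measurableType d) (e : R) (f : T -> X) : measurable_fun setT f ->
  measurable_fun setT (fun t => expR (- (e * sqn (f t)))).
Proof.
move=> mf; apply: measurable_expR_fun; apply: measurableT_comp => //.
by apply: measurable_funM => //; exact: measurable_sqn.
Qed.

Lemma measurable_ygauss d (T : measurableType d) (e : R) (f : T -> Y) : measurable_fun setT f ->
  measurable_fun setT (fun t => ygauss e (f t)).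
Proof.
move=> mf; under eq_fun do rewrite ygaussE.
by apply: measurable_funM; apply: measurable_gauss; apply: measurableT_comp.
Qed.

(** The constant of [periodic_gauss_le]. *)
Definition gauss_cst (e : R) := expR (2 * e * n%:R) * (2 * pi / e) ^+ n.

Lemma gauss_cst_ge0 e : 0 < e -> 0 <= gauss_cst e.
Proof. by move=> e0; rewrite mulr_ge0 ?expR_ge0// exprn_ge0// divr_ge0 ?mulr_ge0 ?pi_ge0// ltW. Qed.

(** Periodicity concerns only the real part; the quotient of phase space is a torus times the whole
    [q]-space. *)
Definition yper (h : Y -> R) := forall q p l, h (q, p + lp l) = h (q, p).

Lemma ygauss_le (e : R) (h : Y -> R) (c : Y) : 0 < e -> measurable_fun setT h ->
  (forall z, 0 <= h z) -> yper h ->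
  (\int[nu]_z (ygauss e (z - c) * h z)%:E <=
   (gauss_cst e)%:E * \int[mu]_q ((expR (- (e * sqn (q - c.1))))%:E * \int[mu]_p (icube p * h (q, p))%:E))%E.
Proof.
move=> e0 mh h0 hper.
have mg : measurable_fun setT (fun z : Y => (ygauss e (z - c) * h z)%:E).
  apply/measurable_EFinP; apply: measurable_funM => //; apply: measurable_ygauss.
  by apply/measurable_fun_pairP; split; apply: measurable_planeB => //; exact: measurable_cst.
have g0 z : (0 <= (ygauss e (z - c) * h z)%:E)%E by rewrite lee_fin mulr_ge0 ?expR_ge0.
have mi : measurable_fun setT (fun z : Y => (icube z.2 * h z)%:E).
  by apply/measurable_EFinP; apply: measurable_funM => //; apply: measurable_icube; exact: measurable_snd.
have i0 z : (0 <= (icube z.2 * h z)%:E)%E by rewrite lee_fin mulr_ge0 ?icube_ge0.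
have mI := measurable_fun_fubini_tonelli_F (m2 := mu) _ mi i0.
have I0 q : (0 <= \int[mu]_p (icube p * h (q, p))%:E)%E.
  by apply: integral_ge0 => p _; exact: (i0 (q, p)).
have mG : measurable_fun setT (fun q : X => (expR (- (e * sqn (q - c.1))))%:E).
  by apply/measurable_EFinP; apply: measurable_gauss; apply: measurable_planeB => //; exact: measurable_cst.
rewrite /nu (fubini_tonelli1 _ mg g0).
rewrite -ge0_integralZl//; last 3 first.
- exact: emeasurable_funM.
- by move=> q _; rewrite mule_ge0 ?lee_fin ?expR_ge0.
- by rewrite lee_fin gauss_cst_ge0.
apply: ge0_le_integral => //.
- by move=> q _; apply: integral_ge0.
- exact: measurable_fun_fubini_tonelli_F.
- by apply: emeasurable_funM; [exact: measurable_cst|exact: emeasurable_funM].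
move=> q _; rewrite /fubini_F.
have mhq : measurable_fun setT (fun p => h (q, p)) by exact: (measurableT_comp mh (pair1_measurable q)).
have := periodic_gauss_le c.2 e0 mhq (fun p => h0 _) (fun p l => hper q p l).
move=> H; rewrite muleCA; apply: le_trans (lee_wpmul2l _ H); last by rewrite lee_fin expR_ge0.
rewrite -ge0_integralZl//.
- apply: ge0_le_integral => //.
  + exact: (measurableT_comp mg (pair1_measurable q)).
  + apply: emeasurable_funM; first exact: measurable_cst.
    apply/measurable_EFinP; apply: measurable_funM => //.
    by apply: measurable_gauss; apply: measurable_planeB => //; exact: measurable_cst.
  + move=> p _; rewrite -EFinM lee_fin ygaussE/= -mulrA [X in _ <= _ * X]mulrC; exact: lexx.
- apply/measurable_EFinP; apply: measurable_funM => //.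
  by apply: measurable_gauss; apply: measurable_planeB => //; exact: measurable_cst.
- by move=> p _; rewrite lee_fin mulr_ge0 ?expR_ge0.
Qed.

(** [ygauss_le] reduces the inner integral to a Gaussian convolution in the imaginary parts alone.
    The cube in the outer [p] then has total mass 1, and integrating the remaining Gaussian over the
    outer [q] gives [(pi / e) ^+ n]. *)
Lemma schur_le (e : R) (h : Y -> R) : 0 < e -> measurable_fun setT h ->
  (forall z, 0 <= h z) -> yper h ->
  (\int[nu]_z ((icube z.2)%:E * \int[nu]_w (ygauss e (z - w) * h w)%:E) <=
   (gauss_cst e * (pi / e) ^+ n)%:E * \int[nu]_z (icube z.2 * h z)%:E)%E.
Proof.
move=> e0 mh h0 hper.
have mi : measurable_fun setT (fun z : Y => (icube z.2 * h z)%:E).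
  by apply/measurable_EFinP; apply: measurable_funM => //; apply: measurable_icube; exact: measurable_snd.
have i0 z : (0 <= (icube z.2 * h z)%:E)%E by rewrite lee_fin mulr_ge0 ?icube_ge0.
pose m q := (\int[mu]_p (icube p * h (q, p))%:E)%E.
have mm : measurable_fun setT m := measurable_fun_fubini_tonelli_F (m2 := mu) _ mi i0.
have m0 q : (0 <= m q)%E by apply: integral_ge0 => p _; exact: (i0 (q, p)).
pose G (w : Y) : \bar R := ((expR (- (e * sqn (w.2 - w.1))))%:E * m w.2)%E.
have mG : measurable_fun setT G.
  apply: emeasurable_funM; last exact: (measurableT_comp mm measurable_snd).
  by apply/measurable_EFinP; apply: measurable_gauss; apply: measurable_planeB.
have G0 w : (0 <= G w)%E by rewrite mule_ge0 ?lee_fin ?expR_ge0.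
have mL := measurable_fun_fubini_tonelli_F (m2 := mu) _ mG G0.
pose L q1 := (\int[mu]_q G (q1, q))%E.
have L0 q1 : (0 <= L q1)%E by apply: integral_ge0.
have mic : measurable_fun setT (fun z : Y => (icube z.2)%:E).
  by apply/measurable_EFinP; apply: measurable_icube; exact: measurable_snd.
have mH : measurable_fun setT (fun z : Y => ((icube z.2)%:E * ((gauss_cst e)%:E * L z.1))%E).
  apply: emeasurable_funM => //; apply: emeasurable_funM; first exact: measurable_cst.
  exact: (measurableT_comp mL measurable_fst).
have H0 z : (0 <= (icube z.2)%:E * ((gauss_cst e)%:E * L z.1))%E.
  by rewrite !mule_ge0 ?lee_fin ?icube_ge0 ?gauss_cst_ge0.
have mF : measurable_fun setT (fun w : YY => (ygauss e (w.1 - w.2) * h w.2)%:E).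
  apply/measurable_EFinP; apply: measurable_funM; last exact: (measurableT_comp mh measurable_snd).
  apply: measurable_ygauss; apply/measurable_fun_pairP; split; apply: measurable_planeB.
  - exact: (measurableT_comp measurable_fst measurable_fst).
  - exact: (measurableT_comp measurable_fst measurable_snd).
  - exact: (measurableT_comp measurable_snd measurable_fst).
  - exact: (measurableT_comp measurable_snd measurable_snd).
have F0 (w : YY) : (0 <= (ygauss e (w.1 - w.2) * h w.2)%:E)%E.
  by rewrite lee_fin mulr_ge0 ?expR_ge0.
have mFF := measurable_fun_fubini_tonelli_F (m2 := nu) _ mF F0.
apply: (@le_trans _ _ (\int[nu]_z ((icube z.2)%:E * ((gauss_cst e)%:E * L z.1)))%E).
  apply: ge0_le_integral => //.
  - by move=> z _; rewrite mule_ge0 ?lee_fin ?icube_ge0//; apply: integral_ge0 => w _; exact: (F0 (z, w)).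
  - exact: emeasurable_funM.
  move=> z _; apply: lee_wpmul2l; first by rewrite lee_fin icube_ge0.
  apply: le_trans (ygauss_le z e0 mh h0 hper); apply: eq_lee.
  by apply: eq_integral => w _; rewrite -opprB /ygauss !sqnN.
rewrite /nu (fubini_tonelli1 _ mH H0) /fubini_F/=.
have mgL : measurable_fun setT (fun q => (gauss_cst e)%:E * L q)%E.
  by apply: emeasurable_funM; [exact: measurable_cst|exact: mL].
have gL0 q : (0 <= (gauss_cst e)%:E * L q)%E by rewrite mule_ge0 ?lee_fin ?gauss_cst_ge0.
have micp : measurable_fun setT (fun p : X => (icube p)%:E).
  by apply/measurable_EFinP; exact: measurable_icube.
apply: (@le_trans _ _ (\int[mu]_q1 ((gauss_cst e)%:E * L q1))%E).
  apply: eq_lee; apply: eq_integral => q1 _.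
  rewrite (ge0_integralZr _ measurableT micp) ?integral_icube ?mul1e//.
  by move=> p _; rewrite lee_fin icube_ge0.
rewrite (ge0_integralZl _ measurableT mL) ?lee_fin ?gauss_cst_ge0//.
rewrite (fubini_tonelli1 _ mi i0) [(gauss_cst e * _)%:E]EFinM -muleA; apply: lee_wpmul2l.
  by rewrite lee_fin gauss_cst_ge0.
rewrite /L (fubini_tonelli G mG G0) -(ge0_integralZl _ measurableT mm)//; last first.
  by rewrite lee_fin exprn_ge0// divr_ge0 ?pi_ge0// ltW.
apply: eq_lee; apply: eq_integral => q _; rewrite /G/=.
have mg1 : measurable_fun setT (fun q1 : X => (expR (- (e * sqn (q - q1))))%:E).
  by apply/measurable_EFinP; apply: measurable_gauss; apply: measurable_planeB.
rewrite (ge0_integralZr _ measurableT mg1)//.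
congr (_ * _)%E; rewrite -(integral_gauss_plane n e0).
have mg2 : measurable_fun setT (fun q1 : X => (expR (- (e * sqn q1)))%:E).
  by apply/measurable_EFinP; exact: measurable_gauss.
have g20 (q1 : X) : (0 <= (expR (- (e * sqn q1)))%:E)%E by rewrite lee_fin expR_ge0.
rewrite -(ge0_integral_plane_shift (- q) mg2 g20).
by apply: eq_integral => p _; rewrite -opprB sqnN.
Qed.

End phase_space.

(** * Heat kernel, weight and reproducing kernel *)
(** For [x = lam * t] the intended values are [gam = lam * coth x / 4], [del = lam * tanh x / 4] and
    [amp = lam / (4 * pi * sinh x)]. Then [lam_sqr] says that [coth * tanh = 1], and [amp_sqr] uses
    [coth x - tanh x = 1 / (sinh x * cosh x)]. The analysis below needs nothing else about
    hyperbolic functions. *)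
Record kparams (R : realType) := KParams {
  gam : R; del : R; lam : R; amp : R;
  del_gt0 : 0 < del;
  del_lt_gam : del < gam;
  lam_sqr : lam ^+ 2 = 16 * (gam * del);
  amp_ge0 : 0 <= amp;
  amp_sqr : amp ^+ 2 * pi ^+ 2 = gam * (gam - del) }.

Section kernels.
Context {R : realType} {n : nat} (c : kparams R).
Local Notation X := (plane R n).
Local Notation Y := (X * X)%type.
Local Notation mu := (mu_plane R n).
Local Notation nu := (nu R n).
Local Notation gam := (gam c).
Local Notation del := (del c).
Local Notation lam := (lam c).
Local Notation amp := (amp c).
Implicit Types (p q x : X).

Lemma gam_gt0 : 0 < gam. Proof. exact: lt_trans (del_gt0 c) (del_lt_gam c). Qed.

(** The exponent is [- gam * dB (z - x) (z - x) - 'i * lam / 2 * dOm z x] at the complex point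
    [z = p + i q], separated into real and imaginary part; at [q = 0] it is the kernel of the
    twisted convolution. *)
Definition kap p q x : R[i] := (amp ^+ n)%:C%C *
  cexp ((lam / 2 * dOm q x - gam * (sqn (p - x) - sqn q)) +i*
        (- (2 * gam * dB (p - x) q) - lam / 2 * dOm p x))%C.

(** The amplitude of the heat kernel at doubled time, by [sinh (2 * x) = 2 * sinh x * cosh x]. *)
Definition amp2 : R := (gam - del) / (2 * pi).

Definition W0 : R := 4 ^+ n * amp2 ^+ n.

Definition wt p q : R := W0 * expR (lam * dOm p q - 2 * (gam + del) * sqn q).

Definition sw p q : R := Num.sqrt W0 * expR (lam / 2 * dOm p q - (gam + del) * sqn q).

(** The twisted heat kernel at doubled time, taken between [p1 + i q1] and the conjugate of
    [p + i q]. Here [(gam + del) / 2] replaces [gam], because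
    [coth x + tanh x = 2 * coth (2 * x)]. *)
Definition ker p1 q1 p q : R[i] := (amp2 ^+ n)%:C%C *
  cexp ((lam / 2 * (dOm q1 p - dOm p1 q) - (gam + del) / 2 * (sqn (p1 - p) - sqn (q1 + q))) +i*
        (- ((gam + del) * dB (p1 - p) (q1 + q)) - lam / 2 * (dOm p1 p + dOm q1 q)))%C.

(** The multiplier [exp (- 'i * lam / 2 * dOm (p + i q) l)]; it has modulus 1 at real points only
    because [q = 0] there. *)
Definition chi p q (l : X) : R[i] := cexp ((lam / 2 * dOm q l) +i* (- (lam / 2 * dOm p l)))%C.

Lemma amp2_gt0 : 0 < amp2.
Proof. by rewrite divr_gt0 ?mulr_gt0 ?pi_gt0// subr_gt0 del_lt_gam. Qed.

Lemma W0_gt0 : 0 < W0.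
Proof. by rewrite mulr_gt0// exprn_gt0// amp2_gt0. Qed.

Lemma sw_gt0 p q : 0 < sw p q.
Proof. by rewrite mulr_gt0 ?expR_gt0// sqrtr_gt0 W0_gt0. Qed.

Lemma wt_gt0 p q : 0 < wt p q.
Proof. by rewrite mulr_gt0 ?expR_gt0// W0_gt0. Qed.

Lemma sw_sqr p q : sw p q ^+ 2 = wt p q.
Proof.
rewrite /sw /wt exprMn sqr_sqrtr ?(ltW W0_gt0)// expr2 -expRD; congr (_ * expR _).
by field.
Qed.

Lemma normc_kap_sw p q x : normc (kap p q x) * sw p q =
  amp ^+ n * Num.sqrt W0 *
  expR (lam / 2 * dOm (p - x) q - gam * sqn (p - x) - del * sqn q).
Proof.
rewrite /kap Normc.normcM normc_real normc_cexp/= ger0_norm ?exprn_ge0 ?amp_ge0//.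
rewrite /sw mulrACA -expRD; congr (_ * expR _).
by rewrite !dOmE (dOmC q x); field.
Qed.

Lemma dB_am_gm (s e : R) p q : 0 < e -> s * dB p q <= e * sqn p + s ^+ 2 / (4 * e) * sqn q.
Proof.
move=> e0; have := sqn_ge0 (p - (s / (2 * e)) *: q).
rewrite !sqnE !dBE (dBC q p) -(pmulr_rge0 _ e0) => h.
have e1 : e != 0 by rewrite gt_eqF.
rewrite -subr_ge0; apply: le_trans h _; apply: eq_ler; by field.
Qed.

Lemma dOm_am_gm (s e : R) p q : 0 < e -> s * dOm p q <= e * sqn p + s ^+ 2 / (4 * e) * sqn q.
Proof. by move=> e0; have := dB_am_gm s p (rJ q) e0; rewrite dB_rJ (sqnE (rJ q)) dB_rJ2. Qed.

(** Half of the Gaussian in [x - p] is spent on the symplectic term, which costs [2 * del * sqn q].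
    Only one [del * sqn q] is available in return, so the bound grows in [q]; this growth is what
    truncation in [q] has to control. *)
Lemma normc_kap_sw_le p q x : normc (kap p q x) * sw p q <=
  amp ^+ n * Num.sqrt W0 * (expR (del * sqn q) * expR (- (gam / 2 * sqn (x - p)))).
Proof.
rewrite normc_kap_sw ler_wpM2l ?mulr_ge0 ?exprn_ge0 ?amp_ge0 ?sqrtr_ge0//.
rewrite -expRD ler_expR -(opprB p x) sqnN.
have g0 : 0 < gam / 2 by rewrite divr_gt0 ?gam_gt0.
have gN : gam != 0 by rewrite gt_eqF ?gam_gt0.
have := dOm_am_gm (lam / 2) (p - x) q g0.
rewrite (_ : (lam / 2) ^+ 2 / (4 * (gam / 2)) = 2 * del); first by lra.
by rewrite exprMn lam_sqr; field.
Qed.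

(** A lower bound, free of square roots, for the gap [(gam + del) / 2 - |lam| / 4] between the
    arithmetic and the geometric mean of [gam] and [del]. *)
Definition keps : R := (gam - del) ^+ 2 / (4 * (gam + del)).

Lemma keps_gt0 : 0 < keps.
Proof.
rewrite divr_gt0 ?exprn_gt0 ?subr_gt0 ?del_lt_gam// mulr_gt0// addr_gt0 ?gam_gt0 ?del_gt0//.
Qed.

(** With [e] the coefficient on the right, [dOm_am_gm] leaves [lam ^+ 2 <= 16 * e ^+ 2]. After
    multiplication by the square of [4 * (gam + del)], the difference is the even power
    [4 * (gam - del) ^+ 4]. *)
Lemma dOm_keps p q : lam / 2 * dOm p q <= ((gam + del) / 2 - keps) * (sqn p + sqn q).
Proof.
have g0 := gam_gt0; have d0 := del_gt0 c; have gd := del_lt_gam c.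
have s0 : 0 < gam + del by rewrite addr_gt0.
have eE : keps * (4 * (gam + del)) = (gam - del) ^+ 2 by rewrite /keps divfK// gt_eqF// mulr_gt0.
set e := (gam + del) / 2 - keps.
have e0 : 0 < e.
  have : 0 < e * (4 * (gam + del)) by rewrite /e mulrBl eE; nra.
  by rewrite pmulr_lgt0// mulr_gt0.
apply: le_trans (dOm_am_gm (lam / 2) p q e0) _.
rewrite (_ : e * (sqn p + sqn q) = e * sqn p + e * sqn q); last by ring.
rewrite lerD2l ler_wpM2r ?sqn_ge0//.
rewrite ler_pdivrMr ?mulr_gt0// exprMn lam_sqr.
have eE2 : e * (4 * (gam + del)) = (gam + del) ^+ 2 * 2 - (gam - del) ^+ 2 by rewrite /e mulrBl eE; field.
rewrite -(ler_pM2r (_ : 0 < (4 * (gam + del)) ^+ 2)); last by rewrite exprn_gt0// mulr_gt0.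
rewrite (_ : e * (4 * e) * _ = 4 * (e * (4 * (gam + del))) ^+ 2); last by ring.
rewrite eE2; rewrite -subr_ge0.
rewrite (_ : _ - _ = 4 * (gam - del) ^+ 4); first by rewrite mulr_ge0// exprn_even_ge0.
by field.
Qed.

Lemma normc_ker_sw p1 q1 p q : normc (ker p1 q1 p q) * sw p1 q1 * sw p q =
  amp2 ^+ n * W0 * expR (lam / 2 * dOm (p1 - p) (q1 - q) -
     (gam + del) / 2 * (sqn (p1 - p) + sqn (q1 - q))).
Proof.
rewrite /ker Normc.normcM normc_real normc_cexp/= ger0_norm ?exprn_ge0 ?(ltW amp2_gt0)//.
rewrite /sw; rewrite -[in RHS](sqr_sqrtr (ltW W0_gt0)).
set S := Num.sqrt W0; rewrite !sqnE !(dBE, dOmE) (dBC p p1) (dBC q q1) (dOmC q1 p).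
transitivity (amp2 ^+ n * S ^+ 2 * (expR (lam / 2 * (- dOm p q1 - dOm p1 q) -
    (gam + del) / 2 *
    (dB p1 p1 - dB p1 p + (- dB p1 p - - dB p p) - (dB q1 q1 + dB q1 q + (dB q1 q + dB q q)))) *
  expR (lam / 2 * dOm p1 q1 - (gam + del) * dB q1 q1) *
  expR (lam / 2 * dOm p q - (gam + del) * dB q q))); first by ring.
by rewrite -!expRD; congr (_ * expR _); field.
Qed.

Lemma normc_ker_sw_le p1 q1 p q : normc (ker p1 q1 p q) * sw p1 q1 * sw p q <=
  amp2 ^+ n * W0 * ygauss keps ((q1, p1) - (q, p)).
Proof.
rewrite normc_ker_sw ler_wpM2l ?mulr_ge0 ?exprn_ge0 ?(ltW amp2_gt0) ?(ltW W0_gt0)//.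
by rewrite ler_expR/=; have := dOm_keps (p1 - p) (q1 - q); lra.
Qed.

(** The Gaussian depends on [p - x] only, so a diagonal translation touches just the symplectic
    terms, and [dOm l l = 0]. *)
Lemma kap_shift p q x (l : X) : kap (p + l) q (x + l) =
  kap p q x * cexp ((lam / 2 * dOm q l) +i* (- (lam / 2 * (dOm p l - dOm x l))))%C.
Proof.
rewrite /kap -[RHS]mulrA -cexpD (_ : p + l - (x + l) = p - x); last by rewrite opprD addrACA subrr addr0.
congr (_ * cexp _); apply: complexP => /=; rewrite !dOmE.
  by ring.
by rewrite (dOmC l x) (_ : dOm l l = 0); [ring|rewrite /dOm dotv_sym subrr].
Qed.

Lemma wt_shift p q (l : X) : normc (chi p q l) ^+ 2 * wt (p + l) q = wt p q.
Proof.
rewrite /chi normc_cexp/= /wt mulrCA expr2 -!expRD !dOmE (dOmC l q).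
by congr (_ * expR _); field.
Qed.

Lemma sw_shift p q (l : X) : normc (chi p q l) * sw (p + l) q = sw p q.
Proof.
rewrite /chi normc_cexp/= /sw mulrCA -!expRD !dOmE (dOmC l q).
by congr (_ * expR _); field.
Qed.

Lemma rJD p q : rJ (p + q) = rJ p + rJ q.
Proof. by rewrite /rJ/= opprD. Qed.

Lemma rJN p : rJ (- p) = - rJ p :> X.
Proof. by []. Qed.

Lemma dOmxx p : dOm p p = 0.
Proof. by rewrite /dOm dotv_sym subrr. Qed.

(** The semigroup law in analytically continued form. The product is a Gaussian of rate [2 * gam] in
    [x] with real and imaginary linear terms [b] and [e], so [cintegral_gauss] evaluates it;
    [lam_sqr] and [amp_sqr] bring the result to the parameters of doubled time. *)
Lemma cintegral_kap_kap p1 q1 p q :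
  cintegral mu (fun x => kap p1 q1 x * (kap p q x)^*%C) = ker p1 q1 p q.
Proof.
have g0 := gam_gt0; have gN : gam != 0 by rewrite gt_eqF.
have pN : pi != 0 :> R by rewrite gt_eqF ?pi_gt0.
pose b := (2 * gam) *: (p1 + p) - (lam / 2) *: rJ (q1 + q).
pose e := (2 * gam) *: (q1 - q) + (lam / 2) *: rJ (p1 - p).
pose k0 : R[i] := ((amp ^+ n) ^+ 2)%:C%C * cexp ((- (gam * (sqn p1 + sqn p - sqn q1 - sqn q))) +i*
   (- (2 * gam * (dB p1 q1 - dB p q))))%C.
transitivity (cintegral mu (fun x => k0 * cexp ((dB b x - (2 * gam) * sqn x) +i* dB e x)%C)).
  apply: eq_cintegral => x; rewrite /kap conjcM cexp_conj.
  rewrite (_ : (amp ^+ n)%:C^*%C = (amp ^+ n)%:C%C); last by apply: complexP => //=; rewrite oppr0.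
  rewrite mulrACA -rmorphM/= -cexpD /k0 -[RHS]mulrA -cexpD -expr2; congr (_ * cexp _).
  apply: complexP => /=; rewrite /b /e ?sqnE !(dBE, dOmE, rJD, rJN) !(dBC (rJ _)) !dB_rJ.
    by rewrite !(dOmC x) (dBC x p) (dBC x p1); field.
  by rewrite !(dOmC x) (dBC x q) (dBC x q1); field.
have g20 : 0 < 2 * gam by rewrite mulr_gt0.
rewrite cintegralZl; last exact: cintegrable_gauss.
rewrite cintegral_gauss// /k0 mulrACA -rmorphM/= -cexpD /ker; congr (_%:C%C * cexp _).
  rewrite -exprM mulnC exprM -exprMn; congr (_ ^+ n).
  have aE : amp ^+ 2 = gam * (gam - del) / pi ^+ 2 by rewrite -amp_sqr mulfK ?expf_neq0.
  by rewrite aE /amp2; move: pi pN => P PN; field; rewrite gN PN.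
have dE : del = lam ^+ 2 / (16 * gam) by rewrite lam_sqr; field.
apply: complexP => /=; rewrite /b /e ?sqnE ?(dBE, dOmE, rJD, rJN) ?dB_rJ2 ?(dBC (rJ _)) ?dB_rJ dE.
  rewrite ?(dBC p p1) ?(dBC q q1) (dOmC q p) (dOmC q p1) (dOmC q1 p) (dOmC q1 p1).
  by field.
rewrite ?(dBC q p) ?(dBC q1 p) ?(dBC q p1) ?(dBC q1 p1) ?(dOmC q q1) ?(dOmC p p1) !dOmxx.
by field.
Qed.

End kernels.

(** * The transform and its adjoint *)
Section transforms.
Context {R : realType} {n : nat} (c : kparams R).
Local Notation X := (plane R n).
Local Notation Y := (X * X)%type.
Local Notation mu := (mu_plane R n).
Local Notation nu := (nu R n).
Local Notation lp := (lpt R).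
Local Notation kap := (kap c).
Local Notation wt := (wt c).
Local Notation sw := (sw c).
Local Notation ker := (ker c).
Local Notation chi := (chi c).
Implicit Types (p q x : X) (z w : Y) (l : lattice n) (f : X -> R[i]) (g : Y -> R[i]).

(** The inequality [u <= 1 + u ^+ 2] turns the estimate [ygauss_le] for integrals into one that
    needs only a square-integrable [u]; the 1 contributes the Gaussian integral over [q]. *)
Lemma ygauss_sqr_le (e : R) (u : Y -> R) (z0 : Y) : 0 < e -> measurable_fun setT u ->
  (forall z, 0 <= u z) -> yper u ->
  (\int[nu]_z (ygauss e (z - z0) * u z)%:E <=
   (gauss_cst n e)%:E * (((pi / e) ^+ n)%:E + \int[nu]_z (icube z.2 * u z ^+ 2)%:E))%E.
Proof.
move=> e0 mu0 u0 uper; pose h z := 1 + u z ^+ 2.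
have mh : measurable_fun setT h by apply: measurable_funD => //; exact: measurable_funX.
have h0 z : 0 <= h z by rewrite addr_ge0 ?sqr_ge0.
have hper : yper h by move=> q p l; rewrite /h uper.
have mY : measurable_fun setT (fun z => ygauss e (z - z0)).
  by apply: measurable_ygauss; apply/measurable_fun_pairP; split; apply: measurable_planeB => //; exact: measurable_cst.
apply: (@le_trans _ _ (\int[nu]_z (ygauss e (z - z0) * h z)%:E)%E).
  apply: ge0_le_integral => //.
  - by move=> z _; rewrite lee_fin mulr_ge0 ?expR_ge0.
  - by apply/measurable_EFinP; exact: measurable_funM.
  - by apply/measurable_EFinP; exact: measurable_funM.
  - move=> z _; rewrite lee_fin ler_wpM2l ?expR_ge0//.
    by have := u0 z; rewrite /h; nra.
apply: le_trans (ygauss_le z0 e0 mh h0 hper) _; apply: lee_wpmul2l.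
  by rewrite lee_fin gauss_cst_ge0.
have mu2 : measurable_fun setT (fun z : Y => (icube z.2 * u z ^+ 2)%:E).
  apply/measurable_EFinP; apply: measurable_funM; first by apply: measurable_icube; exact: measurable_snd.
  exact: measurable_funX.
have u20 z : (0 <= (icube z.2 * u z ^+ 2)%:E)%E by rewrite lee_fin mulr_ge0 ?icube_ge0 ?sqr_ge0.
have mm := measurable_fun_fubini_tonelli_F (m2 := mu) _ mu2 u20.
have m0 q : (0 <= \int[mu]_p (icube p * u (q, p) ^+ 2)%:E)%E by apply: integral_ge0 => p _; exact: (u20 (q, p)).
have mg : measurable_fun setT (fun q : X => (expR (- (e * sqn (q - z0.1))))%:E).
  by apply/measurable_EFinP; apply: measurable_gauss; apply: measurable_planeB => //; exact: measurable_cst.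
have g0 q : (0 <= (expR (- (e * sqn (q - z0.1))))%:E)%E by rewrite lee_fin expR_ge0.
rewrite /nu (fubini_tonelli1 _ mu2 u20).
have <- : (\int[mu]_q (expR (- (e * sqn (q - z0.1))))%:E = ((pi / e) ^+ n)%:E)%E.
  have mg' : measurable_fun setT (fun q : X => (expR (- (e * sqn q)))%:E).
    by apply/measurable_EFinP; exact: measurable_gauss.
  rewrite -(integral_gauss_plane n e0).
  by apply: (ge0_integral_plane_shift (- z0.1) mg') => q; rewrite lee_fin expR_ge0.
rewrite -(ge0_integralD mu measurableT (fun q _ => g0 q) mg (fun q _ => m0 q) mm).
apply: ge0_le_integral => //.
- by move=> q _; rewrite mule_ge0 ?g0//; apply: integral_ge0 => p _; rewrite lee_fin mulr_ge0 ?icube_ge0.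
- apply: emeasurable_funM => //.
  apply: (measurable_fun_fubini_tonelli_F (m2 := mu) (fun z : Y => (icube z.2 * h z)%:E)).
    apply/measurable_EFinP; apply: measurable_funM => //; apply: measurable_icube; exact: measurable_snd.
  by move=> z; rewrite lee_fin mulr_ge0 ?icube_ge0.
- exact: emeasurable_funD.
move=> q _.
have -> : (\int[mu]_p (icube p * h (q, p))%:E = 1 + \int[mu]_p (icube p * u (q, p) ^+ 2)%:E)%E.
  rewrite -(integral_icube R n) -ge0_integralD//.
  - by apply: eq_integral => p _; rewrite /h mulrDr mulr1 EFinD.
  - by move=> p _; rewrite lee_fin icube_ge0.
  - by apply/measurable_EFinP; exact: measurable_icube.
  - by move=> p _; exact: (u20 (q, p)).
  - exact: (measurableT_comp mu2 (pair1_measurable q)).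
rewrite ge0_muleDr ?m0 ?lee01//.
rewrite mule1 leeD2l// -[leRHS]mul1e lee_wpmul2r//.
by rewrite lee_fin -expR0 ler_expR oppr_le0 mulr_ge0 ?sqn_ge0// ltW.
Qed.

Definition qper f := forall x l, f (x + lp l) = chi x 0 (lp l) * f x.

Definition qperY g := forall q p l, g (q, p + lp l) = chi p q (lp l) * g (q, p).

Definition Tr f z : R[i] := cintegral mu (fun x => f x * kap z.2 z.1 x).

Definition Ts g x : R[i] :=
  cintegral nu (fun z => g z * (kap z.2 z.1 x)^*%C * (wt z.2 z.1)%:C%C).

(** Modulus times the square root of the weight: this product is lattice periodic although neither
    factor is, and [ynorm2] is its L^2 norm over a fundamental domain. *)
Definition unorm g z : R := normc (g z) * sw z.2 z.1.

Definition norm1 f : \bar R := (\int[mu]_x (icube x * normc (f x))%:E)%E.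
Definition norm2 f : \bar R := (\int[mu]_x (icube x * normc (f x) ^+ 2)%:E)%E.
Definition ynorm2 g : \bar R := (\int[nu]_z (icube z.2 * unorm g z ^+ 2)%:E)%E.

Lemma normc_qper f x l : qper f -> normc (f (x + lp l)) = normc (f x).
Proof. by move=> fq; rewrite fq Normc.normcM normc_cexp/= dOm0l mulr0 expR0 mul1r. Qed.

Lemma yper_unorm g : qperY g -> yper (unorm g).
Proof. by move=> gq q p l; rewrite /unorm/= gq Normc.normcM mulrAC sw_shift mulrC. Qed.

Lemma measurable_sw d (T : measurableType d) (a b : T -> X) :
  measurable_fun setT a -> measurable_fun setT b -> measurable_fun setT (fun t => sw (a t) (b t)).
Proof.
move=> ma mb; apply: measurable_funM => //; apply: measurable_expR_fun; apply: measurable_funB;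
  apply: measurable_funM => //; [exact: measurable_dOm|exact: measurable_sqn].
Qed.

Lemma measurable_wt d (T : measurableType d) (a b : T -> X) :
  measurable_fun setT a -> measurable_fun setT b -> measurable_fun setT (fun t => wt (a t) (b t)).
Proof.
move=> ma mb; under eq_fun do rewrite -sw_sqr.
by apply: measurable_funX; exact: measurable_sw.
Qed.

Lemma cmeasurable_kap d (T : measurableType d) (a b e : T -> X) :
  measurable_fun setT a -> measurable_fun setT b -> measurable_fun setT e ->
  cmeasurable (fun t => kap (a t) (b t) (e t)).
Proof.
move=> ma mb me; apply: cmeasurableM; first exact: cmeasurable_cst.
apply: cmeasurable_cexp; split => /=; apply: measurable_funB.
- by apply: measurable_funM => //; exact: measurable_dOm.
- apply: measurable_funM => //; apply: measurable_funB; last exact: measurable_sqn.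
  by apply: measurable_sqn; exact: measurable_planeB.
- apply: measurableT_comp => //; apply: measurable_funM => //; apply: measurable_dB => //.
  exact: measurable_planeB.
- by apply: measurable_funM => //; exact: measurable_dOm.
Qed.

Lemma measurable_unorm g : cmeasurable g -> measurable_fun setT (unorm g).
Proof.
by move=> mg; apply: measurable_funM; [exact: measurable_normc|apply: measurable_sw].
Qed.

Lemma unorm_ge0 g z : 0 <= unorm g z.
Proof. by rewrite mulr_ge0 ?normc_ge0 ?(ltW (sw_gt0 _ _ _)). Qed.

Lemma norm1_le f : cmeasurable f -> (norm1 f <= 1 + norm2 f)%E.
Proof.
move=> mf; have mn := measurable_normc mf; rewrite -(integral_icube R n) -ge0_integralD//.
- apply: ge0_le_integral => //.
  + by move=> x _; rewrite lee_fin mulr_ge0 ?icube_ge0 ?normc_ge0.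
  + by apply/measurable_EFinP; apply: measurable_funM => //; exact: measurable_icube.
  + apply: emeasurable_funD; apply/measurable_EFinP; first exact: measurable_icube.
    by apply: measurable_funM; [exact: measurable_icube|exact: measurable_funX].
  + move=> x _; rewrite -EFinD lee_fin; have := icube_ge0 x; have := normc_ge0 (f x).
    by set a := icube x; set b := normc _ => b0 a0; have : b <= 1 + b ^+ 2 by [nra]; nra.
- by move=> x _; rewrite lee_fin icube_ge0.
- by apply/measurable_EFinP; exact: measurable_icube.
- by move=> x _; rewrite lee_fin mulr_ge0 ?icube_ge0 ?sqr_ge0.
- apply/measurable_EFinP; apply: measurable_funM; [exact: measurable_icube|exact: measurable_funX].
Qed.

Definition kcst : R := amp c ^+ n * Num.sqrt (W0 (n := n) c).

Lemma kcst_ge0 : 0 <= kcst.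
Proof. by rewrite mulr_ge0 ?sqrtr_ge0// exprn_ge0// amp_ge0. Qed.

Definition Tcst q : R := kcst * expR (del c * sqn q) * gauss_cst n (gam c / 2).

Lemma gam2_gt0 : 0 < gam c / 2.
Proof. by rewrite divr_gt0 ?gam_gt0. Qed.

Lemma Tcst_ge0 q : 0 <= Tcst q.
Proof.
by apply: mulr_ge0; [rewrite mulr_ge0 ?kcst_ge0 ?expR_ge0|apply: gauss_cst_ge0; exact: gam2_gt0].
Qed.

Lemma integral_kap_le f p q : cmeasurable f -> qper f ->
  (\int[mu]_x (normc (f x) * normc (kap p q x) * sw p q)%:E <= (Tcst q)%:E * norm1 f)%E.
Proof.
move=> mf fq; have mn := measurable_normc mf; have g2 := gam2_gt0.
have mG : measurable_fun setT (fun x : X => expR (- (gam c / 2 * sqn (x - p)))).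
  by apply: measurable_gauss; apply: measurable_planeB => //; exact: measurable_cst.
have k0 : (0 <= (kcst * expR (del c * sqn q))%:E)%E by rewrite lee_fin mulr_ge0 ?kcst_ge0 ?expR_ge0.
apply: (@le_trans _ _ (\int[mu]_x ((kcst * expR (del c * sqn q))%:E *
    (normc (f x) * expR (- (gam c / 2 * sqn (x - p))))%:E))%E).
  apply: ge0_le_integral => //.
  - by move=> x _; rewrite lee_fin !mulr_ge0 ?normc_ge0 ?(ltW (sw_gt0 _ _ _)).
  - apply/measurable_EFinP; apply: measurable_funM => //; apply: measurable_funM => //.
    by apply: measurable_normc; apply: cmeasurable_kap => //; exact: measurable_cst.
  - apply: emeasurable_funM; first exact: measurable_cst.
    by apply/measurable_EFinP; exact: measurable_funM.
  - move=> x _; rewrite -EFinM lee_fin -mulrA.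
    apply: le_trans (ler_wpM2l (normc_ge0 _) (normc_kap_sw_le c p q x)) _.
    by rewrite /kcst; apply: eq_ler; ring.
have mfG : measurable_fun setT (fun x : X => (normc (f x) * expR (- (gam c / 2 * sqn (x - p))))%:E).
  by apply/measurable_EFinP; exact: measurable_funM.
rewrite (ge0_integralZl _ measurableT mfG)//; last first.
  by move=> x _; rewrite lee_fin mulr_ge0 ?normc_ge0 ?expR_ge0.
rewrite /Tcst [(_ * gauss_cst _ _)%:E]EFinM -[leRHS]muleA; apply: lee_wpmul2l => //.
apply: periodic_gauss_le => //; first by move=> x; exact: normc_ge0.
by move=> x l; exact: normc_qper.
Qed.

Lemma cintegrable_kap f p q : cmeasurable f -> qper f -> (norm1 f < +oo)%E ->
  cintegrable mu (fun x => f x * kap p q x).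
Proof.
move=> mf fq foo.
have mfk : cmeasurable (fun x => f x * kap p q x).
  by apply: cmeasurableM => //; apply: cmeasurable_kap => //; exact: measurable_cst.
split => //.
have /(le_lt_trans (integral_kap_le p q mf fq)) : ((Tcst q)%:E * norm1 f < +oo)%E.
  by rewrite lte_mul_pinfty ?lee_fin ?Tcst_ge0.
have -> : (\int[mu]_x (normc (f x) * normc (kap p q x) * sw p q)%:E =
    \int[mu]_x ((normc (f x * kap p q x))%:E * (sw p q)%:E))%E.
  by apply: eq_integral => x _; rewrite (Normc.normcM (f x)) -EFinM.
have mN : measurable_fun setT (fun x => (normc (f x * kap p q x))%:E).
  by apply/measurable_EFinP; exact: measurable_normc.
rewrite (ge0_integralZr _ measurableT mN); last 2 first.
- by move=> x _; rewrite lee_fin normc_ge0.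
- by rewrite lee_fin ltW ?sw_gt0.
case: (\int[mu]_x _)%E => [r _| |_]; [exact: ltry| |by []].
by rewrite gt0_mulye ?lte_fin ?sw_gt0.
Qed.

End transforms.

Arguments kap : simpl never.
Arguments ker : simpl never.
Arguments chi : simpl never.
Arguments wt : simpl never.
Arguments sw : simpl never.
Arguments Normc.normc : simpl never.
Arguments conjc : simpl never.

(** * The adjoint on truncated functions and duality *)

Section adjoint.
Context {R : realType} {n : nat} (c : kparams R).
Local Notation X := (plane R n).
Local Notation Y := (X * X)%type.
Local Notation YX := (X * X * X)%type.
Local Notation XY := (X * (X * X))%type.
Local Notation mu := (mu_plane R n).
Local Notation nu := (nu R n).
Local Notation lp := (lpt R).
Local Notation kap := (kap c).
Local Notation wt := (wt c).
Local Notation sw := (sw c).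
Local Notation ker := (ker c).
Local Notation chi := (chi c).
Local Notation Tr := (Tr c).
Local Notation Ts := (Ts c).
Local Notation qper := (qper c).
Local Notation qperY := (qperY c).
Local Notation unorm := (unorm c).
Local Notation ynorm2 := (ynorm2 c).
Implicit Types (p q x : X) (z w : Y) (l : lattice n) (f : X -> R[i]) (g : Y -> R[i]).

Lemma cmeasurable_swap d1 d2 (T1 : measurableType d1) (T2 : measurableType d2) (h : T1 * T2 -> R[i]) :
  cmeasurable h -> cmeasurable (fun y : T2 * T1 => h (y.2, y.1)).
Proof.
move=> mh; apply: (cmeasurable_comp (f := h) (h := fun y : T2 * T1 => (y.2, y.1))) => //.
by apply/measurable_fun_pairP; split; [exact: measurable_snd|exact: measurable_fst].
Qed.

Lemma gkw_ge0 (g : Y -> R[i]) x z : 0 <= normc (g z) * normc (kap z.2 z.1 x) * wt z.2 z.1.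
Proof. by apply: mulr_ge0; [rewrite mulr_ge0 ?normc_ge0|exact/ltW/wt_gt0]. Qed.

Lemma chi_wt p q (l : X) : chi p q l * (chi p q l)^*%C * (wt (p + l) q)%:C%C = (wt p q)%:C%C.
Proof. by rewrite mulc_conj -(wt_shift c p q l) -(rmorphM (real_complex R)). Qed.

Definition kshift p q x (l : X) : R[i] :=
  cexp ((lam c / 2 * dOm q l) +i* (- (lam c / 2 * (dOm p l - dOm x l))))%C.

Lemma chi_kshift p q x (l : X) : chi x 0 l * kshift p q x l = chi p q l.
Proof.
rewrite /kshift /chi -cexpD; congr cexp.
by apply: complexP; rewrite ?(cReD, cImD)/= ?dOm0l; ring.
Qed.

Lemma chi_kshift_conj p q x (l : X) : (kshift p q x l)^*%C = chi x 0 l * (chi p q l)^*%C.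
Proof.
rewrite /kshift /chi !cexp_conj -cexpD; congr cexp.
by apply: complexP; rewrite ?(cReD, cImD)/= ?dOm0l; ring.
Qed.

Lemma normc_kap_le p q x : normc (kap p q x) <=
  kcst (n := n) c * expR (del c * sqn q) / sw p q * expR (- (gam c / 2 * sqn (x - p))).
Proof.
rewrite mulrAC ler_pdivlMr ?sw_gt0// -[leRHS]mulrA; exact: (normc_kap_sw_le c p q x).
Qed.

Let kbd p q := kcst (n := n) c * expR (del c * sqn q) / sw p q.

Let kbd_ge0 p q : 0 <= kbd p q.
Proof. by rewrite divr_ge0 ?(ltW (sw_gt0 _ _ _))// mulr_ge0 ?kcst_ge0 ?expR_ge0. Qed.

Let mgs (a : R) p : measurable_fun setT (fun x : X => expR (- (a * sqn (x - p)))).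
Proof. by apply: measurable_gauss; apply: measurable_planeB => //; exact: measurable_cst. Qed.

Let gsfin (K : R) p : 0 <= K ->
  (\int[mu]_x (K * expR (- (gam c / 2 * sqn (x - p))))%:E < +oo)%E.
Proof.
move=> K0; have mg : measurable_fun setT (fun x : X => (expR (- (gam c / 2 * sqn x)))%:E).
  by apply/measurable_EFinP; exact: measurable_gauss.
have mg1 : measurable_fun setT (fun x : X => (expR (- (gam c / 2 * sqn (x - p))))%:E).
  by apply/measurable_EFinP.
have g0 x : (0 <= (expR (- (gam c / 2 * sqn x)))%:E)%E by rewrite lee_fin expR_ge0.
under eq_integral do rewrite EFinM.
rewrite (ge0_integralZl _ measurableT mg1 (fun x _ => g0 _)) ?lee_fin//.
rewrite (ge0_integral_plane_shift (- p) mg g0) (integral_gauss_plane n (gam2_gt0 c)).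
by rewrite -EFinM ltry.
Qed.

Lemma cintegrable_kap1 p q : cintegrable mu (kap p q).
Proof.
apply: (@le_cintegrable _ _ _ _ _ (fun x => kbd p q * expR (- (gam c / 2 * sqn (x - p))))).
- by apply: cmeasurable_kap => //; exact: measurable_cst.
- exact: measurable_funM.
- by move=> x; exact: normc_kap_le.
- exact: gsfin.
Qed.

Lemma cintegrable_kap_kap p1 q1 p q : cintegrable mu (fun x => kap p1 q1 x * (kap p q x)^*%C).
Proof.
apply: (@le_cintegrable _ _ _ _ _ (fun x => kbd p1 q1 * kbd p q * expR (- (gam c / 2 * sqn (x - p1))))).
- apply: cmeasurableM; last apply: cmeasurable_conj; by apply: cmeasurable_kap => //; exact: measurable_cst.
- exact: measurable_funM.
- move=> x; rewrite (Normc.normcM (kap p1 q1 x)) normc_conj mulrAC ler_pM ?normc_ge0 ?normc_kap_le//.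
  apply: le_trans (normc_kap_le _ _ _) _; apply: ler_piMr; first exact: kbd_ge0.
  rewrite -[leRHS]expR0 ler_expR oppr_le0.
  by rewrite mulr_ge0 ?sqn_ge0// ltW ?gam2_gt0.
- by apply: gsfin; rewrite mulr_ge0.
Qed.

Lemma Tr_qperY f : cmeasurable f -> qper f -> (norm1 f < +oo)%E -> qperY (Tr f).
Proof.
move=> mf fq foo q p l; rewrite /Tr/=.
have mk : cmeasurable (fun x => f x * kap (p + lp l) q x).
  by apply: cmeasurableM => //; apply: cmeasurable_kap => //; exact: measurable_cst.
rewrite -(cintegral_plane_shift (lp l) mk) -cintegralZl; last exact: cintegrable_kap.
by apply: eq_cintegral => x; rewrite fq kap_shift -/(kshift p q x (lp l)) -(chi_kshift p q x); ring.
Qed.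

Lemma cmeasurable_Tr f : cmeasurable f -> cmeasurable (Tr f).
Proof.
move=> mf; apply: (cmeasurable_cintegral mu (f := fun y : YX => f y.2 * kap y.1.2 y.1.1 y.2)).
apply: cmeasurableM; first by apply: (cmeasurable_comp (f := f)) => //; exact: measurable_snd.
apply: cmeasurable_kap; [|exact: (measurableT_comp measurable_fst measurable_fst)|exact: measurable_snd].
exact: (measurableT_comp measurable_snd measurable_fst).
Qed.

(** Vanishing for large imaginary part tames the factor [expR (del * sqn q)] of
    [normc_kap_sw_le]. *)
Definition cutoff (j : R) g := forall z, j < sqn z.1 -> g z = 0.

Lemma Ts_bound g j : cmeasurable g -> qperY g -> (ynorm2 g < +oo)%E -> cutoff j g ->
  exists2 C : R, 0 <= C & forall x,
    (\int[nu]_z (normc (g z) * normc (kap z.2 z.1 x) * wt z.2 z.1)%:E <= C%:E)%E.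
Proof.
move=> mg gq goo gj; have g2 := gam2_gt0 c.
(* On the support, [del * sqn q <= (del + gam / 2) * j - gam / 2 * sqn q]: the Gaussian in [q]
   borrowed in this way completes the one in [x - p], so that [ygauss_sqr_le] applies with a bound
   uniform in [x]. *)
pose K := kcst (n := n) c * expR ((del c + gam c / 2) * j).
have K0 : 0 <= K by rewrite mulr_ge0 ?expR_ge0 ?kcst_ge0.
pose B := ((gauss_cst n (gam c / 2))%:E * (((pi / (gam c / 2)) ^+ n)%:E + ynorm2 g))%E.
have N0 : (0 <= ynorm2 g)%E.
  by apply: integral_ge0 => z _; rewrite lee_fin mulr_ge0 ?icube_ge0 ?sqr_ge0.
have B0 : (0 <= B)%E.
  rewrite mule_ge0 ?lee_fin ?gauss_cst_ge0// adde_ge0// lee_fin exprn_ge0//.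
  by rewrite divr_ge0 ?pi_ge0// ltW.
have Bfin : B \is a fin_num.
  by rewrite fin_numM// fin_numD/= ge0_fin_numE.
exists (K * fine B) => [|x]; first by rewrite mulr_ge0// fine_ge0.
have mu0 := measurable_unorm c mg; have u0 := unorm_ge0 c g.
have mY : measurable_fun setT (fun z => ygauss (gam c / 2) (z - (0, x))).
  by apply: measurable_ygauss; apply/measurable_fun_pairP; split; apply: measurable_planeB => //; exact: measurable_cst.
have myu : measurable_fun setT (fun z => (ygauss (gam c / 2) (z - (0, x)) * unorm g z)%:E).
  by apply/measurable_EFinP; exact: measurable_funM.
apply: (@le_trans _ _ (\int[nu]_z (K%:E * (ygauss (gam c / 2) (z - (0, x)) * unorm g z)%:E))%E).
  apply: ge0_le_integral => //.
  - by move=> z _; rewrite lee_fin; exact: gkw_ge0.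
  - apply/measurable_EFinP; apply: measurable_funM; last by apply: measurable_wt; [exact: measurable_snd|exact: measurable_fst].
    apply: measurable_funM; first exact: measurable_normc.
    by apply: measurable_normc; apply: cmeasurable_kap; [exact: measurable_snd|exact: measurable_fst|exact: measurable_cst].
  - by apply: emeasurable_funM; first exact: measurable_cst.
  move=> z _; rewrite -EFinM lee_fin -sw_sqr.
  have [zj|zj] := ltP j (sqn z.1); first by rewrite /unorm gj// normc0E !mul0r !mulr0.
  rewrite (_ : normc (g z) * _ * _ = unorm g z * (normc (kap z.2 z.1 x) * sw z.2 z.1)); last by rewrite /unorm; ring.
  apply: le_trans (ler_wpM2l (u0 z) (normc_kap_sw_le c z.2 z.1 x)) _.
  rewrite ygaussE/= subr0 -(sqnN (z.2 - x)) opprB.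
  rewrite (_ : K * _ = unorm g z * (K * expR (- (gam c / 2 * sqn z.1)) * expR (- (gam c / 2 * sqn (x - z.2))))); last by ring.
  rewrite ler_wpM2l// mulrA ler_wpM2r ?expR_ge0// /K -/(kcst c) -[leRHS]mulrA ler_wpM2l ?kcst_ge0//.
  rewrite -expRD ler_expR; have := del_gt0 c; nra.
rewrite (ge0_integralZl _ measurableT myu)//; last first.
  by move=> z _; rewrite lee_fin mulr_ge0 ?expR_ge0.
rewrite [(K * _)%:E]EFinM; apply: lee_wpmul2l; first by rewrite lee_fin.
rewrite fineK//; apply: ygauss_sqr_le => //; exact: yper_unorm.
Qed.

Section bounded.
Context (g : Y -> R[i]) (C : R).
Context (mg : cmeasurable g).
Context (C0 : 0 <= C).
Context (gC : forall x,
    (\int[nu]_z (normc (g z) * normc (kap z.2 z.1 x) * wt z.2 z.1)%:E <= C%:E)%E).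

Let F (y : YX) : R[i] := g y.1 * (kap y.1.2 y.1.1 y.2)^*%C * (wt y.1.2 y.1.1)%:C%C.

Let mkapYX : cmeasurable (fun y : YX => kap y.1.2 y.1.1 y.2).
Proof.
apply: cmeasurable_kap; [|exact: (measurableT_comp measurable_fst measurable_fst)|exact: measurable_snd].
exact: (measurableT_comp measurable_snd measurable_fst).
Qed.

Let mwtYX : cmeasurable (fun y : YX => (wt y.1.2 y.1.1)%:C%C).
Proof.
apply: cmeasurable_real; apply: measurable_wt; last exact: (measurableT_comp measurable_fst measurable_fst).
exact: (measurableT_comp measurable_snd measurable_fst).
Qed.

Let mgYX : cmeasurable (fun y : YX => g y.1).
Proof. by apply: (cmeasurable_comp (f := g)) => //; exact: measurable_fst. Qed.

Let mF : cmeasurable F.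
Proof. by apply: cmeasurableM => //; apply: cmeasurableM => //; exact: cmeasurable_conj. Qed.

Let normF z x : normc (F (z, x)) = normc (g z) * normc (kap z.2 z.1 x) * wt z.2 z.1.
Proof.
rewrite /F/= (Normc.normcM (g z * _)) (Normc.normcM (g z)) normc_conj normc_real ger0_norm//.
exact/ltW/wt_gt0.
Qed.

Lemma cintegrable_Ts x :
  cintegrable nu (fun z => g z * (kap z.2 z.1 x)^*%C * (wt z.2 z.1)%:C%C).
Proof.
split; first by apply: (cmeasurable_comp (f := F) (h := fun z => (z, x))) => //; exact: pair2_measurable.
apply: le_lt_trans (_ : _ <= C%:E)%E (ltry _); apply: le_trans (gC x).
by apply: eq_lee; apply: eq_integral => z _; rewrite -normF.
Qed.

Lemma cmeasurable_Ts : cmeasurable (Ts g).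
Proof.
exact: (cmeasurable_cintegral nu (f := fun y : XY => F (y.2, y.1)) (cmeasurable_swap mF)).
Qed.

Lemma normc_Ts_le x : normc (Ts g x) <= C.
Proof.
rewrite -lee_fin; apply: le_trans (normc_cintegral_le (cintegrable_Ts x)) _.
apply: le_trans (gC x).
by apply: eq_lee; apply: eq_integral => z _; rewrite -normF.
Qed.

Lemma Ts_qper : qperY g -> qper (Ts g).
Proof.
move=> gq x l; rewrite /Ts.
have mk : cmeasurable (fun z => g z * (kap z.2 z.1 (x + lp l))^*%C * (wt z.2 z.1)%:C%C).
  by case: (cintegrable_Ts (x + lp l)).
rewrite -(cintegral_nu_shift (0, lp l) mk) -cintegralZl; last exact: cintegrable_Ts.
apply: eq_cintegral => -[q p].
rewrite (_ : (q, p) + (0, lp l) = (q, p + lp l)); last by congr (_, _); rewrite addr0.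
rewrite /= gq kap_shift -/(kshift p q x (lp l)) conjcM chi_kshift_conj -(chi_wt p q (lp l)); ring.
Qed.

Lemma norm2_Ts_fin : (norm2 (Ts g) < +oo)%E.
Proof.
apply: (@le_lt_trans _ _ (\int[mu]_x ((icube x)%:E * (C ^+ 2)%:E))%E).
  apply: ge0_le_integral => //.
  - by move=> x _; rewrite lee_fin mulr_ge0 ?icube_ge0 ?sqr_ge0.
  - apply/measurable_EFinP; apply: measurable_funM; first exact: measurable_icube.
    by apply: measurable_funX; apply: measurable_normc; exact: cmeasurable_Ts.
  - apply: emeasurable_funM; last exact: measurable_cst.
    by apply/measurable_EFinP; exact: measurable_icube.
  - move=> x _; rewrite -EFinM lee_fin ler_wpM2l ?icube_ge0// lerXn2r ?nnegrE ?normc_ge0//.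
    exact: normc_Ts_le.
have mi : measurable_fun setT (fun x : X => (icube x)%:E) by apply/measurable_EFinP; exact: measurable_icube.
rewrite (ge0_integralZr _ measurableT mi); last 2 first.
- by move=> x _; rewrite lee_fin icube_ge0.
- by rewrite lee_fin sqr_ge0.
by rewrite integral_icube mul1e ltry.
Qed.

Section duality.
Context (f : X -> R[i]).
Context (mf : cmeasurable f).
Context (fq : qper f).
Context (foo : (norm1 f < +oo)%E).
Context (gq : qperY g).

Let Th (y : YX) : R[i] := f y.2 * kap y.1.2 y.1.1 y.2 * (g y.1)^*%C * (wt y.1.2 y.1.1)%:C%C.

Let mTh : cmeasurable Th.
Proof.
apply: cmeasurableM => //; apply: cmeasurableM; last exact: cmeasurable_conj.
by apply: cmeasurableM => //; apply: (cmeasurable_comp (f := f)) => //; exact: measurable_snd.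
Qed.

(** By [chi_kshift] the multipliers of [f] and [kap] combine to [chi p q l]; with the conjugate from
    [g] this gives the squared modulus that [wt] absorbs. *)
Let Th_inv q p x l : Th ((q, p + lp l), x + lp l) = Th ((q, p), x).
Proof.
rewrite /Th/= fq kap_shift gq -/(kshift p q x (lp l)) conjcM -(chi_wt p q (lp l)).
by rewrite -{2}(chi_kshift p q x); ring.
Qed.

Let normTh z x : normc (Th (z, x)) = normc (f x) * (normc (g z) * normc (kap z.2 z.1 x) * wt z.2 z.1).
Proof.
rewrite /Th/= (Normc.normcM (f x * _ * _)) (Normc.normcM (f x * _)) (Normc.normcM (f x)) normc_conj normc_real ger0_norm//.
  by ring.
exact/ltW/wt_gt0.
Qed.

Let mnTh : measurable_fun setT (fun y => normc (Th y)).
Proof. exact: measurable_normc. Qed.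

Let I2 : (\int[triple R n]_y (icube y.2 * normc (Th y))%:E <= C%:E * norm1 f)%E.
Proof.
have m2 : measurable_fun setT (fun y : YX => (icube y.2 * normc (Th y))%:E).
  by apply/measurable_EFinP; apply: measurable_funM => //; exact: measurable_icube2.
have p2 (y : YX) : (0 <= (icube y.2 * normc (Th y))%:E)%E by rewrite lee_fin mulr_ge0 ?icube_ge0 ?normc_ge0.
rewrite /triple (fubini_tonelli2 _ m2 p2).
have mif : measurable_fun setT (fun x : X => (icube x * normc (f x))%:E).
  by apply/measurable_EFinP; apply: measurable_funM; [exact: measurable_icube|exact: measurable_normc].
have if0 x : (0 <= (icube x * normc (f x))%:E)%E by rewrite lee_fin mulr_ge0 ?icube_ge0 ?normc_ge0.
rewrite /norm1 muleC -(ge0_integralZr _ measurableT mif (fun x _ => if0 x)) ?lee_fin//.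
apply: ge0_le_integral => //.
- by move=> x _; apply: integral_ge0.
- exact: (measurable_fun_fubini_tonelli_G _ m2 p2).
- by apply: emeasurable_funM => //; exact: measurable_cst.
move=> x _; rewrite /fubini_G.
apply: le_trans (lee_wpmul2l (if0 x) (gC x)).
have mk : measurable_fun setT (fun z => (normc (g z) * normc (kap z.2 z.1 x) * wt z.2 z.1)%:E).
  apply/measurable_EFinP; under eq_fun do rewrite -normF.
  apply: measurable_normc; apply: (cmeasurable_comp (f := F) (h := fun z => (z, x))) => //; exact: pair2_measurable.
rewrite -(ge0_integralZl _ measurableT mk); last 2 first.
- by move=> z _; rewrite lee_fin; exact: gkw_ge0.
- exact: if0.
by apply: eq_lee; apply: eq_integral => z _; rewrite -EFinM normTh/= -!mulrA.
Qed.

Let I1 : (\int[triple R n]_y (icube y.1.2 * normc (Th y))%:E < +oo)%E.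
Proof.
rewrite (ge0_exchange_triple mnTh (fun y => normc_ge0 _)); last by move=> q p x l; rewrite Th_inv.
by apply: le_lt_trans I2 _; rewrite lte_mul_pinfty ?lee_fin.
Qed.

Let norm_icube x (v : R[i]) : normc ((icube x)%:C%C * v) = icube x * normc v.
Proof. by rewrite Normc.normcM normc_real ger0_norm ?icube_ge0. Qed.

(** [Tr] and [Ts] are adjoint for the two quotient norms: both pairings are the triple integral of
    [Th], with the cube placed on [p] for one and on [x] for the other, and [cexchange_triple] moves
    it. The bound [gC] supplies the absolute convergence. *)
Lemma duality :
  cintegral nu (fun z => (icube z.2)%:C%C * (Tr f z * (g z)^*%C * (wt z.2 z.1)%:C%C)) =
  cintegral mu (fun x => (icube x)%:C%C * (f x * (Ts g x)^*%C)).
Proof.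
pose A1 (y : YX) : R[i] := (icube y.1.2)%:C%C * Th y.
pose A2 (y : YX) : R[i] := (icube y.2)%:C%C * Th y.
have mA1 : cmeasurable A1 by apply: cmeasurableM => //; apply: cmeasurable_real; exact: measurable_icube1.
have mA2 : cmeasurable A2 by apply: cmeasurableM => //; apply: cmeasurable_real; exact: measurable_icube2.
have fin (A : YX -> R[i]) : cmeasurable A -> (\int[triple R n]_y (normc (A y))%:E < +oo)%E ->
    (\int[nu]_z \int[mu]_x (normc (A (z, x)))%:E < +oo)%E.
  move=> mA; rewrite /triple (fubini_tonelli1 (fun y => (normc (A y))%:E))//.
    by apply/measurable_EFinP; exact: measurable_normc.
  by move=> y; rewrite lee_fin normc_ge0.
have f1 : (\int[nu]_z \int[mu]_x (normc (A1 (z, x)))%:E < +oo)%E.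
  by apply: fin => //; under eq_integral do rewrite norm_icube; exact: I1.
have f2 : (\int[nu]_z \int[mu]_x (normc (A2 (z, x)))%:E < +oo)%E.
  apply: fin => //; under eq_integral do rewrite norm_icube; apply: le_lt_trans I2 _.
  by rewrite lte_mul_pinfty ?lee_fin.
transitivity (cintegral nu (fun z => cintegral mu (fun x => A1 (z, x)))).
  apply: eq_cintegral => z; rewrite /A1 /Th/=.
  transitivity (cintegral mu (fun x => (icube z.2)%:C%C * (g z)^*%C * (wt z.2 z.1)%:C%C * (f x * kap z.2 z.1 x))).
    rewrite cintegralZl; [by rewrite /Tr; ring|exact: cintegrable_kap].
  by apply: eq_cintegral => x; ring.
rewrite -(cintegral_prod mA1 f1).
transitivity (cintegral (triple R n) A1); first exact: erefl.
rewrite (cexchange_triple mTh Th_inv).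
transitivity (cintegral nu (fun z => cintegral mu (fun x => A2 (z, x)))).
  exact: (cintegral_prod mA2 f2).
rewrite (cfubini mA2 f2); apply: eq_cintegral => x; rewrite /A2 /Th/=.
rewrite -cintegral_conj; last exact: cintegrable_Ts.
rewrite mulrA -cintegralZl; last by apply: cintegrable_conj; exact: cintegrable_Ts.
apply: eq_cintegral => z; rewrite (conjcM (g z * _)) (conjcM (g z)) conjcK (_ : (wt _ _)%:C^*%C = (wt z.2 z.1)%:C%C); first by ring.
by apply: complexP => //=; rewrite oppr0.
Qed.

End duality.

(** Fubini lets the integral over [x] be done first, where [cintegral_kap_kap] gives [ker]. *)
Lemma Tr_Ts z0 : Tr (Ts g) z0 = cintegral nu (fun w => g w * ker z0.2 z0.1 w.2 w.1 * (wt w.2 w.1)%:C%C).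
Proof.
pose A (y : YX) := kap z0.2 z0.1 y.2 * F y.
have mA : cmeasurable A.
  by apply: cmeasurableM => //; apply: cmeasurable_kap; [exact: measurable_cst|exact: measurable_cst|exact: measurable_snd].
have mnA : measurable_fun setT (fun y : YX => (normc (A y))%:E).
  by apply/measurable_EFinP; exact: measurable_normc.
have nA0 (y : YX) : (0 <= (normc (A y))%:E)%E by rewrite lee_fin normc_ge0.
have mk0 : cmeasurable (fun x => kap z0.2 z0.1 x) by apply: cmeasurable_kap => //; exact: measurable_cst.
have k0fin : (\int[mu]_x (normc (kap z0.2 z0.1 x))%:E < +oo)%E.
  by case: (cintegrable_kap1 z0.2 z0.1).
have f1 : (\int[nu]_z \int[mu]_x (normc (A (z, x)))%:E < +oo)%E.
  rewrite -/(\int[nu]_z (fubini_F mu (fun y => (normc (A y))%:E) z))%E.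
  rewrite (fubini_tonelli _ mnA nA0).
  apply: (@le_lt_trans _ _ (\int[mu]_x ((normc (kap z0.2 z0.1 x))%:E * C%:E))%E); last first.
    rewrite ge0_integralZr ?lee_fin//.
    - by rewrite muleC lte_mul_pinfty ?lee_fin.
    - by apply/measurable_EFinP; exact: measurable_normc.
    - by move=> x _; rewrite lee_fin normc_ge0.
  apply: ge0_le_integral => //.
  - by move=> x _; apply: integral_ge0.
  - exact: (measurable_fun_fubini_tonelli_G _ mnA nA0).
  - by apply: emeasurable_funM; [apply/measurable_EFinP; exact: measurable_normc|exact: measurable_cst].
  move=> x _; apply: le_trans (lee_wpmul2l _ (gC x)); last by rewrite lee_fin normc_ge0.
  have mk : measurable_fun setT (fun z => (normc (g z) * normc (kap z.2 z.1 x) * wt z.2 z.1)%:E).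
    apply/measurable_EFinP; under eq_fun do rewrite -normF.
    apply: measurable_normc; apply: (cmeasurable_comp (f := F) (h := fun z => (z, x))) => //; exact: pair2_measurable.
  rewrite -(ge0_integralZl _ measurableT mk); last 2 first.
  - by move=> z _; rewrite lee_fin; exact: gkw_ge0.
  - by rewrite lee_fin normc_ge0.
  by apply: eq_lee; apply: eq_integral => z _; rewrite -EFinM /A (Normc.normcM (kap _ _ _)) normF.
transitivity (cintegral mu (fun x => cintegral nu (fun z => A (z, x)))).
  apply: eq_cintegral => x; rewrite [LHS]mulrC; apply/esym.
  exact: (cintegralZl (kap z0.2 z0.1 x) (cintegrable_Ts x)).
rewrite -(cfubini mA f1); apply: eq_cintegral => z.
rewrite -cintegral_kap_kap /A /F/=.
transitivity (cintegral mu (fun x => (g z * (wt z.2 z.1)%:C%C) * (kap z0.2 z0.1 x * (kap z.2 z.1 x)^*%C))).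
  by apply: eq_cintegral => x; ring.
by rewrite cintegralZl; [ring|exact: cintegrable_kap_kap].
Qed.

End bounded.

End adjoint.

(** * Boundedness of the adjoint *)

Section norm_bounds.
Context {R : realType} {n : nat} (c : kparams R).
Local Notation X := (plane R n).
Local Notation Y := (X * X)%type.
Local Notation YX := (X * X * X)%type.
Local Notation XY := (X * (X * X))%type.
Local Notation mu := (mu_plane R n).
Local Notation nu := (nu R n).
Local Notation lp := (lpt R).
Local Notation kap := (kap c).
Local Notation wt := (wt c).
Local Notation sw := (sw c).
Local Notation ker := (ker c).
Local Notation chi := (chi c).
Local Notation Tr := (Tr c).
Local Notation Ts := (Ts c).
Local Notation qper := (qper c).
Local Notation qperY := (qperY c).
Local Notation unorm := (unorm c).
Local Notation ynorm2 := (ynorm2 c).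
Implicit Types (p q x : X) (z w : Y) (l : lattice n) (f : X -> R[i]) (g : Y -> R[i]).

Definition good g :=
  [/\ cmeasurable g, qperY g, (ynorm2 g < +oo)%E & exists j, cutoff j g].

Lemma good_bound g : good g -> exists2 C : R, 0 <= C & forall x,
    (\int[nu]_z (normc (g z) * normc (kap z.2 z.1 x) * wt z.2 z.1)%:E <= C%:E)%E.
Proof. by case=> mg gq goo [j gj]; exact: (Ts_bound mg gq goo gj). Qed.

Lemma ynorm2_ge0 g : (0 <= ynorm2 g)%E.
Proof. by apply: integral_ge0 => z _; rewrite lee_fin mulr_ge0 ?icube_ge0 ?sqr_ge0. Qed.

Lemma norm2_ge0 f : (0 <= norm2 f)%E.
Proof. by apply: integral_ge0 => z _; rewrite lee_fin mulr_ge0 ?icube_ge0 ?sqr_ge0. Qed.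

Lemma measurable_iu2 (u : Y -> R) : measurable_fun setT u ->
  measurable_fun setT (fun z : Y => (icube z.2 * u z ^+ 2)%:E).
Proof.
move=> mu0; apply/measurable_EFinP; apply: measurable_funM; last exact: measurable_funX.
by apply: measurable_icube; exact: measurable_snd.
Qed.

Lemma measurable_ygauss_sub (e : R) w : measurable_fun setT (fun z : Y => ygauss e (w - z)).
Proof.
by apply: measurable_ygauss; apply/measurable_fun_pairP; split; apply: measurable_planeB => //; exact: measurable_cst.
Qed.

Lemma ygaussC (e : R) z w : ygauss e (z - w) = ygauss e (w - z).
Proof. by rewrite -(opprB w z) /ygauss/= !sqnN. Qed.

Lemma ygauss_fin (e : R) (u : Y -> R) w : 0 < e -> measurable_fun setT u ->
  (forall z, 0 <= u z) -> yper u -> (\int[nu]_z (icube z.2 * u z ^+ 2)%:E < +oo)%E ->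
  (\int[nu]_z (ygauss e (w - z) * u z)%:E < +oo)%E.
Proof.
move=> e0 mu0 u0 uper uoo; under eq_integral do rewrite ygaussC.
apply: le_lt_trans (ygauss_sqr_le w e0 mu0 u0 uper) _.
rewrite lte_mul_pinfty ?lee_fin ?gauss_cst_ge0// lte_add_pinfty// ltry//.
Qed.

Lemma integral_ygauss (e : R) w : 0 < e ->
  (\int[nu]_z (ygauss e (w - z))%:E = ((pi / e) ^+ n * (pi / e) ^+ n)%:E)%E.
Proof.
move=> e0.
have mg z : measurable_fun setT (fun z : Y => (ygauss e (z - w))%:E).
  by apply/measurable_EFinP; under eq_fun do rewrite ygaussC; exact: measurable_ygauss_sub.
have mg1 : measurable_fun setT (fun z : Y => (ygauss e z)%:E).
  by apply/measurable_EFinP; apply: measurable_ygauss.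
have g0 z : (0 <= (ygauss e z)%:E)%E by rewrite lee_fin expR_ge0.
transitivity (\int[nu]_z (ygauss e (z - w))%:E)%E.
  by apply: eq_integral => z _; rewrite ygaussC.
rewrite (ge0_integral_nu_shift (- w) mg1 g0) /nu (fubini_tonelli1 _ mg1 g0).
have mX : measurable_fun setT (fun q : X => (expR (- (e * sqn q)))%:E).
  by apply/measurable_EFinP; exact: measurable_gauss.
have X0 q : (0 <= (expR (- (e * sqn q)))%:E)%E by rewrite lee_fin expR_ge0.
transitivity (\int[mu]_q ((expR (- (e * sqn q)))%:E * ((pi / e) ^+ n)%:E))%E.
  apply: eq_integral => q _; rewrite -(integral_gauss_plane n e0) -(ge0_integralZl _ measurableT mX (fun q _ => X0 q) (X0 q)).
  by apply: eq_integral => p _; rewrite ygaussE EFinM.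
rewrite (ge0_integralZr _ measurableT mX (fun q _ => X0 q)); last first.
  by rewrite lee_fin exprn_ge0// divr_ge0 ?pi_ge0// ltW.
by rewrite integral_gauss_plane// EFinM.
Qed.

(** After [u z * u w <= u z ^+ 2 + u w ^+ 2], the first summand is the full Gaussian integral over
    [w] multiplying [u z ^+ 2], and the second is the constant of [schur_le] for [u w ^+ 2]. *)
Definition schur_cst (e : R) := (pi / e) ^+ n * (pi / e) ^+ n + gauss_cst n e * (pi / e) ^+ n.

Lemma schur_cst_ge0 e : 0 < e -> 0 <= schur_cst e.
Proof.
move=> e0; have pe : 0 <= (pi / e) ^+ n by rewrite exprn_ge0// divr_ge0 ?pi_ge0// ltW.
by apply: addr_ge0; apply: mulr_ge0 => //; exact: gauss_cst_ge0.
Qed.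

Lemma schur_form (e : R) (u : Y -> R) : 0 < e -> measurable_fun setT u ->
  (forall z, 0 <= u z) -> yper u ->
  (\int[nu]_z ((icube z.2 * u z)%:E * \int[nu]_w (ygauss e (z - w) * u w)%:E) <=
   (schur_cst e)%:E * \int[nu]_z (icube z.2 * u z ^+ 2)%:E)%E.
Proof.
move=> e0 mu0 u0 uper.
have pe : 0 <= (pi / e) ^+ n by rewrite exprn_ge0// divr_ge0 ?pi_ge0// ltW.
pose h z := u z ^+ 2.
have mh : measurable_fun setT h by exact: measurable_funX.
have h0 z : 0 <= h z by exact: sqr_ge0.
have hper : yper h by move=> q p l; rewrite /h uper.
have mS (v : Y -> R) : measurable_fun setT v ->
    measurable_fun setT (fun y : Y * Y => (ygauss e (y.1 - y.2) * v y.2)%:E).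
  move=> mv; apply/measurable_EFinP; apply: measurable_funM; last exact: (measurableT_comp mv measurable_snd).
  apply: measurable_ygauss; apply/measurable_fun_pairP; split; apply: measurable_planeB.
  - exact: (measurableT_comp measurable_fst measurable_fst).
  - exact: (measurableT_comp measurable_fst measurable_snd).
  - exact: (measurableT_comp measurable_snd measurable_fst).
  - exact: (measurableT_comp measurable_snd measurable_snd).
have mT (v : Y -> R) : measurable_fun setT v -> (forall z, 0 <= v z) ->
    measurable_fun setT (fun z => \int[nu]_w (ygauss e (z - w) * v w)%:E)%E.
  move=> mv v0; apply: (measurable_fun_fubini_tonelli_F _ (mS v mv)) => y.
  by rewrite lee_fin mulr_ge0 ?expR_ge0.
have mic : measurable_fun setT (fun z : Y => icube z.2) by apply: measurable_icube; exact: measurable_snd.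
have miu := measurable_iu2 mu0.
have iu0 z : (0 <= (icube z.2 * u z ^+ 2)%:E)%E by rewrite lee_fin mulr_ge0 ?icube_ge0 ?sqr_ge0.
have Th0 z : (0 <= \int[nu]_w (ygauss e (z - w) * h w)%:E)%E.
  by apply: integral_ge0 => w _; rewrite lee_fin mulr_ge0 ?expR_ge0.
have mB : measurable_fun setT (fun z => ((icube z.2)%:E * \int[nu]_w (ygauss e (z - w) * h w)%:E)%E).
  by apply: emeasurable_funM; [exact/measurable_EFinP|exact: mT].
have B0 z : (0 <= (icube z.2)%:E * \int[nu]_w (ygauss e (z - w) * h w)%:E)%E.
  by rewrite mule_ge0 ?lee_fin ?icube_ge0.
have mA : measurable_fun setT (fun z => ((icube z.2 * u z ^+ 2)%:E * ((pi / e) ^+ n * (pi / e) ^+ n)%:E)%E).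
  by apply: emeasurable_funM => //; exact: measurable_cst.
have A0 z : (0 <= (icube z.2 * u z ^+ 2)%:E * ((pi / e) ^+ n * (pi / e) ^+ n)%:E)%E.
  by rewrite mule_ge0// lee_fin mulr_ge0.
apply: (@le_trans _ _ (\int[nu]_z ((icube z.2 * u z ^+ 2)%:E * ((pi / e) ^+ n * (pi / e) ^+ n)%:E +
    (icube z.2)%:E * \int[nu]_w (ygauss e (z - w) * h w)%:E))%E).
  apply: ge0_le_integral => //.
  - move=> z _; rewrite mule_ge0 ?lee_fin ?mulr_ge0 ?icube_ge0//.
    by apply: integral_ge0 => w _; rewrite lee_fin mulr_ge0 ?expR_ge0.
  - apply: emeasurable_funM; last exact: mT.
    by apply/measurable_EFinP; exact: measurable_funM.
  - exact: emeasurable_funD.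
  move=> z _.
  have mgz : measurable_fun setT (fun w => (ygauss e (z - w))%:E).
    by apply/measurable_EFinP; exact: measurable_ygauss_sub.
  have gz0 w : (0 <= (ygauss e (z - w))%:E)%E by rewrite lee_fin expR_ge0.
  have mgu (v : Y -> R) : measurable_fun setT v -> measurable_fun setT (fun w => (ygauss e (z - w) * v w)%:E).
    by move=> mv; apply/measurable_EFinP; apply: measurable_funM => //; exact: measurable_ygauss_sub.
  have gu0 w : (0 <= (ygauss e (z - w) * u w)%:E)%E by rewrite lee_fin mulr_ge0 ?expR_ge0.
  have gh0 w : (0 <= (ygauss e (z - w) * h w)%:E)%E by rewrite lee_fin mulr_ge0 ?expR_ge0.
  have i0 := icube_ge0 z.2.
  rewrite -(integral_ygauss z e0) -(ge0_integralZl _ measurableT mgz (fun w _ => gz0 w) (iu0 z)).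
  rewrite -(ge0_integralZl _ measurableT (mgu h mh) (fun w _ => gh0 w)) ?lee_fin//.
  rewrite -(ge0_integralZl _ measurableT (mgu u mu0) (fun w _ => gu0 w)) ?lee_fin ?mulr_ge0//.
  rewrite -ge0_integralD//; last 4 first.
  - by move=> w _; rewrite mule_ge0.
  - by apply: emeasurable_funM => //; exact: measurable_cst.
  - by move=> w _; rewrite mule_ge0// lee_fin.
  - by apply: emeasurable_funM; [exact: measurable_cst|exact: mgu].
  apply: ge0_le_integral => //.
  - by move=> w _; rewrite mule_ge0// lee_fin mulr_ge0.
  - by apply: emeasurable_funM; [exact: measurable_cst|exact: mgu].
  - apply: emeasurable_funD; apply: emeasurable_funM; by [exact: measurable_cst|exact: mgu|].
  - move=> w _; rewrite -!EFinM -EFinD lee_fin /h.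
    rewrite (_ : _ * _ * (_ * _) = icube z.2 * ygauss e (z - w) * (u z * u w)); last by ring.
    rewrite (_ : _ + _ = icube z.2 * ygauss e (z - w) * (u z ^+ 2 + u w ^+ 2)); last by ring.
    rewrite ler_wpM2l ?mulr_ge0 ?expR_ge0//; have := sqr_ge0 (u z - u w); have := u0 z; have := u0 w; nra.
rewrite (ge0_integralD nu measurableT (fun z _ => A0 z) mA (fun z _ => B0 z) mB).
rewrite (ge0_integralZr _ measurableT miu (fun z _ => iu0 z)) ?lee_fin ?mulr_ge0//.
rewrite /schur_cst EFinD [leRHS]ge0_muleDl ?lee_fin; [|exact: mulr_ge0|by apply: mulr_ge0 => //; exact: gauss_cst_ge0].
by apply: leeD; [rewrite muleC|exact: schur_le].
Qed.

Let K := amp2 c ^+ n * W0 (n := n) c.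

Let K0 : 0 <= K.
Proof. by rewrite mulr_ge0 ?(ltW (W0_gt0 _))// exprn_ge0// ltW ?amp2_gt0. Qed.

Lemma normc_gker g z w :
  normc (g w * ker z.2 z.1 w.2 w.1 * (wt w.2 w.1)%:C%C) * sw z.2 z.1 <=
  K * (ygauss (keps c) (z - w) * unorm g w).
Proof.
rewrite (Normc.normcM (g w * _)) (Normc.normcM (g w)) normc_real ger0_norm; last exact/ltW/wt_gt0.
rewrite -sw_sqr mulrA (_ : _ * _ * _ ^+ 2 * _ = unorm g w *
  (normc (ker z.2 z.1 w.2 w.1) * sw z.2 z.1 * sw w.2 w.1)); last by rewrite /unorm; ring.
apply: le_trans (ler_wpM2l (unorm_ge0 c g w) (normc_ker_sw_le _ _ _ _ _)) _.
by rewrite -!surjective_pairing /K; apply: eq_ler; ring.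
Qed.

Lemma cmeasurable_ker d (T : measurableType d) (a b a' b' : T -> X) :
  measurable_fun setT a -> measurable_fun setT b -> measurable_fun setT a' -> measurable_fun setT b' ->
  cmeasurable (fun t => ker (a t) (b t) (a' t) (b' t)).
Proof.
move=> ma mb ma' mb'; apply: cmeasurableM; first exact: cmeasurable_cst.
apply: cmeasurable_cexp; split => /=; apply: measurable_funB.
- by apply: measurable_funM => //; apply: measurable_funB; exact: measurable_dOm.
- apply: measurable_funM => //; apply: measurable_funB; apply: measurable_sqn.
    exact: measurable_planeB.
  exact: measurable_planeD.
- apply: measurableT_comp => //; apply: measurable_funM => //; apply: measurable_dB => //.
    exact: measurable_planeB.
  exact: measurable_planeD.
- by apply: measurable_funM => //; apply: measurable_funD; exact: measurable_dOm.
Qed.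

Lemma cintegrable_gker g z : cmeasurable g -> qperY g -> (ynorm2 g < +oo)%E ->
  cintegrable nu (fun w => g w * ker z.2 z.1 w.2 w.1 * (wt w.2 w.1)%:C%C).
Proof.
move=> mg gq goo; have e0 := keps_gt0 c.
have mu0 := measurable_unorm c mg; have u0 := unorm_ge0 c g; have up := yper_unorm gq.
have myu : measurable_fun setT (fun w => (ygauss (keps c) (z - w) * unorm g w)%:E).
  by apply/measurable_EFinP; apply: measurable_funM => //; exact: measurable_ygauss_sub.
apply: (@le_cintegrable _ _ _ _ _ (fun w => K / sw z.2 z.1 * (ygauss (keps c) (z - w) * unorm g w))).
- apply: cmeasurableM; last by apply: cmeasurable_real; apply: measurable_wt; [exact: measurable_snd|exact: measurable_fst].
  apply: cmeasurableM => //; apply: cmeasurable_ker; [exact: measurable_cst|exact: measurable_cst|exact: measurable_snd|exact: measurable_fst].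
- by apply: measurable_funM => //; exact/measurable_EFinP.
- move=> w; rewrite [leRHS]mulrAC ler_pdivlMr ?sw_gt0//; exact: normc_gker.
- under eq_integral do rewrite EFinM.
  rewrite (ge0_integralZl _ measurableT myu); last 2 first.
  + by move=> w _; rewrite lee_fin mulr_ge0 ?expR_ge0.
  + by rewrite lee_fin divr_ge0 ?(ltW (sw_gt0 _ _ _)).
  rewrite lte_mul_pinfty ?lee_fin ?divr_ge0 ?(ltW (sw_gt0 _ _ _))//.
  exact: ygauss_fin.
Qed.

(** The composite of [Tr] and [Ts] given by its kernel. Unlike [Ts], it is shown to converge without
    a cutoff, because [ker] decays in all directions of phase space. *)
Definition Kg g z := cintegral nu (fun w => g w * ker z.2 z.1 w.2 w.1 * (wt w.2 w.1)%:C%C).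

Lemma normc_Kg_le g z : cmeasurable g -> qperY g -> (ynorm2 g < +oo)%E ->
  ((normc (Kg g z) * sw z.2 z.1)%:E <= K%:E * \int[nu]_w (ygauss (keps c) (z - w) * unorm g w)%:E)%E.
Proof.
move=> mg gq goo; have gi := cintegrable_gker z mg gq goo.
have mu0 := measurable_unorm c mg; have u0 := unorm_ge0 c g.
have myu : measurable_fun setT (fun w => (ygauss (keps c) (z - w) * unorm g w)%:E).
  by apply/measurable_EFinP; apply: measurable_funM => //; exact: measurable_ygauss_sub.
have s0 : (0 <= (sw z.2 z.1)%:E)%E by rewrite lee_fin ltW ?sw_gt0.
rewrite EFinM; apply: le_trans (lee_wpmul2r s0 (normc_cintegral_le gi)) _.
have mni : measurable_fun setT (fun w => (normc (g w * ker z.2 z.1 w.2 w.1 * (wt w.2 w.1)%:C%C))%:E).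
  by apply/measurable_EFinP; apply: measurable_normc; case: gi.
have ni0 w : (0 <= (normc (g w * ker z.2 z.1 w.2 w.1 * (wt w.2 w.1)%:C%C))%:E)%E by rewrite lee_fin normc_ge0.
have yu0 w : (0 <= (ygauss (keps c) (z - w) * unorm g w)%:E)%E by rewrite lee_fin mulr_ge0 ?expR_ge0.
rewrite -(ge0_integralZr _ measurableT mni (fun w _ => ni0 w))//.
rewrite -(ge0_integralZl _ measurableT myu (fun w _ => yu0 w)) ?lee_fin//.
apply: ge0_le_integral => //.
- by move=> w _; rewrite mule_ge0// lee_fin normc_ge0.
- by apply: emeasurable_funM => //; exact: measurable_cst.
- by apply: emeasurable_funM => //; exact: measurable_cst.
- by move=> w _; rewrite -!EFinM lee_fin; exact: normc_gker.
Qed.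

Definition Tbound := K * schur_cst (keps c).

Lemma Tbound_ge0 : 0 <= Tbound.
Proof. by rewrite mulr_ge0 ?schur_cst_ge0 ?keps_gt0. Qed.

(** Take [f = Ts g] in [duality]: the squared norm of [Ts g] is the pairing of [Kg c g] with [g], a
    quadratic form in [unorm g] whose kernel is dominated by a Gaussian, and [schur_form] bounds
    it. *)
Lemma Ts_norm g : good g -> (norm2 (Ts g) <= Tbound%:E * ynorm2 g)%E.
Proof.
move=> gg; have [mg gq goo [j gj]] := gg; have [C C0 gC] := good_bound gg.
have e0 := keps_gt0 c.
have mu0 := measurable_unorm c mg; have u0 := unorm_ge0 c g; have up := yper_unorm gq.
have mf := cmeasurable_Ts c mg; have fq := Ts_qper mg gC gq; have f2 := norm2_Ts_fin mg C0 gC.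
have f1 : (norm1 (Ts g) < +oo)%E by apply: le_lt_trans (norm1_le mf) _; rewrite lte_add_pinfty// ltry.
have := duality mg C0 gC mf fq f1 gq.
have -> : cintegral mu (fun x => (icube x)%:C%C * (Ts g x * (Ts g x)^*%C)) = (fine (norm2 (Ts g)))%:C%C.
  rewrite -cintegral_real; apply: eq_cintegral => x.
  by rewrite mulc_conj -rmorphM.
set I := (X in cintegral nu X) => E.
have mI : cmeasurable I.
  apply: cmeasurableM; first by apply: cmeasurable_real; apply: measurable_icube; exact: measurable_snd.
  apply: cmeasurableM; last by apply: cmeasurable_real; apply: measurable_wt; [exact: measurable_snd|exact: measurable_fst].
  by apply: cmeasurableM; [exact: cmeasurable_Tr|exact: cmeasurable_conj].
have mS : measurable_fun setT (fun z => \int[nu]_w (ygauss (keps c) (z - w) * unorm g w)%:E)%E.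
  apply: (measurable_fun_fubini_tonelli_F (m2 := nu) (fun y : Y * Y => (ygauss (keps c) (y.1 - y.2) * unorm g y.2)%:E)).
    apply/measurable_EFinP; apply: measurable_funM; last exact: (measurableT_comp mu0 measurable_snd).
    apply: measurable_ygauss; apply/measurable_fun_pairP; split; apply: measurable_planeB.
    - exact: (measurableT_comp measurable_fst measurable_fst).
    - exact: (measurableT_comp measurable_fst measurable_snd).
    - exact: (measurableT_comp measurable_snd measurable_fst).
    - exact: (measurableT_comp measurable_snd measurable_snd).
  by move=> y; rewrite lee_fin mulr_ge0 ?expR_ge0.
have S0 z : (0 <= \int[nu]_w (ygauss (keps c) (z - w) * unorm g w)%:E)%E.
  by apply: integral_ge0 => w _; rewrite lee_fin mulr_ge0 ?expR_ge0.
have miu : measurable_fun setT (fun z : Y => (icube z.2 * unorm g z)%:E).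
  by apply/measurable_EFinP; apply: measurable_funM => //; apply: measurable_icube; exact: measurable_snd.
have iu0 z : (0 <= (icube z.2 * unorm g z)%:E)%E by rewrite lee_fin mulr_ge0 ?icube_ge0.
have mM : measurable_fun setT (fun z => (icube z.2 * unorm g z)%:E * \int[nu]_w (ygauss (keps c) (z - w) * unorm g w)%:E)%E.
  exact: emeasurable_funM.
have M0 z : (0 <= (icube z.2 * unorm g z)%:E * \int[nu]_w (ygauss (keps c) (z - w) * unorm g w)%:E)%E.
  exact: mule_ge0.
have Ile : (\int[nu]_z (normc (I z))%:E <= Tbound%:E * ynorm2 g)%E.
  apply: (@le_trans _ _ (\int[nu]_z (K%:E * ((icube z.2 * unorm g z)%:E * \int[nu]_w (ygauss (keps c) (z - w) * unorm g w)%:E)))%E).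
    apply: ge0_le_integral => //.
    - by move=> z _; rewrite lee_fin normc_ge0.
    - by apply/measurable_EFinP; exact: measurable_normc.
    - by apply: emeasurable_funM => //; exact: measurable_cst.
    move=> z _; have TE : Tr (Ts g) z = Kg g z by exact: (Tr_Ts mg C0 gC).
    rewrite /I TE (Normc.normcM (icube z.2)%:C%C) normc_real ger0_norm ?icube_ge0//.
    rewrite (Normc.normcM (Kg g z * _)) (Normc.normcM (Kg g z)) normc_conj normc_real ger0_norm; last exact/ltW/wt_gt0.
    rewrite -sw_sqr [X in (X%:E <= _)%E](_ : _ = (icube z.2 * unorm g z) * (normc (Kg g z) * sw z.2 z.1)); last first.
      by rewrite /unorm; ring.
    rewrite [X in (X <= _)%E]EFinM muleCA; apply: lee_wpmul2l; first exact: iu0.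
    exact: normc_Kg_le.
  rewrite (ge0_integralZl _ measurableT mM (fun z _ => M0 z)) ?lee_fin//.
  rewrite /Tbound [X in (_ <= X * _)%E]EFinM -muleA; apply: lee_wpmul2l; first by rewrite lee_fin.
  exact: schur_form.
have Ic : cintegrable nu I.
  by split => //; apply: le_lt_trans Ile _; rewrite lte_mul_pinfty ?lee_fin ?Tbound_ge0.
have fE : norm2 (Ts g) = (fine (norm2 (Ts g)))%:E by rewrite fineK// ge0_fin_numE// norm2_ge0.
rewrite fE; apply: le_trans Ile; apply: le_trans (normc_cintegral_le Ic).
by rewrite E normc_real lee_fin ler_norm.
Qed.

End norm_bounds.

(** * Boundedness of the transform *)

Section transform_bound.
Context {R : realType} {n : nat} (c : kparams R).
Local Notation X := (plane R n).
Local Notation Y := (X * X)%type.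
Local Notation YX := (X * X * X)%type.
Local Notation XY := (X * (X * X))%type.
Local Notation mu := (mu_plane R n).
Local Notation nu := (nu R n).
Local Notation lp := (lpt R).
Local Notation kap := (kap c).
Local Notation wt := (wt c).
Local Notation sw := (sw c).
Local Notation ker := (ker c).
Local Notation chi := (chi c).
Local Notation Tr := (Tr c).
Local Notation Ts := (Ts c).
Local Notation qper := (qper c).
Local Notation qperY := (qperY c).
Local Notation unorm := (unorm c).
Local Notation ynorm2 := (ynorm2 c).
Implicit Types (p q x : X) (z w : Y) (l : lattice n) (f : X -> R[i]) (g : Y -> R[i]).

Definition ycut (j : R) z : R := \1_[set z : Y | sqn z.1 <= j] z.

Definition cut (j : R) g z : R[i] := (ycut j z)%:C%C * g z.

Lemma ycutE j z : ycut j z = ((sqn z.1 <= j)%R)%:R.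
Proof. by rewrite /ycut indicE; congr (nat_of_bool _)%:R; apply/idP/idP; rewrite inE. Qed.

Lemma ycut_ge0 j z : 0 <= ycut j z. Proof. by rewrite ycutE. Qed.

Lemma ycut_le1 j z : ycut j z <= 1. Proof. by rewrite ycutE lern1 leq_b1. Qed.

Lemma ycut_sqr j z : ycut j z ^+ 2 = ycut j z.
Proof. by rewrite ycutE; case: (_ <= _); rewrite ?expr1n ?expr0n. Qed.

Lemma measurable_ycut j : measurable_fun setT (ycut j).
Proof.
apply: measurable_indic.
have -> : [set z : Y | sqn z.1 <= j] = setT `&` (fun z : Y => sqn z.1) @^-1` `]-oo, j].
  by rewrite setTI; apply/seteqP; split => z /=; rewrite in_itv.
have ms : measurable_fun setT (fun z : Y => sqn z.1) by apply: measurable_sqn; exact: measurable_fst.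
exact: ms.
Qed.

Lemma cmeasurable_cut j g : cmeasurable g -> cmeasurable (cut j g).
Proof. by move=> mg; apply: cmeasurableM => //; apply: cmeasurable_real; exact: measurable_ycut. Qed.

Lemma qperY_cut j g : qperY g -> qperY (cut j g).
Proof. by move=> gq q p l; rewrite /cut gq !ycutE mulrCA. Qed.

Lemma cutoff_cut j g : cutoff j (cut j g).
Proof. by move=> z jz; rewrite /cut ycutE leNgt jz mul0r. Qed.

Lemma unorm_cut j g z : unorm (cut j g) z = ycut j z * unorm g z.
Proof. by rewrite /unorm /cut (Normc.normcM (ycut j z)%:C%C) normc_real ger0_norm ?ycut_ge0//; ring. Qed.

Lemma unorm_cut_sqr j g z : unorm (cut j g) z ^+ 2 = ycut j z * unorm g z ^+ 2.
Proof. by rewrite unorm_cut [(ycut j z * _) ^+ 2]exprMn ycut_sqr. Qed.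

Lemma ynorm2_cut_le j g : cmeasurable g -> (ynorm2 (cut j g) <= ynorm2 g)%E.
Proof.
move=> mg; apply: ge0_le_integral => //.
- by move=> z _; rewrite lee_fin mulr_ge0 ?icube_ge0 ?sqr_ge0.
- by apply: measurable_iu2; apply: measurable_unorm; exact: cmeasurable_cut.
- by apply: measurable_iu2; exact: measurable_unorm.
- move=> z _; rewrite lee_fin ler_wpM2l ?icube_ge0// unorm_cut_sqr.
  by rewrite ler_piMl ?sqr_ge0 ?ycut_le1.
Qed.

Lemma good_cut j g : cmeasurable g -> qperY g -> (ynorm2 (cut j g) < +oo)%E -> good c (cut j g).
Proof.
move=> mg gq goo; split => //; [exact: cmeasurable_cut|exact: qperY_cut|].
by exists j; exact: cutoff_cut.
Qed.

Lemma ynorm2_cvg g : cmeasurable g ->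
  ynorm2 (cut j%:R g) @[j --> \oo] --> ynorm2 g.
Proof.
move=> mg; have mu0 := measurable_unorm c mg.
pose h (j : nat) z := (icube z.2 * unorm (cut j%:R g) z ^+ 2)%:E.
have mh j : measurable_fun setT (h j).
  by apply: measurable_iu2; apply: measurable_unorm; exact: cmeasurable_cut.
have h0 j z : setT z -> (0 <= h j z)%E by move=> _; rewrite lee_fin mulr_ge0 ?icube_ge0 ?sqr_ge0.
have nh z : setT z -> {homo h^~ z : a b / (a <= b)%N >-> (a <= b)%E}.
  move=> _ a b ab; rewrite lee_fin ler_wpM2l ?icube_ge0// !unorm_cut_sqr.
  rewrite ler_wpM2r ?sqr_ge0// !ycutE ler_nat.
  case: (leP (sqn z.1) a%:R) => // aj; by rewrite (le_trans aj)// ler_nat.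
have /(_ nu) := cvg_monotone_convergence measurableT mh h0 nh.
have -> // : (\int[nu]_z limn (h^~ z) = ynorm2 g)%E.
apply: eq_integral => z _; apply/cvg_lim => //.
apply: cvg_near_cst; exists (Num.truncn (sqn z.1)).+1 => //= j jz.
rewrite /h unorm_cut_sqr ycutE.
have -> : (sqn z.1 <= j%:R) = true; last by rewrite mul1r.
apply/ltW; apply: lt_le_trans (truncnS_gt _) _; by rewrite ler_nat.
Qed.

Lemma ynorm2_sup g (B : \bar R) : cmeasurable g ->
  (forall j : nat, (ynorm2 (cut j%:R g) <= B)%E) -> (ynorm2 g <= B)%E.
Proof.
move=> /ynorm2_cvg cv H; have := cvg_lim (@ereal_hausdorff R) cv => <-.
apply: lime_le; first by apply/cvg_ex; eexists; exact: cv.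
by near=> j; exact: H.
Unshelve. all: by end_near. Qed.

Section bound.
Context (f : X -> R[i]).
Context (mf : cmeasurable f).
Context (fq : qper f).
Context (f2 : (norm2 f < +oo)%E).

Lemma norm1_fin : (norm1 f < +oo)%E.
Proof. by apply: le_lt_trans (norm1_le mf) _; rewrite lte_add_pinfty// ltry. Qed.

Let F1 := fine (norm1 f).

Let F1E : norm1 f = F1%:E.
Proof.
rewrite /F1 fineK// ge0_fin_numE ?norm1_fin//.
by apply: integral_ge0 => x _; rewrite lee_fin mulr_ge0 ?icube_ge0 ?normc_ge0.
Qed.

Lemma unorm_Tr_le z : unorm (Tr f) z <= Tcst (n := n) c z.1 * F1.
Proof.
have ck := cintegrable_kap z.2 z.1 mf fq norm1_fin.
rewrite -lee_fin [leRHS]EFinM -F1E; apply: le_trans (integral_kap_le z.2 z.1 mf fq).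
have s0 : (0 <= (sw z.2 z.1)%:E)%E by rewrite lee_fin ltW ?sw_gt0.
rewrite /unorm EFinM; apply: le_trans (lee_wpmul2r s0 (normc_cintegral_le ck)) _.
have mn : measurable_fun setT (fun x => (normc (f x * kap z.2 z.1 x))%:E).
  by apply/measurable_EFinP; apply: measurable_normc; case: ck.
have n0 x : (0 <= (normc (f x * kap z.2 z.1 x))%:E)%E by rewrite lee_fin normc_ge0.
rewrite -(ge0_integralZr _ measurableT mn (fun x _ => n0 x))//.
by apply: eq_lee; apply: eq_integral => x _; rewrite -EFinM (Normc.normcM (f x)).
Qed.

(** A priori finiteness, without which the term moved to the left in [cut_Tr_le] could be infinite.
    On the ball [sqn q <= j] the integrand is bounded, and [expR j] pays for an artificial Gaussian
    in [q]. *)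
Lemma ynorm2_cut_Tr j : (ynorm2 (cut j (Tr f)) < +oo)%E.
Proof.
pose B := (kcst (n := n) c * expR (del c * j) * gauss_cst n (gam c / 2) * F1) ^+ 2 * expR j.
have d0 := del_gt0 c; have g2 := gam2_gt0 c.
have F10 : 0 <= F1.
  apply: fine_ge0; apply: integral_ge0 => x _; rewrite lee_fin mulr_ge0 ?icube_ge0 ?normc_ge0//.
have B0 : 0 <= B by rewrite mulr_ge0 ?sqr_ge0 ?expR_ge0.
pose G (q : X) : \bar R := (expR (- (1 * sqn q)))%:E.
have mG : measurable_fun setT G by apply/measurable_EFinP; exact: measurable_gauss.
have G0 q : (0 <= G q)%E by rewrite lee_fin expR_ge0.
have mi : measurable_fun setT (fun p : X => (icube p)%:E) by apply/measurable_EFinP; exact: measurable_icube.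
have i0 (p : X) : (0 <= (icube p)%:E)%E by rewrite lee_fin icube_ge0.
pose H (z : Y) : \bar R := (G z.1 * (icube z.2)%:E)%E.
have mH : measurable_fun setT H.
  apply: emeasurable_funM; first exact: (measurableT_comp mG measurable_fst).
  exact: (measurableT_comp mi measurable_snd).
have H0 z : (0 <= H z)%E by exact: mule_ge0.
have mT : cmeasurable (Tr f) by exact: cmeasurable_Tr.
apply: (@le_lt_trans _ _ (\int[nu]_z (B%:E * H z))%E).
  apply: ge0_le_integral => //.
  - by move=> z _; rewrite lee_fin mulr_ge0 ?icube_ge0 ?sqr_ge0.
  - by apply: measurable_iu2; apply: measurable_unorm; exact: cmeasurable_cut.
  - by apply: emeasurable_funM => //; exact: measurable_cst.
  - move=> z _; rewrite /H /G -!EFinM lee_fin mul1r unorm_cut_sqr.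
    rewrite (_ : B * (_ * _) = icube z.2 * (B * expR (- sqn z.1))); last by ring.
    rewrite ler_wpM2l ?icube_ge0// ycutE.
    case: (leP (sqn z.1) j) => zj; last by rewrite mul0r mulr_ge0 ?expR_ge0.
    rewrite mul1r /B -[leRHS]mulrA -expRD -[leLHS]mulr1 ler_pM ?sqr_ge0//.
      rewrite lerXn2r ?nnegrE ?unorm_ge0//.
        by rewrite mulr_ge0// mulr_ge0 ?gauss_cst_ge0// mulr_ge0 ?kcst_ge0 ?expR_ge0.
      apply: le_trans (unorm_Tr_le z) _; rewrite ler_wpM2r// /Tcst ler_wpM2r ?gauss_cst_ge0//.
      by rewrite ler_wpM2l ?kcst_ge0// ler_expR ler_pM2l.
    by rewrite -[leLHS]expR0 ler_expR subr_ge0.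
rewrite (ge0_integralZl _ measurableT mH (fun z _ => H0 z)) ?lee_fin//.
rewrite lte_mul_pinfty ?lee_fin// /nu (fubini_tonelli1 _ mH H0) /fubini_F/=.
have E q : (\int[mu]_y (H (q, y)) = G q)%E.
  by rewrite /H/= (ge0_integralZl _ measurableT mi (fun p _ => i0 p) (G0 q)) integral_icube mule1.
by under eq_integral do rewrite E; rewrite integral_gauss_plane// ltry.
Qed.

(** Pair [Tr f] with its own truncation [g]. Duality and Young's inequality bound the squared norm
    of [g] by [s / 2] times that of [f] plus [(2 * s)^-1] times that of [Ts g]; by [Ts_norm] the
    last term is at most half of the left-hand side. *)
Lemma cut_Tr_le j : (ynorm2 (cut j (Tr f)) <= (Tbound (n := n) c + 1)%:E * norm2 f)%E.
Proof.
have mT : cmeasurable (Tr f) by exact: cmeasurable_Tr.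
have Tq : qperY (Tr f) by apply: Tr_qperY => //; exact: norm1_fin.
set g := cut j (Tr f).
have gg : good c g by apply: good_cut => //; exact: ynorm2_cut_Tr.
have [mg gq goo _] := gg; have [C C0 gC] := good_bound gg.
have := duality mg C0 gC mf fq norm1_fin gq.
have -> : cintegral nu (fun z => (icube z.2)%:C%C * (Tr f z * (g z)^*%C * (wt z.2 z.1)%:C%C)) =
    (fine (ynorm2 g))%:C%C.
  rewrite -cintegral_real; apply: eq_cintegral => z.
  rewrite (rmorphM (real_complex R) (icube z.2)); congr (_ * _).
  rewrite (_ : unorm g z ^+ 2 = normc (g z) ^+ 2 * wt z.2 z.1); last first.
    by rewrite /unorm [(normc _ * _) ^+ 2]exprMn sw_sqr.
  transitivity (g z * (g z)^*%C * (wt z.2 z.1)%:C%C); last first.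
    by rewrite mulc_conj -(rmorphM (real_complex R)).
  congr (_ * _).
  have [yE|yE] : (ycut j z)%:C%C = 1 :> R[i] \/ (ycut j z)%:C%C = 0 :> R[i].
    by rewrite ycutE; case: (sqn z.1 <= j); [left|right].
  - by rewrite /g /cut yE mul1r.
  - by rewrite /g /cut yE mul0r conjc0 !mulr0.
set I := (X in cintegral mu X) => E.
have mS := cmeasurable_Ts c mg.
have mI : cmeasurable I.
  apply: cmeasurableM; first by apply: cmeasurable_real; exact: measurable_icube.
  by apply: cmeasurableM => //; exact: cmeasurable_conj.
(* The [+ 1] makes [s] positive, so that Young's inequality can divide by it, and [s >= Tbound c]
   gives the absorption. *)
pose s := Tbound (n := n) c + 1.
have s0 : 0 < s by rewrite ltr_wpDl ?Tbound_ge0.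
have S2 := Ts_norm gg; have f20 := norm2_ge0 f; have S20 := norm2_ge0 (Ts g); have g20 := ynorm2_ge0 c g.
have S2fin : (norm2 (Ts g) < +oo)%E by exact: norm2_Ts_fin C0 gC.
have m2 (h : X -> R[i]) : cmeasurable h -> measurable_fun setT (fun x => (icube x * normc (h x) ^+ 2)%:E).
  move=> mh; apply/measurable_EFinP; apply: measurable_funM; first exact: measurable_icube.
  by apply: measurable_funX; exact: measurable_normc.
have p2 (h : X -> R[i]) (x : X) : (0 <= (icube x * normc (h x) ^+ 2)%:E)%E.
  by rewrite lee_fin mulr_ge0 ?icube_ge0 ?sqr_ge0.
have Ile : (\int[mu]_x (normc (I x))%:E <= (s / 2)%:E * norm2 f + (2 * s)^-1%:E * norm2 (Ts g))%E.
  rewrite /norm2 -(ge0_integralZl _ measurableT (m2 f mf) (fun x _ => p2 f x)); last first.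
    by rewrite lee_fin divr_ge0 ?ltW.
  rewrite -(ge0_integralZl _ measurableT (m2 _ mS) (fun x _ => p2 _ x)); last first.
    by rewrite lee_fin invr_ge0 mulr_ge0 ?ltW.
  rewrite -ge0_integralD//; last 4 first.
  - by move=> x _; rewrite mule_ge0// lee_fin divr_ge0 ?ltW.
  - by apply: emeasurable_funM; [exact: measurable_cst|exact: m2].
  - by move=> x _; rewrite mule_ge0// lee_fin invr_ge0 mulr_ge0 ?ltW.
  - by apply: emeasurable_funM; [exact: measurable_cst|exact: m2].
  apply: ge0_le_integral => //.
  - by move=> x _; rewrite lee_fin normc_ge0.
  - by apply/measurable_EFinP; exact: measurable_normc.
  - by apply: emeasurable_funD; (apply: emeasurable_funM; [exact: measurable_cst|exact: m2]).
  move=> x _; rewrite -!EFinM -EFinD lee_fin /I (Normc.normcM (icube x)%:C%C) (Normc.normcM (f x)).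
  rewrite normc_conj normc_real ger0_norm ?icube_ge0//.
  set a := normc (f x); set b := normc _; have i0 := icube_ge0 x.
  have sN : s != 0 by rewrite gt_eqF.
  rewrite -subr_ge0 (_ : _ - _ = icube x * ((s * a - b) ^+ 2 / (2 * s))); last by field.
  by rewrite mulr_ge0// divr_ge0 ?sqr_ge0// mulr_ge0// ltW.
have Ic : cintegrable mu I.
  split => //; apply: le_lt_trans Ile _; rewrite lte_add_pinfty// lte_mul_pinfty ?lee_fin//.
    by rewrite divr_ge0 ?ltW.
  by rewrite invr_ge0 mulr_ge0 ?ltW.
have fE : ynorm2 g = (fine (ynorm2 g))%:E by rewrite fineK// ge0_fin_numE.
have f2E : norm2 f = (fine (norm2 f))%:E by rewrite fineK// ge0_fin_numE.
have S2E : norm2 (Ts g) = (fine (norm2 (Ts g)))%:E by rewrite fineK// ge0_fin_numE.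
have : ((fine (ynorm2 g))%:E <= (s / 2)%:E * norm2 f + (2 * s)^-1%:E * norm2 (Ts g))%E.
  apply: le_trans Ile; apply: le_trans (normc_cintegral_le Ic).
  by rewrite -E normc_real lee_fin ler_norm.
move: S2; rewrite fE f2E S2E -!EFinM -EFinD !lee_fin.
set N := fine (ynorm2 g); set F := fine (norm2 f); set S := fine _ => S2 h.
have N0 : 0 <= N by apply: fine_ge0.
have sN : s != 0 by rewrite gt_eqF.
have : (2 * s)^-1 * S <= N / 2.
  rewrite ler_pdivrMl ?mulr_gt0// (_ : 2 * s * (N / 2) = s * N); last by field.
  by apply: le_trans S2 _; rewrite ler_wpM2r// /s lerDl.
have key (A B : R) : N <= A / 2 + B -> B <= N / 2 -> N <= A by move=> ? ?; lra.
by apply: (key (s * F)); rewrite mulrAC.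
Qed.

(** The constant is crude and will be improved to 1; the finiteness of the left-hand side is what
    allows [Tr f] to be reproduced. *)
Lemma Tr_norm : (ynorm2 (Tr f) <= (Tbound (n := n) c + 1)%:E * norm2 f)%E.
Proof. by apply: ynorm2_sup => [|j]; [exact: cmeasurable_Tr|exact: cut_Tr_le]. Qed.

End bound.

End transform_bound.

(** * Entire functions are reproduced *)
Section entire_functions.
Context {R : realType} {n : nat}.
Local Notation XC := (plane R[i] n).
Implicit Types (P Q S Z : XC) (F G : XC -> R[i]).
Let RV : normedModType R[i] := 'rV[R[i]]_n.
Let XM : normedModType R[i] := (RV * RV)%type.

Lemma entire_shift (G : XC -> R[i]) (Q : XC) : entire G -> entire (fun P => G (Q + P)).
Proof.
move=> eG P; have d1 : differentiable (fun P : XM => (Q : XM) + P) (P : XM).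
  by apply: differentiableD; [exact: differentiable_cst|exact: ex_diff].
exact: (@differentiable_comp R[i] XM XM R[i]^o _ G P d1 (eG _)).
Qed.
Lemma differentiable_ray (G : XC -> R[i]) (Q S : XC) (t : R[i]^o) : entire G ->
  differentiable ((fun t => G (Q + t *: S)) : R[i]^o -> R[i]^o) t.
Proof.
move=> eG; have d1 : differentiable (fun t : R[i]^o => (Q : XM) + t *: (S : XM)) t.
  by apply: differentiableD; [exact: differentiable_cst|exact: ex_diff].
exact: (@differentiable_comp R[i] R[i]^o XM R[i]^o _ G t d1 (eG _)).
Qed.
Lemma entire_linear (D : XC -> R[i]) (K : R) : 0 <= K -> (forall a P Q, D (a *: P + Q) = a * D P + D Q) ->
  (forall P, normc (D P) <= K * nrm P) -> entire D.
Proof.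
move=> K0 Dl DK P.
have Dlin : linear (D : XM -> R[i]^o) by move=> a u w; rewrite Dl.
pose dfM := GRing.isLinear.Build _ _ _ _ (D : XM -> R[i]^o) Dlin.
pose df : {linear XM -> R[i]^o} := HB.pack (D : XM -> R[i]^o) dfM.
apply: (@linear_differentiable _ XM R[i]^o df P).
apply: bounded_linear_continuous.
apply/linear_boundedP; exists K%:C%C; split; first by rewrite ger0_real// lecR.
move=> M MM h; rewrite normcE3 nrmE.
apply: le_trans (_ : K%:C%C * (nrm h)%:C%C <= _).
  by rewrite -rmorphM/= lecR; exact: DK.
by rewrite ler_wpM2r//; [rewrite lecR nrm_ge0|exact: ltW].
Qed.

Lemma entire_cst (a : R[i]) : entire (fun _ : XC => a).
Proof. by move=> P; exact: differentiable_cst. Qed.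

Lemma entireD F G : entire F -> entire G -> entire (fun P => F P + G P).
Proof. by move=> eF eG P; exact: (differentiableD (eF P) (eG P)). Qed.

Lemma entireM F G : entire F -> entire G -> entire (fun P => F P * G P).
Proof. by move=> eF eG P; exact: (differentiableM (eF P) (eG P)). Qed.

Lemma entire_cexp F : entire F -> entire (fun P => cexp (F P)).
Proof.
by move=> eF P; exact: (differentiable_comp (eF P) (differentiable_cexp (F P))).
Qed.

Lemma entire_sum m (F : 'I_m -> XC -> R[i]) : (forall i, entire (F i)) ->
  entire (fun P => \sum_i F i P).
Proof.
move=> eF P; have := differentiable_sum (fun i => eF i P).
by congr (differentiable _ _); apply/funext => Q; rewrite fct_sumE.
Qed.

Lemma entire_coord1 j : entire (fun P => P.1 ord0 j).
Proof.
apply: (entire_linear (K := 1)) => // [a P Q|P]; first by rewrite !mxE.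
by rewrite mul1r; exact: coord1_le.
Qed.

Lemma entire_coord2 j : entire (fun P => P.2 ord0 j).
Proof.
apply: (entire_linear (K := 1)) => // [a P Q|P]; first by rewrite !mxE.
by rewrite mul1r; exact: coord2_le.
Qed.

Lemma entire_dBB : entire (fun P => dB P P).
Proof.
by apply: entireD; apply: entire_sum => j; apply: entireM;
  (exact: entire_coord1 || exact: entire_coord2).
Qed.

Lemma entire_dB Z : entire (fun P => dB P Z).
Proof.
apply: (entire_linear (K := nrm1 Z)) => [|a P Q|P]; first exact: nrm1_ge0.
  by rewrite !dBE.
exact: normc_dB_le.
Qed.

(** On the complex line [t |-> p + t q] through two real points the difference is holomorphic in [t]
    and zero for real [t]; the point [P] is reached at [t = 'i]. *)
Lemma entire_eq F G : entire F -> entire G ->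
  (forall p : plane R n, F (cpoint p 0) = G (cpoint p 0)) -> F = G.
Proof.
move=> eF eG FG; apply/funext => P; set p := rep P; set q := imp P.
have -> : P = cpoint p 0 + 'i%C *: cpoint q 0.
  by apply: planeP => j; rewrite !mxE; apply: complexP => /=; ring.
apply/eqP; rewrite -subr_eq0; apply/eqP.
apply: (@holomorphic_eq0_of_real _ (fun t => F (cpoint p 0 + t *: cpoint q 0) -
  G (cpoint p 0 + t *: cpoint q 0))) => [z|x].
  by apply: differentiableB; exact: differentiable_ray.
have -> : cpoint p 0 + x%:C%C *: cpoint q 0 = cpoint (p + x *: q) 0.
  by apply: planeP => j; rewrite !mxE; apply: complexP => /=; ring.
by rewrite FG subrr.
Qed.

End entire_functions.

(** * Rotations of phase space *)

Section rotations.
Context {R : realType} {n : nat}.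
Local Notation X := (plane R n).
Local Notation Y := (X * X)%type.
Local Notation mu := (mu_plane R n).
Local Notation nu := (nu R n).
Implicit Types (s : Y).

(** Multiplication of [p + i q] by [a + i b], on pairs [(q, p)]. *)
Definition prot (a b : R) s : Y := (b *: s.2 + a *: s.1, a *: s.2 - b *: s.1).

Let shear2 (b : R) s : Y := (s.1, s.2 + b *: s.1).
Let shear1 (a : R) s : Y := (s.1 + a *: s.2, s.2).

Let m1 : measurable_fun setT (fun s : Y => s.1). Proof. exact: measurable_fst. Qed.
Let m2 : measurable_fun setT (fun s : Y => s.2). Proof. exact: measurable_snd. Qed.

Let mshear2 b : measurable_fun setT (shear2 b).
Proof.
apply/measurable_fun_pairP; split; first exact: m1.
by apply: measurable_planeD; [exact: m2|exact: measurable_plane_scale].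
Qed.

Let mshear1 b : measurable_fun setT (shear1 b).
Proof.
apply/measurable_fun_pairP; split; last exact: m2.
by apply: measurable_planeD; [exact: m1|exact: measurable_plane_scale].
Qed.

Lemma measurable_rot a b : measurable_fun setT (prot a b).
Proof.
by apply/measurable_fun_pairP; split; [apply: measurable_planeD|apply: measurable_planeB];
  exact: measurable_plane_scale.
Qed.

Let shear2_inv b (h : Y -> \bar R) : measurable_fun setT h -> (forall z, 0 <= h z)%E ->
  (\int[nu]_s h (shear2 b s) = \int[nu]_s h s)%E.
Proof.
move=> mh h0; have mhs : measurable_fun setT (fun s => h (shear2 b s)) by exact: (measurableT_comp mh).
rewrite /nu (fubini_tonelli1 _ mhs (fun z => h0 _)) (fubini_tonelli1 _ mh h0).
apply: eq_integral => q _; rewrite /fubini_F.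
apply: (ge0_integral_plane_shift (b *: q) (f := fun p => h (q, p))) => //.
exact: (measurableT_comp mh (pair1_measurable q)).
Qed.

Let shear1_inv b (h : Y -> \bar R) : measurable_fun setT h -> (forall z, 0 <= h z)%E ->
  (\int[nu]_s h (shear1 b s) = \int[nu]_s h s)%E.
Proof.
move=> mh h0; have mhs : measurable_fun setT (fun s => h (shear1 b s)) by exact: (measurableT_comp mh).
rewrite /nu (fubini_tonelli2 _ mhs (fun z => h0 _)) (fubini_tonelli2 _ mh h0).
apply: eq_integral => p _; rewrite /fubini_G.
apply: (ge0_integral_plane_shift (b *: p) (f := fun q => h (q, p))) => //.
exact: (measurableT_comp mh (pair2_measurable p)).
Qed.

(** A rotation by [th] is a product of three shears, the outer ones with parameter
    [t = tan (th / 2) = b / (1 + a)], and a shear is a translation in one variable while the other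
    is fixed. The half-turn [a = -1], where [t] is undefined, is the square of a quarter-turn. *)
Lemma ge0_integral_rot a b (h : Y -> \bar R) : a ^+ 2 + b ^+ 2 = 1 ->
  measurable_fun setT h -> (forall z, 0 <= h z)%E ->
  (\int[nu]_s h (prot a b s) = \int[nu]_s h s)%E.
Proof.
have key a' b' (h' : Y -> \bar R) : a' ^+ 2 + b' ^+ 2 = 1 -> 1 + a' != 0 ->
    measurable_fun setT h' -> (forall z, 0 <= h' z)%E ->
    (\int[nu]_s h' (prot a' b' s) = \int[nu]_s h' s)%E.
  move=> ab a1 mh h0; pose t := b' / (1 + a').
  transitivity (\int[nu]_s h' (shear2 (- t) (shear1 b' (shear2 (- t) s))))%E.
    apply: eq_integral => s _; congr h'.
    have tE : t * (1 + a') = b' by rewrite /t divfK.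
    have stE : b' * t = 1 - a'.
      by apply: (mulIf a1); rewrite -mulrA tE; move: ab; rewrite !expr2 => ab2; lra.
    have aE : a' = 1 - b' * t by rewrite stE; ring.
    have bE (x : R) : b' * x = (2 * t - t * t * b') * x by rewrite -{1}tE aE; ring.
    rewrite /prot /shear2 /shear1/=; congr (_, _); apply: planeP => j; rewrite !mxE aE; first 2 last.
    - by rewrite (bE (s.1.1 ord0 j)); ring.
    - by rewrite (bE (s.1.2 ord0 j)); ring.
    - by ring.
    - by ring.
  rewrite (shear2_inv (- t) (h := fun s => h' (shear2 (- t) (shear1 b' s))))//; last first.
    by apply: (measurableT_comp mh); apply: (measurableT_comp (mshear2 _)).
  rewrite (shear1_inv b' (h := fun s => h' (shear2 (- t) s)))//; last exact: (measurableT_comp mh).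
  exact: shear2_inv.
move=> ab mh h0; have [a1|a1] := eqVneq (1 + a) 0; last exact: key.
have aE : a = -1 by apply/eqP; rewrite -addr_eq0 addrC a1.
have bE : b = 0.
  by apply/eqP; rewrite -sqrf_eq0; apply/eqP; move: ab; rewrite aE sqrrN expr1n => /eqP; rewrite -subr_eq0 addrC addrA addNr add0r => /eqP.
have h01 : (0 : R) ^+ 2 + 1 ^+ 2 = 1 by rewrite expr1n expr0n add0r.
have n0 : (1 : R) + 0 != 0 by rewrite addr0 oner_neq0.
transitivity (\int[nu]_s h (prot 0 1 (prot 0 1 s)))%E.
  by apply: eq_integral => s _; rewrite /prot/= aE bE !scale0r !scale1r !scaleN1r !add0r !addr0 ?sub0r ?subr0 ?oppr0 ?addr0.
rewrite (key 0 1 (fun s => h (prot 0 1 s)))//; last exact: (measurableT_comp mh (measurable_rot _ _)).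
exact: key.
Qed.

Lemma cpoint_rot (th : R) s : cpoint (prot (cos th) (sin th) s).2 (prot (cos th) (sin th) s).1 =
  cexp (0 +i* th)%C *: cpoint s.2 s.1.
Proof.
rewrite (_ : cexp (0 +i* th)%C = (cos th +i* sin th)%C); last by rewrite /cexp/= expR0 !mul1r.
by apply: planeP => j; rewrite !mxE; apply: complexP => /=; ring.
Qed.

Lemma sqn_rot a b s : a ^+ 2 + b ^+ 2 = 1 ->
  sqn (prot a b s).1 + sqn (prot a b s).2 = sqn s.1 + sqn s.2.
Proof.
move=> ab; rewrite /prot/= !sqnE !dBE (dBC s.1 s.2).
rewrite (_ : _ + _ = (a ^+ 2 + b ^+ 2) * (dB s.1 s.1 + dB s.2 s.2)); first by rewrite ab mul1r.
by ring.
Qed.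

Lemma dOm_rot a b s : a ^+ 2 + b ^+ 2 = 1 -> dOm (prot a b s).2 (prot a b s).1 = dOm s.2 s.1.
Proof.
move=> ab; rewrite /prot/= !dOmE (dOmC s.1 s.2) !dOmxx.
rewrite [LHS](_ : _ = (a ^+ 2 + b ^+ 2) * dOm s.2 s.1); first by rewrite ab mul1r.
by ring.
Qed.

End rotations.

(** * The reproducing formula *)

Section reproducing.
Context {R : realType} {n : nat} (c : kparams R).
Local Notation X := (plane R n).
Local Notation Y := (X * X)%type.
Local Notation YX := (X * X * X)%type.
Local Notation XY := (X * (X * X))%type.
Local Notation mu := (mu_plane R n).
Local Notation nu := (nu R n).
Local Notation lp := (lpt R).
Local Notation kap := (kap c).
Local Notation wt := (wt c).
Local Notation sw := (sw c).
Local Notation ker := (ker c).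
Local Notation chi := (chi c).
Local Notation Tr := (Tr c).
Local Notation Ts := (Ts c).
Local Notation qper := (qper c).
Local Notation qperY := (qperY c).
Local Notation unorm := (unorm c).
Local Notation ynorm2 := (ynorm2 c).
Implicit Types (p q x : X) (z w : Y) (l : lattice n) (f : X -> R[i]) (g : Y -> R[i]).

(** The exponent of the non-holomorphic factor of the recentred [ker * wt]; both of its terms are
    invariant under multiplication of [p + i q] by a phase. *)
Definition hq z : R := (gam c + del c) * (sqn z.1 + sqn z.2) - lam c * dOm z.2 z.1.

Let C : R := amp2 c ^+ n * W0 (n := n) c.

Let C_gt0 : 0 < C.
Proof. by rewrite mulr_gt0 ?exprn_gt0 ?amp2_gt0 ?W0_gt0. Qed.

Lemma measurable_hq : measurable_fun setT (fun z : Y => expR (- hq z)).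
Proof.
apply: measurable_expR_fun; apply: measurableT_comp => //; apply: measurable_funB; apply: measurable_funM => //.
  by apply: measurable_funD; apply: measurable_sqn; [exact: measurable_fst|exact: measurable_snd].
by apply: measurable_dOm; [exact: measurable_snd|exact: measurable_fst].
Qed.

(** Integrating out [p] leaves a Gaussian in [q] of rate [al - lam ^+ 2 / (4 * al) = (gam - del) ^+
    2 / al]. The product of the two Gaussian integrals is [(pi / (gam - del)) ^+ (2 * n)], and the
    normalisation [W0] of the weight is exactly what makes this the inverse of [C]. *)
Lemma integral_hq : (\int[nu]_z (expR (- hq z))%:E = (C^-1)%:E)%E.
Proof.
have g0 := gam_gt0 c; have d0 := del_gt0 c; have gd := del_lt_gam c.
pose al := gam c + del c.
have al0 : 0 < al by rewrite addr_gt0.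
have gdN : gam c - del c != 0 by rewrite gt_eqF// subr_gt0.
pose be := (gam c - del c) ^+ 2 / al.
have be0 : 0 < be by rewrite divr_gt0// exprn_gt0// subr_gt0.
have mh : measurable_fun setT (fun z : Y => (expR (- hq z))%:E) by apply/measurable_EFinP; exact: measurable_hq.
rewrite /nu (fubini_tonelli1 _ mh (fun z => _)) ?lee_fin ?expR_ge0// /fubini_F.
transitivity (\int[mu]_q (((pi / al) ^+ n)%:E * (expR (- (be * sqn q)))%:E))%E.
  apply: eq_integral => q _.
  transitivity ((expR (- (al * sqn q)))%:E * \int[mu]_p (expR (dB (lam c *: rJ q) p - al * sqn p))%:E)%E.
    rewrite -ge0_integralZl//; last first.
      apply/measurable_EFinP; apply: measurable_expR_fun; apply: measurable_funB.
        by apply: measurable_dB => //; exact: measurable_cst.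
      by apply: measurable_funM => //; exact: measurable_sqn.
    apply: eq_integral => p _; rewrite -EFinM -expRD; congr (expR _)%:E.
    by rewrite /hq/= dBZl dBC dB_rJ -/al; ring.
  rewrite integral_gauss_shifted// -!EFinM mulrCA -expRD; congr (_ * expR _)%:E.
  rewrite (sqnE (_ *: _)) !dBE dB_rJ2 -sqnE /be.
  have alN : al != 0 by rewrite gt_eqF.
  rewrite (_ : lam c * (lam c * sqn q) = lam c ^+ 2 * sqn q); last by ring.
  by rewrite lam_sqr; move: alN; rewrite /al => alN; field.
have mq : measurable_fun setT (fun q : X => (expR (- (be * sqn q)))%:E).
  by apply/measurable_EFinP; exact: measurable_gauss.
rewrite (ge0_integralZl _ measurableT mq (fun q _ => _)) ?lee_fin ?expR_ge0//; last first.
  by rewrite exprn_ge0// divr_ge0 ?pi_ge0// ltW.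
rewrite integral_gauss_plane// -EFinM; congr _%:E.
have pN : pi != 0 :> R by rewrite gt_eqF ?pi_gt0.
have alN : al != 0 by rewrite gt_eqF.
rewrite /C /W0 mulrCA -!exprMn -exprVn; congr (_ ^+ n).
rewrite /be /amp2; move: pi pN => P PN; field.
by rewrite PN alN gdN.
Qed.

Context (G : plane R[i] n -> R[i]) (z0 : Y).
Context (eG : entire G).

Let g z := G (cpoint z.2 z.1).

Context (gq : qperY g).
Context (goo : (ynorm2 g < +oo)%E).

(** [zr] and [zi] are the real and imaginary parts of the linear coefficient that appears when the
    kernel is recentred at [z0]. *)
Let zr : X := (lam c / 2) *: rJ z0.1.
Let zi : X := (2 * (gam c + del c)) *: z0.1 + (lam c / 2) *: rJ z0.2.

Let hol (S : plane R[i] n) : R[i] := ((gam c + del c) / 2)%:C%C * dB S S + dB S (cpoint zr zi).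

(** Recentring at [z0] separates a phase-invariant Gaussian from the exponential of a holomorphic
    quadratic polynomial that vanishes at 0; [G] can be multiplied by this exponential without
    leaving the entire functions. *)
Let kernel_hol s : ker z0.2 z0.1 (s.2 + z0.2) (s.1 + z0.1) * (wt (s.2 + z0.2) (s.1 + z0.1))%:C%C =
  C%:C%C * ((expR (- hq s))%:C%C * cexp (hol (cpoint s.2 s.1))).
Proof.
rewrite /hol /zr /zi; set q := s.1; set p := s.2; set q0 := z0.1; set p0 := z0.2.
have wE (a b : X) : (wt a b)%:C%C = (W0 (n := n) c)%:C%C *
    cexp (lam c * dOm a b - 2 * (gam c + del c) * sqn b)%:C%C.
  by rewrite cexp_real /wt; apply: complexP; rewrite ?(cReM, cImM)/=; ring.
have CE : C%:C%C = (amp2 c ^+ n)%:C%C * (W0 (n := n) c)%:C%C by rewrite /C (rmorphM (real_complex R)).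
rewrite CE wE /ker mulrACA -(cexp_real (- hq s)) -!cexpD; congr (_ * cexp _).
rewrite !dB_cpoint /hq -/p -/q.
apply: complexP; rewrite ?(cReD, cImD, cReM, cImM)/= ?sqnE !(dBE, dOmE) ?dB_rJ ?dOmxx.
  rewrite ?(dBC p0 p) ?(dBC q0 q) ?(dOmC q0) ?(dOmC p0) ?dOmxx.
  by field.
rewrite ?(dBC p0) ?(dBC q0) ?(dBC q p) ?(dOmC q0) ?(dOmC p0) ?dOmxx.
by field.
Qed.

Let u (S : plane R[i] n) : R[i] := G (cpoint z0.2 z0.1 + S) * cexp (hol S).

Let eu : entire u.
Proof.
apply: entireM; first exact: entire_shift.
apply: entire_cexp; apply: entireD; last exact: entire_dB.
by apply: entireM; [exact: entire_cst|exact: entire_dBB].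
Qed.

Let E z : R[i] := (expR (- hq z))%:C%C * u (cpoint z.2 z.1).

Let mz d (T : measurableType d) (f : T -> Y) (a : T -> R[i]) : measurable_fun setT f -> cmeasurable a ->
  cmeasurable (fun t => u (a t *: cpoint (f t).2 (f t).1)).
Proof.
move=> mf ma.
have mc (h : T -> 'rV[R]_n) j : measurable_fun setT h -> measurable_fun setT (fun t => h t ord0 j).
  by move=> mh; exact: (measurableT_comp (measurable_coord j) mh).
have m1 := measurableT_comp measurable_fst mf; have m2 := measurableT_comp measurable_snd mf.
apply: cmeasurable_entire => // j; under eq_fun do rewrite !mxE; apply: cmeasurableM => //; split => /=; apply: mc.
- exact: (measurableT_comp measurable_fst m2).
- exact: (measurableT_comp measurable_fst m1).
- exact: (measurableT_comp measurable_snd m2).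
- exact: (measurableT_comp measurable_snd m1).
Qed.

Let mE : cmeasurable E.
Proof.
apply: cmeasurableM; first by apply: cmeasurable_real; exact: measurable_hq.
rewrite (_ : (fun z : Y => u (cpoint z.2 z.1)) = (fun z => u (1 *: cpoint z.2 z.1))).
  exact: (@mz _ Y id (fun=> 1) (@measurable_id _ _ setT) (cmeasurable_cst _ 1)).
by apply/funext => z; rewrite scale1r.
Qed.

Let mg : cmeasurable g.
Proof.
have mc (h : Y -> 'rV[R]_n) j : measurable_fun setT h -> measurable_fun setT (fun t => h t ord0 j).
  by move=> mh; exact: (measurableT_comp (measurable_coord j) mh).
apply: cmeasurable_entire => // j; under eq_fun do rewrite !mxE; split => /=; apply: mc.
- exact: (measurableT_comp measurable_fst measurable_snd).
- exact: (measurableT_comp measurable_fst measurable_fst).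
- exact: (measurableT_comp measurable_snd measurable_snd).
- exact: (measurableT_comp measurable_snd measurable_fst).
Qed.

Let Phi w : R[i] := g w * ker z0.2 z0.1 w.2 w.1 * (wt w.2 w.1)%:C%C.

Let PhiE s : Phi (s + z0) = C%:C%C * E s.
Proof.
rewrite /Phi /= -mulrA kernel_hol /E /u /g.
rewrite (_ : cpoint z0.2 z0.1 + cpoint s.2 s.1 = cpoint (s.2 + z0.2) (s.1 + z0.1)); first by ring.
by rewrite cpointD addrC (addrC z0.1).
Qed.

Let PhiI : cintegrable nu Phi.
Proof. exact: cintegrable_gker. Qed.

Let EI : cintegrable nu E.
Proof.
split => //; have [mP Pfin] := PhiI.
have : (\int[nu]_s (normc (Phi (s + z0)))%:E < +oo)%E.
  rewrite (ge0_integral_nu_shift z0 (h := fun z => (normc (Phi z))%:E))//.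
    by apply/measurable_EFinP; exact: measurable_normc.
  by move=> z; rewrite lee_fin normc_ge0.
have mnE : measurable_fun setT (fun s => (normc (E s))%:E).
  by apply/measurable_EFinP; exact: measurable_normc.
have nE0 s : (0 <= (normc (E s))%:E)%E by rewrite lee_fin normc_ge0.
have -> : (\int[nu]_s (normc (Phi (s + z0)))%:E = \int[nu]_s (C%:E * (normc (E s))%:E))%E.
  apply: eq_integral => s _.
  by rewrite PhiE (Normc.normcM C%:C%C) normc_real ger0_norm ?(ltW C_gt0)// EFinM.
rewrite (ge0_integralZl _ measurableT mnE (fun s _ => nE0 s)) ?lee_fin ?(ltW C_gt0)//.
case: (\int[nu]_s _)%E => [r _| |_]; [exact: ltry| |by []].
by rewrite gt0_muley ?lte_fin.
Qed.

Let I := cintegral nu E.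

Let rot_unit (th : R) : cos th ^+ 2 + sin th ^+ 2 = 1 := cos2Dsin2 th.

Let Erot th s : E (prot (cos th) (sin th) s) =
  (expR (- hq s))%:C%C * u (cexp (0 +i* th)%C *: cpoint s.2 s.1).
Proof. by rewrite /E cpoint_rot /hq sqn_rot// dOm_rot. Qed.

Let Irot th : cintegral nu (fun s => (expR (- hq s))%:C%C * u (cexp (0 +i* th)%C *: cpoint s.2 s.1)) = I.
Proof.
transitivity (cintegral nu (fun s => E (prot (cos th) (sin th) s))).
  by apply: eq_cintegral => s; rewrite Erot.
apply: (cintegral_invariant (s := prot (cos th) (sin th)) mE) => h mh h0.
exact: (ge0_integral_rot (rot_unit th) mh h0).
Qed.

Let rotI th : cintegrable nu (fun s => (expR (- hq s))%:C%C * u (cexp (0 +i* th)%C *: cpoint s.2 s.1)).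
Proof.
rewrite (_ : (fun s => _) = (fun s => E (prot (cos th) (sin th) s))); last first.
  by apply/funext => s; rewrite Erot.
split; first by apply: (cmeasurable_comp (f := E)) => //; exact: measurable_rot.
have mnE : measurable_fun setT (fun s => (normc (E s))%:E).
  by apply/measurable_EFinP; exact: measurable_normc.
have nE0 s : (0 <= (normc (E s))%:E)%E by rewrite lee_fin normc_ge0.
by rewrite (ge0_integral_rot (rot_unit th) mnE nE0); case: EI.
Qed.

Let leb : {sigma_finite_measure set (measurableTypeR R) -> \bar R} := @lebesgue_measure R.

Let F (y : measurableTypeR R * Y) : R[i] := (\1_`]0, 2 * pi] y.1 : R)%:C%C *
  ((expR (- hq y.2))%:C%C * u (cexp (0 +i* y.1)%C *: cpoint y.2.2 y.2.1)).

Let mF : cmeasurable F.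
Proof.
apply: cmeasurableM.
  apply: cmeasurable_real; apply: (measurableT_comp _ measurable_fst).
  by apply: measurable_indic; exact: measurable_itv.
apply: cmeasurableM.
  by apply: cmeasurable_real; exact: (measurableT_comp measurable_hq measurable_snd).
apply: mz; first exact: measurable_snd.
by apply: cmeasurable_cexp; split => /=; [exact: measurable_cst|exact: measurable_fst].
Qed.

Let pi2 : (0 : R) <= 2 * pi.
Proof. by rewrite mulr_ge0 ?pi_ge0. Qed.

Let Ffin : (\int[leb]_x \int[nu]_y (normc (F (x, y)))%:E < +oo)%E.
Proof.
have mnE : measurable_fun setT (fun s => (normc (E s))%:E).
  by apply/measurable_EFinP; exact: measurable_normc.
have nE0 s : (0 <= (normc (E s))%:E)%E by rewrite lee_fin normc_ge0.
have [_ Efin] := EI.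
have -> : (\int[leb]_x \int[nu]_y (normc (F (x, y)))%:E =
    \int[leb]_x ((\1_`]0, 2 * pi] x : R)%:E * \int[nu]_s (normc (E s))%:E))%E.
  apply: eq_integral => th _.
  rewrite -(ge0_integral_rot (rot_unit th) mnE nE0).
  have mr : measurable_fun setT (fun s => (normc (E (prot (cos th) (sin th) s)))%:E).
    exact: (measurableT_comp mnE (measurable_rot _ _)).
  have i0 : (0 <= (\1_`]0%R, (2 * pi)%R] th : R)%:E)%E by rewrite lee_fin.
  rewrite -(ge0_integralZl _ measurableT mr (fun s _ => nE0 _) i0).
  apply: eq_integral => s _; rewrite Erot /F (Normc.normcM (\1_`]0, 2 * pi] _)%:C%C) normc_real.
  by rewrite ger0_norm ?EFinM.
rewrite ge0_integralZr//.
- by rewrite integral_indic_ocitv// lte_mul_pinfty// ?lee_fin ?subr0.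
- by apply/measurable_EFinP; apply: measurable_indic; exact: measurable_itv.
- by apply: integral_ge0.
Qed.

(** The integral [I] is unchanged when the argument of [u] is rotated, so it equals its average over
    all angles. After Fubini, the mean value property replaces the average of [u] over each circle
    by [u 0 = g z0], since [hol 0 = 0], and [integral_hq] supplies the remaining factor [C^-1]. *)
Lemma reproducing : Kg c g z0 = g z0.
Proof.
have mP : cmeasurable Phi by case: PhiI.
have -> : Kg c g z0 = C%:C%C * I.
  rewrite /Kg -[LHS]/(cintegral nu Phi) -(cintegral_nu_shift z0 mP) /I -cintegralZl//.
  by apply: eq_cintegral => s; rewrite PhiE.
suff IE : (2 * pi)%:C%C * I = (2 * pi)%:C%C * (g z0 * (C^-1)%:C%C).
  have pN : (2 * pi)%:C%C != 0 :> R[i].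
    by rewrite -normc0_eq normc_real normr_eq0 mulf_neq0 ?gt_eqF ?pi_gt0.
  transitivity (C%:C%C * (g z0 * (C^-1)%:C%C)); first by congr (_ * _); exact: (mulfI pN IE).
  by rewrite mulrCA -(rmorphM (real_complex R)) mulfV ?gt_eqF//= mulr1.
have pc := path_continuous_cst I.
rewrite -[(2 * pi)%:C%C * I](_ : cint 0 (2 * pi) (fun _ => I) = _); last by rewrite cint_cst// subr0.
transitivity (cintegral leb (fun th => cintegral nu (fun s => F (th, s)))).
  apply: eq_cintegral => th.
  transitivity ((\1_`]0, 2 * pi] th : R)%:C%C *
    cintegral nu (fun s => (expR (- hq s))%:C%C * u (cexp (0 +i* th)%C *: cpoint s.2 s.1))).
    by rewrite (Irot th).
  apply/esym; exact: (cintegralZl (\1_`]0, 2 * pi] th : R)%:C%C (rotI th)).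
rewrite (cfubini mF Ffin).
transitivity (cintegral nu (fun s => (2 * pi)%:C%C * g z0 * (expR (- hq s))%:C%C)).
  apply: eq_cintegral => s.
  (* The point [s] is fixed, and the mean value property is used for one complex variable, on the
     unit circle of the complex line through it. *)
  pose v (t : R[i]) := (expR (- hq s))%:C%C * u (0 + t *: cpoint s.2 s.1).
  have dv (t : R[i]^o) : differentiable (v : R[i]^o -> R[i]^o) t.
    apply: (@differentiable_mulr _ (fun=> _)); first exact: differentiable_cst.
    exact: differentiable_ray.
  transitivity (cint 0 (2 * pi) (fun th => v (0 + (1 : R)%:C%C * cexp (0 +i* th)%C))).
    by apply: eq_cintegral => th; rewrite /F /v/= add0r mul1r add0r.
  rewrite circle_mean_value// /v scale0r addr0 /u addr0 /hol dB0l !dB0l mulr0 addr0 cexp0 mulr1.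
  by rewrite /g; ring.
rewrite cintegralZl; last first.
  split; first by apply: cmeasurable_real; exact: measurable_hq.
  under eq_integral do rewrite normc_real ger0_norm ?expR_ge0//.
  by rewrite integral_hq ltry.
by rewrite cintegral_real /Rintegral integral_hq/= mulrA.
Qed.

End reproducing.

(** * Surjectivity *)
Section complex_limits.
Context {R : realType}.
Implicit Types (F : nat -> R[i]) (a b : R[i]).

Definition cto F a := normc (F j - a) @[j --> \oo] --> (0 : R).

Lemma cto_unique F a b : cto F a -> cto F b -> a = b.
Proof.
move=> ha hb; apply/eqP; rewrite -subr_eq0 -normc0_eq; apply/eqP.
have h : normc (F j - a) + normc (F j - b) @[j --> \oo] --> (0 + 0 : R) by exact: cvgD.
have h2 : (normc (a - b) : R) @[j --> \oo] --> (0 : R).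
  apply: (@squeeze_cvgr _ _ _ _ (fun=> 0) (fun j => normc (F j - a) + normc (F j - b))).
  - apply: nearW => j; rewrite normc_ge0/= (_ : a - b = - (F j - a) + (F j - b)); last by ring.
    by apply: le_trans (le_normcD _ _) _; rewrite normcN.
  - exact: cvg_cst.
  - by rewrite addr0 in h.
have := cvg_unique (@Rhausdorff R) h2 (cvg_cst (normc (a - b))) => <-//.
Qed.

Lemma cto_part F a (r : R[i] -> R) : (forall z w, `|r z - r w| <= normc (z - w)) ->
  cto F a -> r (F j) @[j --> \oo] --> r a.
Proof.
move=> rl h; apply/cvgrPdist_le => e e0.
have /cvgrPdist_le/(_ _ e0) := h; apply: filterS => j.
rewrite sub0r normrN ger0_norm ?normc_ge0// => he; apply: le_trans (rl _ _) _.
by rewrite -normcN opprB.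
Qed.

Lemma absReB z w : `|complex.Re z - complex.Re w| <= normc (z - w) :> R.
Proof. by rewrite -cReN -cReD absRe_le. Qed.

Lemma absImB z w : `|complex.Im z - complex.Im w| <= normc (z - w) :> R.
Proof. by rewrite -cImN -cImD absIm_le. Qed.

Lemma normcB_abs z w : `|normc z - normc w| <= normc (z - w) :> R.
Proof.
have h1 : normc z <= normc (z - w) + normc w by rewrite -{1}(subrK w z); exact: le_normcD.
have h2 : normc w <= normc (z - w) + normc z.
  by rewrite -[normc (z - w)]normcN opprB -{1}(subrK z w); exact: le_normcD.
by rewrite ler_norml; apply/andP; split; lra.
Qed.

Lemma ctoZ F a b : cto F a -> cto (fun j => b * F j) (b * a).
Proof.
move=> h; rewrite /cto; under eq_fun do rewrite -mulrBr Normc.normcM.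
have h2 : normc b * normc (F j - a) @[j --> \oo] --> normc b * 0 by apply: cvgM => //; exact: cvg_cst.
by rewrite mulr0 in h2.
Qed.

Lemma ctoP F a : complex.Re (F j) @[j --> \oo] --> complex.Re a ->
  complex.Im (F j) @[j --> \oo] --> complex.Im a -> cto F a.
Proof.
move=> hr hi.
have h : `|complex.Re (F j) - complex.Re a| + `|complex.Im (F j) - complex.Im a| @[j --> \oo] --> (0 + 0 : R).
  apply: cvgD; rewrite -[X in _ --> X](normr0 R); apply: cvg_norm.
    by rewrite -[X in _ --> X](subrr (complex.Re a)); apply: cvgB => //; exact: cvg_cst.
  by rewrite -[X in _ --> X](subrr (complex.Im a)); apply: cvgB => //; exact: cvg_cst.
rewrite addr0 in h; apply: (@squeeze_cvgr _ _ _ _ (fun=> 0) _ _ _ _ _ h); last exact: cvg_cst.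
apply: nearW => j; rewrite normc_ge0/=; apply: le_trans (normc_le _) _.
by rewrite cReD cReN cImD cImN.
Qed.

(** Absolutely summable increments: the real and imaginary parts are telescoping series that
    converge absolutely. *)
Lemma cto_ex F (M : R) : (forall m, \sum_(0 <= i < m) normc (F i.+1 - F i) <= M) ->
  exists a, cto F a.
Proof.
move=> HM.
have key (r : R[i] -> R) : (forall z w, `|r z - r w| <= normc (z - w)) ->
    cvgn (fun j => r (F j)).
  move=> rl; pose u (i : nat) : R := r (F i.+1) - r (F i).
  have cs : cvgn (series u).
    apply: normed_cvg; apply: nondecreasing_is_cvgn.
      by apply: (@nondecreasing_series R (fun i => `|u i|) xpredT 0%N) => i _ _.
    exists M => _ [m _ <-]; apply: le_trans (HM m); rewrite /series/=.
    by apply: ler_sum => i _; exact: rl.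
  have -> : (fun j => r (F j)) = (fun j => series u j + r (F 0%N)).
    by apply/funext => j; rewrite /series/= telescope_sumr// subrK.
  by apply: is_cvgD => //; exact: is_cvg_cst.
have /cvg_ex[a ha] := key _ absReB; have /cvg_ex[b hb] := key _ absImB.
by exists (a +i* b)%C; exact: ctoP.
Qed.

End complex_limits.

(** * Completeness of L^2 with quasi-periodic representatives *)

Section riesz_fischer.
Context {R : realType} {n : nat} (c : kparams R).
Local Notation X := (plane R n).
Local Notation mu := (mu_plane R n).
Local Notation lp := (lpt R).
Local Notation qper := (qper (n := n) c).
Implicit Types (x : X) (l : lattice n) (f : X -> R[i]).

Context (F : nat -> X -> R[i]) (B : R).
Context (mF : forall i, cmeasurable (F i)).
Context (qF : forall i, qper (F i)).
Context (F0fin : (norm2 (F 0%N) < +oo)%E).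
Context (FB : forall i, (norm2 (fun x => F i.+1 x - F i x)%R <= (B * 8^-1 ^+ i)%:E)%E).

Let u i x := F i.+1 x - F i x.

Let mu_ i : cmeasurable (u i). Proof. exact: cmeasurableB. Qed.

(** The weight [2 ^+ i] is large enough for a finite sum to force pointwise convergence of [F], and
    small enough to remain summable against [8^-1 ^+ i]: the product is [4^-1 ^+ i]. *)
Let Us i x : \bar R := (2 ^+ i * normc (u i x) ^+ 2)%:E.

Let Us0 i x : (0 <= Us i x)%E.
Proof. by rewrite lee_fin mulr_ge0 ?sqr_ge0// exprn_ge0. Qed.

Let mUs i : measurable_fun setT (Us i).
Proof.
by apply/measurable_EFinP; apply: measurable_funM => //; apply: measurable_funX; exact: measurable_normc.
Qed.

Let U x : \bar R := ((normc (F 0%N x) ^+ 2)%:E + \sum_(i <oo) Us i x)%E.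

Let mFs : measurable_fun setT (fun x => (normc (F 0%N x) ^+ 2)%:E).
Proof. by apply/measurable_EFinP; apply: measurable_funX; exact: measurable_normc. Qed.

Let Fs0 x : (0 <= (normc (F 0%N x) ^+ 2)%:E)%E.
Proof. by rewrite lee_fin sqr_ge0. Qed.

Let mS : measurable_fun setT (fun x => \sum_(i <oo) Us i x)%E.
Proof.
have := @ge0_emeasurable_sum _ _ R setT Us xpredT (fun i x _ _ => Us0 i x) (fun i _ => mUs i).
exact.
Qed.

Let S0 x : (0 <= \sum_(i <oo) Us i x)%E.
Proof. by apply: nneseries_ge0 => i _ _. Qed.

Let mU : measurable_fun setT U.
Proof. exact: emeasurable_funD. Qed.

Let U0 x : (0 <= U x)%E.
Proof. exact: adde_ge0. Qed.

Let mi : measurable_fun setT (fun x : X => (icube x)%:E).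
Proof. by apply/measurable_EFinP; exact: measurable_icube. Qed.

Let i0 x : (0 <= (icube x)%:E :> \bar R)%E.
Proof. by rewrite lee_fin icube_ge0. Qed.

Let Ufin : (\int[mu]_x ((icube x)%:E * U x) < +oo)%E.
Proof.
rewrite (_ : (\int[mu]_x ((icube x)%:E * U x) = norm2 (F 0%N) +
    \int[mu]_x (\sum_(i <oo) ((icube x)%:E * Us i x)))%E); last first.
  rewrite -ge0_integralD//.
  - apply: eq_integral => x _; rewrite /U ge0_muleDr// EFinM; congr (_ + _)%E.
    by rewrite nneseriesZl.
  - by move=> x _; rewrite lee_fin mulr_ge0 ?icube_ge0 ?sqr_ge0.
  - by under eq_fun do rewrite EFinM; exact: emeasurable_funM.
  - by move=> x _; apply: nneseries_ge0 => i _ _; exact: mule_ge0.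
  - apply: (@ge0_emeasurable_sum _ _ R setT (fun i x => (icube x)%:E * Us i x)%E xpredT).
      by move=> i x _ _; exact: mule_ge0.
    by move=> i _; exact: emeasurable_funM.
rewrite lte_add_pinfty// integral_nneseries//; last 2 first.
- by move=> i; exact: emeasurable_funM.
- by move=> i x _; exact: mule_ge0.
have E i : (\int[mu]_x ((icube x)%:E * Us i x) <= (B * 4^-1 ^+ i)%:E)%E.
  have -> : (\int[mu]_x ((icube x)%:E * Us i x) = (2 ^+ i)%:E * norm2 (u i))%E.
    rewrite /norm2 -ge0_integralZl//.
    - by apply: eq_integral => x _; rewrite /Us -!EFinM; congr _%:E; ring.
    - under eq_fun do rewrite EFinM; apply: emeasurable_funM => //.
      by apply/measurable_EFinP; apply: measurable_funX; exact: measurable_normc.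
    - by move=> x _; rewrite lee_fin mulr_ge0 ?icube_ge0 ?sqr_ge0.
  apply: le_trans (lee_wpmul2l _ (FB i)) _; first by rewrite lee_fin exprn_ge0.
  rewrite -EFinM lee_fin mulrCA -exprMn.
  by rewrite (_ : 2 * 8^-1 = 4^-1 :> R)//; field.
have B0 : 0 <= B.
  have := FB 0%N; rewrite expr0 mulr1 => h; rewrite -lee_fin; apply: le_trans h.
  by apply: integral_ge0 => x _; rewrite lee_fin mulr_ge0 ?icube_ge0 ?sqr_ge0.
apply: (@le_lt_trans _ _ (2 * B)%:E); last exact: ltry.
apply: lime_le.
  by apply: is_cvg_nneseries => i _ _; apply: integral_ge0 => x _; exact: mule_ge0.
apply: nearW => k; apply: le_trans (_ : (\sum_(0 <= i < k) (B * 4^-1 ^+ i)%:E <= _)%E).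
  by apply: lee_sum => i _; exact: E.
rewrite sumEFin lee_fin -mulr_sumr mulrC ler_wpM2r//.
have : \sum_(0 <= i < k) 4^-1 ^+ i <= 2 * (1 - 4^-1 ^+ k) :> R.
  elim: k => [|k ih]; first by rewrite big_nil expr0 subrr mulr0.
  rewrite big_nat_recr//= exprS.
  have q0 : 0 <= 4^-1 ^+ k :> R by rewrite exprn_ge0.
  set s := BIG_F in ih *; set q := 4^-1 ^+ k in ih q0 *; lra.
have q0 : 0 <= 4^-1 ^+ k :> R by rewrite exprn_ge0.
by lra.
Qed.

Let V m x := normc (F 0%N x) ^+ 2 + \sum_(0 <= i < m) 2 ^+ i * normc (u i x) ^+ 2.

Let V0 m x : 0 <= V m x.
Proof. by rewrite addr_ge0 ?sqr_ge0// sumr_ge0// => i _; rewrite mulr_ge0 ?sqr_ge0// exprn_ge0. Qed.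

Let VU m x : ((V m x)%:E <= U x)%E.
Proof.
rewrite /V /U EFinD leeD2l// -sumEFin.
apply: (@nneseries_lim_ge R (fun i => Us i x) xpredT 0%N m) => i _ _; exact: Us0.
Qed.

(** Induction with [(a + b) ^+ 2 <= (al + q) * (a ^+ 2 / al + b ^+ 2 / q)] for [q = 2^-1 ^+ m] and
    [al = 3 - 2 * q]. Then [al + q] is the coefficient of the next step, and all coefficients stay
    below 3. *)
Let FV m x : normc (F m x) ^+ 2 <= (3 - 2 * 2^-1 ^+ m) * V m x.
Proof.
elim: m => [|m ih]; first by rewrite expr0 /V big_nil addr0; apply: eq_ler; ring.
have q0 : 0 < 2^-1 ^+ m :> R by rewrite exprn_gt0.
have q1 : 2^-1 ^+ m <= 1 :> R by rewrite exprn_ile1// invf_le1// ler1n.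
rewrite [2^-1 ^+ m.+1]exprS; set q := 2^-1 ^+ m in ih q0 q1 *.
have tq : 2 ^+ m * q = 1 by rewrite /q -exprMn divff ?expr1n.
have -> : V m.+1 x = V m x + 2 ^+ m * normc (u m x) ^+ 2 by rewrite /V big_nat_recr//= addrA.
set a := normc (F m x) in ih *; set b := normc (u m x); set v := V m x in ih *; set t := 2 ^+ m in tq *.
have tri : normc (F m.+1 x) <= a + b.
  by rewrite -(subrK (F m x) (F m.+1 x)) addrC; exact: le_normcD.
have [a0 b0] : 0 <= a /\ 0 <= b by split; exact: normc_ge0.
have al0 : 0 < 3 - 2 * q by lra.
have -> : 3 - 2 * (2^-1 * q) = (3 - 2 * q) + q by field.
apply: (@le_trans _ _ ((a + b) ^+ 2)).
  by rewrite lerXn2r ?nnegrE ?normc_ge0 ?addr_ge0.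
have tE : t = q^-1 by apply: (mulIf (lt0r_neq0 q0)); rewrite tq mulVf ?lt0r_neq0.
have h : (a + b) ^+ 2 <= (3 - 2 * q + q) * (a ^+ 2 / (3 - 2 * q) + t * b ^+ 2).
  rewrite -subr_ge0 tE (_ : _ - _ = (q * a - (3 - 2 * q) * b) ^+ 2 / ((3 - 2 * q) * q)).
    by rewrite divr_ge0 ?sqr_ge0// mulr_ge0// ltW.
  by field; rewrite !lt0r_neq0.
apply: le_trans h _; apply: ler_wpM2l; first by rewrite addr_ge0// ltW.
by rewrite lerD2r ler_pdivrMr// mulrC.
Qed.

(** Off the set where [U] is finite everything is replaced by 0, so that convergence and domination
    hold at every point. The set is lattice invariant by [Uper], hence quasi-periodicity
    survives. *)
Let iN x : R := \1_[set x | (U x < +oo)%E] x.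

Let iNE x : iN x = ((U x < +oo)%E)%:R.
Proof. by rewrite /iN indicE; congr (nat_of_bool _)%:R; apply/idP/idP; rewrite inE. Qed.

Let miN : measurable_fun setT iN.
Proof.
apply: measurable_indic; rewrite -[X in measurable X]setTI.
exact: (emeasurable_fun_infty_o measurableT mU).
Qed.

Let F' j x := (iN x)%:C%C * F j x.

Let mF' j : cmeasurable (F' j).
Proof. by apply: cmeasurableM => //; exact: cmeasurable_real. Qed.

Let S x := 3 * fine (U x).

Let Sge0 x : 0 <= S x.
Proof. by rewrite mulr_ge0 ?fine_ge0. Qed.

Let F'S j x : normc (F' j x) ^+ 2 <= S x.
Proof.
rewrite /F' (Normc.normcM (iN x)%:C%C) normc_real iNE.
have [Uoo|] := boolP (U x < +oo)%E; last by rewrite normr0 mul0r expr0n.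
rewrite normr1 mul1r; apply: le_trans (FV j x) _.
have q0 : 0 < 2^-1 ^+ j :> R by rewrite exprn_gt0.
apply: (@le_trans _ _ (3 * V j x)); first by rewrite ler_wpM2r//; lra.
rewrite /S ler_wpM2l// -lee_fin fineK ?VU// ge0_fin_numE//.
Qed.

Let Uper x l : U (x + lp l) = U x.
Proof.
rewrite /U (normc_qper _ _ (qF 0)); congr (_ + _)%E; apply: eq_eseriesr => i _.
by rewrite /Us /u !qF -mulrBr Normc.normcM normc_cexp/= dOm0l mulr0 expR0 mul1r.
Qed.

Let F'cvg x : exists a, cto (F' ^~ x) a.
Proof.
have [Uoo|Uoo] := boolP (U x < +oo)%E; last first.
  exists 0; rewrite /cto /F' iNE (negbTE Uoo) (_ : (fun j => _) = fun=> 0); first exact: cvg_cst.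
  by apply/funext => j; rewrite mul0r subrr normc0E.
apply: (@cto_ex _ _ (2 + fine (U x))) => m.
have UE : U x = (fine (U x))%:E by rewrite fineK// ge0_fin_numE.
have := VU m x; rewrite UE lee_fin => Vle.
have h : \sum_(0 <= i < m) 2^-1 ^+ i <= 2 * (1 - 2^-1 ^+ m) :> R.
  elim: (m) => [|k ih]; first by rewrite big_nil expr0 subrr mulr0.
  rewrite big_nat_recr//= exprS.
  set s := BIG_F in ih *; set q := 2^-1 ^+ k in ih *; lra.
have q0 : 0 < 2^-1 ^+ m :> R by rewrite exprn_gt0.
(* Each increment satisfies [b <= q + b ^+ 2 / q] with [q = 2^-1 ^+ i]; the first terms sum to at
   most 2 and the second ones to at most [U x]. *)
apply: (@le_trans _ _ (\sum_(0 <= i < m) 2^-1 ^+ i + \sum_(0 <= i < m) 2 ^+ i * normc (u i x) ^+ 2)).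
  rewrite -big_split/=; apply: ler_sum => i _.
  rewrite /F' -mulrBr iNE Uoo mul1r -/(u i x).
  have r0 : 0 < 2^-1 ^+ i :> R by rewrite exprn_gt0.
  have tq : 2 ^+ i * 2^-1 ^+ i = 1 :> R by rewrite -exprMn divff ?expr1n.
  set q := 2^-1 ^+ i in r0 tq *; set t := 2 ^+ i in tq *; set b := normc _.
  have tE : t = q^-1 by apply: (mulIf (lt0r_neq0 r0)); rewrite tq mulVf ?lt0r_neq0.
  have b0 : 0 <= b by exact: normc_ge0.
  rewrite tE -(ler_pM2r r0) mulrDl mulrAC mulVf ?lt0r_neq0// mul1r.
  by have := sqr_ge0 (q - b); nra.
apply: lerD; first by lra.
by apply: le_trans Vle; rewrite /V lerDr sqr_ge0.
Qed.

Let f x := xget 0 [set a | cto (F' ^~ x) a].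

Let fP x : cto (F' ^~ x) (f x).
Proof. by have [a ha] := F'cvg x; rewrite /f; case: xgetP => // /(_ a). Qed.

(** On the cube, [K] times the mass of the set where [U] is infinite stays below one finite integral
    for every [K], so the mass is 0. Periodicity spreads this to the plane: [periodic_gauss_le]
    shows that the indicator times a positive Gaussian has integral 0. *)
Lemma null_infinite : {ae mu, forall x, iN x = 1}.
Proof.
pose h x : R := 1 - iN x.
have h0 x : 0 <= h x by rewrite /h iNE; case: (U x < _)%E; rewrite ?subrr ?subr0.
have mh : measurable_fun setT h by apply: measurable_funB => //; exact: measurable_cst.
have hper x l : h (x + lp l) = h x by rewrite /h !iNE Uper.
have mih : measurable_fun setT (fun x : X => (icube x * h x)%:E).
  by apply/measurable_EFinP; apply: measurable_funM => //; exact: measurable_icube.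
have ih0 x : (0 <= (icube x * h x)%:E)%E by rewrite lee_fin mulr_ge0 ?icube_ge0.
have Z : (\int[mu]_x (icube x * h x)%:E = 0)%E.
  pose J := (\int[mu]_x (icube x * h x)%:E)%E.
  have J0 : (0 <= J)%E by apply: integral_ge0.
  have JK (K : R) : 0 <= K -> (K%:E * J <= \int[mu]_x ((icube x)%:E * U x))%E.
    move=> K0; rewrite /J -ge0_integralZl ?lee_fin//.
    apply: ge0_le_integral => //.
    - by move=> x _; rewrite mule_ge0// lee_fin.
    - by apply: emeasurable_funM => //; exact: measurable_cst.
    - exact: emeasurable_funM.
    move=> x _; rewrite EFinM muleCA; apply: lee_wpmul2l => //.
    rewrite /h iNE; case: ltP => [_|]; first by rewrite subrr mule0.
    by rewrite leye_eq => /eqP ->; exact: leey.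
  have Jfin : J \is a fin_num.
    rewrite ge0_fin_numE//; have := JK 1 ler01; rewrite mul1e => /le_lt_trans; apply; exact: Ufin.
  have UI := Ufin; set I := (\int[mu]_x ((icube x)%:E * U x))%E in UI JK.
  have I0 : (0 <= I)%E by apply: integral_ge0 => x _; exact: mule_ge0.
  have IE : I = (fine I)%:E by rewrite fineK// ge0_fin_numE.
  have JE : J = (fine J)%:E by rewrite fineK.
  apply/eqP; rewrite -/J JE eqe; apply/negP => /negP Jn.
  have Jp : 0 < fine J by rewrite lt0r Jn fine_ge0.
  have I0' : 0 <= fine I by rewrite fine_ge0.
  have := JK ((fine I + 1) / fine J); rewrite JE IE -EFinM lee_fin divfK ?gt_eqF//.
  by rewrite divr_ge0 ?addr_ge0 ?(ltW Jp)// => /(_ isT); rewrite gerDl ler10.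
pose hg x : R := h x * expR (- (1 * sqn (x - 0))).
have mhg : measurable_fun setT (EFin \o hg).
  apply/measurable_EFinP; apply: measurable_funM => //; apply: measurable_gauss.
  by apply: measurable_planeB => //; exact: measurable_cst.
have : (\int[mu]_x `|(EFin \o hg) x| = 0)%E.
  apply/eqP; rewrite eq_le; apply/andP; split; last by apply: integral_ge0.
  have := periodic_gauss_le 0 (@ltr01 R) mh h0 hper; rewrite Z mule0; apply: le_trans.
  apply: eq_lee; apply: eq_integral => x _.
  by rewrite /comp gee0_abs ?lee_fin ?mulr_ge0 ?expR_ge0.
move/(ae_eq_integral_abs mu measurableT mhg); apply: filterS => x /(_ I)/= [/eqP].
rewrite /hg mulf_eq0 [X in _ || X]gt_eqF ?expR_gt0// orbF subr_eq0 => /eqP <-//.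
Qed.

(** Besides completeness, it provides what the limit arguments for [Tr] require: quasi-periodicity
    and convergence at every point, and one periodic function [S], integrable over the cube, that
    dominates all squares. *)
Theorem riesz_fischer : exists (f : X -> R[i]) (S : X -> R) (F' : nat -> X -> R[i]),
  [/\ cmeasurable f, qper f, (forall j, cmeasurable (F' j) /\ {ae mu, forall x, F' j x = F j x}),
      (forall x, cto (F' ^~ x) (f x)) &
      [/\ measurable_fun setT S, (forall x, 0 <= S x), (forall x l, S (x + lp l) = S x),
          (\int[mu]_x (icube x * S x)%:E < +oo)%E &
          (forall j x, normc (F' j x) ^+ 2 <= S x) /\ (forall x, normc (f x) ^+ 2 <= S x)]].
Proof.
exists f, S, F'; split => //.
- split; [apply: (measurable_fun_cvg (h := fun j x => complex.Re (F' j x)))|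
          apply: (measurable_fun_cvg (h := fun j x => complex.Im (F' j x)))].
  + by move=> j; case: (mF' j).
  + by move=> x _; apply: (cto_part absReB (fP x)).
  + by move=> j; case: (mF' j).
  + by move=> x _; apply: (cto_part absImB (fP x)).
- move=> x l; apply: (cto_unique (fP (x + lp l))).
  rewrite (_ : F' ^~ (x + lp l) = fun j => chi c x 0 (lp l) * F' j x); first exact: ctoZ.
  by apply/funext => j; rewrite /F' qF mulrCA iNE Uper -iNE.
- move=> j; split => //; apply: filterS null_infinite => x iN1.
  by rewrite /F' iN1 mul1r.
split => //.
- by apply: measurable_funM => //; exact: measurableT_comp.
- by move=> x l; rewrite /S Uper.
- apply: (@le_lt_trans _ _ (\int[mu]_x (3%:E * ((icube x)%:E * U x)))%E).
    apply: ge0_le_integral => //.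
    + by move=> x _; rewrite lee_fin mulr_ge0 ?icube_ge0.
    + apply/measurable_EFinP; apply: measurable_funM; first exact: measurable_icube.
      by apply: measurable_funM => //; exact: measurableT_comp.
    + by apply: emeasurable_funM; [exact: measurable_cst|exact: emeasurable_funM].
    move=> x _; rewrite EFinM [(S x)%:E]EFinM muleCA; apply: lee_wpmul2l; first by rewrite lee_fin.
    apply: lee_wpmul2l => //; have := U0 x; case: (U x) => //= _; exact: leey.
  rewrite ge0_integralZl//; last 2 first.
  + exact: emeasurable_funM.
  + by move=> x _; exact: mule_ge0.
  by apply: lte_mul_pinfty; rewrite ?lee_fin//; exact: Ufin.
split => // x; have h := cto_part normcB_abs (fP x).
have h2 : normc (F' j x) ^+ 2 @[j --> \oo] --> normc (f x) ^+ 2 by rewrite !expr2; apply: cvgM.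
rewrite -(cvg_lim (@Rhausdorff R) h2); apply: limr_le; first by apply/cvg_ex; eexists; exact: h2.
by apply: nearW.
Qed.

End riesz_fischer.

Section complex_sequences.
Context {R : realType}.

Lemma cto_cintegral d (T : measurableType d) (m : {measure set T -> \bar R})
    (f : nat -> T -> R[i]) (g : T -> R[i]) (h : T -> R) :
  (forall j, cmeasurable (f j)) -> cmeasurable g -> measurable_fun setT h ->
  (forall j x, normc (f j x) <= h x) -> (forall x, normc (g x) <= h x) ->
  (\int[m]_x (h x)%:E < +oo)%E -> (forall x, cto (f ^~ x) (g x)) ->
  cto (fun j => cintegral m (f j)) (cintegral m g).
Proof. by move=> *; apply: cdominated_convergence; eassumption. Qed.

Lemma cto_near (F : nat -> R[i]) (a : R[i]) N : (forall j, (N <= j)%N -> F j = a) -> cto F a.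
Proof.
move=> H; apply: cvg_near_cst; exists N => // j /H ->.
by rewrite subrr normc0E.
Qed.

Lemma le_sqr1 (a b : R) : 0 <= a -> a ^+ 2 <= b -> a <= 1 + b.
Proof. by move=> a0 h; have := sqr_ge0 (a - 1); rewrite sqrrB; nra. Qed.

End complex_sequences.

(** * Construction of a preimage with the same norm *)

Section surjectivity.
Context {R : realType} {n : nat} (c : kparams R).
Local Notation X := (plane R n).
Local Notation Y := (X * X)%type.
Local Notation YX := (X * X * X)%type.
Local Notation XY := (X * (X * X))%type.
Local Notation mu := (mu_plane R n).
Local Notation nu := (nu R n).
Local Notation lp := (lpt R).
Local Notation kap := (kap c).
Local Notation wt := (wt c).
Local Notation sw := (sw c).
Local Notation ker := (ker c).
Local Notation chi := (chi c).
Local Notation Tr := (Tr c).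
Local Notation Ts := (Ts c).
Local Notation qper := (qper c).
Local Notation qperY := (qperY c).
Local Notation unorm := (unorm c).
Local Notation ynorm2 := (ynorm2 c).
Implicit Types (p q x : X) (z w : Y) (l : lattice n) (f : X -> R[i]) (g : Y -> R[i]).

Lemma cintegral_iu2 g : (ynorm2 g < +oo)%E ->
  cintegral nu (fun z => (icube z.2 * unorm g z ^+ 2)%:C%C) = (fine (ynorm2 g))%:C%C.
Proof. by move=> _; rewrite cintegral_real. Qed.

Section reconstruction.
Context (g : Y -> R[i]).
Context (mg : cmeasurable g).
Context (gq : qperY g).
Context (goo : (ynorm2 g < +oo)%E).
Context (gK : forall z, Kg c g z = g z).

Let N := fine (ynorm2 g).

Let NE : ynorm2 g = N%:E.
Proof. by rewrite /N fineK// ge0_fin_numE// ynorm2_ge0. Qed.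

Let cutfin j : (ynorm2 (cut j g) < +oo)%E.
Proof. exact: le_lt_trans (ynorm2_cut_le _ _ mg) goo. Qed.

Let a (j : nat) := fine (ynorm2 (cut j%:R g)).

Let aE j : ynorm2 (cut j%:R g) = (a j)%:E.
Proof. by rewrite /a fineK// ge0_fin_numE// ynorm2_ge0. Qed.

Let a_cvg : a j @[j --> \oo] --> N.
Proof.
apply: fine_cvg; rewrite /N fineK; first exact: ynorm2_cvg.
by rewrite ge0_fin_numE// ynorm2_ge0.
Qed.

Let aN j : a j <= N.
Proof. by rewrite -lee_fin -NE -aE ynorm2_cut_le. Qed.

(** Truncation radii growing so fast that the missing mass decays at the geometric rate asked for by
    [riesz_fischer]. *)
Let radii : exists r : nat -> nat, forall m, (m <= r m)%N /\ N - a (r m) <= 8^-1 ^+ m.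
Proof.
suff H m : exists j, (m <= j)%N /\ N - a j <= 8^-1 ^+ m by have [r rP] := choice H; exists r.
have e0 : 0 < 8^-1 ^+ m :> R by rewrite exprn_gt0.
have /cvgrPdist_le/(_ _ e0)[J _ HJ] := a_cvg.
exists (maxn J m); rewrite leq_maxr; split => //.
by apply: le_trans (ler_norm _) _; apply: HJ; rewrite /= leq_maxl.
Qed.

Let tail_le j : (\int[nu]_z (icube z.2 * ((1 - ycut j%:R z) * unorm g z ^+ 2))%:E <= (N - a j)%:E)%E.
Proof.
have mu0 := measurable_unorm c mg.
have my : measurable_fun setT (fun z : Y => ycut j%:R z) by exact: measurable_ycut.
have mi : measurable_fun setT (fun z : Y => icube z.2) by exact: measurable_icube.
rewrite EFinB -NE -aE leeBrDr ?aE// -aE /ynorm2 -ge0_integralD//.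
- apply: eq_lee; apply: eq_integral => z _; rewrite -EFinD unorm_cut_sqr; congr _%:E; ring.
- by move=> z _; rewrite lee_fin; apply: mulr_ge0 (icube_ge0 _) (mulr_ge0 _ (sqr_ge0 _)); rewrite subr_ge0 ycut_le1.
- apply/measurable_EFinP; apply: measurable_funM => //; apply: measurable_funM.
    by apply: measurable_funB => //; exact: measurable_cst.
  exact: measurable_funX.
- by move=> z _; rewrite lee_fin mulr_ge0 ?icube_ge0 ?sqr_ge0.
- by apply: measurable_iu2; apply: measurable_unorm; exact: cmeasurable_cut.
Qed.

Let good_cutg j : good c (cut j g).
Proof. exact: good_cut. Qed.

Let diff i j z := cut i%:R g z - cut j%:R g z.

(** The squared difference of the indicators of two balls is at most the sum of the indicators of
    their complements. *)
Let ynorm2_diff (i j : nat) : (ynorm2 (diff i j) <= (N - a i + (N - a j))%:E)%E.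
Proof.
have mu0 := measurable_unorm c mg.
have mi : measurable_fun setT (fun z : Y => icube z.2) by exact: measurable_icube.
have mt k : measurable_fun setT (fun z : Y => (icube z.2 * ((1 - ycut k%:R z) * unorm g z ^+ 2))%:E).
  apply/measurable_EFinP; apply: measurable_funM => //; apply: measurable_funM.
    by apply: measurable_funB; [exact: measurable_cst|exact: measurable_ycut].
  exact: measurable_funX.
have t0 k z : (0 <= (icube z.2 * ((1 - ycut k%:R z) * unorm g z ^+ 2))%:E)%E.
  by rewrite lee_fin; apply: mulr_ge0 (icube_ge0 _) (mulr_ge0 _ (sqr_ge0 _)); rewrite subr_ge0 ycut_le1.
rewrite EFinD; apply: le_trans (leeD (tail_le i) (tail_le j)).
rewrite -ge0_integralD//; apply: ge0_le_integral => //.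
- by move=> z _; rewrite lee_fin mulr_ge0 ?icube_ge0 ?sqr_ge0.
- by apply: measurable_iu2; apply: measurable_unorm; apply: cmeasurableB; exact: cmeasurable_cut.
- exact: emeasurable_funD.
move=> z _; rewrite -EFinD lee_fin -mulrDr; apply: ler_wpM2l; first exact: icube_ge0.
have -> : unorm (diff i j) z = `|ycut i%:R z - ycut j%:R z| * unorm g z.
  rewrite /unorm /diff /cut -mulrBl (_ : _ - _ = (ycut i%:R z - ycut j%:R z)%:C%C); last by rewrite raddfB.
  rewrite (Normc.normcM (ycut i%:R z - ycut j%:R z)%:C%C) normc_real; ring.
rewrite [(`|_| * _) ^+ 2]exprMn -mulrDl; apply: ler_wpM2r; first exact: sqr_ge0.
rewrite !ycutE; case: (sqn z.1 <= i%:R)%R; case: (sqn z.1 <= j%:R)%R;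
  rewrite /= ?mulr1n ?mulr0n ?subrr ?subr0 ?sub0r ?normrN ?normr0 ?normr1 ?expr1n ?expr0n/=; lra.
Qed.

Let TsB (i j : nat) x : Ts (cut i%:R g) x - Ts (cut j%:R g) x = Ts (diff i j) x.
Proof.
have [C C0 gC] := good_bound (good_cutg i%:R); have [D D0 gD] := good_bound (good_cutg j%:R).
rewrite /Ts -cintegralB.
- by apply: eq_cintegral => z; rewrite /diff; ring.
- by apply: (cintegrable_Ts _ gC); exact: cmeasurable_cut.
- by apply: (cintegrable_Ts _ gD); exact: cmeasurable_cut.
Qed.

Let good_diff i j : good c (diff i j).
Proof.
split.
- by apply: cmeasurableB; exact: cmeasurable_cut.
- by move=> q p l; rewrite /diff !(qperY_cut _ gq) mulrBr.
- by apply: le_lt_trans (ynorm2_diff i j) _; exact: ltry.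
- exists (Num.max i%:R j%:R) => z; rewrite gt_max => /andP[zi zj].
  by rewrite /diff (cutoff_cut g zi) (cutoff_cut g zj) subrr.
Qed.

(** By [Ts_norm] the functions [Ts] of the truncations form a fast Cauchy sequence, with a limit
    [f]. Applying [Tr] gives [Kg] of the truncations, which tends to [Kg c g = g], so [Tr f = g].
    The norm is then found by duality. *)
Theorem reconstruct : exists f, [/\ cmeasurable f, qper f, (norm2 f < +oo)%E,
  norm2 f = ynorm2 g & forall z, Tr f z = g z].
Proof.
have [r rP] := radii.
pose F m := Ts (cut (r m)%:R g).
have gd m := good_cutg (r m)%:R.
have mcg m : cmeasurable (cut (r m)%:R g) by exact: cmeasurable_cut.
have mF m : cmeasurable (F m).
  exact: (cmeasurable_Ts c (mcg m)).
have qF m : qper (F m).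
  have [C C0 gC] := good_bound (gd m); apply: (Ts_qper (mcg m) gC).
  exact: qperY_cut.
have F0 : (norm2 (F 0%N) < +oo)%E.
  by have [C C0 gC] := good_bound (gd 0%N); exact: (norm2_Ts_fin (mcg 0%N) C0 gC).
have FB m : (norm2 (fun x => F m.+1 x - F m x)%R <= (2 * Tbound (n := n) c * 8^-1 ^+ m)%:E)%E.
  have -> : (fun x => F m.+1 x - F m x) = Ts (diff (r m.+1) (r m)).
    by apply/funext => x; exact: TsB.
  apply: le_trans (Ts_norm (good_diff _ _)) _.
  apply: le_trans (lee_wpmul2l _ (ynorm2_diff _ _)) _; first by rewrite lee_fin Tbound_ge0.
  rewrite (_ : 2 * Tbound c * _ = Tbound (n := n) c * (2 * 8^-1 ^+ m)); last by ring.
  rewrite -EFinM lee_fin; apply: ler_wpM2l; first exact: Tbound_ge0.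
  have [_ h1] := rP m; have [_] := rP m.+1; rewrite exprS.
  have q0 : 0 <= 8^-1 ^+ m :> R by rewrite exprn_ge0.
  by move: h1 q0; set q := 8^-1 ^+ m; lra.
have [f [S [F' [mf fq mF' F'f [mS S0 Sper Sfin [F'S fS]]]]]] := riesz_fischer mF qF F0 FB.
have mi : measurable_fun setT (fun x : X => icube x) by exact: measurable_icube.
have f2 : (norm2 f < +oo)%E.
  apply: le_lt_trans Sfin; apply: ge0_le_integral => //.
  - by move=> x _; rewrite lee_fin mulr_ge0 ?icube_ge0 ?sqr_ge0.
  - apply/measurable_EFinP; apply: measurable_funM => //; apply: measurable_funX; exact: measurable_normc.
  - by apply/measurable_EFinP; exact: measurable_funM.
  - by move=> x _; rewrite lee_fin ler_wpM2l ?icube_ge0.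
have f1 := norm1_fin mf f2.
have TrF m z : Tr (F m) z = Kg c (cut (r m)%:R g) z.
  by have [C C0 gC] := good_bound (gd m); rewrite (Tr_Ts (mcg m) C0 gC).
have TrF' m z : Tr (F' m) z = Tr (F m) z.
  have [mF'm ae] := mF' m.
  have mk : cmeasurable (fun x => kap z.2 z.1 x).
    by apply: cmeasurable_kap; [exact: measurable_cst|exact: measurable_cst|exact: measurable_id_plane].
  apply: ae_eq_cintegral; [exact: cmeasurableM|exact: cmeasurableM|].
  by apply: filterS ae => x ->.
have ycut1 (m : nat) z : (Num.truncn (sqn z.1) < m)%N -> ycut (r m)%:R z = 1.
  move=> zm; rewrite ycutE (_ : _ <= _ = true)//; apply/ltW; apply: lt_le_trans (truncnS_gt _) _.
  by rewrite ler_nat; apply: leq_trans zm _; case: (rP m).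
have TrG z : cto (fun m => Tr (F m) z) (g z).
  rewrite -(gK z) (_ : (fun m => Tr (F m) z) = (fun m => Kg c (cut (r m)%:R g) z)); last first.
    by apply/funext => m; exact: TrF.
  have ck := cintegrable_gker z mg gq goo.
  apply: (cto_cintegral (h := fun w => normc (g w * ker z.2 z.1 w.2 w.1 * (wt w.2 w.1)%:C%C))) ck.2 _.
  - move=> m; rewrite (_ : (fun w => _) = fun w => (ycut (r m)%:R w)%:C%C * (g w * ker z.2 z.1 w.2 w.1 * (wt w.2 w.1)%:C%C)).
      by apply: cmeasurableM; [apply: cmeasurable_real; exact: measurable_ycut|exact: ck.1].
    by apply/funext => w; rewrite /cut !mulrA.
  - exact: ck.1.
  - exact: measurable_normc ck.1.
  - move=> m w; rewrite /cut -2!mulrA (Normc.normcM (ycut _ _)%:C%C) normc_real ger0_norm ?ycut_ge0//.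
    by rewrite mulrA -[leRHS]mul1r; apply: ler_wpM2r; [exact: normc_ge0|exact: ycut_le1].
  - by [].
  move=> w; apply: (cto_near (N := (Num.truncn (sqn w.1)).+1)) => m wm.
  by rewrite /cut ycut1// mul1r.
have Tf z : Tr f z = g z.
  apply: cto_unique (TrG z).
  have -> : (fun m => Tr (F m) z) = (fun m => Tr (F' m) z) by apply/funext => m; rewrite TrF'.
  pose k x := normc (kap z.2 z.1 x).
  have ck : cmeasurable (kap z.2 z.1).
    by apply: cmeasurable_kap; [exact: measurable_cst|exact: measurable_cst|exact: measurable_id_plane].
  have mk : measurable_fun setT k by exact: measurable_normc.
  have m1S : measurable_fun setT (fun x => 1 + S x).
    by apply: measurable_funD => //; exact: measurable_cst.
  (* [le_sqr1] turns the bound [S] on squares into the bound [1 + S] on moduli. This is periodic and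
     integrable over the cube, hence integrable against the Gaussian decay of [kap]. *)
  apply: (cto_cintegral (h := fun x => (1 + S x) * k x)).
  - by move=> m; apply: cmeasurableM => //; case: (mF' m).
  - exact: cmeasurableM.
  - exact: measurable_funM.
  - move=> m x; rewrite (Normc.normcM (F' m x)); apply: ler_wpM2r; first exact: normc_ge0.
    by apply: le_sqr1; [exact: normc_ge0|exact: F'S].
  - move=> x; rewrite (Normc.normcM (f x)); apply: ler_wpM2r; first exact: normc_ge0.
    by apply: le_sqr1; [exact: normc_ge0|exact: fS].
  - set K := kcst (n := n) c * expR (del c * sqn z.1) / sw z.2 z.1.
    have K0 : 0 <= K by apply: divr_ge0; [apply: mulr_ge0; [exact: kcst_ge0|exact: expR_ge0]|apply: ltW; exact: sw_gt0].
    have mgs : measurable_fun setT (fun x : X => expR (- (gam c / 2 * sqn (x - z.2)))).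
      by apply: measurable_gauss; apply: measurable_planeB; [exact: measurable_id_plane|exact: measurable_cst].
    have mSg : measurable_fun setT (fun x : X => ((1 + S x) * expR (- (gam c / 2 * sqn (x - z.2))))%:E).
      by apply/measurable_EFinP; exact: measurable_funM.
    have s0 x : 0 <= 1 + S x by rewrite addr_ge0.
    apply: (@le_lt_trans _ _ (\int[mu]_x (K%:E * ((1 + S x) * expR (- (gam c / 2 * sqn (x - z.2))))%:E))%E).
      apply: ge0_le_integral => //.
      + by move=> x _; rewrite lee_fin mulr_ge0 ?normc_ge0.
      + by apply/measurable_EFinP; exact: measurable_funM.
      + by apply: emeasurable_funM => //; exact: measurable_cst.
      move=> x _; rewrite -EFinM lee_fin mulrCA; apply: ler_wpM2l => //.
      exact: normc_kap_le.
    rewrite ge0_integralZl//; last by move=> x _; rewrite lee_fin mulr_ge0 ?expR_ge0.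
    apply: lte_mul_pinfty; rewrite ?lee_fin//.
    apply: le_lt_trans (periodic_gauss_le z.2 (gam2_gt0 c) m1S s0 _) _.
      by move=> x l; rewrite Sper.
    apply: lte_mul_pinfty; rewrite ?lee_fin//; first by apply: gauss_cst_ge0; exact: gam2_gt0.
    rewrite (_ : (\int[mu]_x _ = \int[mu]_x (icube x)%:E + \int[mu]_x (icube x * S x)%:E)%E).
      by rewrite integral_icube lte_add_pinfty// ltry.
    rewrite -ge0_integralD//.
    + by apply: eq_integral => x _; rewrite -EFinD; congr _%:E; ring.
    + by move=> x _; rewrite lee_fin icube_ge0.
    + exact/measurable_EFinP.
    + by move=> x _; rewrite lee_fin mulr_ge0 ?icube_ge0.
    + by apply/measurable_EFinP; exact: measurable_funM.
  - move=> x /=; rewrite (mulrC (f x)).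
    rewrite (_ : (fun m => _) = fun m => kap z.2 z.1 x * F' m x); first exact: ctoZ.
    by apply/funext => m; rewrite mulrC.
exists f; split => //.
have f2E : norm2 f = (fine (norm2 f))%:E by rewrite fineK// ge0_fin_numE// norm2_ge0.
rewrite NE f2E; congr _%:E.
suff : (fine (norm2 f))%:C%C = N%:C%C :> R[i] by case.
(* The limit [f] is paired with the approximants: since [Tr f = g], duality makes the pairing
   exactly the truncated norm of [g]. Letting [m] grow, the pairing tends to the squared norm of [f]
   and the truncated norm to that of [g], with no loss of constants. *)
have D m : cintegral mu (fun x => (icube x)%:C%C * (f x * (F m x)^*%C)) = (a (r m))%:C%C.
  have [C C0 gC] := good_bound (gd m).
  rewrite -(duality (mcg m) C0 gC mf fq f1 (qperY_cut _ gq)) -(cintegral_iu2 (cutfin _)).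
  apply: eq_cintegral => z; rewrite Tf /cut conjcM conjc_real.
  rewrite unorm_cut_sqr /unorm [(normc _ * _) ^+ 2]exprMn sw_sqr.
  rewrite (_ : g z * _ = (ycut (r m)%:R z)%:C%C * (g z * (g z)^*%C)); last by ring.
  by rewrite mulc_conj; apply: complexP; rewrite ?(cReM, cImM)/=; ring.
have D' m : cintegral mu (fun x => (icube x)%:C%C * (f x * (F' m x)^*%C)) = (a (r m))%:C%C.
  have [mF'm ae] := mF' m; have ci : cmeasurable (fun x : X => (icube x)%:C%C) by exact: cmeasurable_real.
  have mm H : cmeasurable H -> cmeasurable (fun x => (icube x)%:C%C * (f x * (H x)^*%C)).
    by move=> mH; apply: cmeasurableM => //; apply: cmeasurableM => //; exact: cmeasurable_conj.
  rewrite -D; apply: ae_eq_cintegral; [exact: mm|exact: mm|].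
  by apply: filterS ae => x ->.
have L1 : cto (fun m => (a (r m))%:C%C) N%:C%C.
  apply: (@squeeze_cvgr _ _ _ _ (fun=> 0) (fun m => 8^-1 ^+ m)).
  - apply: nearW => m; rewrite normc_ge0/= -(raddfB (real_complex R)) normc_real -normrN opprB ger0_norm ?subr_ge0//.
    by case: (rP m).
  - exact: cvg_cst.
  - by apply: cvg_expr; rewrite ger0_norm// invf_lt1// ltr1n.
apply: cto_unique L1; rewrite (_ : (fun m => _) = fun m => cintegral mu (fun x => (icube x)%:C%C * (f x * (F' m x)^*%C))); last first.
  by apply/funext => m; rewrite D'.
have -> : (fine (norm2 f))%:C%C = cintegral mu (fun x => (icube x)%:C%C * (f x * (f x)^*%C)).
  rewrite -(cintegral_real mu (fun x => icube x * normc (f x) ^+ 2)); apply: eq_cintegral => x.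
  by rewrite mulc_conj (rmorphM (real_complex R)).
have ci : cmeasurable (fun x : X => (icube x)%:C%C) by exact: cmeasurable_real.
have mm H : cmeasurable H -> cmeasurable (fun x => (icube x)%:C%C * (f x * (H x)^*%C)).
  by move=> mH; apply: cmeasurableM => //; apply: cmeasurableM => //; exact: cmeasurable_conj.
have nE (v w : R[i]) x : normc ((icube x)%:C%C * (v * w^*%C)) = icube x * (normc v * normc w).
  by rewrite Normc.normcM normc_real ger0_norm ?icube_ge0// (Normc.normcM v) normc_conj.
have bd (v w : R[i]) x : normc v ^+ 2 <= S x -> normc w ^+ 2 <= S x ->
    normc ((icube x)%:C%C * (v * w^*%C)) <= icube x * S x.
  move=> vS wS; rewrite nE; apply: ler_wpM2l; first exact: icube_ge0.
  by have := sqr_ge0 (normc v - normc w); rewrite sqrrB; lra.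
apply: (cto_cintegral (h := fun x => icube x * S x)).
- by move=> m; apply: mm; case: (mF' m).
- exact: mm.
- exact: measurable_funM.
- by move=> m x; exact: bd.
- by move=> x; exact: bd.
- exact: Sfin.
move=> x; rewrite /cto.
rewrite (_ : (fun j => _) = fun j => icube x * normc (f x) * normc (F' j x - f x)); last first.
  apply/funext => j; rewrite -mulrBr -mulrBr -(raddfB (@conjc R)).
  by rewrite nE mulrA.
by rewrite -[X in _ --> X](mulr0 (icube x * normc (f x))); apply: cvgM; [exact: cvg_cst|exact: F'f].
Qed.

End reconstruction.

End surjectivity.

(** * Injectivity *)
Section orthants.
Context {R : realType} {n : nat}.
Local Notation X := (plane R n).

(** Closed lower orthants are stable under intersection and generate the sigma-algebra, as Dynkin
    induction requires. *)
Definition orthant (a : X) : set X :=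
  [set p : X | (forall j, p.1 ord0 j <= a.1 ord0 j) /\ (forall j, p.2 ord0 j <= a.2 ord0 j)].

Lemma coord_sqr_le (p : X) j : p.1 ord0 j ^+ 2 <= sqn p /\ p.2 ord0 j ^+ 2 <= sqn p.
Proof.
have h (v : 'rV[R]_n) : 0 <= v ord0 j ^+ 2 <= dotv v v.
  rewrite sqr_ge0 /dotv (bigD1 j)//= expr2 lerDl sumr_ge0// => i _.
  by rewrite -expr2 sqr_ge0.
rewrite /sqn; case/andP: (h p.1) => a1 a2; case/andP: (h p.2) => b1 b2.
by split; [apply: le_trans a2 _; rewrite lerDl (le_trans b1)|
           apply: le_trans b2 _; rewrite lerDr (le_trans a1)].
Qed.

Lemma measurable_orthant a : measurable (orthant a).
Proof.
have h (v : X -> 'rV[R]_n) (b : 'rV[R]_n) : measurable_fun setT v ->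
    measurable [set p | forall j, v p ord0 j <= b ord0 j].
  move=> mv; rewrite (_ : [set p | _] = \bigcap_(j in [set: 'I_n]) [set p | v p ord0 j <= b ord0 j]).
    apply: fin_bigcap_measurable => [|j _]; first exact: finite_finset.
    have mj : measurable_fun setT ((fun p : X => v p ord0 j) : _ -> measurableTypeR R).
      exact: (measurableT_comp (measurable_coord j) mv).
    have := mj measurableT `]-oo, (b ord0 j)]%classic (measurable_itv _).
    rewrite setTI; congr measurable; apply/seteqP; split=> p /=; by rewrite in_itv.
  by apply/seteqP; split=> p hp j; [move=> _; exact: hp|exact: (hp j I)].
rewrite (_ : orthant a = [set p : X | forall j, p.1 ord0 j <= a.1 ord0 j] `&`
  [set p : X | forall j, p.2 ord0 j <= a.2 ord0 j])//.
by apply: measurableI; apply: h; [exact: measurable_fst|exact: measurable_snd].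
Qed.

Lemma orthantI : setI_closed (range orthant).
Proof.
move=> _ _ [a _ <-] [b _ <-].
exists (\row_j Num.min (a.1 ord0 j) (b.1 ord0 j), \row_j Num.min (a.2 ord0 j) (b.2 ord0 j)) => //.
apply/seteqP; split=> p /= [].
- move=> h1 h2; split; split=> j; [have := h1 j|have := h2 j|have := h1 j|have := h2 j];
    by rewrite mxE le_min => /andP[].
- by move=> [h1 h2] [h3 h4]; split=> j; rewrite mxE le_min ?h1 ?h2 ?h3 ?h4.
Qed.

(** A coordinate half-space is the union over [k] of the orthants whose other corner coordinates
    equal [k]. Hence every coordinate is measurable for the generated sigma-algebra, and with the
    coordinates the identity map. *)
Lemma measurable_orthants : @measurable _ X = <<s range orthant >>.
Proof.
apply/seteqP; split; last first.
  apply: smallest_sub; first exact: sigma_algebra_measurable.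
  by move=> _ [a _ <-]; exact: measurable_orthant.
move=> A mA; pose T := g_sigma_algebraType (range orthant).
suff mid : measurable_fun setT ((fun t => (t.1, t.2)) : T -> X).
  have := mid measurableT A mA; rewrite setTI.
  by rewrite (_ : _ @^-1` A = A)//; apply/seteqP; split=> -[].
have ub (t : X) : exists k : nat, forall j, t.1 ord0 j <= k%:R /\ t.2 ord0 j <= k%:R.
  exists (Num.truncn (1 + sqn t)).+1 => j; have [h1 h2] := coord_sqr_le t j.
  have h3 : forall x : R, x ^+ 2 <= sqn t -> x <= (Num.truncn (1 + sqn t)).+1%:R.
    move=> x hx; apply/ltW; apply: le_lt_trans (truncnS_gt _).
    by apply: le_trans (ler_norm _) _; apply: le_sqr1 => //; rewrite -normrX ger0_norm ?sqr_ge0.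
  by split; apply: h3.
have gen (D : X -> R) : (forall b : R, exists a : nat -> X, [set t | D t <= b] = \bigcup_k orthant (a k)) ->
    measurable_fun setT (D : T -> measurableTypeR R).
  move=> HD; apply: (@measurability _ _ T (measurableTypeR R) _ _ (@RGenOInfty.G R)); first exact: RGenOInfty.measurableE.
  move=> _ [_ [b ->] <-].
  rewrite setTI; have [a Ea] := HD b.
  have -> : (D : T -> R) @^-1` `]b, +oo[ = ~` [set t : T | D t <= b].
    by apply/seteqP; split=> t /=; rewrite in_itv/= andbT ltNge; [move/negP|move/negP].
  apply: measurableC; rewrite Ea; apply: bigcupT_measurable => k.
  by apply: sub_sigma_algebra; exists (a k).
apply: measurable_fun_pair; apply: measurable_rV => j; apply: gen => b.
- exists (fun k => (\row_i (if i == j then b else k%:R), \row_i k%:R)).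
  apply/seteqP; split=> t /=.
    move=> tb; have [k hk] := ub t; exists k => //; split=> i; rewrite mxE/=; last by case: (hk i).
    by case: eqP => [->//|_]; case: (hk i).
  by move=> [k _ [/(_ j)]]; rewrite mxE eqxx.
- exists (fun k => (\row_i k%:R, \row_i (if i == j then b else k%:R))).
  apply/seteqP; split=> t /=.
    move=> tb; have [k hk] := ub t; exists k => //; split=> i; rewrite mxE/=; first by case: (hk i).
    by case: eqP => [->//|_]; case: (hk i).
  by move=> [k _ [_ /(_ j)]]; rewrite mxE eqxx.
Qed.

End orthants.

(** * An integrable function with zero Fourier transform is zero *)

Section fourier_uniqueness.
Context {R : realType} {n : nat}.
Local Notation X := (plane R n).
Local Notation mu := (mu_plane R n).
Implicit Types (x e h : X) (A : set X).

Context (phi : X -> R[i]).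
Context (pI : cintegrable mu phi).
Context (fourier0 : forall xi : X, cintegral mu (fun x => phi x * cexp (0 +i* dB xi x)%C) = 0).

Let m1 : measurable_fun setT (fun y : X * X => y.1). Proof. exact: measurable_fst. Qed.
Let m2 : measurable_fun setT (fun y : X * X => y.2). Proof. exact: measurable_snd. Qed.

Let mphi1 : cmeasurable (fun y : X * X => phi y.1).
Proof. exact: (cmeasurable_comp m1 pI.1). Qed.

Lemma integral_gauss_sub (b : R) x : 0 < b ->
  (\int[mu]_e (expR (- (b * sqn (x - e))))%:E = ((pi / b) ^+ n)%:E)%E.
Proof.
move=> b0; rewrite -(integral_gauss_plane _ b0).
rewrite -(ge0_integral_plane_shift (- x) (f := fun e => (expR (- (b * sqn e)))%:E)).
- by apply: eq_integral => e _; rewrite -(sqnN (x - e)) opprB.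
- by apply/measurable_EFinP; apply: measurable_gauss; exact: measurable_id_plane.
- by move=> p; rewrite lee_fin expR_ge0.
Qed.

(* The Gaussian is itself the Fourier transform of a Gaussian. *)
Lemma gauss_conv0 (b : R) h : 0 < b ->
  cintegral mu (fun x => phi x * (expR (- (b * sqn (x - h))))%:C%C) = 0.
Proof.
move=> b0; pose al := 1 / (4 * b).
have al0 : 0 < al by rewrite divr_gt0// mulr_gt0.
pose F (y : X * X) := phi y.1 * cexp ((dB 0 y.2 - al * sqn y.2) +i* dB (y.1 - h) y.2)%C.
have mF : cmeasurable F.
  apply: cmeasurableM => //; apply: cmeasurable_cexp; split => /=.
    apply: measurable_funB; first by apply: measurable_dB => //; exact: measurable_cst.
    by apply: measurable_funM; [exact: measurable_cst|exact: measurable_sqn].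
  apply: measurable_dB => //; apply: measurable_planeB => //; exact: measurable_cst.
have K0 : 0 < (pi / al) ^+ n by rewrite exprn_gt0// divr_gt0// pi_gt0.
have Ffin : (\int[mu]_x \int[mu]_y (normc (F (x, y)))%:E < +oo)%E.
  rewrite (_ : (\int[mu]_x _ = \int[mu]_x ((normc (phi x))%:E * ((pi / al) ^+ n)%:E))%E).
    rewrite ge0_integralZr//; last 3 first.
    - exact: measurable_EFin_normc pI.1.
    - by move=> x _; rewrite lee_fin normc_ge0.
    - by rewrite lee_fin ltW.
    by rewrite muleC; apply: lte_mul_pinfty; rewrite ?lee_fin ?(ltW K0)//; exact: pI.2.
  apply: eq_integral => x _; rewrite -(integral_gauss_plane _ al0) -ge0_integralZl//.
  - apply: eq_integral => y _; rewrite -EFinM (Normc.normcM (phi x)) normc_cexp/= dB0l sub0r//.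
  - by apply/measurable_EFinP; apply: measurable_gauss; exact: measurable_id_plane.
  - by rewrite lee_fin normc_ge0.
have E x : phi x * (expR (- (b * sqn (x - h))))%:C%C =
    (((pi / al) ^+ n)^-1)%:C%C * cintegral mu (fun y => F (x, y)).
  rewrite /F/= cintegralZl; last exact: cintegrable_gauss.
  rewrite (cintegral_gauss _ _ al0) dB0l mul0r.
  rewrite (_ : (_ +i* 0)%C = (- (b * sqn (x - h)))%:C%C); last first.
    by apply: complexP => //=; rewrite /al sqnE dB0l; field; rewrite gt_eqF.
  rewrite cexp_real; set g := (expR _)%:C%C; rewrite [RHS]mulrCA; congr (_ * _).
  by rewrite mulrA -(rmorphM (real_complex R)) mulVf ?gt_eqF// rmorph1 mul1r.
rewrite (eq_cintegral _ E) cintegralZl; last exact: cintegrable_cintegral.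
rewrite cfubini// (@eq_cintegral _ _ _ _ _ (fun=> 0)) ?cintegral0 ?mulr0// => y.
have Ey x : F (x, y) = cexp ((- (al * sqn y)) +i* (- dB h y))%C * (phi x * cexp (0 +i* dB y x)%C).
  rewrite /F/= mulrCA -cexpD; congr (_ * cexp _).
  by apply: complexP => /=; rewrite ?dBE ?dB0l ?(dBC y x); ring.
rewrite (eq_cintegral _ Ey) cintegralZl ?fourier0 ?mulr0//.
apply: (le_cintegrable (g := fun x => normc (phi x))) pI.2 => //.
- apply: cmeasurableM; first exact: pI.1.
  apply: cmeasurable_cexp; split => /=; first exact: measurable_cst.
  by apply: measurable_dB; [exact: measurable_cst|exact: measurable_id_plane].
- exact: measurable_normc pI.1.
- by move=> x; rewrite (Normc.normcM (phi x)) normc_cexp/= expR0 mulr1.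
Qed.

Let ind A x : R := \1_A x.

Let ind01 A x : 0 <= ind A x <= 1.
Proof. by rewrite /ind indicE ler0n lern1 leq_b1. Qed.

Let pib (b : R) : 0 < b -> b / pi * (pi / b) = 1.
Proof. by move=> b0; have p0 := pi_gt0 R; rewrite mulrA divfK ?divff// gt_eqF. Qed.

(** The average of the indicator of [A] under a normalised Gaussian in [e] centred at [x - h]. *)
Let smooth A (b : R) h x : R[i] := ((b / pi) ^+ n)%:C%C *
  cintegral mu (fun e => (ind A e * expR (- (b * sqn (x - (h + e)))))%:C%C).

Let mgs (b : R) h : measurable_fun setT (fun y : X * X => expR (- (b * sqn (y.1 - (h + y.2))))).
Proof.
apply: measurable_gauss; apply: measurable_planeB => //.
by apply: measurable_planeD => //; exact: measurable_cst.
Qed.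

Let mind A : measurable A -> measurable_fun setT (ind A).
Proof. by move=> mA; exact: measurable_indic. Qed.

Let msm A (b : R) h : measurable A ->
  cmeasurable (fun y : X * X => (ind A y.2 * expR (- (b * sqn (y.1 - (h + y.2)))))%:C%C).
Proof.
move=> mA; apply: cmeasurable_real; apply: measurable_funM => //.
exact: (measurableT_comp (mind mA) m2).
Qed.

Let gsub (b : R) h x : 0 < b ->
  (\int[mu]_e (expR (- (b * sqn (x - (h + e)))))%:E = ((pi / b) ^+ n)%:E)%E.
Proof.
move=> b0; rewrite -(integral_gauss_sub (x - h) b0); apply: eq_integral => e _.
by rewrite opprD addrA.
Qed.

Let mge (b : R) h x : measurable_fun setT (fun e : X => expR (- (b * sqn (x - (h + e))))).
Proof. exact: (measurableT_comp (mgs b h) (pair1_measurable x)). Qed.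

Let smI A (b : R) h x : 0 < b -> measurable A ->
  cintegrable mu (fun e => (ind A e * expR (- (b * sqn (x - (h + e)))))%:C%C).
Proof.
move=> b0 mA; apply: (le_cintegrable (g := fun e => expR (- (b * sqn (x - (h + e)))))) => //.
- by apply: cmeasurable_real; apply: measurable_funM => //; exact: mind.
- move=> e; rewrite normc_real; have /andP[i0 i1] := ind01 A e.
  by rewrite ger0_norm ?mulr_ge0 ?expR_ge0// ler_piMl ?expR_ge0.
- by rewrite gsub// ltry.
Qed.

Let normc_smooth A (b : R) h x : 0 < b -> measurable A -> normc (smooth A b h x) <= 1.
Proof.
move=> b0 mA; have c0 : 0 < b / pi by rewrite divr_gt0// pi_gt0.
rewrite /smooth (Normc.normcM ((b / pi) ^+ n)%:C%C) normc_real ger0_norm ?exprn_ge0 ?(ltW c0)//.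
rewrite -[leRHS](_ : (b / pi) ^+ n * (pi / b) ^+ n = 1); last first.
  by rewrite -exprMn pib// expr1n.
rewrite ler_pM2l ?exprn_gt0// -lee_fin; apply: le_trans (normc_cintegral_le (smI h x b0 mA)) _.
rewrite -(gsub h x b0); apply: ge0_le_integral => //.
- by move=> e _; rewrite lee_fin normc_ge0.
- by apply: measurable_EFin_normc; exact: (smI h x b0 mA).1.
- exact/measurable_EFinP.
- move=> e _; rewrite lee_fin normc_real; have /andP[i0 i1] := ind01 A e.
  by rewrite ger0_norm ?mulr_ge0 ?expR_ge0// ler_piMl ?expR_ge0.
Qed.

Let cmeasurable_smooth A (b : R) h : measurable A -> cmeasurable (smooth A b h).
Proof.
move=> mA; apply: cmeasurableM; first exact: cmeasurable_cst.
exact: (cmeasurable_cintegral _ (msm b h mA)).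
Qed.

(** Fubini reduces the pairing with the average to [gauss_conv0] at each centre [h + e]. *)
Let smooth0 A (b : R) h : 0 < b -> measurable A -> cintegral mu (fun x => phi x * smooth A b h x) = 0.
Proof.
move=> b0 mA.
pose G (y : X * X) := phi y.1 * (ind A y.2 * expR (- (b * sqn (y.1 - (h + y.2)))))%:C%C.
have mG : cmeasurable G by apply: cmeasurableM => //; exact: msm.
have K0 : 0 < (pi / b) ^+ n by rewrite exprn_gt0// divr_gt0// pi_gt0.
have Gfin : (\int[mu]_x \int[mu]_y (normc (G (x, y)))%:E < +oo)%E.
  apply: (@le_lt_trans _ _ (\int[mu]_x ((normc (phi x))%:E * ((pi / b) ^+ n)%:E))%E).
    apply: ge0_le_integral => //.
    - by move=> x _; apply: integral_ge0 => y _; rewrite lee_fin normc_ge0.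
    - apply: (@measurable_fun_fubini_tonelli_F _ _ _ _ _ mu (fun z => (normc (G z))%:E)) => //.
        exact: measurable_EFin_normc.
      by move=> z; rewrite lee_fin normc_ge0.
    - by apply: emeasurable_funM; [exact: measurable_EFin_normc pI.1|exact: measurable_cst].
    move=> x _; rewrite -(gsub h x b0) -ge0_integralZl//; last 2 first.
    - exact/measurable_EFinP.
    - by rewrite lee_fin normc_ge0.
    apply: ge0_le_integral => //.
    - by move=> e _; rewrite lee_fin normc_ge0.
    - apply: measurable_EFin_normc; exact: (cmeasurable_comp (pair1_measurable x) mG).
    - by apply: emeasurable_funM; [exact: measurable_cst|exact/measurable_EFinP].
    move=> e _; rewrite -EFinM lee_fin (Normc.normcM (phi x)) ler_wpM2l ?normc_ge0//.
    rewrite normc_real; have /andP[i0 i1] := ind01 A e.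
    by rewrite ger0_norm ?mulr_ge0 ?expR_ge0// ler_piMl ?expR_ge0.
  rewrite ge0_integralZr//; last 3 first.
  - exact: measurable_EFin_normc pI.1.
  - by move=> x _; rewrite lee_fin normc_ge0.
  - by rewrite lee_fin ltW.
  by rewrite muleC; apply: lte_mul_pinfty; rewrite ?lee_fin ?(ltW K0)//; exact: pI.2.
have E x : phi x * smooth A b h x = ((b / pi) ^+ n)%:C%C * cintegral mu (fun y => G (x, y)).
  by rewrite /G/= cintegralZl 1?mulrCA//; exact: smI.
rewrite (eq_cintegral _ E) cintegralZl; last exact: cintegrable_cintegral.
rewrite cfubini// (@eq_cintegral _ _ _ _ _ (fun=> 0)) ?cintegral0 ?mulr0// => e.
have Ee x : G (x, e) = (ind A e)%:C%C * (phi x * (expR (- (b * sqn (x - (h + e)))))%:C%C).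
  by rewrite /G/= (rmorphM (real_complex R)) mulrCA.
rewrite (eq_cintegral _ Ee) cintegralZl ?gauss_conv0 ?mulr0//.
apply: (le_cintegrable (g := fun x => normc (phi x))) pI.2 => //.
- apply: cmeasurableM; first exact: pI.1.
  by apply: cmeasurable_real; apply: (measurableT_comp (mgs b h) (pair2_measurable e)).
- exact: measurable_normc pI.1.
- move=> x; rewrite (Normc.normcM (phi x)) normc_real ger0_norm ?expR_ge0// ler_piMr ?normc_ge0//.
  by rewrite -expR0 ler_expR oppr_le0 mulr_ge0 ?sqn_ge0// ltW.
Qed.

(** The exponent 3 makes the width of the Gaussian, of order [N.+1 ^- (3/2)], negligible against the
    displacement [N.+1%:R^-1]: [beta N * N.+1%:R^-1 ^+ 2 = N.+1%:R] tends to infinity. *)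
Let beta (N : nat) : R := N.+1%:R ^+ 3.
Let beta0 N : 0 < beta N. Proof. by rewrite exprn_gt0. Qed.
Let step (N : nat) : X := (const_mx (- N.+1%:R^-1), const_mx (- N.+1%:R^-1)).

(* The centre of the Gaussian is moved inside the orthant, so that boundary points also converge. *)
Let near_orthant (a : X) x : exists N0, forall N, (N0 <= N)%N -> forall e,
  sqn (x - (- step N + e)) < N.+1%:R^-1 ^+ 2 -> ind (orthant a) e = ind (orthant a) x.
Proof.
have close N e j : sqn (x - (- step N + e)) < N.+1%:R^-1 ^+ 2 ->
    (x.1 ord0 j - 2 * N.+1%:R^-1 < e.1 ord0 j < x.1 ord0 j) /\
    (x.2 ord0 j - 2 * N.+1%:R^-1 < e.2 ord0 j < x.2 ord0 j).
  have i0 : 0 < N.+1%:R^-1 :> R by rewrite invr_gt0.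
  move=> hs; have [h1 h2] := coord_sqr_le (x - (- step N + e)) j.
  have ab (v : R) : v ^+ 2 <= sqn (x - (- step N + e)) -> - N.+1%:R^-1 < v < N.+1%:R^-1.
    move=> /le_lt_trans/(_ hs); rewrite -ltr_norml -[v ^+ 2]real_normK ?num_real//.
    by rewrite ltr_pXn2r// nnegrE ltW.
  move: h1 h2 => /ab + /ab; rewrite /step /= !mxE opprK => /andP[u1 u2] /andP[u3 u4].
  move: u1 u2 u3 u4; move: (N.+1%:R^-1 : R) => iv u1 u2 u3 u4.
  by split; apply/andP; split; lra.
have [xA|xA] := pselect (orthant a x).
  exists 0%N => N _ e hs; have h j := close N e j hs; rewrite /ind !indicE !mem_set//.
  by case: xA => h1 h2; split=> j; have [/andP[_ u] /andP[_ v]] := h j;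
    [exact: le_trans (ltW u) (h1 j)|exact: le_trans (ltW v) (h2 j)].
have [j hj] : exists j, (a.1 ord0 j < x.1 ord0 j) || (a.2 ord0 j < x.2 ord0 j).
  apply: contrapT => H; apply: xA; split=> j; rewrite leNgt; apply/negP => hj; apply: H; exists j.
    by rewrite hj.
  by rewrite hj orbT.
have small (d : R) N : 0 < d -> (Num.truncn (2 / d) <= N)%N -> 2 * N.+1%:R^-1 < d.
  move=> d0 hN; rewrite ltr_pdivrMr// mulrC -ltr_pdivrMr//.
  by apply: lt_le_trans (truncnS_gt _) _; rewrite ler_nat.
case/orP: hj => hj.
- exists (Num.truncn (2 / (x.1 ord0 j - a.1 ord0 j))) => N hN e /(close N e j)[/andP[he _] _].
  have d0 : 0 < x.1 ord0 j - a.1 ord0 j by rewrite subr_gt0.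
  have h := small _ N d0 hN.
  move: he h; move: (N.+1%:R^-1 : R) => iv he h.
  by rewrite /ind !indicE !memNset// => -[/(_ j) h1 _]; lra.
- exists (Num.truncn (2 / (x.2 ord0 j - a.2 ord0 j))) => N hN e /(close N e j)[_ /andP[he _]].
  have d0 : 0 < x.2 ord0 j - a.2 ord0 j by rewrite subr_gt0.
  have h := small _ N d0 hN.
  move: he h; move: (N.+1%:R^-1 : R) => iv he h.
  by rewrite /ind !indicE !memNset// => -[_ /(_ j) h1]; lra.
Qed.

(** Within distance [N.+1%:R^-1] of the displaced centre the indicator already has its value at [x].
    Beyond it, half of the exponent gives the factor [expR (- (M N / 2)) <= 2 / M N], and the other
    half is still a Gaussian, whose renormalisation costs [2 ^+ n]. *)
Let smooth_cvg (a : X) x : cto (fun N => smooth (orthant a) (beta N) (- step N) x) (ind (orthant a) x)%:C%C.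
Proof.
have mA := measurable_orthant a; have [N0 HN] := near_orthant a x.
pose M (N : nat) : R := N.+1%:R.
suff bound N : (N0 <= N)%N ->
    normc (smooth (orthant a) (beta N) (- step N) x - (ind (orthant a) x)%:C%C) <= 2 ^+ n * 2 * (M N)^-1.
  apply: (@squeeze_cvgr _ _ _ _ (fun=> 0) (fun N => 2 ^+ n * 2 * (M N)^-1)).
  - by exists N0 => // N /= /bound; rewrite normc_ge0.
  - exact: cvg_cst.
  - rewrite -[X in _ --> X](mulr0 (2 ^+ n * 2)); apply: cvgM; first exact: cvg_cst.
    exact: cvg_harmonic.
move=> {}/HN hN; set b := beta N; set h := - step N; set i := ind (orthant a) x.
have M0 : 0 < M N by rewrite ltr0n.
have b0 : 0 < b by exact: beta0.
have c0 : 0 < (b / pi) ^+ n by rewrite exprn_gt0// divr_gt0// pi_gt0.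
pose g e := expR (- (b * sqn (x - (h + e)))).
have gI : cintegrable mu (fun e => (g e)%:C%C).
  apply: (le_cintegrable (g := g)) => //.
  - by apply: cmeasurable_real; exact: mge.
  - exact: mge.
  - by move=> e; rewrite normc_real ger0_norm ?expR_ge0.
  - by rewrite gsub// ltry.
have Ei : i%:C%C = ((b / pi) ^+ n)%:C%C * cintegral mu (fun e => i%:C%C * (g e)%:C%C).
  rewrite cintegralZl// cintegral_real /Rintegral gsub//= mulrCA -(rmorphM (real_complex R)) -exprMn.
  by rewrite pib// expr1n rmorph1 mulr1.
have iI : cintegrable mu (fun e => i%:C%C * (g e)%:C%C) by exact: cintegrableZl.
rewrite {1}Ei -mulrBr -cintegralB//; last exact: smI.
rewrite (Normc.normcM ((b / pi) ^+ n)%:C%C) normc_real ger0_norm ?(ltW c0)//.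
have dI : cintegrable mu (fun e => (ind (orthant a) e * expR (- (b * sqn (x - (h + e)))))%:C%C - i%:C%C * (g e)%:C%C).
  by apply: cintegrableB => //; exact: smI.
have b2 : 0 < b / 2 by rewrite divr_gt0.
have key : normc (cintegral mu (fun e => (ind (orthant a) e * expR (- (b * sqn (x - (h + e)))))%:C%C - i%:C%C * (g e)%:C%C))
    <= expR (- (M N / 2)) * (pi / (b / 2)) ^+ n.
  rewrite -lee_fin; apply: le_trans (normc_cintegral_le dI) _.
  rewrite EFinM -(gsub h x b2) -ge0_integralZl//; last by apply/measurable_EFinP; exact: mge.
  apply: ge0_le_integral => //.
  - by move=> e _; rewrite lee_fin normc_ge0.
  - by apply: measurable_EFin_normc; exact: dI.1.
  - by apply: emeasurable_funM; [exact: measurable_cst|apply/measurable_EFinP; exact: mge].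
  move=> e _; rewrite -EFinM lee_fin -(rmorphM (real_complex R)) -(raddfB (real_complex R)) -mulrBl.
  rewrite normc_real normrM [`|expR _|]ger0_norm ?expR_ge0// -expRD.
  have [s1|s1] := ltP (sqn (x - (h + e))) (N.+1%:R^-1 ^+ 2).
    by rewrite (hN e s1) subrr normr0 mul0r expR_ge0.
  have : `|ind (orthant a) e - i| <= 1.
    by have := ind01 (orthant a) e; have := ind01 (orthant a) x; rewrite -/i ler_norml; lra.
  move/(ler_wpM2r (expR_ge0 (- (b * sqn (x - (h + e)))))); rewrite mul1r => /le_trans; apply.
  have bM : b * N.+1%:R^-1 ^+ 2 = M N by rewrite /b /beta /M; field; rewrite gt_eqF.
  have := ler_wpM2l (ltW b0) s1; rewrite bM ler_expR; lra.
apply: le_trans (ler_wpM2l (ltW c0) key) _.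
rewrite mulrCA -exprMn (_ : b / pi * (pi / (b / 2)) = 2); last first.
  by have p0 := pi_gt0 R; rewrite mulrA divfK ?gt_eqF// invf_div mulrCA divff ?mulr1// gt_eqF.
rewrite mulrC -mulrA ler_wpM2l ?exprn_ge0// expRN.
have h1 : M N / 2 <= expR (M N / 2) by apply: le_trans (expR_ge1Dx _); rewrite lerDr.
rewrite (_ : 2 / M N = (M N / 2)^-1); last by rewrite invf_div.
by rewrite lef_pV2// posrE ?expR_gt0// divr_gt0.
Qed.

Lemma orthant0 (a : X) : cintegral mu (fun x => phi x * (ind (orthant a) x)%:C%C) = 0.
Proof.
have mA := measurable_orthant a.
have h : cto (fun N => cintegral mu (fun x => phi x * smooth (orthant a) (beta N) (- step N) x))
    (cintegral mu (fun x => phi x * (ind (orthant a) x)%:C%C)).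
  apply: (cto_cintegral (h := fun x => normc (phi x))) pI.2 _ => //.
  - by move=> N; apply: cmeasurableM; [exact: pI.1|exact: cmeasurable_smooth].
  - by apply: cmeasurableM; [exact: pI.1|apply: cmeasurable_real; exact: mind].
  - exact: measurable_normc pI.1.
  - move=> N x; rewrite (Normc.normcM (phi x)) ler_piMr ?normc_ge0//; exact: normc_smooth.
  - move=> x; rewrite (Normc.normcM (phi x)) ler_piMr ?normc_ge0// normc_real.
    by have /andP[i0 i1] := ind01 (orthant a) x; rewrite ger0_norm.
  - by move=> x; apply: ctoZ; exact: smooth_cvg.
apply: cto_unique h _; apply: (cto_near (N := 0)) => N _; exact: smooth0.
Qed.

Let cI A : measurable A -> cintegrable mu (fun x => phi x * (ind A x)%:C%C).
Proof.
move=> mA; apply: (le_cintegrable (g := fun x => normc (phi x))) pI.2.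
- by apply: cmeasurableM; [exact: pI.1|apply: cmeasurable_real; exact: mind].
- exact: measurable_normc pI.1.
- move=> x; rewrite (Normc.normcM (phi x)) ler_piMr ?normc_ge0// normc_real.
  by have /andP[i0 i1] := ind01 A x; rewrite ger0_norm.
Qed.

(** Dynkin induction from the orthants; the whole plane is the Fourier transform at frequency 0, and
    disjoint unions follow by dominated convergence of the partial unions. *)
Lemma measurable0 A : measurable A -> cintegral mu (fun x => phi x * (ind A x)%:C%C) = 0.
Proof.
move=> mA; have gA : <<s range (@orthant R n) >> A by rewrite -measurable_orthants.
pose P (B : set X) := cintegral mu (fun x => phi x * (ind B x)%:C%C) = 0.
have PT : P setT.
  rewrite /P -[RHS](fourier0 0); apply: eq_cintegral => x.
  by rewrite /ind indicE in_setT dB0l cexp0 rmorph1.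
apply: (dynkin_induction (P := P) measurable_orthants orthantI PT) gA.
- by move=> _ [a _ <-]; exact: orthant0.
- move=> S mS PS; rewrite /P -[RHS](subr0 0) -{1}PT -PS -cintegralB; [|exact: cI|exact: cI].
  apply: eq_cintegral => x; rewrite -mulrBr -raddfB; congr (_ * _%:C%C).
  by rewrite /ind !indicE in_setT in_setC; case: (x \in S); rewrite ?subrr ?subr0.
move=> F mF tF PF.
have mU k : measurable (\big[setU/set0]_(i < k) F i) by apply: bigsetU_measurable.
have mUU : measurable (\bigcup_k F k) by exact: bigcupT_measurable.
have Uk k : P (\big[setU/set0]_(i < k) F i).
  elim: k => [|k ih].
    rewrite big_ord0 /P (@eq_cintegral _ _ _ _ _ (fun=> 0)) ?cintegral0// => x.
    by rewrite /ind indicE in_set0 mulr0.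
  rewrite big_ord_recr/= /P -[RHS](addr0 0) -{1}ih -(PF k) -cintegralD; [|exact: cI|exact: cI].
  apply: eq_cintegral => x; rewrite -mulrDr -raddfD; congr (_ * _%:C%C).
  rewrite /ind !indicE in_setU; have [xk|_] := boolP (x \in F k); last by rewrite orbF addr0.
  rewrite orbT; case: (boolP (x \in _)) => [|_]; last by rewrite add0r.
  rewrite inE -bigcup_mkord => -[i /= ik xi]; move: xk; rewrite inE => xk.
  have e : i = k by apply: (tF i k I I); exists x.
  by rewrite e ltnn in ik.
have h : cto (fun k => cintegral mu (fun x => phi x * (ind (\big[setU/set0]_(i < k) F i) x)%:C%C))
    (cintegral mu (fun x => phi x * (ind (\bigcup_k F k) x)%:C%C)).
  have nle B x : normc (phi x * (ind B x)%:C%C) <= normc (phi x).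
    rewrite (Normc.normcM (phi x)) ler_piMr ?normc_ge0// normc_real.
    by have /andP[i0 i1] := ind01 B x; rewrite ger0_norm.
  apply: (cto_cintegral (h := fun x => normc (phi x))) pI.2 _ => //.
  - by move=> k; case: (cI (mU k)).
  - by case: (cI mUU).
  - exact: measurable_normc pI.1.
  move=> x; apply: ctoZ; have [[k _ xk]|xU] := pselect ((\bigcup_k F k) x).
    apply: (cto_near (N := k.+1)) => j kj; rewrite /ind !indicE !mem_set//; first by exists k.
    by rewrite -bigcup_mkord; exists k.
  apply: (cto_near (N := 0)) => j _; rewrite /ind !indicE !memNset//.
  by rewrite -bigcup_mkord => -[i _ xi]; apply: xU; exists i.
apply: cto_unique h _; apply: (cto_near (N := 0)) => k _; exact: Uk.
Qed.

(** One argument for the real and the imaginary part [r]: subtracting the integrals over the set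
    where [r (phi x)] is nonnegative and over its complement gives the integral of [|r (phi x)|],
    which is therefore 0. *)
Let part0 (r : R[i] -> R) : (forall z w, r (z - w) = r z - r w) ->
  (forall z (x : R), r (z * x%:C%C) = r z * x) ->
  (forall z, `|r z| <= normc z) -> (forall f, r (cintegral mu f) = \int[mu]_x r (f x)) ->
  measurable_fun setT (fun x => r (phi x)) -> {ae mu, forall x, r (phi x) = 0}.
Proof.
move=> rB rZ rle rI mr; pose A := [set x | 0 <= r (phi x)].
have mA : measurable A.
  have := mr measurableT `[0, +oo[%classic (measurable_itv _).
  rewrite setTI; congr measurable; apply/seteqP; split=> x /=; by rewrite in_itv/= andbT.
have E x : `|r (phi x)| = r (phi x * (ind A x)%:C%C - phi x * (ind (~` A) x)%:C%C).
  rewrite rB !rZ /ind !indicE in_setC; case: (boolP (x \in A)).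
    by rewrite inE => xA; rewrite mulr1 mulr0 subr0 ger0_norm.
  by rewrite notin_setE /A/= => /negP; rewrite -ltNge => xA; rewrite mulr1 mulr0 sub0r ltr0_norm.
have mE : measurable_fun setT (EFin \o (fun x => r (phi x))) by exact/measurable_EFinP.
have Z : \int[mu]_x `|r (phi x)| = 0.
  rewrite (_ : (fun x => _) = fun x => r (phi x * (ind A x)%:C%C - phi x * (ind (~` A) x)%:C%C)); last first.
    by apply/funext => x; exact: E.
  rewrite -rI cintegralB; [|exact: cI|by apply: cI; exact: measurableC].
  rewrite !measurable0//; last exact: measurableC.
  by rewrite rB subrr.
have : (\int[mu]_x `|(EFin \o (fun x => r (phi x))) x| = 0)%E.
  move: Z; rewrite /Rintegral => Z; rewrite -[RHS]/(0%:E) -Z fineK//.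
  rewrite ge0_fin_numE; last by apply: integral_ge0 => x _; rewrite lee_fin.
  apply: le_lt_trans pI.2; apply: ge0_le_integral => //.
  - by apply/measurable_EFinP; exact: measurableT_comp.
  - exact: measurable_EFin_normc pI.1.
  - by move=> x _; rewrite lee_fin.
by move/(ae_eq_integral_abs mu measurableT mE); apply: filterS => x /(_ I)/= [].
Qed.

Theorem fourier_unique : {ae mu, forall x, phi x = 0}.
Proof.
have hr : {ae mu, forall x, complex.Re (phi x) = 0}.
  apply: part0; [by move=> z w; rewrite cReD cReN|by move=> z x; rewrite cReM/= mulr0 subr0|
                 exact: absRe_le|by []|by case: pI => -[]].
have hi : {ae mu, forall x, complex.Im (phi x) = 0}.
  apply: part0; [by move=> z w; rewrite cImD cImN|by move=> z x; rewrite cImM/= mulr0 add0r|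
                 exact: absIm_le|by []|by case: pI => -[]].
by apply: filterS2 hr hi => x h1 h2; exact: complexP.
Qed.

End fourier_uniqueness.

(** * Injectivity of the transform *)

Section injectivity.
Context {R : realType} {n : nat} (c : kparams R).
Local Notation X := (plane R n).
Local Notation Y := (X * X)%type.
Local Notation YX := (X * X * X)%type.
Local Notation XY := (X * (X * X))%type.
Local Notation mu := (mu_plane R n).
Local Notation nu := (nu R n).
Local Notation lp := (lpt R).
Local Notation kap := (kap c).
Local Notation wt := (wt c).
Local Notation sw := (sw c).
Local Notation ker := (ker c).
Local Notation chi := (chi c).
Local Notation Tr := (Tr c).
Local Notation Ts := (Ts c).
Local Notation qper := (qper c).
Local Notation qperY := (qperY c).
Local Notation unorm := (unorm c).
Local Notation ynorm2 := (ynorm2 c).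
Implicit Types (p q x : X) (z w : Y) (l : lattice n) (f : X -> R[i]) (g : Y -> R[i]).

(** At suitable points [(q, p)] the kernel in [x] is a constant times [expR (- (gam * sqn x))] times
    a character. So [Tr f = 0] says that the integrable function [phi] has zero Fourier transform,
    and the Gaussian factor never vanishes. *)
Theorem Tr_injective f : cmeasurable f -> qper f -> (norm2 f < +oo)%E ->
  (forall z, Tr f z = 0) -> {ae mu, forall x, f x = 0}.
Proof.
move=> mf fq f2 Tf0; have f1 := norm1_fin mf f2.
have g0 := gam_gt0 c; have d0 := del_gt0 c; have dg := del_lt_gam c.
pose gs x := expR (- (gam c * sqn (x - 0))).
have mgs : measurable_fun setT gs.
  by apply: measurable_gauss; apply: measurable_planeB; [exact: measurable_id_plane|exact: measurable_cst].
pose phi x := f x * (gs x)%:C%C.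
have mphi : cmeasurable phi by apply: cmeasurableM => //; exact: cmeasurable_real.
have mnf : measurable_fun setT (fun x => normc (f x)) by exact: measurable_normc.
have pI : cintegrable mu phi.
  split => //; apply: (@le_lt_trans _ _ (\int[mu]_x (normc (f x) * gs x)%:E)%E).
    apply: eq_lee; apply: eq_integral => x _.
    by rewrite (Normc.normcM (f x)) normc_real ger0_norm ?expR_ge0.
  apply: le_lt_trans (periodic_gauss_le 0 g0 mnf (fun x => normc_ge0 _) _) _.
    by move=> x l; exact: normc_qper.
  by apply: lte_mul_pinfty => //; rewrite lee_fin; exact: gauss_cst_ge0.
have F0 (xi : X) : cintegral mu (fun x => phi x * cexp (0 +i* dB xi x)%C) = 0.
  (* With the [p] below, the phase of [kap] is linear in [x] along [q] with coefficient [2 * gam -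
     lam ^+ 2 / (8 * gam) = 2 * (gam - del)]. This is nonzero, so every frequency [xi] is
     attained. *)
  pose q : X := (2 * (gam c - del c))^-1 *: xi.
  (* This choice makes [2 * gam * dB p x] the opposite of [lam / 2 * dOm q x], so no real term
     linear in [x] remains. *)
  pose p : X := (lam c / (4 * gam c)) *: rJ q.
  pose k : R[i] := (amp c ^+ n)%:C%C *
     cexp ((- (gam c * (sqn p - sqn q))) +i* (- (2 * gam c * dB p q)))%C.
  have k0 : k != 0.
    rewrite mulf_neq0 ?cexp_neq0// fmorph_eq0 expf_neq0//.
    apply/eqP => a0; have := amp_sqr c; rewrite a0 expr0n/= mul0r => /esym/eqP.
    by rewrite mulf_eq0 !gt_eqF// subr_gt0.
  have xiE : xi = (2 * (gam c - del c)) *: q.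
    by rewrite /q scalerA divff ?scale1r// gt_eqF// mulr_gt0// subr_gt0.
  have pE : p = (lam c / (4 * gam c)) *: rJ q by [].
  clearbody p q.
  have E x : f x * kap p q x = k * (phi x * cexp (0 +i* dB xi x)%C).
    rewrite /kap /phi /k /gs -cexp_real.
    rewrite (_ : k * _ = f x * ((amp c ^+ n)%:C%C * (cexp (- (gam c * (sqn p - sqn q)) +i* - (2 * gam c * dB p q))%C *
      cexp (- (gam c * sqn (x - 0)))%:C%C * cexp (0 +i* dB xi x)%C))); last by rewrite /k; ring.
    congr (_ * (_ * _)); rewrite -!cexpD; congr cexp.
    have h1 : dOm q x = - dB x (rJ q) by rewrite dB_rJ dOmC.
    have h2 : dOm p x = (lam c / (4 * gam c)) * dB x q.
      by rewrite pE dOmZl dOmC dOm_rJ opprK.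
    have l2 := lam_sqr c.
    apply: complexP => /=.
      rewrite subr0 !sqnE !dBE h1 (dBC p x) pE !dBE; field; rewrite !gt_eqF//.
    rewrite xiE h2 !dBE (dBC q x) (_ : lam c / 2 * _ = lam c ^+ 2 / (8 * gam c) * dB x q); last first.
      by field; rewrite !gt_eqF//.
    by rewrite l2; field; rewrite !gt_eqF//.
  have : Tr f (q, p) = 0 by exact: Tf0.
  rewrite /Tr/= (eq_cintegral _ E) cintegralZl.
    by move/eqP; rewrite mulf_eq0 (negbTE k0)/= => /eqP.
  apply: (le_cintegrable (g := fun x => normc (phi x))) pI.2.
  - apply: cmeasurableM => //; apply: cmeasurable_cexp; split => /=; first exact: measurable_cst.
    by apply: measurable_dB; [exact: measurable_cst|exact: measurable_id_plane].
  - exact: measurable_normc.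
  - by move=> x; rewrite (Normc.normcM (phi x)) normc_cexp/= expR0 mulr1.
apply: filterS (fourier_unique pI F0) => x /eqP; rewrite mulf_eq0 => /orP[/eqP//|].
by rewrite fmorph_eq0 gt_eqF ?expR_gt0.
Qed.

End injectivity.

(** * The isometry *)
Section isometry.
Context {R : realType} {n : nat} (c : kparams R).
Local Notation X := (plane R n).
Local Notation Y := (X * X)%type.
Local Notation YX := (X * X * X)%type.
Local Notation XY := (X * (X * X))%type.
Local Notation mu := (mu_plane R n).
Local Notation nu := (nu R n).
Local Notation lp := (lpt R).
Local Notation kap := (kap c).
Local Notation wt := (wt c).
Local Notation sw := (sw c).
Local Notation ker := (ker c).
Local Notation chi := (chi c).
Local Notation Tr := (Tr c).
Local Notation Ts := (Ts c).
Local Notation qper := (qper c).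
Local Notation qperY := (qperY c).
Local Notation unorm := (unorm c).
Local Notation ynorm2 := (ynorm2 c).
Implicit Types (p q x : X) (z w : Y) (l : lattice n) (f : X -> R[i]) (g : Y -> R[i]).
Local Notation XC := (plane R[i] n).
Let RV : normedModType R[i] := 'rV[R[i]]_n.
Let XM : normedModType R[i] := (RV * RV)%type.

(** Completing the square in each complex coordinate; it lets any exponential moment be absorbed by
    a Gaussian of arbitrarily small rate [e]. *)
Lemma nrm1_cpoint_le (M e : R) (a b : X) : 0 < e ->
  M * nrm1 (cpoint a b) <= e * (sqn a + sqn b) + 2 * n%:R * (M ^+ 2 / (4 * e)).
Proof.
move=> e0; have h (u v : R) : M * normc (u +i* v)%C <= e * (u * u + v * v) + M ^+ 2 / (4 * e).
  have := sqr_normcE (u +i* v)%C; rewrite /= !expr2 => <-; set t := normc _.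
  rewrite -subr_ge0 (_ : _ - _ = (2 * e * t - M) ^+ 2 / (4 * e)); last by field; rewrite gt_eqF.
  by rewrite divr_ge0 ?sqr_ge0// mulr_ge0// ltW.
have H (u v : 'rV[R]_n) : M * \sum_j normc ((map2_mx (@Complex R) u v) ord0 j) <=
    e * (dotv u u + dotv v v) + n%:R * (M ^+ 2 / (4 * e)).
  rewrite mulr_sumr; apply: (@le_trans _ _ (\sum_(j < n) (e * (u ord0 j * u ord0 j + v ord0 j * v ord0 j) + M ^+ 2 / (4 * e)))).
    by apply: ler_sum => j _; rewrite mxE.
  by rewrite big_split/= -mulr_sumr big_split/= sumr_const card_ord -[X in _ <= X + _]/(_) [n%:R * _]mulrC mulr_natr.
have := lerD (H a.1 b.1) (H a.2 b.2); rewrite -mulrDr /nrm1 /sqn => /le_trans; apply.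
by apply: eq_ler; ring.
Qed.

(** The linear coefficient of the exponent of [kap], seen as the polynomial [- gam * dB P P + dB P
    (zeta x) - gam * sqn x] in the complex point [P]; it exhibits [Tr f] as a Gaussian times a
    Laplace transform. *)
Let zeta x : XC := cpoint ((2 * gam c) *: x) (- ((lam c / 2) *: rJ x)).

Let kap_zeta p q x : kap p q x = (amp c ^+ n)%:C%C * cexp (- (gam c)%:C%C * dB (cpoint p q) (cpoint p q)) *
  ((expR (- (gam c * sqn x)))%:C%C * cexp (dB (cpoint p q) (zeta x))).
Proof.
rewrite /kap -(cexp_real (- (gam c * sqn x))) -[RHS]mulrA -!cexpD; congr (_ * cexp _).
rewrite /zeta !dB_cpoint; apply: complexP; rewrite ?(cReD, cImD, cReM, cImM)/= ?sqnE !dBE !dB_rJ.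
  by rewrite (dBC x p); field.
by rewrite (dBC x q) (dBC q p); field.
Qed.

Section transform.
Context (f : X -> R[i]).
Context (mf : cmeasurable f).
Context (fq : qper f).
Context (f2 : (norm2 f < +oo)%E).

Let phi x := f x * (expR (- (gam c * sqn x)))%:C%C.

Let mgs (a : R) : measurable_fun setT (fun x : X => expR (- (a * sqn x))).
Proof. by apply: measurable_gauss; exact: measurable_id_plane. Qed.

Let mphi : cmeasurable phi.
Proof. by apply: cmeasurableM => //; apply: cmeasurable_real; exact: mgs. Qed.

Let cpart_zeta j : cmeasurable (fun x => (zeta x).1 ord0 j) /\ cmeasurable (fun x => (zeta x).2 ord0 j).
Proof.
have mj1 : measurable_fun setT (fun x : X => x.1 ord0 j).
  exact: (measurableT_comp (measurable_coord j) measurable_fst).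
have mj2 : measurable_fun setT (fun x : X => x.2 ord0 j).
  exact: (measurableT_comp (measurable_coord j) measurable_snd).
have mc (k : R) (u : X -> R) : measurable_fun setT u -> measurable_fun setT (fun x => k * u x).
  by move=> mu_; apply: measurable_funM => //; exact: measurable_cst.
by split; split=> /=; under eq_fun do rewrite !mxE /= ?mxE /= ?mulrN ?opprK -?mulNr; exact: mc.
Qed.

Lemma entire_transform : exists2 T : XC -> R[i], entire T & forall z, Tr f z = T (cpoint z.2 z.1).
Proof.
have g0 := gam_gt0 c; have f1 := norm1_fin mf f2.
have L : entire (fun P : XC => cintegral mu (fun x => phi x * cexp (dB P (zeta x)))).
  move=> P; apply: (@differentiable_laplace _ _ _ mu XM phi (fun x => nrm1 (zeta x)) (fun x P => dB P (zeta x))) => //.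
  - apply: measurable_funD; apply: measurable_sum => j;
      apply: measurable_normc; by case: (cpart_zeta j).
  - by move=> x; exact: nrm1_ge0.
  - move=> v; apply: cmeasurableD; apply: cmeasurable_sum => j;
      apply: cmeasurableM; (try exact: cmeasurable_cst); by case: (cpart_zeta j).
  - by move=> x v w; exact: dBDl.
  - by move=> x a v; exact: dBZl.
  - by move=> x v; exact: normc_dB_le.
  (* [ka * sqn x] is the squared size of [zeta x], and [e] is chosen so that the moment [M] uses up
     exactly half of the Gaussian rate [gam]. *)
  move=> M; pose ka := 4 * gam c ^+ 2 + lam c ^+ 2 / 4.
  have ka0 : 0 < ka by rewrite ltr_pwDl ?divr_ge0 ?sqr_ge0// mulr_gt0// exprn_gt0.
  pose e := gam c / (2 * ka); have e0 : 0 < e by rewrite divr_gt0// mulr_gt0.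
  pose C := expR (2 * n%:R * (M ^+ 2 / (4 * e))).
  have bd x : normc (phi x) * expR (M * nrm1 (zeta x)) <= C * (normc (f x) * expR (- (gam c / 2 * sqn (x - 0)))).
    rewrite (Normc.normcM (f x)) normc_real ger0_norm ?expR_ge0// -mulrA [leRHS]mulrCA.
    apply: ler_wpM2l; first exact: normc_ge0.
    rewrite -!expRD ler_expR subr0.
    have := nrm1_cpoint_le M ((2 * gam c) *: x) (- ((lam c / 2) *: rJ x)) e0.
    rewrite (_ : sqn _ + sqn _ = ka * sqn x); last by rewrite !sqnE !dBE dB_rJ2 /ka; field.
    rewrite (_ : e * (ka * sqn x) = gam c / 2 * sqn x); last by rewrite /e; field; rewrite gt_eqF.
    rewrite -/(zeta x); set u := M * _; set v := 2 * _ * _; lra.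
  have mnf : measurable_fun setT (fun x => normc (f x)) by exact: measurable_normc.
  have mg2 : measurable_fun setT (fun x : X => expR (- (gam c / 2 * sqn (x - 0)))).
    by under eq_fun do rewrite subr0; exact: mgs.
  have mN : measurable_fun setT (fun x => nrm1 (zeta x)).
    apply: measurable_funD; apply: measurable_sum => j;
      apply: measurable_normc; by case: (cpart_zeta j).
  apply: (@le_lt_trans _ _ (\int[mu]_x (C%:E * (normc (f x) * expR (- (gam c / 2 * sqn (x - 0))))%:E))%E).
    apply: ge0_le_integral => //.
    - by move=> x _; rewrite lee_fin mulr_ge0 ?normc_ge0 ?expR_ge0.
    - apply/measurable_EFinP; apply: measurable_funM; first exact: measurable_normc.
      by apply: measurable_expR_fun; apply: measurable_funM => //; exact: measurable_cst.
    - apply: emeasurable_funM; first exact: measurable_cst.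
      by apply/measurable_EFinP; exact: measurable_funM.
    by move=> x _; rewrite -EFinM lee_fin.
  rewrite ge0_integralZl//; last 3 first.
  - by apply/measurable_EFinP; exact: measurable_funM.
  - by move=> x _; rewrite lee_fin mulr_ge0 ?normc_ge0 ?expR_ge0.
  - by rewrite lee_fin expR_ge0.
  apply: lte_mul_pinfty; rewrite ?lee_fin ?expR_ge0//.
  apply: le_lt_trans (periodic_gauss_le 0 (gam2_gt0 c) mnf (fun x => normc_ge0 _) _) _.
    by move=> x l; exact: normc_qper.
  by apply: lte_mul_pinfty => //; rewrite lee_fin; apply: gauss_cst_ge0; exact: gam2_gt0.
exists (fun P => (amp c ^+ n)%:C%C * cexp (- (gam c)%:C%C * dB P P) *
    cintegral mu (fun x => phi x * cexp (dB P (zeta x)))).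
  apply: entireM => //; apply: entireM; first exact: entire_cst.
  by apply: entire_cexp; apply: entireM; [exact: entire_cst|exact: entire_dBB].
move=> z; set k := (X in X * _).
have kk := cintegrable_kap z.2 z.1 mf fq f1.
have k0 : k != 0.
  rewrite mulf_neq0 ?cexp_neq0// fmorph_eq0 expf_neq0//.
  apply/eqP => a0; have := amp_sqr c; rewrite a0 expr0n/= mul0r => /esym/eqP.
  by rewrite mulf_eq0 !gt_eqF// subr_gt0 del_lt_gam.
have E x : phi x * cexp (dB (cpoint z.2 z.1) (zeta x)) = k^-1 * (f x * kap z.2 z.1 x).
  by rewrite kap_zeta -/k /phi mulrCA (mulrA k^-1) mulVf// mul1r mulrA.
by rewrite (eq_cintegral _ E) cintegralZl// mulrA divff// mul1r.
Qed.

Lemma ynorm2_Tr_fin : (ynorm2 (Tr f) < +oo)%E.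
Proof.
apply: le_lt_trans (Tr_norm mf fq f2) _; apply: lte_mul_pinfty => //.
by rewrite lee_fin addr_ge0 ?Tbound_ge0.
Qed.

End transform.

Lemma reproduced (G : XC -> R[i]) g : entire G -> (forall z, g z = G (cpoint z.2 z.1)) ->
  qperY g -> (ynorm2 g < +oo)%E -> cmeasurable g /\ forall z, Kg c g z = g z.
Proof.
move=> eG gG gq goo; have gE : g = fun z => G (cpoint z.2 z.1) by apply/funext.
rewrite gE in gq goo *; split; last by move=> z; exact: reproducing.
apply: (cmeasurable_entire (zeta := fun z : Y => cpoint z.2 z.1)) => // j;
  split; under eq_fun do rewrite /= mxE /=; apply: (measurableT_comp (measurable_coord j)).
- exact: (measurableT_comp measurable_fst measurable_snd).
- exact: (measurableT_comp measurable_fst measurable_fst).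
- exact: (measurableT_comp measurable_snd measurable_snd).
- exact: (measurableT_comp measurable_snd measurable_fst).
Qed.

Lemma Tr_ae_eq f f' : cmeasurable f -> qper f -> (norm2 f < +oo)%E ->
  cmeasurable f' -> qper f' -> (norm2 f' < +oo)%E ->
  (forall z, Tr f z = Tr f' z) -> {ae mu, forall x, f x = f' x}.
Proof.
move=> mf fq f2 mf' fq' f2' TT.
have mi : measurable_fun setT (fun x : X => icube x) by exact: measurable_icube.
have mn h : cmeasurable h -> measurable_fun setT (fun x => (icube x * normc (h x) ^+ 2)%:E).
  by move=> mh; apply/measurable_EFinP; apply: measurable_funM => //; apply: measurable_funX; exact: measurable_normc.
have n0 h x : (0 <= (icube x * normc (h x) ^+ 2)%:E)%E.
  by rewrite lee_fin mulr_ge0 ?icube_ge0 ?sqr_ge0.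
have md : cmeasurable (fun x => f x - f' x) by exact: cmeasurableB.
have d2 : (norm2 (fun x => f x - f' x)%R < +oo)%E.
  apply: (@le_lt_trans _ _ (2%:E * norm2 f + 2%:E * norm2 f')%E); last first.
    by rewrite lte_add_pinfty// lte_mul_pinfty.
  rewrite /norm2 -!ge0_integralZl//; [|exact: mn|exact: mn].
  rewrite -ge0_integralD//; last 4 first.
  - by move=> x _; rewrite mule_ge0.
  - by apply: emeasurable_funM; [exact: measurable_cst|exact: mn].
  - by move=> x _; rewrite mule_ge0.
  - by apply: emeasurable_funM; [exact: measurable_cst|exact: mn].
  apply: ge0_le_integral => //.
  - by move=> x _; exact: (n0 (fun x => f x - f' x)).
  - exact: (mn _ md).
  - by apply: emeasurable_funD; apply: emeasurable_funM; (try exact: measurable_cst); exact: mn.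
  move=> x _; rewrite -!EFinM -EFinD lee_fin.
  rewrite (_ : 2 * _ + _ = icube x * (2 * normc (f x) ^+ 2 + 2 * normc (f' x) ^+ 2)); last by ring.
  apply: ler_wpM2l; first exact: icube_ge0.
  have := le_normcD (f x) (- f' x); rewrite normcN; set s := normc _; set t := normc _; set u := normc _ => h.
  have s0 : 0 <= s by exact: normc_ge0.
  have := sqr_ge0 (t - u); nra.
have dq : qper (fun x => f x - f' x) by move=> x l; rewrite fq fq' mulrBr.
have Td z : Tr (fun x => f x - f' x) z = 0.
  rewrite /Tr (@eq_cintegral _ _ _ _ _ (fun x => f x * kap z.2 z.1 x - f' x * kap z.2 z.1 x)); last first.
    by move=> x; rewrite mulrBl.
  rewrite cintegralB; [|exact: (cintegrable_kap z.2 z.1 mf fq (norm1_fin mf f2))|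
    exact: (cintegrable_kap z.2 z.1 mf' fq' (norm1_fin mf' f2'))].
  by have := TT z; rewrite /Tr => ->; rewrite subrr.
apply: filterS (Tr_injective md dq d2 Td) => x /eqP; rewrite subr_eq0 => /eqP //.
Qed.

Theorem norm_Tr f : cmeasurable f -> qper f -> (norm2 f < +oo)%E -> ynorm2 (Tr f) = norm2 f.
Proof.
move=> mf fq f2; have goo := ynorm2_Tr_fin mf fq f2.
have gq := Tr_qperY mf fq (norm1_fin mf f2).
have [T eT TE] := entire_transform mf fq f2.
have [mg gK] := reproduced eT TE gq goo.
have [f' [mf' fq' f2' f'g f'T]] := reconstruct mg gq goo gK.
rewrite -f'g.
have mi : measurable_fun setT (fun x : X => icube x) by exact: measurable_icube.
have mn h : cmeasurable h -> measurable_fun setT (fun x => (icube x * normc (h x) ^+ 2)%:E).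
  by move=> mh; apply/measurable_EFinP; apply: measurable_funM => //; apply: measurable_funX; exact: measurable_normc.
have ae := Tr_ae_eq mf' fq' f2' mf fq f2 f'T.
by apply: ae_eq_integral => //; [exact: mn|exact: mn|apply: filterS ae => x -> _].
Qed.

End isometry.

(** * Back to the Heisenberg group *)
Lemma powM_inv (R : realType) (n : nat) (a b s : R) :
  a ^- n * b ^+ n * s ^- n = (b / (a * s)) ^+ n.
Proof. by rewrite expr_div_n [(a * s) ^+ n]exprMn invfM; ring. Qed.

(** * Hyperbolic functions as kernel parameters *)

Section hyperbolic_parameters.
Context {R : realType} (la S Ch : R).
Context (laS : 0 < la * S).
Context (Ch0 : 0 < Ch).
Context (ChS : Ch ^+ 2 = 1 + S ^+ 2).

Let S0 : S != 0. Proof. by apply/eqP => S0; move: laS; rewrite S0 mulr0 ltxx. Qed.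
Let ChN0 : Ch != 0. Proof. by rewrite gt_eqF. Qed.
Let pi0 : 0 < pi :> R. Proof. exact: pi_gt0. Qed.
Let piN : pi != 0 :> R. Proof. by rewrite gt_eqF. Qed.

Let p1 : 0 < 4^-1 * la * (S / Ch).
Proof.
have -> : 4^-1 * la * (S / Ch) = la * S / (4 * Ch) by field.
by rewrite divr_gt0// mulr_gt0.
Qed.

Let gd : 4^-1 * la * (Ch / S) - 4^-1 * la * (S / Ch) = la / (4 * S * Ch).
Proof.
have -> : 4^-1 * la * (Ch / S) - 4^-1 * la * (S / Ch) = la * (Ch ^+ 2 - S ^+ 2) / (4 * S * Ch).
  by field; rewrite S0 ChN0.
by rewrite ChS addrK mulr1.
Qed.

Let p2 : 4^-1 * la * (S / Ch) < 4^-1 * la * (Ch / S).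
Proof.
rewrite -subr_gt0 gd; have -> : la / (4 * S * Ch) = la * S / (4 * S ^+ 2 * Ch) by field; rewrite S0 ChN0.
by apply: divr_gt0 laS _; apply: mulr_gt0 Ch0; apply: mulr_gt0; rewrite // lt0r sqrf_eq0 S0 sqr_ge0.
Qed.

Let p3 : la ^+ 2 = 16 * (4^-1 * la * (Ch / S) * (4^-1 * la * (S / Ch))).
Proof. by field; rewrite S0 ChN0. Qed.

Let p4 : 0 <= la / (4 * pi * S).
Proof.
have -> : la / (4 * pi * S) = la * S / (4 * pi * S ^+ 2).
  by have := piN; move: (pi : R) => w wN; field; rewrite ?wN ?S0 ?mulf_neq0.
apply: divr_ge0; first exact: ltW.
by apply: mulr_ge0; [apply: mulr_ge0 => //; exact: ltW|exact: sqr_ge0].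
Qed.

Let p5 : (la / (4 * pi * S)) ^+ 2 * pi ^+ 2 =
  4^-1 * la * (Ch / S) * (4^-1 * la * (Ch / S) - 4^-1 * la * (S / Ch)).
Proof. by rewrite gd; have := piN; move: (pi : R) => w wN; field; rewrite ?wN ?S0 ?ChN0 ?mulf_neq0. Qed.

Definition hyp_params : kparams R := KParams p1 p2 p3 p4 p5.

Lemma amp2_hyp : amp2 hyp_params = la / (4 * pi * (2 * S * Ch)).
Proof. by rewrite /amp2 /= gd; have := piN; move: (pi : R) => w wN; field; rewrite ?wN ?S0 ?ChN0 ?mulf_neq0. Qed.

(** The fraction is [coth] at the doubled argument; the factor 4 comes from the arguments [2 *: y]
    and [2 *: v] in [weight]. *)
Lemma double_coth (x : R) : 4^-1 * la * ((Ch ^+ 2 + S ^+ 2) / (2 * S * Ch)) * (4 * x) =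
  2 * (gam hyp_params + del hyp_params) * x.
Proof. by rewrite /=; field; rewrite ?S0 ?ChN0. Qed.

End hyperbolic_parameters.

Section heat_parameters.
Context {R : realType} (la t : R).
Context (la0 : la != 0).
Context (t0 : 0 < t).

Let Ch0 : 0 < cosh (la * t).
Proof. by rewrite /cosh divr_gt0// addr_gt0// expR_gt0. Qed.

Let laS : 0 < la * sinh (la * t).
Proof.
rewrite /sinh mulrA divr_gt0//; have [l0|l0|l0] := ltgtP la 0; last by move: la0; rewrite l0 eqxx.
  rewrite nmulr_rgt0// subr_lt0 ltr_expR; have := nmulr_rlt0 t l0; rewrite t0; lra.
by rewrite mulr_gt0// subr_gt0 ltr_expR; have := mulr_gt0 l0 t0; lra.
Qed.

Let ChS : cosh (la * t) ^+ 2 = 1 + sinh (la * t) ^+ 2.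
Proof.
have : expR (la * t) * expR (- (la * t)) = 1 :> R by rewrite -expRD subrr expR0.
rewrite /cosh /sinh; set a := expR (la * t); set b := expR (- (la * t)) => h.
have E : ((a + b) / 2) ^+ 2 - (1 + ((a - b) / 2) ^+ 2) = a * b - 1 by field.
by apply/eqP; rewrite -subr_eq0 E h subrr.
Qed.

Definition heat_params : kparams R := hyp_params laS Ch0 ChS.

Context {n : nat}.

Lemma twisted_heatE (p : plane R n) :
  twisted_heat la t p = amp heat_params ^+ n * expR (- (gam heat_params * sqn p)).
Proof. by rewrite /twisted_heat powM_inv. Qed.

Lemma weightE (p q : plane R n) : weight la t (cpoint p q) = wt heat_params p q.
Proof.
rewrite /weight /=.
have mR (u v : 'rV[R]_n) : map_mx (@complex.Re R) (map2_mx (@Complex R) u v) = u by apply/rowP => j; rewrite !mxE.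
have mI (u v : 'rV[R]_n) : map_mx (@complex.Im R) (map2_mx (@Complex R) u v) = v by apply/rowP => j; rewrite !mxE.
rewrite !mR !mI /twisted_heat /= powM_inv /wt /W0 amp2_hyp /coth.
have e2 : la * (2 * t) = la * t + la * t by ring.
have -> : sinh (la * (2 * t)) = 2 * sinh (la * t) * cosh (la * t).
  by rewrite /sinh e2 opprD !expRD /sinh /cosh; field.
have -> : cosh (la * (2 * t)) = cosh (la * t) ^+ 2 + sinh (la * t) ^+ 2.
  by rewrite /cosh e2 opprD !expRD /sinh; field.
have E : la * (dotv p.2 q.1 - dotv q.2 p.1) - 4^-1 * la *
    ((cosh (la * t) ^+ 2 + sinh (la * t) ^+ 2) / (2 * sinh (la * t) * cosh (la * t))) *
    (dotv (2 *: q.1) (2 *: q.1) + dotv (2 *: q.2) (2 *: q.2)) =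
    lam heat_params * dOm p q - 2 * (gam heat_params + del heat_params) * sqn q.
  have -> : dotv (2 *: q.1) (2 *: q.1) + dotv (2 *: q.2) (2 *: q.2) = 4 * sqn q.
    by rewrite !dotvZl !(dotv_sym _ (2 *: _)) !dotvZl /sqn; ring.
  by rewrite (double_coth laS Ch0 ChS) /dOm (dotv_sym q.2).
by rewrite mulrACA -expRD E.
Qed.

Lemma twisted_convE (f : plane R n -> R[i]) p :
  twisted_conv la f (twisted_heat la t) p = Tr heat_params f (0, p).
Proof.
rewrite /twisted_conv lebesgue_planeE; apply: eq_cintegral => x.
rewrite -[LHS]mulrA (_ : (p.1 - x.1, p.2 - x.2) = p - x)// twisted_heatE; congr (_ * _).
have sp (a b : R) : (a * b)%:C%C = a%:C%C * b%:C%C :> R[i] by exact: (rmorphM (real_complex R)).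
rewrite sp -[LHS]mulrA; congr (_ * _).
rewrite -(cexp_real (- _)) -cexpD; congr cexp; apply: complexP => /=.
  by rewrite dOm0l !sqnE dB0l; ring.
by rewrite dB0r /dOm; ring.
Qed.

End heat_parameters.

(** * Integrals and null sets on the Heisenberg group *)

Section product_null_sets.
Context {R : realType} {n : nat}.
Local Notation X := (plane R n).
Local Notation mu := (mu_plane R n).
Let leb : {sigma_finite_measure set (measurableTypeR R) -> \bar R} := @lebesgue_measure R.

Lemma haarE : haar R n = (mu \x leb)%E :> (set _ -> \bar R).
Proof. by []. Qed.

Lemma haar_null (N : set X) : measurable N -> haar R n (N `*` setT) = 0%E <-> mu N = 0%E.
Proof.
move=> mN; have -> : haar R n (N `*` setT) = (mu N * leb setT)%E.
  by rewrite haarE; exact: product_measure1E.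
split=> [h|->]; last by rewrite mul0e.
apply/eqP; have : (mu N * leb `[0%R, 1%R]%classic <= mu N * leb setT)%E.
  by apply: lee_wpmul2l => //; apply: le_measure; rewrite ?inE.
rewrite h /leb /= lebesgue_measure_itv/= lte_fin ltr01 oppr0 adde0 mule1 => h1.
by rewrite eq_le h1 measure_ge0.
Qed.

(** The factor [2^-1] is the length of the central interval in the fundamental domain. *)
Lemma integral_strip (h : X -> R) : measurable_fun setT h -> (forall p, 0 <= h p) ->
  (\int[haar R n]_(z in fundamental_domain (R := R) (n := n)) (h z.1)%:E =
   (2^-1)%:E * \int[mu]_p (icube p * h p)%:E)%E.
Proof.
move=> mh h0; pose J : set (measurableTypeR R) := [set xi | 0 <= xi < 2^-1].
have JE : J = `[0, 2^-1[%classic by apply/seteqP; split=> x /=; rewrite in_itv.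
have mJ : measurable J by rewrite JE.
have mi : measurable_fun setT (fun p : X => icube p * h p).
  by apply: measurable_funM => //; exact: measurable_icube.
have mf : measurable_fun setT (fun z : X * measurableTypeR R => (icube z.1 * h z.1 * \1_J z.2)%:E).
  apply/measurable_EFinP; apply: measurable_funM; first exact: (measurableT_comp mi measurable_fst).
  exact: (measurableT_comp (measurable_indic mJ) measurable_snd).
have f0 (z : X * measurableTypeR R) : (0 <= (icube z.1 * h z.1 * \1_J z.2)%:E)%E.
  by rewrite lee_fin !mulr_ge0 ?icube_ge0.
rewrite integral_mkcond haarE.
transitivity (\int[(mu \x leb)%E]_z (icube z.1 * h z.1 * \1_J z.2)%:E)%E.
  apply: eq_integral => -[p xi] _; rewrite patchE /= icubeE indicE.
  have -> : ((p, xi) \in fundamental_domain (R := R) (n := n)) = (p \in cube (R := R) (n := n)) && (xi \in J).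
    by apply/idP/andP => [|[]]; rewrite !inE => -[].
  by case: (boolP (p \in cube (R := R) (n := n))); case: (boolP (xi \in J)); rewrite /= ?mul0r ?mulr0 ?mul1r ?mulr1.
rewrite (fubini_tonelli1 _ mf f0) -ge0_integralZl//.
- apply: eq_integral => p _; rewrite /fubini_F/=.
  under eq_integral do rewrite EFinM.
  rewrite ge0_integralZl//; last 2 first.
  + by apply/measurable_EFinP; exact: measurable_indic.
  + by rewrite lee_fin mulr_ge0 ?icube_ge0.
  rewrite integral_indic// setIT JE /leb /= lebesgue_measure_itv/= lte_fin invr_gt0 ltr0n oppr0 adde0.
  by rewrite muleC.
- exact/measurable_EFinP.
- by move=> p _; rewrite lee_fin mulr_ge0 ?icube_ge0.
Qed.

Lemma integral_cube (h : X -> \bar R) :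
  (\int[mu]_(p in unit_cube (R := R) (n := n) `*` unit_cube (R := R) (n := n)) h p =
   \int[mu]_p ((icube p)%:E * h p))%E.
Proof.
rewrite integral_mkcond; apply: eq_integral => p _.
by rewrite patchE icubeE /cube; case: (p \in _); rewrite /= ?mul1e ?mul0e.
Qed.

End product_null_sets.

(** * The heat map on the isotypic component *)

Section heat_map_theory.
Context {R : realType} {n : nat} (t : R) (k : int).
Context (t0 : 0 < t).
Context (k0 : k != 0).
Local Notation X := (plane R n).
Local Notation Y := (X * X)%type.
Local Notation XC := (plane R[i] n).
Local Notation mu := (mu_plane R n).
Local Notation lp := (lpt R).
Implicit Types (F : heis R n -> R[i]) (G : XC -> R[i]) (p q : X) (l : lattice n).

Let la : R := - (4 * pi * k%:~R).

Let la0 : la != 0.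
Proof.
rewrite oppr_eq0; apply: mulf_neq0; last by rewrite intr_eq0.
by apply: mulf_neq0 => //; rewrite gt_eqF// pi_gt0.
Qed.

Let c := heat_params la0 t0.

Let lamE : lam c = la. Proof. by []. Qed.

Definition slice F p := F (p, 0).

Lemma iota_lpt l : (map_mx intr l.1, map_mx intr l.2) = iotac (lp l) :> XC.
Proof. by apply: planeP => j /=; rewrite !mxE rmorph_int. Qed.

Lemma chi_multiplier p q l :
  cexp ((0 +i* (2 * pi * k%:~R))%C * dOm (cpoint p q) (iotac (lp l))) = chi c p q (lp l).
Proof.
rewrite iotaE dOm_cpoint /chi lamE /la !dOm0r; congr cexp.
by apply: complexP; rewrite ?(cReM, cImM)/=; field.
Qed.

Lemma qperY_cpoint G :
  qperY c (fun z => G (cpoint z.2 z.1)) <->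
  forall (a b : 'rV[int]_n) z w, let m := map_mx intr a in let m' := map_mx intr b in
    G (z + m, w + m') = cexp ((0 +i* (2 * pi * k%:~R))%C * (dotv w m - dotv z m')) * G (z, w).
Proof.
split=> [H a b z w /= | H q p [a b] /=].
- have := H (imp (z, w)) (rep (z, w)) (a, b); rewrite -chi_multiplier /= -{1}[imp _]addr0 -cpointD -iotaE.
  by rewrite cpoint_rep -iota_lpt.
- have := H a b (cpoint p q).1 (cpoint p q).2; rewrite /= -chi_multiplier -iota_lpt /=.
  rewrite (_ : (_ + _, _ + _) = cpoint (p + lp (a, b)) q)//.
  apply: planeP => j; rewrite /lpt /= !mxE -(rmorph_int (real_complex R));
    by apply: complexP; rewrite ?(cReD, cImD)/= ?addr0.
Qed.

Lemma Hspace_normc F p xi : Hspace k F -> normc (F (p, xi)) = normc (slice F p).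
Proof. by move=> [_ ->]; rewrite Normc.normcM normc_cexp expR0 mul1r. Qed.

Lemma integral_Hspace F : cmeasurable F -> (forall p xi, normc (F (p, xi)) = normc (slice F p)) ->
  (\int[haar R n]_(h in fundamental_domain (R := R) (n := n)) (normc (F h) ^+ 2)%:E =
   (2^-1)%:E * norm2 (slice F))%E.
Proof.
move=> mF nF; rewrite /norm2 -(integral_strip (h := fun p => normc (slice F p) ^+ 2)).
- by apply: eq_integral => -[p xi] _; rewrite nF.
- apply: measurable_funX; apply: measurable_normc.
  exact: (cmeasurable_comp (pair2_measurable (0 : measurableTypeR R)) mF).
- by move=> p; exact: sqr_ge0.
Qed.

(** Invariance is used for lattice elements with central coordinate 0: the group law then produces a
    central term [dOm], which the character in [xi] turns into the multiplier [chi]. *)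
Lemma slice_space F : Hspace k F ->
  [/\ cmeasurable (slice F), qper c (slice F) & (norm2 (slice F) < +oo)%E].
Proof.
move=> HF; have [[mF invF Ffin] phF] := HF.
split.
- exact: (cmeasurable_comp (pair2_measurable (0 : measurableTypeR R)) mF).
- move=> x l; have Gl : Gamma (lp l, 0 : measurableTypeR R).
    by exists l.1, l.2, 0; rewrite mul0r.
  have := invF _ (x, 0) Gl; rewrite /heis_mul /= addr0 add0r.
  rewrite (_ : ((map_mx intr l.1 + x.1, map_mx intr l.2 + x.2)) = x + lp l); last by apply: planeP => j; rewrite /lpt /= !mxE addrC.
  have -> : dotv (map_mx intr l.2) x.1 - dotv (map_mx intr l.1) x.2 = - dOm x (lp l) by exact: (dOmC (lp l) x).
  rewrite phF /slice => <-; rewrite mulrA -cexpD /chi lamE /la.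
  rewrite -[LHS]mul1r -cexp0; congr (cexp _ * _).
  by apply: complexP; rewrite ?(cReD, cImD)/= ?dOm0l ?mulr0 ?addr0//; field.
- move: Ffin; rewrite (integral_Hspace mF (fun p xi => Hspace_normc p xi HF)).
  have N0 : (0 <= norm2 (slice F))%E by exact: norm2_ge0.
  move=> h; rewrite ltNge leye_eq; apply/negP => /eqP E; move: h.
  by rewrite E mulry gtr0_sg ?invr_gt0// mul1e ltxx.
Qed.

Lemma heat_convE F p : heat_conv t k F p = Tr c (slice F) (0, p).
Proof. exact: twisted_convE. Qed.

Lemma entire_extension_unique (g : X -> R[i]) G G' :
  entire_extension g G -> entire_extension g G' -> G = G'.
Proof.
move=> [eG hG] [eG' hG']; apply: entire_eq => // p; rewrite -iotaE /iotac.
by case: p => x u; rewrite hG hG'.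
Qed.

(** Entire extensions are unique, so once one is exhibited [xget] returns it and the default value
    is excluded. *)
Lemma extendE (g : X -> R[i]) G : entire_extension g G -> extend g = G.
Proof. by move=> h; exact: (entire_extension_unique (xgetI (cst 0) h) h). Qed.

Lemma heat_map_extension F : Hspace k F -> entire_extension (heat_conv t k F) (heat_map t k F) /\
  forall z, Tr c (slice F) z = heat_map t k F (cpoint z.2 z.1).
Proof.
move=> /slice_space[mf fq f2]; have [T eT TE] := entire_transform mf fq f2.
have ext : entire_extension (heat_conv t k F) T.
  by split=> // x u; rewrite heat_convE TE/= -iotaE.
by rewrite /heat_map (extendE ext).
Qed.

Lemma Bspace_sqnormE G : entire G ->
  Bspace_sqnorm t k G = ynorm2 c (fun z => G (cpoint z.2 z.1)).
Proof.
move=> eG; have mg : cmeasurable (fun z : Y => G (cpoint z.2 z.1)).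
  apply: (cmeasurable_entire (zeta := fun z : Y => cpoint z.2 z.1)) => // j;
    split; under eq_fun do rewrite /= mxE /=; apply: (measurableT_comp (measurable_coord j)).
  - exact: (measurableT_comp measurable_fst measurable_snd).
  - exact: (measurableT_comp measurable_fst measurable_fst).
  - exact: (measurableT_comp measurable_snd measurable_snd).
  - exact: (measurableT_comp measurable_snd measurable_fst).
have mI := measurable_iu2 (measurable_unorm c mg).
have I0 (z : Y) : (0 <= (icube z.2 * unorm c (fun z => G (cpoint z.2 z.1)) z ^+ 2)%:E)%E.
  by rewrite lee_fin mulr_ge0 ?icube_ge0 ?sqr_ge0.
rewrite /ynorm2 (fubini_tonelli1 _ mI I0) /Bspace_sqnorm.
apply: eq_integral => q _; rewrite /fubini_F integral_cube; apply: eq_integral => p _.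
by rewrite -EFinM -/la (weightE la0 t0) /unorm/= [(normc _ * _) ^+ 2]exprMn sw_sqr.
Qed.

Lemma Hspace_sqnormE F : Hspace_sqnorm F = norm2 (slice F).
Proof.
by rewrite /Hspace_sqnorm integral_cube; apply: eq_integral => p _; rewrite -EFinM.
Qed.

Lemma isometric_heat_map F : Hspace k F -> Bspace_sqnorm t k (heat_map t k F) = Hspace_sqnorm F.
Proof.
move=> HF; have [[eT _] TE] := heat_map_extension HF; have [mf fq f2] := slice_space HF.
rewrite Bspace_sqnormE// Hspace_sqnormE -(norm_Tr mf fq f2); congr ynorm2.
by apply/funext => z; rewrite TE.
Qed.

Lemma Bspace_heat_map F : Hspace k F -> Bspace t k (heat_map t k F).
Proof.
move=> HF; have [[eT _] TE] := heat_map_extension HF; have [mf fq f2] := slice_space HF.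
split=> //; last by rewrite isometric_heat_map// Hspace_sqnormE.
apply/qperY_cpoint; have := Tr_qperY mf fq (norm1_fin mf f2).
by rewrite (_ : Tr c (slice F) = fun z => heat_map t k F (cpoint z.2 z.1))//; apply/funext.
Qed.

(** The central character never vanishes, so the set where [F] and [F'] differ is a cylinder over
    the set where their slices differ, and [haar_null] compares the two measures. *)
Lemma ae_slice F F' : Hspace k F -> Hspace k F' ->
  {ae haar R n, forall h, F h = F' h} <-> {ae mu, forall p, slice F p = slice F' p}.
Proof.
move=> HF HF'; have [mf _ _] := slice_space HF; have [mf' _ _] := slice_space HF'.
pose N : set X := ~` [set p | slice F p = slice F' p].
have mN : measurable N.
  have md : measurable_fun setT (fun p => normc (slice F p - slice F' p)).
    by apply: measurable_normc; exact: cmeasurableB.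
  have := md measurableT [set 0] (measurable_set1 0); rewrite setTI => h.
  apply: measurableC; move: h; congr measurable; apply/seteqP; split=> p /=.
    by move/eqP; rewrite normc0_eq subr_eq0 => /eqP.
  by move=> ->; rewrite subrr normc0E.
have NE : ~` [set h | F h = F' h] = N `*` setT.
  apply/seteqP; split=> -[p xi] /=.
    by move=> h; split=> // pp; apply: h; rewrite (HF.2) (HF'.2) /slice in pp *; rewrite pp.
  move=> [h _] hh; apply: h; move: hh; rewrite (HF.2) (HF'.2); exact: (mulfI (cexp_neq0 _)).
have A1 : {ae mu, forall p, slice F p = slice F' p} <-> mu N = 0%E by exact: negligibleP.
have mNT : measurable (N `*` [set: measurableTypeR R]) by exact: measurableX.
have A2 : {ae haar R n, forall h, F h = F' h} <-> haar R n (N `*` setT) = 0%E.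
  by rewrite -(negligibleP (haar R n) mNT) -NE.
by rewrite A1 A2; exact: haar_null.
Qed.

Lemma injective_heat_map F F' : Hspace k F -> Hspace k F' ->
  (heat_map t k F = heat_map t k F' <-> {ae haar R n, forall h, F h = F' h}).
Proof.
move=> HF HF'; rewrite (ae_slice HF HF').
have [mf fq f2] := slice_space HF; have [mf' fq' f2'] := slice_space HF'.
have [_ TE] := heat_map_extension HF; have [_ TE'] := heat_map_extension HF'.
split=> [E|ae].
  apply: (Tr_ae_eq mf fq f2 mf' fq' f2') => z.
  by rewrite TE TE' E.
rewrite /heat_map (_ : heat_conv t k F = heat_conv t k F')//; apply/funext => p.
rewrite !heat_convE; have mk : cmeasurable (fun x => kap c p 0 x).
  by apply: cmeasurable_kap; [exact: measurable_cst|exact: measurable_cst|exact: measurable_id_plane].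
apply: ae_eq_cintegral; [exact: cmeasurableM|exact: cmeasurableM|].
by apply: filterS ae => x ->.
Qed.

(** By uniqueness of the extension it is enough to compare at real points, where the identity is
    linearity of the integral. *)
Lemma linear_heat_map (a : R[i]) F F' : Hspace k F -> Hspace k F' ->
  heat_map t k (fun h => a * F h + F' h) = (fun P => a * heat_map t k F P + heat_map t k F' P).
Proof.
move=> HF HF'; have [[eT hT] _] := heat_map_extension HF; have [[eT' hT'] _] := heat_map_extension HF'.
have [mf fq f2] := slice_space HF; have [mf' fq' f2'] := slice_space HF'.
apply: extendE; split; first by apply: entireD => //; apply: entireM => //; exact: entire_cst.
move=> x u; rewrite hT hT' !heat_convE /Tr /=.
have I1 := cintegrable_kap (x, u) 0 mf fq (norm1_fin mf f2).
have I2 := cintegrable_kap (x, u) 0 mf' fq' (norm1_fin mf' f2').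
rewrite -cintegralZl// -cintegralD//; last exact: cintegrableZl.
by apply: eq_cintegral => y; rewrite /slice mulrDl mulrA.
Qed.

Lemma surjective_heat_map G : Bspace t k G -> exists2 F, Hspace k F & heat_map t k F = G.
Proof.
move=> [eG Gq Gfin]; pose g (z : Y) := G (cpoint z.2 z.1).
have gq : qperY c g by apply/qperY_cpoint.
have goo : (ynorm2 c g < +oo)%E by rewrite -Bspace_sqnormE.
have [mg gK] := reproduced eG (fun z => erefl) gq goo.
have [f [mf fq f2 _ fT]] := reconstruct mg gq goo gK.
pose ph (xi : R) : R[i] := cexp (0 +i* (4 * pi * k%:~R * xi))%C.
pose F (h : heis R n) := ph h.2 * f h.1.
have F0 : slice F = f.
  by apply/funext => p; rewrite /slice /F /ph /= mulr0 cexp0 mul1r.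
have nF p xi : normc (F (p, xi)) = normc (slice F p).
  by rewrite F0 /F /ph Normc.normcM normc_cexp expR0 mul1r.
have mF : cmeasurable F.
  apply: cmeasurableM; last exact: (cmeasurable_comp measurable_fst mf).
  apply: cmeasurable_cexp; split => /=; first exact: measurable_cst.
  by apply: measurable_funM; [exact: measurable_cst|exact: measurable_snd].
have HF : Hspace k F.
  split; last by move=> p xi; rewrite -/(slice F p) F0.
  split=> //; last by rewrite (integral_Hspace mF nF) F0 lte_mul_pinfty// lee_fin.
  move=> _ [x xi] [a [b [m ->]]]; rewrite /heis_mul /F /=.
  rewrite (_ : (map_mx intr a + x.1, map_mx intr b + x.2) = x + lp (a, b)); last by apply: planeP => j; rewrite /lpt /= !mxE addrC.
  have -> : dotv (map_mx intr b) x.1 - dotv (map_mx intr a) x.2 = - dOm x (lp (a, b)).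
    by exact: (dOmC (lp (a, b)) x).
  rewrite fq mulrA; congr (_ * _); rewrite /ph /chi -cexpD lamE /la.
  (* A central lattice element [m / 2] acts by [exp (2 * pi * 'i * k * m) = 1]; this is where the
     half-integers in the centre of [Gamma] match the character [4 * pi * k]. *)
  rewrite -[RHS]mul1r -(cexp_2pi (R := R) (k * m)) -cexpD; congr cexp.
  by apply: complexP; rewrite ?(cReD, cImD)/= ?dOm0l ?mulr0 ?addr0// intrM; field.
exists F => //; apply: extendE; split=> // x u.
by rewrite heat_convE F0 fT /g/= -iotaE.
Qed.

End heat_map_theory.

(** Elements of the source are classes modulo null sets: the second clause says at once that the map
    is well defined on classes and injective on them. *)
Theorem theorem4p7 (R : realType) (n : nat) (t : R) (k : int)
    (hn : (0 < n)%N) (ht : 0 < t) (hk : k != 0) :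
  [/\ forall F : heis R n -> R[i], Hspace k F ->
        (exists! G : plane R[i] n -> R[i],
           entire_extension (heat_conv t k F) G) /\
        Bspace t k (heat_map t k F),
      forall F F' : heis R n -> R[i], Hspace k F -> Hspace k F' ->
        (heat_map t k F = heat_map t k F' <->
         {ae haar R n, forall h, F h = F' h}),
      forall (a : R[i]) (F F' : heis R n -> R[i]),
        Hspace k F -> Hspace k F' ->
        heat_map t k (fun h => a * F h + F' h) =
        (fun P => a * heat_map t k F P + heat_map t k F' P),
      forall F : heis R n -> R[i], Hspace k F ->
        Bspace_sqnorm t k (heat_map t k F) = Hspace_sqnorm F &
      forall G : plane R[i] n -> R[i], Bspace t k G ->
        exists2 F : heis R n -> R[i], Hspace k F & heat_map t k F = G].
Proof.
split.
- move=> F HF; split; last exact: Bspace_heat_map.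
  have [ext _] := heat_map_extension ht hk HF; exists (heat_map t k F); split => // G.
  exact: entire_extension_unique ext.
- exact: injective_heat_map.
- exact: linear_heat_map.
- exact: isometric_heat_map.
- exact: surjective_heat_map.
Qed.
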